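(* Let $N\ge 2$, $1<p<\infty$, $0<r<R$, let $\Omega=B_R\subset\mathbb{R}^N$ and let the hole be the centered ball $A=B_r$. Suppose $1<q\le p$. Then this configuration is critical in the following sense: for every smooth, globally Lipschitz vector field $V:\mathbb{R}^N\to\mathbb{R}^N$ with support in $\Omega$ whose associated deformation preserves the volume of $B_r$, one has $S_q'(0)=0$, where $S_q'(0)=\frac{d}{dt}S_q(t)\big|_{t=0}$ and $S_q(t)=S_q(\psi_t(B_r))$.
   Context: $B_\rho$ is the open ball of $\mathbb{R}^N$ with center $0$ and radius $\rho$. For a bounded smooth domain $\Omega$ and a smooth open $A\subset\overline{\Omega}$, $W^{1,p}_A(\Omega)$ denotes the closure in the $W^{1,p}(\Omega)$-norm of $C_0^\infty(\overline{\Omega}\setminus A)$ (functions smooth up to $\partial\Omega$ that vanish on $A$, with no condition imposed on $\partial\Omega$), and $$ S_q(A)=\inf_{u\in W^{1,p}_A(\Omega)\setminus W^{1,p}_0(\Omega)}\frac{\int_\Omega |\nabla u|^p+|u|^p\,\mathrm{d}x}{\left(\int_{\partial\Omega}|u|^q\,\mathrm{d}S\right)^{p/q}}. $$ The flow $\psi_t$ of $V$ is the unique solution of $\frac{d}{dt}\psi_t(x)=V(\psi_t(x))$ for $t>0$, $\psi_0(x)=x$. The deformation preserves the volume of $B_r$ if $|\psi_t(B_r)|=|B_r|$ for all $t\ge0$. Since $S_q(t)$ is defined for $t\ge 0$, the derivative at $t=0$ is $\lim_{t\to0^+}(S_q(t)-S_q(0))/t$. *)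

(* Defs.v *)
From HB Require Import structures.
From mathcomp Require Import all_boot all_order all_algebra.
From mathcomp Require Import all_classical all_reals all_analysis.

Set Implicit Arguments.
Unset Strict Implicit.
Unset Printing Implicit Defensive.
Import Order.TTheory GRing.Theory Num.Theory.
Import numFieldNormedType.Exports.

Local Open Scope classical_set_scope.
Local Open Scope ring_scope.

(* The product sigma-algebra on R^N, which is its Borel sigma-algebra. *)
Section measurable_rV.
Context (R : realType) (N : nat).

Let coord (i : 'I_N) (x : 'rV[R]_N) : measurableTypeR R := x ord0 i.

Let rV_set0 : g_sigma_preimage coord set0.
Proof. exact: sigma_algebra0. Qed.

Let rV_setC A : g_sigma_preimage coord A -> g_sigma_preimage coord (~` A).
Proof. exact: sigma_algebraC. Qed.

Let rV_bigcup (F : _^nat) : (forall i, g_sigma_preimage coord (F i)) ->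
  g_sigma_preimage coord (\bigcup_i (F i)).
Proof. exact: sigma_algebra_bigcup. Qed.

HB.instance Definition _ :=
  @isMeasurable.Build (measure_tuple_display R.-ocitv.-measurable.-sigma)
    'rV[R]_N (g_sigma_preimage coord) rV_set0 rV_setC rV_bigcup.

Lemma measurable_coord (i : 'I_N) : measurable_fun [set: 'rV[R]_N] (coord i).
Proof.
move=> _ Y mY; rewrite setTI; apply: sub_sigma_algebra => /=.
rewrite -bigcup_seq/=; exists i => /=; first by rewrite mem_index_enum.
by exists Y => //; rewrite setTI.
Qed.

Lemma measurable_fun_coordP d (T : measurableType d) (f : T -> 'rV[R]_N) :
  (forall i, measurable_fun [set: T] (coord i \o f)) ->
  measurable_fun [set: T] f.
Proof.
move=> mf.
suff prefS : g_sigma_preimage (fun i => coord i \o f) `<=` measurable.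
  rewrite g_sigma_preimage_comp in prefS.
  by move=> _ A mA; apply: prefS; exists A.
apply: smallest_sub; first exact: sigma_algebra_measurable.
rewrite -bigcup_seq; apply: bigcup_sub => i _.
by move=> A [B mB <-]; exact: mf.
Qed.

End measurable_rV.

Section lebesgue_rV.
Context (R : realType).

Definition rV_cons (n : nat) (p : measurableTypeR R * 'rV[R]_n) : 'rV[R]_n.+1 :=
  \row_(i < n.+1) oapp (fun j => p.2 ord0 j) (p.1 : R) (unlift ord0 i).

Lemma measurable_rV_cons (n : nat) : measurable_fun setT (@rV_cons n).
Proof.
apply: measurable_fun_coordP => i; case: (unliftP ord0 i) => [j ij|i0].
  rewrite (_ : _ \o _ = (fun x : 'rV[R]_n => x ord0 j : measurableTypeR R) \o snd).
    by apply: measurableT_comp; [exact: measurable_coord|exact: measurable_snd].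
  by apply/funext => p /=; rewrite mxE ij liftK.
rewrite (_ : _ \o _ = fst); first exact: measurable_fst.
by apply/funext => p /=; rewrite mxE i0 unlift_none.
Qed.

Section step.
Context (n : nat) (m : {sigma_finite_measure set 'rV[R]_n -> \bar R}).

Definition lebesgue_step : set 'rV[R]_n.+1 -> \bar R :=
  pushforward (@lebesgue_measure R \x m)%E (@rV_cons n).

Let mcons := @measurable_rV_cons n.

Let step0 : lebesgue_step set0 = 0%E.
Proof. by rewrite /lebesgue_step /pushforward preimage_set0 measure0. Qed.

Let step_ge0 A : (0 <= lebesgue_step A)%E.
Proof. exact: measure_ge0. Qed.

Let step_sigma_additive : semi_sigma_additive lebesgue_step.
Proof.
exact: (@measure_semi_sigma_additive _ _ _
  (measure_function_pushforward__canonical__measure_function_Measure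
    (@lebesgue_measure R \x m)%E mcons)).
Qed.

HB.instance Definition _ := isMeasure.Build _ _ _ lebesgue_step
  step0 step_ge0 step_sigma_additive.

Let step_sigma_finite : sigma_finite setT lebesgue_step.
Proof.
have [F UF Foo] : sigma_finite setT (@lebesgue_measure R \x m)%E.
  have /sigma_finiteP[F [TF ndF Foo]] := sigma_finiteT (@lebesgue_measure R).
  have /sigma_finiteP[G [TG ndG Goo]] := sigma_finiteT m.
  exists (fun k => F k `*` G k).
    rewrite -setXTT TF TG predeqE => -[x y]; split.
      move=> [/= [i _ Fix] [k _ Gky]]; exists (maxn i k) => //; split.
      - by move: x Fix; exact/subsetPset/ndF/leq_maxl.
      - by move: y Gky; exact/subsetPset/ndG/leq_maxr.
    by move=> [i _ []/= ? ?]; split; exists i.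
  move=> k; have [? ?] := Foo k; have [? ?] := Goo k.
  split; first exact: measurableX.
  by rewrite product_measure1E// lte_mul_pinfty// ge0_fin_numE.
pose g (x : 'rV[R]_n.+1) : measurableTypeR R * 'rV[R]_n :=
  (x ord0 ord0, \row_j x ord0 (lift ord0 j)).
have mg : measurable_fun setT g.
  apply/measurable_fun_pair => /=; first exact: measurable_coord.
  apply: measurable_fun_coordP => i.
  rewrite (_ : _ \o _ =
    fun x : 'rV[R]_n.+1 => x ord0 (lift ord0 i) : measurableTypeR R).
    exact: measurable_coord.
  by apply/funext => x /=; rewrite mxE.
have gK p : g (rV_cons p) = p.
  case: p => a y; rewrite /g mxE unlift_none; congr pair.
  by apply/rowP => j; rewrite !mxE liftK.
exists (fun k => g @^-1` F k).
  by rewrite -preimage_bigcup -UF preimage_setT.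
move=> k; have [mF Fk] := Foo k; split.
  by rewrite -[X in measurable X]setTI; exact: mg.
rewrite /lebesgue_step /pushforward -comp_preimage.
by rewrite (_ : g \o _ = id) //; apply/funext => p /=; rewrite gK.
Qed.

HB.instance Definition _ := Measure_isSigmaFinite.Build _ _ _ lebesgue_step
  step_sigma_finite.

End step.

(* Lebesgue measure as an iterated product, through R x R^n = R^(n+1). *)
Fixpoint lebesgue_rV (n : nat) : {sigma_finite_measure set 'rV[R]_n -> \bar R} :=
  match n with
  | 0 => \d_ (0 : 'rV[R]_0)
  | n'.+1 => lebesgue_step (lebesgue_rV n')
  end.

End lebesgue_rV.

(* The library norm `|x| on 'rV[R]_N is the sup norm; balls and |grad u| need
   the Euclidean one. *)
Definition enorm (R : realType) (N : nat) (x : 'rV[R]_N) : R :=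
  Num.sqrt (\sum_(i < N) x ord0 i ^+ 2).

Definition eball (R : realType) (N : nat) (rho : R) : set 'rV[R]_N :=
  [set x | enorm x < rho].
Arguments eball {R} N rho.

Definition bdry (T : topologicalType) (A : set T) : set T :=
  closure A `\` interior A.

(* Surface measure of the sphere of radius rho, as a measure on R^N carried by
   that sphere, in polar coordinates: dS(E) = (N / rho) |cone over E|, where the
   cone over E is {s y : y in E, |y| = rho, 0 < s <= 1}. *)
Definition sphere_measure (R : realType) (N : nat) (rho : R)
    (E : set 'rV[R]_N) : \bar R :=
  ((N%:R / rho)%:E * lebesgue_rV R N
     [set x | (0 < enorm x <= rho)%R /\ E ((rho / enorm x)%R *: x)])%E.
Arguments sphere_measure {R} N rho E.

Fixpoint is_Ck (R : realType) (N : nat) (W : normedModType R) (k : nat)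
    (f : 'rV[R]_N -> W) : Prop :=
  match k with
  | 0 => continuous f
  | k'.+1 => (forall x, differentiable f x) /\ (forall v, is_Ck k' ('D_v f))
  end.

Definition smooth (R : realType) (N : nat) (W : normedModType R)
    (f : 'rV[R]_N -> W) : Prop := forall k, is_Ck k f.

Definition supp (R : realType) (N : nat) (W : normedModType R)
    (f : 'rV[R]_N -> W) : set 'rV[R]_N := closure [set x | f x != 0].

Definition grad (R : realType) (N : nat) (f : 'rV[R]_N -> R) (x : 'rV[R]_N) :
    'rV[R]_N := \row_i 'D_(delta_mx ord0 i) f x.

Section sobolev.
Context (R : realType) (N : nat) (p : R) (Omega : set 'rV[R]_N).

Local Notation leb := (lebesgue_rV R N).

(* A Sobolev function is handled as a pair (u, g) of Borel representatives of
   the function and of its weak gradient. *)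
Definition sobolev_pair : Type :=
  (('rV[R]_N -> R) * ('rV[R]_N -> 'rV[R]_N))%type.

(* The p-th power of the W^{1,p}(Omega)-norm. *)
Definition energy (w : sobolev_pair) : \bar R :=
  (\int[leb]_(x in Omega) (enorm (w.2 x) `^ p + `|w.1 x| `^ p)%:E)%E.

Definition Cc_infty : set ('rV[R]_N -> R) :=
  [set phi | [/\ smooth phi, compact (supp phi) & supp phi `<=` Omega]].

Definition weak_grad (u : 'rV[R]_N -> R) (g : 'rV[R]_N -> 'rV[R]_N) : Prop :=
  forall phi, Cc_infty phi -> forall i : 'I_N,
    (\int[leb]_(x in Omega) (u x * grad phi x ord0 i)%:E =
     - \int[leb]_(x in Omega) (g x ord0 i * phi x)%:E)%E.

Definition W1p : set sobolev_pair :=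
  [set w | [/\ measurable_fun Omega w.1, measurable_fun Omega w.2,
               (energy w < +oo)%E & weak_grad w.1 w.2]].

(* phi_n -> w in W^{1,p}(Omega), for classically differentiable phi_n. *)
Definition W1p_cvg (phi : nat -> 'rV[R]_N -> R) (w : sobolev_pair) : Prop :=
  (energy (fun x => phi n x - w.1 x, fun x => grad (phi n) x - w.2 x)
     @[n --> \oo] --> 0%E).

Definition W1p_closure (C : set ('rV[R]_N -> R)) : set sobolev_pair :=
  [set w | W1p w /\ exists2 phi, (forall n, C (phi n)) & W1p_cvg phi w].

Definition W1p0 : set sobolev_pair := W1p_closure Cc_infty.

(* Functions smooth up to the boundary are restrictions to closure Omega of
   smooth functions on R^N. *)
Definition W1pA (A : set 'rV[R]_N) : set sobolev_pair :=
  W1p_closure [set phi | smooth phi /\ forall x, A x -> phi x = 0].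

Section steklov.
Context (q : R) (sigma : set 'rV[R]_N -> \bar R).

(* The trace W^{1,p}(Omega) -> L^p(bdry Omega) is the extension by continuity of
   phi |-> phi|_(bdry Omega) on functions smooth up to the boundary. *)
Definition is_trace (w : sobolev_pair) (tr : 'rV[R]_N -> R) : Prop :=
  [/\ measurable_fun (bdry Omega) tr,
      (\int[sigma]_(x in bdry Omega) (`|tr x| `^ p)%:E < +oo)%E &
      exists phi : nat -> 'rV[R]_N -> R,
        [/\ forall n, smooth (phi n), W1p_cvg phi w &
            (\int[sigma]_(x in bdry Omega) (`|phi n x - tr x| `^ p)%:E
               @[n --> \oo] --> 0)%E]].

Definition steklov (A : set 'rV[R]_N) : \bar R :=
  ereal_inf [set y | exists w tr,
    [/\ W1pA A w, ~ W1p0 w, is_trace w tr &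
        y = (energy w /
             (\int[sigma]_(x in bdry Omega) (`|tr x| `^ q)%:E) `^ (p / q))%E]].

End steklov.
End sobolev.

Definition is_flow (R : realType) (N : nat) (V : 'rV[R]_N -> 'rV[R]_N)
    (psi : R -> 'rV[R]_N -> 'rV[R]_N) : Prop :=
  forall x, [/\ psi 0 x = x, {within `[0, +oo[, continuous (psi ^~ x)} &
    forall t : R, 0 < t -> is_derive t 1 (psi ^~ x) (V (psi t x))].

Definition preserves_volume (R : realType) (N : nat)
    (psi : R -> 'rV[R]_N -> 'rV[R]_N) (A : set 'rV[R]_N) : Prop :=
  forall t, 0 <= t -> lebesgue_rV R N (psi t @` A) = lebesgue_rV R N A.

(* Main.v *)
(* Let [h] be the normal component of [V] on the sphere of radius [r]. Volume
   preservation forces [h] to have mean zero on the sphere, and the hole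
   [psi_t(B_r)] has its boundary within [O(t^2)] of the graph [r + t h]. With
   [L] the value of the quotient for the radial extremal, one shows
   [S(t) = L + O(t^2)] by bounding [S] directly from both sides.

   Radial extremals [v] satisfy [v' = v / z], where [z] solves the Riccati
   equation [z' = 1 + (N-1)/(p-1) z/x - z^p/(p-1)], [z(r) = 0]; the flux is
   [z^(1-p)]. For the lower bound the flux, shifted along the graph of [t h], is
   used as a calibration on each ray: Young's inequality bounds the energy from
   below by a multiple of the integral of [|u|^p] over the outer sphere, up to a
   term linear in [t h]. That term is absorbed because [h] has mean zero: by a
   Poincare inequality on spheres it is controlled by [t] times the tangential
   part of the energy, hence costs only [O(t^2)]. Jensen's inequality on the
   sphere ([q <= p]) passes from the exponent [p] to [q]. For the upper bound,
   [v(|x| - t h - O(t^2))] vanishes on the hole, and the terms linear in [t]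
   in its energy and boundary norm again vanish since [h] has mean zero. *)
Require Import Defs.
From mathcomp Require Import all_boot all_order all_algebra.
From mathcomp Require Import all_classical all_reals all_analysis.
From mathcomp Require Import measurable_realfun ring lra.
Import Order.TTheory GRing.Theory Num.Theory.
Import numFieldNormedType.Exports.
Set Implicit Arguments.
Unset Strict Implicit.
Unset Printing Implicit Defensive.
Local Open Scope classical_set_scope.
Local Open Scope ring_scope.

(** * The Euclidean norm on row vectors *)

(** Neither minimisers for [steklov] nor differentiability of [S] is established beforehand, and no
    shape derivative is computed. The deformed ball and the original one obey the same two bounds,
    so the difference quotient is squeezed without a separate evaluation of [S 0]; each bound has to
    be exact to first order. The extremal is approached through [z = v / v'] because [v' / v] is
    infinite at radius [r], where [v] vanishes, while [z] starts from 0 there. This singularity,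
    placed just inside the hole, is what makes the calibration sharp. The flux is dilated rather
    than translated, since a dilation only changes the constant on the right of its equation. In the
    test function the angular tilt is harmless: [h] is homogeneous of degree 0, so its gradient is
    orthogonal to the radial direction and enters squared. Directions are averaged over a punctured
    ball instead of the sphere: only Lebesgue measure is needed, and the Poincare inequality is
    proved along chords of that ball. Both bounds work with smooth functions; the trace inequality
    carries the lower one to the closure. *)

Section euclidean_norm.
Context (R : realType) (N : nat).
Implicit Types (x y : 'rV[R]_N) (a : R).

Definition dot x y : R := \sum_(i < N) x ord0 i * y ord0 i.

Lemma dotC x y : dot x y = dot y x.
Proof. by apply: eq_bigr => i _; rewrite mulrC. Qed.

Lemma dotDl x y z : dot (x + y) z = dot x z + dot y z.
Proof.
by rewrite /dot -big_split /=; apply: eq_bigr => i _; rewrite mxE mulrDl.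
Qed.

Lemma dotZl a x y : dot (a *: x) y = a * dot x y.
Proof.
by rewrite /dot mulr_sumr; apply: eq_bigr => i _; rewrite mxE mulrA.
Qed.

Lemma dotDr x y z : dot x (y + z) = dot x y + dot x z.
Proof. by rewrite dotC dotDl !(dotC x). Qed.

Lemma dotZr a x y : dot x (a *: y) = a * dot x y.
Proof. by rewrite dotC dotZl dotC. Qed.

Lemma enorm2 x : enorm x ^+ 2 = dot x x.
Proof. by rewrite sqr_sqrtr ?sumr_ge0// => i _; rewrite sqr_ge0. Qed.

Lemma dotxx_ge0 x : 0 <= dot x x.
Proof. by rewrite -enorm2 sqr_ge0. Qed.

Lemma enorm_ge0 x : 0 <= enorm x.
Proof. exact: sqrtr_ge0. Qed.

Lemma enormE x : enorm x = Num.sqrt (dot x x).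
Proof. by []. Qed.

Lemma enormZ a x : enorm (a *: x) = `|a| * enorm x.
Proof. by rewrite !enormE dotZl dotZr mulrA -expr2 sqrtrM ?sqr_ge0// sqrtr_sqr. Qed.

Lemma enorm0 : enorm (0 : 'rV[R]_N) = 0.
Proof. by rewrite -(scale0r 0) enormZ normr0 mul0r. Qed.

Lemma enormN x : enorm (- x) = enorm x.
Proof. by rewrite -scaleN1r enormZ normrN1 mul1r. Qed.

Lemma normr_coord_enorm x i : `|x ord0 i| <= enorm x.
Proof.
rewrite -ler_sqr ?nnegrE ?normr_ge0 ?enorm_ge0// enorm2 real_normK ?num_real//.
rewrite /dot (bigD1 i)//= -expr2 lerDl sumr_ge0// => j _.
by rewrite -expr2 sqr_ge0.
Qed.

Lemma enorm_eq0 x : (enorm x == 0) = (x == 0).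
Proof.
apply/eqP/eqP => [x0|->]; last exact: enorm0.
apply/rowP => i; rewrite mxE; apply/eqP; rewrite -normr_le0 -x0.
exact: normr_coord_enorm.
Qed.

Lemma enorm_gt0 x : (0 < enorm x) = (x != 0).
Proof. by rewrite lt_neqAle enorm_ge0 andbT eq_sym enorm_eq0. Qed.

Lemma dot_le_enorm x y : dot x y <= enorm x * enorm y.
Proof.
have [x0|x0] := eqVneq x 0.
  by rewrite x0 -(scale0r 0) dotZl mul0r mulr_ge0// enorm_ge0.
have [y0|y0] := eqVneq y 0.
  by rewrite y0 -(scale0r 0) dotZr mul0r mulr_ge0// enorm_ge0.
have ex : 0 < enorm x by rewrite enorm_gt0.
have ey : 0 < enorm y by rewrite enorm_gt0.
have := dotxx_ge0 (enorm y *: x + (- enorm x) *: y).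
rewrite !dotDl !dotDr !dotZl !dotZr -!enorm2 (dotC y x) => H.
have {}H : 0 <= 2 * (enorm x * enorm y) * (enorm x * enorm y - dot x y).
  by move: H; congr (_ <= _); ring.
by move: H; rewrite pmulr_rge0 ?subr_ge0// !mulr_gt0.
Qed.

Lemma normr_dot_le_enorm x y : `|dot x y| <= enorm x * enorm y.
Proof.
rewrite ler_norml dot_le_enorm andbT lerNl.
by rewrite -mulN1r -dotZl -(enormN x) scaleN1r dot_le_enorm.
Qed.

Lemma enormD x y : enorm (x + y) <= enorm x + enorm y.
Proof.
rewrite -ler_sqr ?nnegrE ?addr_ge0 ?enorm_ge0// enorm2 sqrrD !enorm2.
rewrite !dotDl !dotDr (dotC y x).
have := dot_le_enorm x y; lra.
Qed.

Lemma enormB x y : enorm (x - y) <= enorm x + enorm y.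
Proof. by rewrite (le_trans (enormD _ _))// enormN. Qed.

Lemma enorm_distl x y : enorm x - enorm y <= enorm (x - y).
Proof. by rewrite lerBlDr -{1}(subrK y x) enormD. Qed.

Lemma normr_le_enorm x : `|x| <= enorm x.
Proof.
have -> : `|x| = mx_norm x by [].
rewrite mx_normrE; elim/big_ind : _ => //.
- exact: enorm_ge0.
- by move=> a b ha hb; rewrite ge_max ha.
- by move=> i _; rewrite (ord1 i.1); exact: normr_coord_enorm.
Qed.

Lemma coord_le_normr x i : `|x ord0 i| <= `|x|.
Proof.
have -> : `|x| = mx_norm x by [].
rewrite mx_normrE; exact: (le_bigmax _ (fun j : _ * _ => `|x j.1 j.2|) (ord0, i)).
Qed.

(** Topology and continuity refer to the sup norm, lengths to the Euclidean one. Only the existence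
    of a constant matters, so [N] stands where its square root would do. *)
Lemma enorm_le_normr x : enorm x <= N%:R * `|x|.
Proof.
rewrite -ler_sqr ?nnegrE ?mulr_ge0 ?enorm_ge0// enorm2 /dot.
apply: (@le_trans _ _ (\sum_(i < N) `|x| ^+ 2)).
  apply: ler_sum => i _; rewrite -expr2 -real_normK ?num_real//.
  by rewrite ler_sqr ?nnegrE// coord_le_normr.
rewrite sumr_const card_ord -[leLHS]mulr_natl exprMn.
apply: ler_wpM2r; first exact: sqr_ge0.
by rewrite -natrX ler_nat; case: (N) => // n; rewrite leq_pmulr.
Qed.

Lemma enorm_delta i : enorm (delta_mx ord0 i : 'rV[R]_N) = 1.
Proof.
rewrite enormE /dot (bigD1 i)//= mxE !eqxx mulr1 big1 ?addr0 ?sqrtr1// => j ji.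
by rewrite mxE (negbTE ji) andbF mulr0.
Qed.

Lemma dot_delta x i : dot x (delta_mx ord0 i) = x ord0 i.
Proof.
rewrite /dot (bigD1 i)//= mxE !eqxx mulr1 big1 ?addr0// => j ji.
by rewrite mxE (negbTE ji) andbF mulr0.
Qed.

Lemma coord_continuous_rV i : continuous (fun x : 'rV[R]_N => x ord0 i).
Proof. exact: coord_continuous. Qed.

Lemma continuous_dot (T : topologicalType) (f g : T -> 'rV[R]_N) :
  continuous f -> continuous g -> continuous (fun t => dot (f t) (g t)).
Proof.
move=> cf cg t; apply: (@cvg_big _ _ _ 0); first exact: add_continuous.
move=> i _; apply: cvgM.
- by apply: (@continuous_comp _ _ _ f (fun x => x ord0 i)); [exact: cf|exact: coord_continuous].
- by apply: (@continuous_comp _ _ _ g (fun x => x ord0 i)); [exact: cg|exact: coord_continuous].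
Qed.

Lemma continuous_enorm : continuous (@enorm R N).
Proof.
move=> x; rewrite /enorm; apply: continuous_comp; last exact: sqrt_continuous.
by apply: (@continuous_dot _ id id) => // y; exact: cvg_id.
Qed.

Lemma open_eball rho : open (eball N rho : set 'rV[R]_N).
Proof.
rewrite (_ : eball N rho = @enorm R N @^-1` `]-oo, rho[); last first.
  by apply/seteqP; split => x /=; rewrite in_itv.
apply: open_comp; last exact: interval_open.
by move=> x _; exact: continuous_enorm.
Qed.

End euclidean_norm.

(** * Borel measurability in R^N *)

Section measurability.
Context (R : realType) (N : nat).

Lemma measurable_ball_rV (x : 'rV[R]_N) (e : R) :
  measurable (ball x e : set 'rV[R]_N).
Proof.
have [e0|e0] := ltP 0 e; last first.
  rewrite (_ : ball x e = set0); first exact: measurable0.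
  by apply/seteqP; split => y //= [] /(le_lt_trans e0); rewrite ltxx.
rewrite (_ : ball x e = \bigcap_(i in [set: 'I_N]) (fun y : 'rV[R]_N => y ord0 i : measurableTypeR R) @^-1` (ball (x ord0 i) e)); last first.
  apply/seteqP; split => [y [_ H] i _ /=|y H]; first exact: H.
  by split => // i j; rewrite (ord1 i); exact: H.
apply: fin_bigcap_measurable => // i _.
rewrite -[X in measurable X]setTI; apply: measurable_coord => //.
exact: measurable_ball.
Qed.

(** The sigma-algebra is generated by the coordinates, so openness is traded for a countable union:
    an open set is the union of the sup-norm balls with rational centre and radius [1 / (n + 1)]
    that it contains. *)
Lemma measurable_open_rV (A : set 'rV[R]_N) : open A -> measurable A.
Proof.
move=> oA.
pose toR (q : 'rV[rat]_N) : 'rV[R]_N := map_mx ratr q.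
rewrite (_ : A = \bigcup_(c in [set c : 'rV[rat]_N * nat | ball (toR c.1) (c.2.+1%:R^-1) `<=` A])
   ball (toR c.1) (c.2.+1%:R^-1)).
  rewrite bigcup_mkcond; apply: countable_bigcupT_measurable => //.
  by move=> c; case: ifP => // _; exact: measurable_ball_rV.
apply/seteqP; split => [x Ax|x [c /= +]]; last exact.
have /nbhs_ballP[e /= e0 xeA] : nbhs x A by exact: open_nbhs_nbhs.
(* Half of [e], because both [x] and an arbitrary point of the rational ball are within
   [1 / (n + 1)] of its centre. *)
have [n ne] : exists n : nat, (n.+1%:R^-1 : R) < e / 2.
  have [n _ /(_ n (leqnn n)) H] := near_infty_natSinv_lt (PosNum (divr_gt0 e0 (ltr0Sn R 1))).
  by exists n.
have H i : exists q : rat, ball (x ord0 i) (n.+1%:R^-1) (ratr q : R).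
  have [q] := @rat_in_itvoo R (x ord0 i - n.+1%:R^-1) (x ord0 i + n.+1%:R^-1) ltac:(by rewrite ltrBlDr -addrA ltrDl addr_gt0).
  rewrite in_itv/= => /andP[h1 h2]; exists q.
  by rewrite /ball/= distrC ltr_distl h1.
have [f Hf] := choice H.
have xq : ball (toR (\row_i f i)) (n.+1%:R^-1) x.
  split; first by rewrite invr_gt0.
  by move=> i j; rewrite (ord1 i) !mxE; exact/ball_sym/Hf.
exists (\row_i f i, n) => //= y yb; apply: xeA.
have := ball_triangle (ball_sym xq) yb.
by apply: le_ball; rewrite [leRHS](splitr e); apply: lerD; exact: ltW.
Qed.

Lemma continuous_measurable_rV (f : 'rV[R]_N -> R) :
  continuous f -> measurable_fun [set: 'rV[R]_N] f.
Proof.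
move=> /continuousP cf; apply: (measurability _ (RGenOpens.measurableE R)) => //.
move=> _ [_ [a [b ->] <-]]; rewrite setTI; apply: measurable_open_rV.
by apply: cf; exact: interval_open.
Qed.

Lemma measurable_enorm : measurable_fun [set: 'rV[R]_N] (@enorm R N).
Proof. by apply: continuous_measurable_rV; exact: continuous_enorm. Qed.

Lemma measurable_eball rho : measurable (eball N rho : set 'rV[R]_N).
Proof. by apply: measurable_open_rV; exact: open_eball. Qed.

Lemma measurable_set1_rV (x : 'rV[R]_N) : measurable [set x].
Proof.
rewrite -[X in measurable X]setCK; apply: measurableC; apply: measurable_open_rV.
rewrite openC; apply: accessible_closed_set1; exact: hausdorff_accessible.
Qed.

End measurability.

(** * Polar coordinates *)

Section affine_change.
Context (R : realType).

(** Lebesgue measure is determined by its values on half-open intervals; the pushforward under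
    [x |-> c * x + b], multiplied by [c], has the same values. *)
Lemma integral_affine_R (c b : R) (g : R -> \bar R) : 0 < c ->
  measurable_fun [set: measurableTypeR R] g -> (forall x, 0 <= g x)%E ->
  (\int[@lebesgue_measure R]_x g (c * x + b)%R =
   (c^-1)%:E * \int[@lebesgue_measure R]_x g x)%E.
Proof.
move=> c0 mg g0.
pose phi : measurableTypeR R -> measurableTypeR R := fun x => c * x + b.
have mphi : measurable_fun setT phi.
  by apply: measurable_funD => //; exact: measurable_funM.
pose mu := pushforward (@lebesgue_measure R) phi.
pose nu := mscale (NngNum (ltW c0)) (measure_function_pushforward__canonical__measure_function_Measure (@lebesgue_measure R) mphi).
have E A : measurable A -> lebesgue_measure A = nu A.
  apply: lebesgue_measure_unique => //= _ [[x y]] _ <-.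
  rewrite /nu /mscale/= /pushforward.
  rewrite (_ : phi @^-1` _ = `](x - b) / c, (y - b) / c]%classic); last first.
    apply/seteqP; split => z /=; rewrite !in_itv/= /phi;
      by rewrite ltr_pdivrMr// ler_pdivlMr// ltrBlDr lerBrDr (mulrC z).
  rewrite !lebesgue_measure_itv/= !lte_fin ltr_pM2r ?invr_gt0// ltrD2r.
  case: ifPn => xy; last by rewrite mule0.
  rewrite -!EFinB -EFinM; congr EFin; field; exact: lt0r_neq0.
have -> : (\int[@lebesgue_measure R]_x g x = \int[nu]_x g x)%E.
  by apply: eq_measure_integral => A mA _; exact: E.
rewrite ge0_integral_mscale// muleA -EFinM/= mulVf ?lt0r_neq0// mul1e.
by rewrite ge0_integral_pushforward.
Qed.

Lemma measurable_fun_rV_comp d (T : measurableType d) n (f : T -> 'rV[R]_n) :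
  (forall i, measurable_fun [set: T] (fun t => f t ord0 i : measurableTypeR R)) ->
  measurable_fun [set: T] f.
Proof. by move=> H; apply: measurable_fun_coordP. Qed.

Lemma measurable_fun_scale_rV d (T : measurableType d) n (a : T -> R)
  (f : T -> 'rV[R]_n) : measurable_fun [set: T] a -> measurable_fun [set: T] f ->
  measurable_fun [set: T] (fun t => a t *: f t).
Proof.
move=> ma mf; apply: measurable_fun_rV_comp => i.
rewrite [X in measurable_fun _ X](_ : _ = fun t => a t * f t ord0 i); last first.
  by apply/funext => p; rewrite mxE.
by apply: measurable_funM => //; exact: (measurableT_comp (measurable_coord i) mf).
Qed.

Lemma measurable_fun_add_rV d (T : measurableType d) n
  (f g : T -> 'rV[R]_n) : measurable_fun [set: T] f -> measurable_fun [set: T] g ->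
  measurable_fun [set: T] (fun t => f t + g t).
Proof.
move=> mf mg; apply: measurable_fun_rV_comp => i.
rewrite [X in measurable_fun _ X](_ : _ = fun t => f t ord0 i + g t ord0 i); last first.
  by apply/funext => p; rewrite mxE.
by apply: measurable_funD; apply: (measurableT_comp (measurable_coord i)).
Qed.

Lemma integral_rV_S n (g : 'rV[R]_n.+1 -> \bar R) :
  measurable_fun setT g -> (forall x, 0 <= g x)%E ->
  (\int[lebesgue_rV R n.+1]_x g x =
   \int[@lebesgue_measure R]_a \int[lebesgue_rV R n]_y g (rV_cons (a, y)))%E.
Proof.
move=> mg g0.
transitivity (\int[@lebesgue_measure R \x lebesgue_rV R n]_p g (rV_cons p))%E.
  by rewrite (ge0_integral_pushforward (@measurable_rV_cons R n)).
rewrite (fubini_tonelli1 (fun p => g (rV_cons p)))//.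
exact: measurableT_comp mg (@measurable_rV_cons R n).
Qed.

Lemma measurable_integral_rV_cons n (g : 'rV[R]_n.+1 -> \bar R) :
  measurable_fun setT g -> (forall x, 0 <= g x)%E ->
  measurable_fun [set: measurableTypeR R]
    (fun a => \int[lebesgue_rV R n]_y g (rV_cons (a, y)))%E.
Proof.
move=> mg g0.
apply: (@measurable_fun_fubini_tonelli_F _ _ (measurableTypeR R) 'rV[R]_n R (lebesgue_rV R n) (fun p => g (rV_cons p))) => //.
exact: measurableT_comp mg (@measurable_rV_cons R n).
Qed.

Lemma rV0E (x : 'rV[R]_0) : x = 0.
Proof. by apply/rowP => -[]. Qed.

(** Induction along the iterated definition of [lebesgue_rV]: the first coordinate contributes one
    factor [c^-1], the remaining ones are the induction hypothesis on each slice. *)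
Lemma integral_affine_rV n (c : R) (b : 'rV[R]_n) (g : 'rV[R]_n -> \bar R) :
  0 < c -> measurable_fun setT g -> (forall x, 0 <= g x)%E ->
  (\int[lebesgue_rV R n]_x g (c *: x + b)%R =
   (c^-1 ^+ n)%:E * \int[lebesgue_rV R n]_x g x)%E.
Proof.
move=> c0; elim: n => [|n IH] in b g *; move=> mg g0.
  rewrite expr0 mul1e; apply: eq_integral => x _.
  by rewrite (rV0E (_ + _)) (rV0E x).
have mg' : measurable_fun [set: 'rV[R]_n.+1] (fun x => g (c *: x + b)).
  apply: (measurableT_comp mg); apply: measurable_fun_add_rV => //.
  exact: measurable_fun_scale_rV.
rewrite !integral_rV_S//.
pose b' : 'rV[R]_n := \row_j b ord0 (lift ord0 j).
have E a y : c *: rV_cons (a, y) + b = rV_cons (c * a + b ord0 ord0, c *: y + b').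
  apply/rowP => i; rewrite !mxE; case: (unliftP ord0 i) => [j ->|->].
    by rewrite /= !mxE.
  by [].
transitivity (\int[@lebesgue_measure R]_a
    ((c^-1 ^+ n)%:E * \int[lebesgue_rV R n]_y g (rV_cons ((c * a + b ord0 ord0)%R, y))))%E.
  apply: eq_integral => a _; under eq_integral do rewrite E.
  rewrite (IH b' (fun y => g (rV_cons (c * a + b ord0 ord0, y))))//.
  apply: (measurableT_comp mg).
  by apply: (measurableT_comp (@measurable_rV_cons R n)); exact: measurable_pair1.
have mF := measurable_integral_rV_cons mg g0.
have F0 a : (0 <= \int[lebesgue_rV R n]_y g (rV_cons (a, y)))%E by exact: integral_ge0.
have mc : measurable_fun [set: measurableTypeR R] (fun a : measurableTypeR R => c * a + b ord0 ord0).
  by apply: measurable_funD => //; exact: measurable_funM.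
have cn0 : (0 <= (c^-1 ^+ n)%:E)%E by rewrite lee_fin exprn_ge0// invr_ge0 ltW.
rewrite (ge0_integralZl _ measurableT (measurableT_comp mF mc) (fun a _ => F0 _) cn0).
rewrite (@integral_affine_R c _ (fun a => \int[lebesgue_rV R n]_y g (rV_cons (a, y)))%E)//.
by rewrite muleA -EFinM -exprSr.
Qed.

Lemma lebesgue_rV_set0 n : lebesgue_rV R n.+1 [set (0 : 'rV[R]_n.+1)] = 0%E.
Proof.
rewrite -[LHS]mul1e -integral_cst; last exact: measurable_set1_rV.
rewrite integral_mkcond integral_rV_S; first last.
- by move=> x; rewrite patchE; case: ifP.
- by apply/(measurable_restrictT _ (measurable_set1_rV _)).
rewrite (_ : (fun a => _) = (fun a => \int[lebesgue_rV R n]_y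
   ((cst 1%E) \_ [set (0 : 'rV[R]_n.+1)%R]) (rV_cons (a, y)))%E \_ [set 0]).
  by rewrite -integral_mkcond integral_set1.
apply/funext => a; rewrite patchE; case: ifPn => // /negP a0.
apply: integral0_eq => y _; rewrite patchE; case: ifPn => // /set_mem.
move=> /rowP/(_ ord0); rewrite !mxE unlift_none/= => a0'.
by exfalso; apply: a0; rewrite inE.
Qed.

End affine_change.

(** * The polar decomposition, with directions averaged over a ball *)

Section polar.
Context (R : realType) (n : nat).
Local Notation N := n.+1.
Local Notation leb := (lebesgue_rV R N).

Definition punctured_ball (rho : R) : set 'rV[R]_N :=
  [set x | 0 < enorm x <= rho].

Lemma measurable_punctured_ball rho : measurable (punctured_ball rho).
Proof.
rewrite (_ : punctured_ball rho = @enorm R N @^-1` `]0, rho]); last first.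
  by apply/seteqP; split => x /=; rewrite in_itv.
rewrite -[X in measurable X]setTI; apply: measurable_enorm => //.
Qed.

(** Inversion is discontinuous at 0, but it is a product of [x] with a real power of [x ^+ 2], and
    real powers are measurable on the whole line. *)
Lemma measurable_invr : measurable_fun [set: R] (@GRing.inv R).
Proof.
rewrite (_ : @GRing.inv R = fun x => x * (x ^+ 2) `^ (-1)); last first.
  apply/funext => x; rewrite powR_inv1 ?sqr_ge0//.
  by have [->|x0] := eqVneq x 0; rewrite ?invr0 ?mul0r//; field.
apply: measurable_funM => //; apply: (measurableT_comp (measurable_powR _)).
exact: measurable_funX.
Qed.

Lemma measurable_inv_pow m :
  measurable_fun [set: measurableTypeR R] (fun s : measurableTypeR R => (s ^+ m)^-1).
Proof. by apply: (measurableT_comp measurable_invr); exact: measurable_funX. Qed.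

Lemma integral_powV (a : R) : 0 < a ->
  (\int[@lebesgue_measure R]_(s in `[a, +oo[) ((s ^- N.+1)%:E) =
   ((a ^- N) / N%:R)%:E)%E.
Proof.
move=> a0; pose F (s : R) := - (s ^- N / N%:R).
have dF (s : R) : 0 < s -> is_derive s 1 F (s ^- N.+1).
  move=> s0.
  have -> : F = (fun s => - N%:R^-1) * (fun s => (s ^+ N)^-1).
    by apply/funext => x; rewrite /F /= !fctE mulNr mulrC.
  have d1 : is_derive s 1 (fun s : R => s ^+ N) (N%:R * s ^+ n).
    have := @is_deriveX _ _ id N s 1 1 (is_derive_id s 1).
    rewrite (_ : id ^+ N = fun s => s ^+ N); last by apply/funext => x; rewrite exprfctE.
    by move=> h; apply: is_derive_eq; rewrite [LHS]mulr1 -mulr_natl.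
  have sN0 : s ^+ N != 0 by rewrite expf_neq0// lt0r_neq0.
  have d2 : is_derive s 1 (fun s : R => (s ^+ N)^-1) (- (s ^+ N) ^- 2 * (N%:R * s ^+ n)).
    apply: DeriveDef; first by apply: derivableV => //; apply: ex_derive.
    rewrite (@deriveV _ _ (fun s : R => s ^+ N) s 1 sN0); last exact: ex_derive.
    by rewrite derive_val.
  apply: is_derive_eq.
  rewrite scaler0 addr0; change (- N%:R^-1 * (- s ^+ N ^- 2 * (N%:R * s ^+ n)) = s ^- N.+1).
  have N0 : N%:R != 0 :> R by rewrite pnatr_eq0.
  rewrite !(exprS s); field.
  by rewrite -natr1 addrC in N0; rewrite N0 expf_neq0 lt0r_neq0.
rewrite (@ge0_continuous_FTC2y _ (fun s => s ^- N.+1) F a 0)//.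
- by rewrite /F -EFinB sub0r opprK.
- by move=> x ax; rewrite invr_ge0 exprn_ge0// (le_trans (ltW a0)).
- apply: continuous_in_subspaceT => x; rewrite inE/= in_itv/= andbT => ax.
  have x0 : 0 < x by exact: lt_le_trans ax.
  apply: cvgV; first by rewrite expf_neq0// lt0r_neq0.
  exact: exprn_continuous.
- rewrite -[X in _ --> X](_ : - (0 / N%:R) = 0); last by rewrite mul0r oppr0.
  apply: cvgN; apply: cvgM; last exact: cvg_cst.
  apply/cvgrPdist_lt => e e0; near=> t.
  have t1 : 1 < t by near: t; exact: nbhs_pinfty_gt.
  have t0 : 0 < t by exact: lt_trans t1.
  rewrite sub0r normrN ger0_norm ?invr_ge0 ?exprn_ge0 ?ltW//.
  have te : e^-1 < t by near: t; apply: nbhs_pinfty_gt; exact: num_real.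
  rewrite invf_plt ?posrE ?exprn_gt0// (lt_le_trans te)//.
  by rewrite exprS ler_peMr ?exprn_ege1// ltW.
- by move=> x ax; have /dF[] : 0 < x by exact: lt_trans ax.
- apply: cvg_at_right_filter; apply: differentiable_continuous.
  by apply/derivable1_diffP; have [] := dF a a0.
- by move=> x; rewrite in_itv/= andbT => ax; rewrite derive1E; apply: derive_val; apply: dF; exact: lt_trans ax.
Unshelve. all: by end_near. Qed.

Definition ray (x : 'rV[R]_N) (s : R) : 'rV[R]_N := (s / enorm x) *: x.

(** Substitute [s = |x| t] on each ray, swap the integrals, put [y = t x] for fixed [t], and swap
    back. What remains is the integral of [t ^- N.+1] over [t >= |y| / rho], equal to
    [(rho / |y|)^N / N]; this is the origin of the constant. *)
Theorem polar_coordinates (rho : R) (g : 'rV[R]_N -> R) : 0 < rho ->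
  measurable_fun setT g -> (forall x, 0 <= g x) ->
  (\int[leb]_x (g x)%:E = (N%:R / rho ^+ N)%:E *
    \int[leb]_(x in punctured_ball rho)
      \int[@lebesgue_measure R]_(s in `]0%R, +oo[) (g (ray x s) * s ^+ n)%:E)%E.
Proof.
move=> rho0 mg g0.
pose ind (x : 'rV[R]_N) : R := \1_(punctured_ball rho) x.
(* The integrand after the substitution along each ray. *)
pose K (p : 'rV[R]_N * measurableTypeR R) : R :=
  ind p.1 * \1_(`]0%R, +oo[%classic : set R) p.2 * (g (p.2 *: p.1) * enorm p.1 ^+ N * p.2 ^+ n).
have mK : measurable_fun setT K.
  apply: measurable_funM.
    apply: measurable_funM.
      apply: (measurableT_comp _ measurable_fst).
      exact: measurable_indic (measurable_punctured_ball rho).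
    by apply: (measurableT_comp _ measurable_snd); exact: measurable_indic.
  apply: measurable_funM.
    apply: measurable_funM.
      apply: (measurableT_comp mg).
      exact: measurable_fun_scale_rV.
    apply: measurable_funX; apply: (measurableT_comp (@measurable_enorm _ _)); exact: measurable_fst.
  by apply: measurable_funX; exact: measurable_snd.
have K0 p : 0 <= K p.
  rewrite /K /ind !indicE; case: (_ \in _); rewrite ?mul0r// mul1r.
  have [|_] := boolP (p.2 \in _); last by rewrite mul0r.
  rewrite mem_setE in_itv/= andbT => p0.
  by rewrite mul1r !mulr_ge0 ?exprn_ge0 ?enorm_ge0// ltW.
have -> : (\int[leb]_(x in punctured_ball rho)
      \int[@lebesgue_measure R]_(s in `]0%R, +oo[) (g (ray x s) * s ^+ n)%:E =
   \int[leb]_x \int[@lebesgue_measure R]_s (K (x, s))%:E)%E.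
  rewrite integral_mkcond; apply: eq_integral => x _; rewrite patchE.
  case: ifPn => [xr|xr]; last first.
    apply/esym; apply: integral0_eq => s _.
    by rewrite /K/ind/= indicE (negbTE xr) !mul0r.
  have /andP[ex _] := set_mem xr.
  rewrite integral_mkcond.
  have := @integral_affine_R R (enorm x)^-1 0 (fun s => (K (x, s))%:E).
  rewrite invr_gt0 => /(_ ex) H; rewrite -[RHS]mul1e.
  have -> : 1%E = ((enorm x)^-1 * (enorm x)^-1^-1)%:E.
    by rewrite invrK mulVf ?lt0r_neq0.
  rewrite EFinM -muleA -H; first last.
  - by move=> s; rewrite lee_fin.
  - apply/measurable_EFinP; apply: (measurableT_comp mK); exact: measurable_pair1.
  rewrite -ge0_integralZl//; first last.
  - by rewrite lee_fin invr_ge0 ltW.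
  - by move=> s _; rewrite lee_fin.
  - apply/measurable_EFinP; apply: (measurableT_comp mK).
    apply/measurable_fun_pair => //=.
    by apply: measurable_funD => //; exact: measurable_funM.
  apply: eq_integral => s _; rewrite patchE -EFinM.
  have E : (s \in (`]0, +oo[%classic : set R)) = (((enorm x)^-1 * s + 0) \in (`]0, +oo[%classic : set R)).
    rewrite !mem_setE addr0 !in_itv/= !andbT pmulr_rgt0 ?invr_gt0//.
  rewrite /K/ind/= !indicE xr -E; case: ifPn => [s0|_]; last by rewrite mulr0 !mul0r mulr0.
  rewrite !mul1r addr0 /ray (mulrC s) exprMn exprVn; congr EFin.
  rewrite (exprS (enorm x) n); field.
  by rewrite expf_neq0 lt0r_neq0.
rewrite (fubini_tonelli (fun p => (K p)%:E)); first last.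
- by move=> p; rewrite lee_fin.
- exact/measurable_EFinP.
(* The integrand after [y = s x]. The Jacobian [s ^- N], the factor [|x|^N = |y|^N s^(-N)] and
   [s ^+ n] combine to [|y|^N s^(-N-1)], and [|x| <= rho] becomes a lower bound on [s]. *)
pose L (p : 'rV[R]_N * measurableTypeR R) : R := \1_[set p : 'rV[R]_N * measurableTypeR R | p.1 != 0 /\ enorm p.1 / rho <= p.2] p
  * (g p.1 * enorm p.1 ^+ N * p.2 ^- N.+1).
have mset : measurable [set p : 'rV[R]_N * measurableTypeR R | p.1 != 0 /\ enorm p.1 / rho <= p.2].
  rewrite (_ : [set _ | _] = (fst @^-1` ~` [set 0]) `&` ((fun p => enorm p.1 / rho <= p.2) @^-1` [set true])); last first.
    by apply/seteqP; split => p /= [/eqP h1 h2]; split => //; apply/eqP.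
  apply: measurableI; rewrite -[X in measurable X]setTI.
    by apply: measurable_fst => //; apply: measurableC; exact: measurable_set1_rV.
  apply: (@measurable_fun_ler _ ('rV[R]_N * measurableTypeR R)%type _ _ (fun p : 'rV[R]_N * measurableTypeR R => enorm p.1 / rho) (fun p : 'rV[R]_N * measurableTypeR R => (p.2 : R))) => //; last exact: measurable_snd.
    apply: measurable_funM => //; apply: (measurableT_comp (@measurable_enorm _ _)); exact: measurable_fst.
have mL : measurable_fun setT L.
  apply: measurable_funM.
    exact: measurable_indic.
  apply: measurable_funM.
    apply: measurable_funM; first exact: (measurableT_comp mg).
    apply: measurable_funX; apply: (measurableT_comp (@measurable_enorm _ _)); exact: measurable_fst.
  rewrite (_ : (fun p => _) = (fun s => (s ^+ N.+1)^-1) \o snd)//.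
  apply: measurableT_comp => //.
  apply: measurable_inv_pow.
have L0 p : 0 <= L p.
  rewrite /L indicE; have [|_] := boolP (p \in _); last by rewrite mul0r.
  rewrite inE/= => -[_ H]; rewrite mul1r.
  have p20 : 0 <= p.2 by apply: le_trans H; rewrite divr_ge0 ?enorm_ge0 ?ltW.
  by rewrite !mulr_ge0 ?invr_ge0 ?exprn_ge0 ?enorm_ge0.
have -> : (\int[@lebesgue_measure R]_s \int[leb]_x (K (x, s))%:E =
   \int[@lebesgue_measure R]_s \int[leb]_y (L (y, s))%:E)%E.
  apply: eq_integral => s _.
  have [s0|s0] := leP s 0.
    rewrite integral0_eq; last first.
      move=> x _; rewrite /K/= indicE (_ : _ \in _ = false) ?mulr0 ?mul0r//.
      by apply/negbTE; rewrite mem_setE in_itv/= andbT -leNgt.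
    rewrite integral0_eq// => x _; rewrite /L/= indicE.
    have [|_] := boolP ((x, s) \in _); last by rewrite mul0r.
    rewrite inE/= => -[x0 H]; exfalso.
    have : enorm x / rho <= 0 by exact: le_trans H s0.
    by rewrite leNgt divr_gt0// enorm_gt0.
  have mLs : measurable_fun setT (fun y => (L (y, s))%:E).
    by apply/measurable_EFinP; apply: (measurableT_comp mL); exact: measurable_pair2.
  rewrite -[RHS]mul1e -(_ : ((s ^+ N) * s^-1 ^+ N)%:E = 1%E); last first.
    by rewrite exprVn mulfV// expf_neq0// lt0r_neq0.
  rewrite EFinM -muleA -(@integral_affine_rV R N s 0 (fun y => (L (y, s))%:E) s0)//; last first.
    by move=> y; rewrite lee_fin.
  rewrite -ge0_integralZl//; first last.
  - by rewrite lee_fin exprn_ge0// ltW.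
  - by move=> y _; rewrite lee_fin.
  - apply: (measurableT_comp mLs); apply: measurable_fun_add_rV => //.
    exact: measurable_fun_scale_rV.
  apply: eq_integral => x _; rewrite -EFinM /K /L /ind /= addr0; congr EFin.
  rewrite !indicE /= (_ : (s \in _) = true); last by rewrite mem_setE in_itv/= andbT.
  rewrite (_ : _ \in [set p | _] = (x \in punctured_ball rho)); last first.
    apply/idP/idP; rewrite !inE /punctured_ball/= scaler_eq0 negb_or lt0r_neq0//= enormZ gtr0_norm//.
      move=> [x0]; rewrite -mulrA ger_pMr// ler_pdivrMr// mul1r enorm_gt0 => ->; rewrite andbT//.
    by move=> /andP[x0 xr]; rewrite -enorm_gt0 x0 -mulrA ger_pMr// ler_pdivrMr// mul1r.
  case: (x \in _); rewrite ?mul0r ?mulr0// !mul1r enormZ gtr0_norm// exprMn.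
  rewrite !(exprS s); field.
  by rewrite expf_neq0 lt0r_neq0.
rewrite -(fubini_tonelli (fun p => (L p)%:E)); first last.
- by move=> p; rewrite lee_fin.
- exact/measurable_EFinP.
(* Rays miss the origin, so the value of [g] there is erased; it is a null set. *)
pose M (y : 'rV[R]_N) : R := \1_(~` [set 0]) y * g y.
have ME y : M y = if y == 0 then 0 else g y.
  rewrite /M indicE; case: eqVneq => [->|y0]; first by rewrite memNset ?mul0r//=; exact.
  by rewrite mem_set ?mul1r//=; exact/eqP.
have mM : measurable_fun setT M.
  apply: measurable_funM => //; apply: measurable_indic; apply: measurableC.
  exact: measurable_set1_rV.
have gM : (\int[leb]_x (g x)%:E = \int[leb]_x (M x)%:E)%E.
  apply: ge0_ae_eq_integral => //.
  - exact/measurable_EFinP.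
  - exact/measurable_EFinP.
  - by move=> x _; rewrite lee_fin.
  - by move=> x _; rewrite lee_fin ME; case: ifP.
  exists [set (0 : 'rV[R]_N)]; split.
  - exact: measurable_set1_rV.
  - exact: lebesgue_rV_set0.
  - move=> x /= H; apply: contrapT => x0; apply: H => _; rewrite ME.
    by case: eqVneq x0.
rewrite gM -ge0_integralZl//; first last.
- by rewrite lee_fin divr_ge0// exprn_ge0// ltW.
- by move=> y _; apply: integral_ge0 => s _; rewrite lee_fin.
- apply: (@measurable_fun_fubini_tonelli_F _ _ 'rV[R]_N (measurableTypeR R) R (@lebesgue_measure R) (fun p => (L p)%:E)).
  + exact/measurable_EFinP.
  + by move=> p; rewrite lee_fin.
apply: eq_integral => y _; rewrite ME; case: ifPn => [/eqP y0|y0].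
  rewrite integral0_eq ?mule0// => s _.
  by rewrite /L indicE memNset ?mul0r//= y0 eqxx => -[].
have ey : 0 < enorm y by rewrite enorm_gt0.
transitivity ((N%:R / rho ^+ N)%:E * \int[@lebesgue_measure R]_(s in `[(enorm y / rho)%R, +oo[)
   ((g y * enorm y ^+ N)%:E * ((s : R) ^- N.+1)%:E))%E; last first.
  congr (_ * _)%E; rewrite integral_mkcond; apply: eq_integral => s _.
  rewrite patchE /L indicE mem_setE in_itv/= andbT.
  rewrite (_ : (_ \in [set p | _]) = (enorm y / rho <= s)); last first.
    by apply/idP/idP; rewrite inE/=; [case|split].
  by case: ifP => _; rewrite ?mul0r// mul1r -EFinM.
rewrite ge0_integralZl//; first last.
- by rewrite lee_fin mulr_ge0// exprn_ge0// enorm_ge0.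
- move=> s /=; rewrite in_itv/= andbT => ys.
  by rewrite lee_fin invr_ge0 exprn_ge0// (le_trans _ ys)// divr_ge0 ?ltW.
- apply/measurable_EFinP; apply: measurable_funTS.
  apply: measurable_inv_pow.
rewrite integral_powV ?divr_gt0// -!EFinM; congr EFin.
rewrite expr_div_n; field.
by rewrite !expf_neq0 ?lt0r_neq0//=; lra.
Qed.

End polar.

(** * One-variable calculus *)

Section one_variable.
Context (R : realType).

Lemma lerN_normlW (x C : R) : `|x| <= C -> - C <= x.
Proof. by rewrite ler_norml => /andP[]. Qed.

Implicit Types (f g df dg : R -> R) (a b x y p q : R).

Lemma is_derive_continuous f x d : is_derive x 1 f d -> {for x, continuous f}.
Proof. by move=> [df _]; exact/differentiable_continuous/derivable1_diffP. Qed.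

(** Growth estimates are stated as comparisons of two functions with ordered derivatives.
    Derivatives are asked for in the open interval only, since [z] solves its equation only beyond
    [r]. *)
Lemma MVT_le f g df dg a b : a <= b ->
  (forall x, a < x < b -> is_derive x 1 f (df x)) ->
  (forall x, a < x < b -> is_derive x 1 g (dg x)) ->
  (forall x, a < x < b -> df x <= dg x) ->
  {within `[a, b], continuous f} -> {within `[a, b], continuous g} ->
  f b - f a <= g b - g a.
Proof.
move=> ab hf hg hd cf cg.
have D x : x \in `]a, b[ -> derivable (f - g) x 1.
  rewrite in_itv/= => xab; apply: derivableB; apply: ex_derive; [exact: hf|exact: hg].
have D0 x : x \in `]a, b[ -> derive1 (f - g) x <= 0.
  rewrite in_itv/= => xab; rewrite derive1E deriveB.
  + have := hf _ xab; have := hg _ xab => h1 h2.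
    by rewrite !derive_val subr_le0; exact: hd.
  + by have [] := hf _ xab.
  + by have [] := hg _ xab.
have C : {within `[a, b], continuous (f - g)}.
  by move=> x; apply: cvgB; [exact: cf|exact: cg].
have := @ler0_derive1_le_cc R (f - g) a b D D0 C b a.
rewrite !in_itv/= !lexx ab => /(_ isT isT isT).
by rewrite !fctE; lra.
Qed.

Lemma continuous_within f (A : set R) : continuous f -> {within A, continuous f}.
Proof. exact: continuous_subspaceT. Qed.

Lemma MVT_leT f g df dg a b : a <= b ->
  (forall x, a <= x <= b -> is_derive x 1 f (df x)) ->
  (forall x, a <= x <= b -> is_derive x 1 g (dg x)) ->
  (forall x, a <= x <= b -> df x <= dg x) -> f b - f a <= g b - g a.
Proof.
move=> ab hf hg hd; have W x : a < x < b -> a <= x <= b.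
  by move=> /andP[/ltW -> /ltW ->].
apply: (MVT_le ab (df := df) (dg := dg)).
- by move=> x /W; exact: hf.
- by move=> x /W; exact: hg.
- by move=> x /W; exact: hd.
- apply: continuous_in_subspaceT => x; rewrite inE/= in_itv/= => xab.
  exact: is_derive_continuous (hf _ xab).
- apply: continuous_in_subspaceT => x; rewrite inE/= in_itv/= => xab.
  exact: is_derive_continuous (hg _ xab).
Qed.

Lemma exists_primitive f (c : R) : continuous f ->
  exists F : R -> R, forall x, c < x -> is_derive x 1 F (f x).
Proof.
move=> cf; exists (fun x => \int[@lebesgue_measure R]_(t in `[c, x]) f t) => x cx.
have xx1 : x < x + 1 by rewrite ltrDl.
have I : lebesgue_measure.-integrable `[c, x + 1] (EFin \o f).
  apply: continuous_compact_integrable; first exact: segment_compact.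
  exact: continuous_within.
case: (@continuous_FTC1 R f (BLeft c) x (x + 1) xx1 I _ (cf x)) => [|d E].
  by rewrite /= lte_fin.
by apply: DeriveDef; [exact: d|rewrite -derive1E; exact: E].
Qed.

Lemma integral_FTC f F a b : a <= b -> continuous f ->
  (forall x, a <= x <= b -> is_derive x 1 F (f x)) ->
  (\int[@lebesgue_measure R]_(x in `[a, b]) (f x)%:E = (F b - F a)%:E)%E.
Proof.
rewrite le_eqVlt => /predU1P[<- cf _|ab cf dF].
  by rewrite subrr set_itv1 integral_set1.
rewrite (@continuous_FTC2 R f F a b) ?EFinB//.
- exact: continuous_within.
- split.
  + move=> x; rewrite in_itv/= => /andP[ax xb].
    by have [] := dF x; rewrite ?ltW.
  + by apply: cvg_at_right_filter; apply: (is_derive_continuous (dF a _)); rewrite lexx ltW.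
  + by apply: cvg_at_left_filter; apply: (is_derive_continuous (dF b _)); rewrite lexx ltW.
- move=> x; rewrite in_itv/= => /andP[ax xb]; rewrite derive1E.
  by apply: derive_val; apply: dF; rewrite !ltW.
Qed.

(** Only the continuous upper bound [K] is integrated, so [dg] may be any function below it: [g] is
    compared with a primitive of [K]. *)
Lemma FTC_le g dg K a b : a <= b -> continuous K ->
  (forall x, a < x < b -> is_derive x 1 g (dg x)) ->
  (forall x, a < x < b -> dg x <= K x) ->
  {within `[a, b], continuous g} ->
  ((g b - g a)%:E <= \int[@lebesgue_measure R]_(x in `[a, b]) (K x)%:E)%E.
Proof.
move=> ab cK hg hd cg; have [F dF] := exists_primitive (a - 1) cK.
have dF' x : a <= x <= b -> is_derive x 1 F (K x).
  by move=> /andP[ax _]; apply: dF; lra.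
rewrite (integral_FTC ab cK dF') lee_fin.
apply: (MVT_le ab hg _ hd cg).
  by move=> x /andP[ax xb]; apply: dF'; rewrite !ltW.
apply: continuous_in_subspaceT => x; rewrite inE/= in_itv/= => xab.
exact: is_derive_continuous (dF' _ xab).
Qed.

Lemma powR_ge_le x y p : 0 <= p -> 0 <= x -> x <= y -> x `^ p <= y `^ p.
Proof. by move=> p0 x0 xy; apply: ge0_ler_powR; rewrite ?nnegrE// (le_trans x0). Qed.

Lemma continuous_norm_powR p : 0 < p -> continuous (fun y : R => `|y| `^ p).
Proof.
move=> p0 y; have [->|y0] := eqVneq y 0.
  apply/cvgrPdist_lt => e e0; rewrite normr0 powR0 ?gt_eqF//.
  have d0 : 0 < e `^ p^-1 by exact: powR_gt0.
  near=> t.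
  rewrite sub0r normrN ger0_norm ?powR_ge0//.
  have td : `|t| < e `^ p^-1.
    near: t; apply/nbhs_ballP; exists (e `^ p^-1) => //= t.
    by rewrite /ball/= sub0r normrN.
  have -> : e = (e `^ p^-1) `^ p by rewrite -powRrM mulVf ?gt_eqF// powRr1// ltW.
  by apply: gt0_ltr_powR => //; rewrite ?nnegrE// powR_ge0.
have ny : 0 < `|y| by rewrite normr_gt0.
apply: (@continuous_comp _ _ _ (fun y : R => `|y|) (fun x => x `^ p)).
  exact: norm_continuous.
exact: is_derive_continuous (is_derive1_powR p ny).
Unshelve. all: by end_near. Qed.

(** At the origin the difference quotient has size [|h|^(p - 1)], which tends to 0 as [p > 1]; the
    formula agrees because [Num.sg 0 = 0]. *)
Lemma is_derive_norm_powR p y : 1 < p ->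
  is_derive y 1 (fun y : R => `|y| `^ p) (p * Num.sg y * `|y| `^ (p - 1)).
Proof.
move=> p1; have [y0|y0|->] := ltrgtP y 0.
- rewrite ltr0_sg// mulrN1 ltr0_norm//.
  have ny : 0 < - y by rewrite oppr_gt0.
  have H := @is_derive1_comp R (fun x => x `^ p) (fun x => - x) y _ _ (is_derive1_powR p ny) (is_deriveNid y 1).
  apply: (@near_eq_is_derive _ R^o R^o (fun x => (- x) `^ p)).
    near=> x; rewrite ltr0_norm//; near: x; exact: lt_nbhsl.
  by apply: is_derive_eq; rewrite mulrN1 mulNr.
- rewrite gtr0_sg// mulr1 gtr0_norm//.
  apply: (@near_eq_is_derive _ R^o R^o (fun x => x `^ p)).
    near=> x; rewrite gtr0_norm//; near: x; exact: lt_nbhsr.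
  exact: is_derive1_powR.
- rewrite sgr0 mulr0 mul0r.
  have p0 : 0 < p - 1 by rewrite subr_gt0.
  have H : (fun h : R => h^-1 *: (((fun y : R => `|y| `^ p) \o shift (0 : R)) (h *: (1 : R)) - `|0 : R| `^ p)) h @[h --> (0:R)^'] --> (0 : R).
    have C : `|h| `^ (p - 1) @[h --> (0:R)^'] --> (0:R).
      have : `|h| `^ (p - 1) @[h --> (0 : R)] --> `|0 : R| `^ (p - 1).
        exact: continuous_norm_powR.
      rewrite normr0 powR0 ?gt_eqF// => C.
      by apply: cvg_trans C; apply: cvg_app; exact: nbhs_dnbhs.
    apply/cvgrPdist_lt => e e0.
    move/cvgrPdist_lt : C => /(_ e e0) C.
    near=> h.
    have h0 : h != 0 by near: h; exact: nbhs_dnbhs_neq.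
    have : `|0 - `|h| `^ (p - 1)| < e by near: h.
    rewrite !sub0r !normrN normr0 powR0 ?gt_eqF//; last lra.
    rewrite /= addr0 subr0 /GRing.scale/= mulr1 normrM normfV.
    rewrite (ger0_norm (powR_ge0 _ _)) (ger0_norm (powR_ge0 _ _)).
    rewrite powRB ?normr_eq0 ?h0 ?implybT// powRr1//.
    by rewrite mulrC.
  apply: DeriveDef.
    by apply/cvg_ex; exists 0.
  exact: (cvg_lim _ H).
Unshelve. all: by end_near. Qed.

Lemma young a b p : 1 < p -> 0 <= a -> 0 <= b ->
  p * (a * b) <= a `^ p + (p - 1) * b `^ (p / (p - 1)).
Proof.
move=> p1 a0 b0; have p0 : 0 < p by lra.
have q0 : 0 < p / (p - 1) by rewrite divr_gt0//; lra.
have pq : p^-1 + (p / (p - 1))^-1 = 1.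
  by rewrite invf_div; field; rewrite gt_eqF.
have := conjugate_powR a0 b0 p0 q0 pq.
rewrite -(ler_pM2l p0) => /le_trans; apply; rewrite mulrDr.
have -> : p * (a `^ p / p) = a `^ p by field; rewrite gt_eqF.
rewrite lerD2l le_eqVlt; apply/orP; left; apply/eqP; field.
by rewrite !gt_eqF// subr_gt0.
Qed.

(** Convexity of the power at [a / (1 - m)] and [b / m] with weights [1 - m] and [m]. As [m] tends
    to 0 the coefficient of [a ^ p] tends to 1, so a vanishing [b] can be added at almost no
    cost. *)
Lemma powR_split a b p m : 1 < p -> 0 <= a -> 0 <= b -> 0 < m < 1 ->
  (a + b) `^ p <= (1 - m) `^ (1 - p) * a `^ p + m `^ (1 - p) * b `^ p.
Proof.
move=> p1 a0 b0 /andP[m0 m1].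
have m1' : 0 < 1 - m by rewrite subr_gt0.
have t01 : (0%R <= m)%R && (m <= 1%R)%R by rewrite !ltW.
have /= := @convex_powR R p (ltW p1) (Itv01 (ltW m0) (ltW m1)) (b / m) (a / (1 - m)).
rewrite !inE/= !in_itv/= !andbT !divr_ge0 ?(ltW m0) ?(ltW m1')// => /(_ isT isT).
rewrite !convRE/= /unstable.onem => H.
have {}H : (a + b) `^ p <= m * (b / m) `^ p + (1 - m) * (a / (1 - m)) `^ p.
  move: H; congr (_ `^ _ <= _).
  transitivity (m * (b / m) + (1 - m) * (a / (1 - m))); first by [].
  by field; rewrite !gt_eqF.
apply: (le_trans H); rewrite le_eqVlt; apply/orP; left; apply/eqP.
have E (c d : R) : 0 < c -> 0 <= d -> c * (d / c) `^ p = c `^ (1 - p) * d `^ p.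
  move=> c0 d0; rewrite (powRM _ d0) ?invr_ge0 ?(ltW c0)// -(powR_inv1 (ltW c0)) -powRrM mulN1r.
  rewrite mulrCA mulrC; congr (_ * _).
  by rewrite powRD ?(gt_eqF c0) ?implybT// powRr1// ltW.
by rewrite !E// addrC.
Qed.

Lemma is_derive_mull (c y : R) : is_derive y 1 ( *%R c) c.
Proof.
by have := @is_deriveZ _ _ _ id c y 1 1 (is_derive_id y 1); rewrite /GRing.scale/= mulr1.
Qed.

(** The mean value theorem twice: the derivative of the error is [q * ((1 + y)^(q - 1) - 1)], itself
    at most a multiple of [|y|]. For [|x| <= 1/2] the base stays away from 0, which matters for
    negative exponents. *)
Lemma powR_quadratic q : exists2 C, 0 <= C &
  forall x, `|x| <= 2^-1 -> `|(1 + x) `^ q - 1 - q * x| <= C * x ^+ 2.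
Proof.
have B r : exists2 C, 0 <= C & forall x, `|x| <= 2^-1 -> (1 + x) `^ r <= C.
  exists (2 `^ `|r|); first exact: powR_ge0.
  move=> x; rewrite ler_norml => /andP[x1 x2].
  have x0 : 0 < 1 + x by lra.
  have l2 : `|ln (1 + x)| <= ln 2.
    rewrite ler_norml -lnV ?posrE//; apply/andP; split.
      by rewrite ler_ln ?posrE//; lra.
    by rewrite ler_ln ?posrE//; lra.
  rewrite /powR (gt_eqF x0) (_ : (2 : R) == 0 = false); last by rewrite gt_eqF.
  rewrite ler_expR (le_trans (ler_norm _))// normrM ler_wpM2l//.
have D r x : `|x| <= 2^-1 -> is_derive x 1 (fun x => (1 + x) `^ r) (r * (1 + x) `^ (r - 1)).
  rewrite ler_norml => /andP[x1 x2].
  have x0 : 0 < 1 + x by lra.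
  have H1 : is_derive x 1 (fun x => 1 + x) 1.
    have := is_deriveD (is_derive_cst (1 : R) x 1) (is_derive_id x (1 : R)).
    by rewrite add0r.
  have := @is_derive1_comp R (fun x => x `^ r) (fun x => 1 + x) x _ _ (is_derive1_powR r x0) H1.
  by rewrite mulr1.
have Lip r : exists2 C, 0 <= C & forall x, `|x| <= 2^-1 -> `|(1 + x) `^ r - 1| <= C * `|x|.
  have [C C0 HC] := B (r - 1); exists (`|r| * C); first by rewrite mulr_ge0.
  move=> x x2.
  have H y : `|y| <= 2^-1 -> `|r * (1 + y) `^ (r - 1)| <= `|r| * C.
    by move=> y2; rewrite normrM ler_wpM2l// ger0_norm ?powR_ge0// HC.
  have E0 : 1 = (1 + 0) `^ r :> R by rewrite addr0 powR1.
  have dl (y : R) : is_derive y 1 (fun x : R => `|r| * C * x) (`|r| * C).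
    exact: is_derive_mull.
  have dl' (y : R) : is_derive y 1 (fun x : R => - (`|r| * C) * x) (- (`|r| * C)).
    exact: is_derive_mull.
  have [x0|x0] := leP 0 x.
    have W y : 0 <= y <= x -> `|y| <= 2^-1.
      by move=> /andP[y0 yx]; rewrite (le_trans _ x2)// !ger0_norm.
    have := MVT_leT x0 (fun y h => D r y (W y h)) (fun y _ => dl y) (fun y h => le_trans (ler_norm _) (H y (W y h))).
    have := MVT_leT x0 (fun y _ => dl' y) (fun y h => D r y (W y h)) (fun y h => lerN_normlW (H y (W y h))).
    rewrite -E0 !mulr0 !subr0 => h1 h2.
    by rewrite ler_norml (ger0_norm x0); apply/andP; split; lra.
  have {}x0 := ltW x0.
  have W y : x <= y <= 0 -> `|y| <= 2^-1.
    by move=> /andP[y0 yx]; rewrite (le_trans _ x2)// !ler0_norm// lerN2.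
  have := MVT_leT x0 (fun y h => D r y (W y h)) (fun y _ => dl y) (fun y h => le_trans (ler_norm _) (H y (W y h))).
  have := MVT_leT x0 (fun y _ => dl' y) (fun y h => D r y (W y h)) (fun y h => lerN_normlW (H y (W y h))).
  rewrite -E0 !mulr0 !sub0r => h1 h2.
  by rewrite ler_norml (ler0_norm x0); apply/andP; split; lra.
have [C C0 HC] := Lip (q - 1); exists (`|q| * C); first by rewrite mulr_ge0.
move=> x x2.
have dg (y : R) : `|y| <= 2^-1 -> is_derive y 1 (fun x => (1 + x) `^ q - 1 - q * x) (q * ((1 + y) `^ (q - 1) - 1)).
  move=> y2; have := is_deriveB (is_deriveB (D q y y2) (is_derive_cst (1 : R) y 1)) (is_derive_mull q y).
  by rewrite subr0 mulrBr mulr1.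
have g0 : (1 + 0) `^ q - 1 - q * 0 = 0 by rewrite addr0 powR1 mulr0 subr0 subrr.
have Hd y : `|y| <= 2^-1 -> `|y| <= `|x| -> `|q * ((1 + y) `^ (q - 1) - 1)| <= `|q| * C * `|x|.
  move=> y2 yx; rewrite normrM -mulrA ler_wpM2l// (le_trans (HC y y2))//.
  by rewrite ler_wpM2l.
have dl (c y : R) : is_derive y 1 (fun x : R => c * x) c.
  exact: is_derive_mull.
rewrite -(real_normK (num_real x)) expr2 mulrA.
have [x0|x0] := leP 0 x.
  have W y : 0 <= y <= x -> `|y| <= `|x|.
    by move=> /andP[y0 yx]; rewrite !ger0_norm.
  have W2 y (h : 0 <= y <= x) := le_trans (W y h) x2.
  have := MVT_leT x0 (fun y h => dg y (W2 y h)) (fun y _ => dl (`|q| * C * `|x|) y)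
    (fun y h => le_trans (ler_norm _) (Hd y (W2 y h) (W y h))).
  have := MVT_leT x0 (fun y _ => dl (- (`|q| * C * `|x|)) y) (fun y h => dg y (W2 y h))
    (fun y h => lerN_normlW (Hd y (W2 y h) (W y h))).
  rewrite g0 !mulr0 !subr0 => h1 h2.
  by rewrite ler_norml {2 4}(ger0_norm x0); apply/andP; split; lra.
have {}x0 := ltW x0.
have W y : x <= y <= 0 -> `|y| <= `|x|.
  by move=> /andP[y0 yx]; rewrite !ler0_norm// lerN2.
have W2 y (h : x <= y <= 0) := le_trans (W y h) x2.
have := MVT_leT x0 (fun y h => dg y (W2 y h)) (fun y _ => dl (`|q| * C * `|x|) y)
  (fun y h => le_trans (ler_norm _) (Hd y (W2 y h) (W y h))).
have := MVT_leT x0 (fun y _ => dl (- (`|q| * C * `|x|)) y) (fun y h => dg y (W2 y h))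
  (fun y h => lerN_normlW (Hd y (W2 y h) (W y h))).
rewrite g0 !mulr0 !sub0r => h1 h2.
by rewrite ler_norml {2 4}(ler0_norm x0); apply/andP; split; lra.
Qed.

End one_variable.

(** * The Riccati equation *)

Section picard.
Context (R : realType) (a K B : R) (G : R -> R -> R).
Hypothesis K0 : 0 < K.
Hypothesis GL : forall s x y, `|G s x - G s y| <= K * `|x - y|.
Hypothesis GB : forall s x, `|G s x| <= B.
Hypothesis GC : forall z, continuous z -> continuous (fun s => G s (z s)).

Implicit Types (f g w L dL : R -> R) (s x y c : R).

(** Solutions are continued by 0 to the left of [a]: the iterates are then continuous on the whole
    line, and the equation is asked for only to the right of [a]. *)
Let is_prim f w := [/\ continuous w, forall x, x <= a -> w x = 0 &
  forall x, a < x -> is_derive x 1 w (f x)].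

Let exists_prim f : continuous f -> exists w, is_prim f w.
Proof.
move=> cf; have [F dF] := exists_primitive (a - 1) cf.
exists (fun x => F (Num.max x a) - F a).
have cmax : continuous (fun x : R => Num.max x a).
  by move=> x; apply: continuous_max; [exact: cvg_id|exact: cvg_cst].
split.
- move=> x; apply: cvgB; last exact: cvg_cst.
  apply: (@continuous_comp _ _ _ (fun x : R => Num.max x a) F); first exact: cmax.
  by apply: is_derive_continuous; apply: dF; rewrite lt_max orbC ltrBlDr ltrDl ltr01.
- by move=> x xa; rewrite max_r// subrr.
- move=> x ax; apply: (@near_eq_is_derive _ R^o R^o (fun x => F x - F a)).
    by near=> t; rewrite max_l// ltW//; near: t; exact: lt_nbhsr.
  have ax1 : a - 1 < x by lra.
  by have := is_deriveB (dF x ax1) (is_derive_cst (F a) x 1); rewrite subr0.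
Unshelve. all: by end_near. Qed.

Let prim f : R -> R := xget (fun=> 0) (is_prim f).

Let primP f : continuous f -> is_prim f (prim f).
Proof. by move=> cf; apply: xgetPex; exact: exists_prim. Qed.

Let z_ : nat -> R -> R := fix z_ n :=
  if n is n'.+1 then prim (fun s => G s (z_ n' s)) else fun=> 0.

Let cz n : continuous (z_ n).
Proof.
elim: n => [|n IH]; first exact: cst_continuous.
by have [] := primP (GC IH).
Qed.

Let zP n : is_prim (fun s => G s (z_ n s)) (z_ n.+1).
Proof. exact: primP (GC (@cz n)). Qed.

Let B0 : 0 <= B.
Proof. exact: le_trans (GB 0 0). Qed.

Let prim_le f w x L dL : is_prim f w -> a <= x ->
  (forall s, a < s < x -> `|f s| <= dL s) ->
  (forall s, is_derive s 1 L (dL s)) -> `|w x| <= L x - L a.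
Proof.
move=> [cw wa dw] ax fd dL'.
have cL : continuous L by move=> s; exact: is_derive_continuous (dL' s).
have w0 : w a = 0 by exact: wa.
have dN s : is_derive s 1 (fun s => - L s) (- dL s) by exact: is_deriveN.
have cN : continuous (fun s => - L s) by move=> s; apply: cvgN; exact: cL.
have dw' s (h : a < s < x) : is_derive s 1 w (f s) by apply: dw; case/andP: h.
have := @MVT_le R (fun s => - L s) w (fun s => - dL s) f a x ax (fun s _ => dN s) dw'
  (fun s h => lerN_normlW (fd s h)) (continuous_within cN) (continuous_within cw).
have := @MVT_le R w L f dL a x ax dw' (fun s _ => dL' s)
  (fun s h => le_trans (ler_norm _) (fd s h)) (continuous_within cw) (continuous_within cL).
by rewrite w0 ler_norml => h1 h2; apply/andP; split; lra.
Qed.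

(** Bielecki's weight. Measured against an exponential of rate [2 * K], one Picard step contracts by
    1/2 on every interval, however long. *)
Let E (x : R) := expR (2 * K * (x - a)).

Let dE c x : is_derive x 1 (fun x => c * E x) (2 * K * c * E x).
Proof.
have h1 : is_derive x 1 (fun x : R => 2 * K * (x - a)) (2 * K).
  have := is_deriveB (is_derive_id x (1 : R)) (is_derive_cst (a : R) x 1).
  move/(is_deriveZ (2 * K)); rewrite subr0 /GRing.scale/= mulr1; exact.
have h2 := @is_derive1_comp R expR (fun x => 2 * K * (x - a)) x _ _ (is_derive_expR _) h1.
have := is_deriveZ c h2.
by rewrite /GRing.scale/= /E => h; apply: is_derive_eq h _; ring.
Qed.

Let E1 x : a <= x -> 1 <= E x.
Proof.
move=> ax; rewrite -expR0 ler_expR mulr_ge0//; first by rewrite mulr_ge0// ltW.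
by rewrite subr_ge0.
Qed.

Let E_gt0 x : 0 < E x.
Proof. exact: expR_gt0. Qed.

Let E_ge0 x : 0 <= E x.
Proof. exact: ltW. Qed.

Let h_ge0 n : 0 <= (2^-1 : R) ^+ n.
Proof. by rewrite exprn_ge0// invr_ge0. Qed.

Let is_primB f g w w' : is_prim f w -> is_prim g w' ->
  is_prim (fun s => f s - g s) (fun s => w s - w' s).
Proof.
move=> [c1 h1 d1] [c2 h2 d2]; split.
- by move=> x; apply: cvgB; [exact: c1|exact: c2].
- by move=> x xa; rewrite h1// h2// subrr.
- by move=> x ax; apply: is_deriveB; [exact: d1|exact: d2].
Qed.

Let D := B / K.

Let D0 : 0 <= D.
Proof. by rewrite divr_ge0// ltW. Qed.

Let D2E n x : 0 <= 2 * D * 2^-1 ^+ n * E x.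
Proof. by apply: mulr_ge0 => //; apply: mulr_ge0 => //; apply: mulr_ge0. Qed.

Let step n x : a <= x -> `|z_ n.+1 x - z_ n x| <= D * 2^-1 ^+ n * E x.
Proof.
elim: n x => [|n IH] x ax.
  rewrite expr0 mulr1 /= subr0.
  have := prim_le (zP 0) ax (L := fun x => D / 2 * E x) (dL := fun x => 2 * K * (D / 2) * E x).
  move=> /(_ _ (dE _)) => /(_ _)/le_trans; apply.
    move=> s /andP[/ltW/E1 as1 _]; rewrite (le_trans (GB _ _))//.
    have -> : 2 * K * (D / 2) = B by rewrite /D; field; rewrite gt_eqF.
    by rewrite ler_peMr.
  have := E1 ax; have := D0; have : 0 <= D * E x by rewrite mulr_ge0// ltW.
  have : 0 <= D * E a by rewrite mulr_ge0// ltW.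
  lra.
have := prim_le (is_primB (zP n.+1) (zP n)) ax (L := fun x => D * 2^-1 ^+ n.+1 * E x)
  (dL := fun x => 2 * K * (D * 2^-1 ^+ n.+1) * E x).
move=> H; apply: (le_trans (H _ (dE _))); last first.
  by rewrite lerBlDr lerDl mulr_ge0// mulr_ge0.
move=> s /andP[/ltW as1 _]; rewrite (le_trans (GL _ _ _))//.
  apply: (le_trans (ler_wpM2l (ltW K0) (IH s as1))).
  rewrite exprS le_eqVlt; apply/orP; left; apply/eqP; by field.
Qed.

Let far n m x : a <= x -> `|z_ (n + m) x - z_ n x| <= 2 * D * 2^-1 ^+ n * E x.
Proof.
move=> ax; suff : `|z_ (n + m) x - z_ n x| <= 2 * D * 2^-1 ^+ n * E x - 2 * D * 2^-1 ^+ (n + m) * E x.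
  by move/le_trans; apply; rewrite lerBlDr lerDl.
elim: m => [|m IH]; first by rewrite addn0 !subrr normr0.
have -> : z_ (n + m.+1) x - z_ n x = (z_ (n + m).+1 x - z_ (n + m) x) + (z_ (n + m) x - z_ n x).
  by rewrite addnS; ring.
apply: (le_trans (ler_normD _ _)); apply: (le_trans (lerD (step _ ax) IH)).
rewrite addnS exprS; lra.
Qed.

Let half_cvg : (fun n => (2^-1 : R) ^+ n) @ \oo --> (0 : R).
Proof. by apply: cvg_expr; rewrite ger0_norm ?invr_ge0// invf_lt1// ltr1n. Qed.

Let z_cvg x : a <= x -> cvgn (fun n => z_ n x).
Proof.
move=> ax; apply/cauchy_cvgP; apply/cauchy_ballP => e e0.
have C0 : 0 <= 2 * D * E x by have := D2E 0 x; rewrite expr0 mulr1.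
have : (fun n : nat => 2 * D * E x * 2^-1 ^+ n) @ \oo --> (2 * D * E x * 0).
  by apply: cvgM; [exact: cvg_cst|exact: half_cvg].
rewrite mulr0 => /cvgrPdist_lt/(_ (e / 2)); rewrite divr_gt0// => /(_ isT)[n _ Hn].
have Hn' m : (n <= m)%N -> `|z_ m x - z_ n x| < e / 2.
  move=> nm; rewrite -(subnKC nm); apply: (le_lt_trans (far _ _ ax)).
  have := Hn n (leqnn n); rewrite /= sub0r normrN ger0_norm.
    by move/(le_lt_trans _); apply; rewrite mulrAC.
  by rewrite mulr_ge0// exprn_ge0// invr_ge0.
exists ([set z_ m x | m in [set m | (n <= m)%N]], [set z_ m x | m in [set m | (n <= m)%N]]).
  by split; exists n => // m /= nm; exists m.
move=> [u v] [/= [i ni <-] [j nj <-]]; rewrite /ball/=.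
have -> : z_ i x - z_ j x = (z_ i x - z_ n x) - (z_ j x - z_ n x) by ring.
by rewrite (le_lt_trans (ler_normB _ _))// [ltRHS](splitr e) ltrD ?Hn'.
Qed.

Let z x : R := if x <= a then 0 else limn (fun n => z_ n x).

Let z_lim x : z_ n x @[n --> \oo] --> z x.
Proof.
rewrite /z; case: leP => xa; last by apply: z_cvg; exact: ltW.
rewrite (_ : (fun n => z_ n x) = fun=> 0); first exact: cvg_cst.
apply/funext => -[|n]//; by have [_ ->] := zP n.
Qed.

Let z_far n x : a <= x -> `|z x - z_ n x| <= 2 * D * 2^-1 ^+ n * E x.
Proof.
move=> ax.
have C : (fun m => `|z_ (m + n)%N x - z_ n x|) @ \oo --> `|z x - z_ n x|.
  apply: cvg_norm; apply: cvgB; last exact: cvg_cst.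
  by have := @z_lim x; rewrite -(cvg_shiftn n).
have C' : (fun=> 2 * D * 2^-1 ^+ n * E x) @ \oo --> 2 * D * 2^-1 ^+ n * E x.
  exact: cvg_cst.
apply: (ler_cvg_to C C'); apply: nearW => m /=.
by rewrite addnC; exact: far.
Qed.

Let cont_z : continuous z.
Proof.
have B1 : 0 < B + 1 by rewrite ltr_wpDl.
have LipP n x y : a <= x -> x <= y -> `|z_ n y - z_ n x| <= (B + 1) * (y - x).
  move=> ax xy; case: n => [|n].
    by rewrite /= subrr normr0 mulr_ge0 ?subr_ge0// ltW.
  have [cw wa dw] := zP n.
  have dl c s : is_derive s 1 (fun s => c * s) c by exact: is_derive_mull.
  have H s : `|G s (z_ n s)| <= B + 1 by rewrite (le_trans (GB _ _))// lerDl.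
  have := @MVT_le R (z_ n.+1) (fun s => (B + 1) * s) _ (fun=> B + 1) x y xy
    (fun s h => dw s (le_lt_trans ax (proj1 (andP h)))) (fun s _ => dl _ s)
    (fun s _ => le_trans (ler_norm _) (H s)) (continuous_within cw)
    (continuous_within (fun s => is_derive_continuous (dl _ s))).
  have := @MVT_le R (fun s => - (B + 1) * s) (z_ n.+1) (fun=> - (B + 1)) _ x y xy
    (fun s _ => dl _ s) (fun s h => dw s (le_lt_trans ax (proj1 (andP h))))
    (fun s _ => lerN_normlW (H s))
    (continuous_within (fun s => is_derive_continuous (dl _ s))) (continuous_within cw).
  by move=> h1 h2; rewrite ler_norml; apply/andP; split; lra.
have Lip x y : x <= y -> `|z y - z x| <= (B + 1) * (y - x).
  move=> xy.
  have La u v : a <= u -> u <= v -> `|z v - z u| <= (B + 1) * (v - u).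
    move=> au uv.
    have C : (fun m => `|z_ m v - z_ m u|) @ \oo --> `|z v - z u|.
      by apply: cvg_norm; apply: cvgB; exact: z_lim.
    have C' : (fun=> (B + 1) * (v - u)) @ \oo --> (B + 1) * (v - u) by exact: cvg_cst.
    by apply: (ler_cvg_to C C'); apply: nearW => m /=; exact: LipP.
  have za u : u <= a -> z u = z a by move=> ua; rewrite /z ua lexx.
  have [ax|/ltW xa] := leP a x; first exact: La.
  have [ay|/ltW ya] := leP a y; last first.
    by rewrite !za// subrr normr0 mulr_ge0 ?subr_ge0// ltW.
  rewrite (za x xa) (le_trans (La _ _ (lexx _) ay))//; apply: ler_wpM2l; [exact: ltW|lra].
move=> x; apply/cvgrPdist_lt => e e0; near=> y.
have yx : `|x - y| < e / (B + 1).
  near: y; apply/nbhs_ballP; exists (e / (B + 1)); first by rewrite /= divr_gt0.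
  by move=> t; rewrite /ball/=.
rewrite ltr_pdivlMr// mulrC in yx; apply: le_lt_trans yx.
have [xy|/ltW xy] := leP x y.
  by rewrite distrC (distrC x) (ger0_norm (_ : 0 <= y - x)) ?subr_ge0// Lip.
by rewrite (ger0_norm (_ : 0 <= x - y)) ?subr_ge0// Lip.
Unshelve. all: by end_near. Qed.

Theorem picard : exists z : R -> R,
  [/\ continuous z, z a = 0 & forall x, a < x -> is_derive x 1 z (G x (z x))].
Proof.
exists z; split; first exact: cont_z.
  by rewrite /z lexx.
(* The limit is identified with the primitive of its own right-hand side: both are limits of
   [z_ n.+1]. *)
have [w Pw] := exists_prim (GC cont_z).
suff E' : w = z by move: Pw; rewrite E' => -[].
apply/funext => x; have [xa|ax] := leP x a.
  by have [_ -> //] := Pw; rewrite /z xa.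
have {}ax' := ltW ax.
suff H : forall n, `|w x - z_ n.+1 x| <= 2 * D * K * E x * (x - a) * 2^-1 ^+ n.
  have Cw : (fun n => z_ n.+1 x) @ \oo --> w x.
    apply/cvgrPdist_lt => e e0.
    have : (fun n : nat => 2 * D * K * E x * (x - a) * 2^-1 ^+ n) @ \oo --> (2 * D * K * E x * (x - a) * 0).
      by apply: cvgM; [exact: cvg_cst|exact: half_cvg].
    rewrite mulr0 => /cvgrPdist_lt/(_ e e0); apply: filterS => n /=.
    rewrite sub0r normrN => h; apply: le_lt_trans h.
    by rewrite (le_trans (H n))// ler_norm.
  have Cz : (fun n => z_ n.+1 x) @ \oo --> z x.
    by have := @z_lim x; rewrite -(cvg_shiftn 1); under eq_fun do rewrite addn1.
  exact: cvg_unique Cw Cz.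
move=> n.
have dl s : is_derive s 1 (fun s => 2 * D * K * E x * 2^-1 ^+ n * s) (2 * D * K * E x * 2^-1 ^+ n).
  exact: is_derive_mull.
have := prim_le (is_primB Pw (zP n)) ax' _ dl.
have -> : 2 * D * K * E x * 2^-1 ^+ n * x - 2 * D * K * E x * 2^-1 ^+ n * a =
  2 * D * K * E x * (x - a) * 2^-1 ^+ n by ring.
apply => s /andP[/ltW sa /ltW sx].
rewrite (le_trans (GL _ _ _))// (le_trans (ler_wpM2l (ltW K0) (z_far n sa)))//.
rewrite [leLHS](_ : _ = 2 * D * K * 2^-1 ^+ n * E s); last by ring.
rewrite [leRHS](_ : _ = 2 * D * K * 2^-1 ^+ n * E x); last by ring.
apply: ler_wpM2l; first by apply: mulr_ge0 => //; apply: mulr_ge0; [apply: mulr_ge0|exact: ltW].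
by rewrite ler_expR ler_wpM2l ?lerB// mulr_ge0// ltW.
Qed.

End picard.

Section riccati.
Context (R : realType) (p r c0 : R).
Hypothesis p1 : 1 < p.
Hypothesis r0 : 0 < r.
Hypothesis c0_ge0 : 0 <= c0.

(* If the right-hand side is nonnegative wherever the solution is negative,
   |z|^3 - z^3 is nonincreasing. *)
Lemma barrier (z dz : R -> R) : continuous z -> 0 <= z r ->
  (forall x, r < x -> is_derive x 1 z (dz x)) ->
  (forall x, r < x -> z x < 0 -> 0 <= dz x) -> forall x, r <= x -> 0 <= z x.
Proof.
move=> cz zr hz dz0 x rx.
pose m (y : R) := `|y| `^ 3 - y ^+ 3.
have dm (y : R) : is_derive y 1 m (3 * Num.sg y * `|y| `^ (3 - 1) - 3 * y ^+ 2).
  apply: is_deriveB; first by apply: is_derive_norm_powR; rewrite ltr1n.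
  have := @is_deriveX _ _ id 3 y 1 1 (is_derive_id y 1).
  rewrite (_ : id ^+ 3 = fun s => s ^+ 3); last by apply/funext => t; rewrite exprfctE.
  by move=> h; apply: is_derive_eq; rewrite [LHS]mulr1 -mulr_natl.
have hm s : r < s -> is_derive s 1 (m \o z) ((3 * Num.sg (z s) * `|z s| `^ (3 - 1) - 3 * z s ^+ 2) * dz s).
  by move=> rs; apply: is_derive1_comp; exact: hz.
have cm : continuous (m \o z).
  by move=> s; apply: continuous_comp; [exact: cz|exact: is_derive_continuous (dm _)].
have H0 s : r < s < x -> (3 * Num.sg (z s) * `|z s| `^ (3 - 1) - 3 * z s ^+ 2) * dz s <= 0.
  move=> /andP[rs _].
  have -> : (3 : R) - 1 = 2%:R by lra.
  rewrite powR_mulrn// real_normK ?num_real//.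
  have [zs|zs|->] := ltrgtP (z s) 0.
  - rewrite ltr0_sg// mulr_le0_ge0 ?dz0//; have := sqr_ge0 (z s); lra.
  - by rewrite gtr0_sg// mulr1 subrr mul0r.
  - by rewrite expr0n/= !mulr0 subrr mul0r.
have H := @MVT_le R (m \o z) (fun=> 0) _ (fun=> 0) r x rx
  (fun s h => hm s (proj1 (andP h))) (fun s _ => is_derive_cst (0 : R) s (1 : R)) H0
  (continuous_within cm) (continuous_within (@cst_continuous _ _ (0 : R))).
have m0 : m (z r) = 0.
  by rewrite /m ger0_norm// powR_mulrn// subrr.
move: H; rewrite /= m0 !subr0 /m powR_mulrn// leNgt => H.
rewrite leNgt; apply: contra H => zx; rewrite ltr0_norm// exprNn.
have : 0 < - z x by rewrite oppr_gt0.
move=> /(exprn_gt0 3); rewrite exprNn; lra.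
Qed.

Let clip (M x : R) : R := Num.min (Num.max x 0) M.

Let cont_clip M : continuous (clip M).
Proof.
move=> x; apply: (@continuous_min _ _ (fun y : R => Num.max y 0) (fun=> M) x); last exact: cvg_cst.
by apply: continuous_max; [exact: cvg_id|exact: cvg_cst].
Qed.

Let clip_itv M x : 0 <= M -> 0 <= clip M x <= M.
Proof. by move=> M0; rewrite /clip ge_min lexx orbT andbT le_min M0 le_max lexx orbT. Qed.

Let clip_id M x : 0 <= x <= M -> clip M x = x.
Proof. by move=> /andP[x0 xM]; rewrite /clip max_l// min_l. Qed.

Let clip_lip M x y : 0 <= M -> `|clip M x - clip M y| <= `|x - y|.
Proof.
move=> M0; wlog xy : x y / x <= y.
  move=> H; have [/H//|/ltW/H] := leP x y.
  by rewrite distrC (distrC y).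
have cxy : clip M x <= clip M y.
  by rewrite /clip /Order.min /Order.max; repeat case: ifPn; rewrite -?leNgt; lra.
rewrite distrC (distrC x) !ger0_norm ?subr_ge0//.
by rewrite /clip /Order.min /Order.max; repeat case: ifPn; rewrite -?leNgt; lra.
Qed.

(** This is the equation of [v / v'] for radial solutions of the p-Laplace equation
    [Delta_p v = v^(p-1)], where [c0 = n / (p - 1)]. It is not globally Lipschitz in [z] and is
    singular at [x = 0], so [z] is clipped to [[0, M]] and [x] to [[r, +oo[] for Picard iteration;
    two uses of [barrier] show that the solution stays where clipping changes nothing. *)
Theorem exists_riccati : exists z M K, [/\ continuous z, z r = 0, 0 < M /\ 0 <= K,
  forall x, r < x -> is_derive x 1 z (1 + c0 * z x / x - z x `^ p / (p - 1)) &
  forall x, r < x -> [/\ 0 < z x, z x <= M & z x <= K * (x - r)]].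
Proof.
have p1' : 0 < p - 1 by rewrite subr_gt0.
pose A := (p - 1) * (1 + c0 / r).
(* A supersolution: [M^(p-1) >= A] and [M >= 1] make the right-hand side nonpositive at height
   [M]. *)
pose M := Num.max 1 (A `^ (p - 1)^-1).
have A0 : 0 < A by rewrite mulr_gt0// ltr_pwDl// divr_ge0// ltW.
have M1 : 1 <= M by rewrite le_max lexx.
have M0 : 0 < M by exact: lt_le_trans M1.
have MA : A <= M `^ (p - 1).
  have -> : A = (A `^ (p - 1)^-1) `^ (p - 1).
    by rewrite -powRrM mulVf ?gt_eqF// powRr1// ltW.
  by apply: powR_ge_le; rewrite ?powR_ge0 ?le_max ?lexx ?orbT// ltW.
have Mp : 1 + c0 * M / r <= M `^ p / (p - 1).
  have -> : M `^ p = M * M `^ (p - 1) by rewrite mulr_powRB1// ?ltW//; lra.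
  apply: (@le_trans _ _ (M * A / (p - 1))); last first.
    by rewrite ler_pM2r ?invr_gt0// ler_pM2l.
  have -> : M * A / (p - 1) = M + c0 * M / r.
    by rewrite /A; field; rewrite !gt_eqF.
  by rewrite lerD2r.
pose G (s x : R) := 1 + c0 * clip M x / Num.max s r - `|clip M x| `^ p / (p - 1).
have mr s : r <= Num.max s r by rewrite le_max lexx orbT.
have mr0 s : 0 < Num.max s r by exact: lt_le_trans (mr s).
have minv s : 0 <= (Num.max s r)^-1 <= r^-1.
  by rewrite invr_ge0 ltW//= lef_pV2// posrE.
have powM x y : 0 <= x <= M -> 0 <= y <= M -> `|x `^ p - y `^ p| <= p * M `^ (p - 1) * `|x - y|.
  wlog xy : x y / x <= y.
    move=> H hx hy; have [/H|/ltW/H] := leP x y; first exact.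
    by rewrite distrC (distrC y); exact.
  move=> /andP[x0 xM] /andP[y0 yM].
  rewrite distrC (distrC x) (ger0_norm (_ : 0 <= y - x)) ?subr_ge0//.
  rewrite ger0_norm; last by rewrite subr_ge0 powR_ge_le//; lra.
  have := @MVT_leT R (fun x => `|x| `^ p) ( *%R (p * M `^ (p - 1)))
    (fun y => p * Num.sg y * `|y| `^ (p - 1)) (fun=> p * M `^ (p - 1)) x y xy
    (fun s _ => is_derive_norm_powR s p1) (fun s _ => is_derive_mull _ s).
  rewrite !ger0_norm// mulrBr; apply.
  move=> s /andP[xs sy]; have s0 : 0 <= s by exact: le_trans xs.
  have sg1 : Num.sg s <= 1 by case: (sgrP s); rewrite ?lerN1 ?ler01//; lra.
  have p0 : 0 <= p by lra.
  rewrite -!mulrA; apply: ler_wpM2l => //.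
  rewrite ger0_norm//; apply: (@le_trans _ _ (1 * s `^ (p - 1))).
    by apply: ler_wpM2r => //; exact: powR_ge0.
  rewrite mul1r; apply: powR_ge_le => //; first exact: ltW.
  exact: le_trans yM.
pose K := c0 / r + p * M `^ (p - 1) / (p - 1).
have K0 : 0 < K.
  rewrite ltr_wpDl//; first by rewrite divr_ge0// ltW.
  by rewrite divr_gt0// mulr_gt0 ?powR_gt0//; lra.
have GL s x y : `|G s x - G s y| <= K * `|x - y|.
  have -> : G s x - G s y = c0 * (Num.max s r)^-1 * (clip M x - clip M y) -
     (clip M x `^ p - clip M y `^ p) / (p - 1).
    have /andP[x0 _] := clip_itv x (ltW M0); have /andP[y0 _] := clip_itv y (ltW M0).
    rewrite /G !ger0_norm//; field.
    by rewrite !gt_eqF.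
  have h1 := clip_lip x y (ltW M0).
  have /andP[i0 ir] := minv s.
  apply: (le_trans (ler_normB _ _)); rewrite [leRHS]mulrDl; apply: lerD.
    rewrite normrM; apply: ler_pM => //.
    by rewrite ger0_norm ?mulr_ge0// ler_wpM2l.
  rewrite normrM (ger0_norm (_ : 0 <= (p - 1)^-1)) ?invr_ge0 ?(ltW p1')// mulrAC.
  apply: ler_wpM2r; first by rewrite invr_ge0 ltW.
  apply: (le_trans (powM _ _ (clip_itv x (ltW M0)) (clip_itv y (ltW M0)))).
  by apply: ler_wpM2l => //; rewrite mulr_ge0 ?powR_ge0//; lra.
pose B := 1 + c0 * M / r + M `^ p / (p - 1).
have GB s x : `|G s x| <= B.
  have /andP[x0 xM] := clip_itv x (ltW M0).
  have /andP[i0 ir] := minv s.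
  have e1 : 0 <= c0 * clip M x / Num.max s r by rewrite !mulr_ge0.
  have e2 : c0 * clip M x / Num.max s r <= c0 * M / r.
    by apply: ler_pM => //; [exact: mulr_ge0|exact: ler_wpM2l].
  have e3 : 0 <= `|clip M x| `^ p / (p - 1) by rewrite divr_ge0 ?powR_ge0// ltW.
  have e4 : `|clip M x| `^ p / (p - 1) <= M `^ p / (p - 1).
    rewrite ler_pM2r ?invr_gt0// ger0_norm//; apply: powR_ge_le => //; lra.
  by rewrite /G /B ler_norml; apply/andP; split; lra.
have GC z : continuous z -> continuous (fun s => G s (z s)).
  move=> cz s.
  have ccz : clip M (z u) @[u --> s] --> clip M (z s).
    by apply: (@continuous_comp _ _ _ z (clip M)); [exact: cz|exact: cont_clip].
  apply: cvgB.
    apply: cvgD; first exact: cvg_cst.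
    apply: cvgM; first by apply: cvgM => //; exact: cvg_cst.
    apply: cvgV; first by rewrite gt_eqF.
    by apply: continuous_max; [exact: cvg_id|exact: cvg_cst].
  apply: cvgM; last exact: cvg_cst.
  apply: (@continuous_comp _ _ _ (fun u => clip M (z u)) (fun x => `|x| `^ p)) => //.
  by apply: continuous_norm_powR; lra.
have [z [cz zr dz]] := picard r K0 GL GB GC.
have z0 x : r <= x -> 0 <= z x.
  apply: (barrier cz _ dz); first by rewrite zr.
  move=> s rs zs; rewrite /G /clip max_r ?ltW// min_l ?ltW//.
  by rewrite normr0 powR0 ?gt_eqF//; lra.
have zM x : r <= x -> z x <= M.
  move=> rx; rewrite -subr_ge0; move: x rx.
  apply: (@barrier (fun x => M - z x) (fun x => 0 - G x (z x))).
  - by move=> s; apply: cvgB; [exact: cvg_cst|exact: cz].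
  - by rewrite zr subr0 ltW.
  - by move=> s rs; apply: is_deriveB; exact: dz.
  - move=> s rs; rewrite subr_lt0 => zs.
    have -> : G s (z s) = 1 + c0 * M / s - M `^ p / (p - 1).
      rewrite /G /clip (max_l (_ : 0 <= z s)) ?min_r ?ltW// ?(max_l (ltW rs)).
        by rewrite gtr0_norm.
      exact: lt_trans zs.
    have : c0 * M / s <= c0 * M / r.
      apply: ler_wpM2l; first by rewrite mulr_ge0// ltW.
      by rewrite lef_pV2 ?posrE ?(ltW rs)// (lt_trans r0).
    lra.
exists z, M, B; split => //.
- by split => //; exact: le_trans (normr_ge0 _) (GB 0 0).
- move=> x rx; have := dz x rx; rewrite /G clip_id ?z0 ?zM ?ltW//.
  by rewrite (max_l (ltW rx)) ger0_norm// z0// ltW.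
move=> x rx; split; first last.
- have := @MVT_le R z (fun x => B * x) (fun x => G x (z x)) (fun=> B) r x (ltW rx)
    (fun s h => dz s (proj1 (andP h))) (fun s _ => is_derive_mull B s)
    (fun s _ => le_trans (ler_norm _) (GB _ _)) (continuous_within cz)
    (continuous_within (fun s => is_derive_continuous (is_derive_mull B s))).
  by rewrite zr subr0 mulrBr.
- by apply: zM; exact: ltW.
(* Strict positivity by an integrating factor: for [0 <= z <= M] the term [z^p / (p - 1)] is at most
   [L * z], so [expR (L * x) * z] grows at least at the constant rate [expR (L * r)]. *)
pose L := M `^ (p - 1) / (p - 1).
have dE (s : R) : is_derive s 1 (fun s => expR (L * s)) (L * expR (L * s)).
  have := @is_derive1_comp R expR ( *%R L) s _ _ (is_derive_expR _) (is_derive_mull L s).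
  by rewrite mulrC.
have dEz s : r < s -> is_derive s 1 (fun s => expR (L * s) * z s)
    (expR (L * s) * G s (z s) + z s * (L * expR (L * s))).
  by move=> rs; have := is_deriveM (dE s) (dz s rs).
have H s : r < s < x -> expR (L * r) <= expR (L * s) * G s (z s) + z s * (L * expR (L * s)).
  move=> /andP[rs _]; have rs' := ltW rs.
  have -> : expR (L * s) * G s (z s) + z s * (L * expR (L * s)) = expR (L * s) * (G s (z s) + L * z s) by ring.
  have L0 : 0 <= L by rewrite divr_ge0 ?powR_ge0// ltW.
  rewrite -[leLHS]mulr1; apply: ler_pM => //.
    by rewrite ler_expR ler_wpM2l.
  have /andP[i0 _] := minv s.
  rewrite /G clip_id ?z0 ?zM//.
  have e1 : 0 <= c0 * z s / Num.max s r by rewrite !mulr_ge0// z0.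
  have e2 : `|z s| `^ p / (p - 1) <= L * z s.
    rewrite ger0_norm ?z0// -mulr_powRB1 ?z0//; last lra.
    rewrite /L mulrC mulrA mulrAC; apply: ler_wpM2r; first exact: z0.
    rewrite mulrC ler_pM2r ?invr_gt0//; apply: powR_ge_le; [exact: ltW|exact: z0|exact: zM].
  lra.
have cE : continuous (fun s => expR (L * s) * z s).
  by move=> s; apply: cvgM; [exact: is_derive_continuous (dE s)|exact: cz].
have := @MVT_le R ( *%R (expR (L * r))) (fun s => expR (L * s) * z s) (fun=> expR (L * r)) _ r x (ltW rx)
  (fun s _ => is_derive_mull _ s) (fun s h => dEz s (proj1 (andP h))) H
  (continuous_within (fun s => is_derive_continuous (is_derive_mull _ s))) (continuous_within cE).
rewrite zr mulr0 subr0 -mulrBr => /(lt_le_trans _) h.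
by have := h 0 _; rewrite mulr_gt0 ?expR_gt0 ?subr_gt0// => /(_ isT); rewrite pmulr_rgt0// expR_gt0.
Qed.

End riccati.

(** * Functions of class C^k *)

Section Ck_on.
Context (R : realType).

Lemma near_eq_differentiable (V W : normedModType R) (f g : V -> W) (x : V) :
  (\near x, f x = g x) -> differentiable f x -> differentiable g x.
Proof.
move=> fg df; have [cdf dfE] := (diff_locallyP x f).1 df.
have fgx : f x = g x by exact: nbhs_singleton fg.
have gE : g \o shift x = cst (g x) + 'd f x +o_ (0 : V) id.
  apply/eqaddoP => e e0; move/eqaddoP: dfE => /(_ e e0).
  have fg0 : \forall h \near (0 : V), f (h + x) = g (h + x).
    have : (h + x) @[h --> (0 : V)] --> x.
      rewrite -[X in _ --> X]add0r; apply: cvgD; [exact: cvg_id|exact: cvg_cst].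
    by move=> /(_ _ fg).
  apply: filterS2 fg0 => h fgh.
  by rewrite !fctE /= fgh fgx.
apply/diff_locallyP; rewrite (diff_unique cdf gE).
by split.
Qed.

Context (U : normedModType R).
Implicit Types (D : set U) (f g : U -> R) (k : nat).

(** Total functions, with conditions at the points of [D] only: [z], [enorm] and [h] are smooth
    merely on open subsets. The recursion over all directional derivatives mirrors [is_Ck]. *)
Fixpoint Ck_on k D f : Prop :=
  match k with
  | 0 => forall x, D x -> {for x, continuous f}
  | k'.+1 => (forall x, D x -> differentiable f x) /\
             (forall v, Ck_on k' D ('D_v f))
  end.

Lemma Ck_on_continuous k D f : Ck_on k D f -> forall x, D x -> {for x, continuous f}.
Proof. by case: k => [//|k] [df _] x Dx; exact/differentiable_continuous/df. Qed.

Lemma Ck_on_sub k D E f : E `<=` D -> Ck_on k D f -> Ck_on k E f.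
Proof.
move=> ED; elim: k f => [|k IH] f /=; first by move=> cf x /ED; exact: cf.
by move=> [df Df]; split=> [x /ED/df//|v]; exact: IH.
Qed.

Lemma Ck_on_setU k D E f : Ck_on k D f -> Ck_on k E f -> Ck_on k (D `|` E) f.
Proof.
elim: k f => [|k IH] f /=; first by move=> h1 h2 x [/h1|/h2].
move=> [d1 D1] [d2 D2]; split=> [x [/d1|/d2]//|v]; exact: IH.
Qed.

(** Openness of [D] makes derivatives at its points local, so agreement on [D] passes to all
    iterated derivatives. *)
Lemma Ck_on_eq k D f g : open D -> (forall x, D x -> f x = g x) ->
  Ck_on k D f -> Ck_on k D g.
Proof.
move=> oD; elim: k f g => [|k IH] f g fg /=.
  move=> cf x Dx; have nfg : \near x, f x = g x.
    by apply: filterS fg _; exact: open_nbhs_nbhs.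
  have H : g y @[y --> x] --> f x.
    apply: cvg_trans (cf x Dx).
    by apply: near_eq_cvg; apply: filterS nfg => y ->.
  by rewrite (fg x Dx) in H; exact: H.
move=> [df Df]; split=> [x Dx|v].
  apply: near_eq_differentiable (df x Dx).
  by apply: filterS fg _; exact: open_nbhs_nbhs.
apply: IH (Df v) => x Dx; apply: near_eq_derive.
by apply: filterS fg _; exact: open_nbhs_nbhs.
Qed.

Lemma Ck_onW k D f : Ck_on k.+1 D f -> Ck_on k D f.
Proof.
elim: k f => [|k IH] f; first by move=> [df _] x Dx; exact/differentiable_continuous/df.
by move=> [df Df]; split => // v; exact: IH.
Qed.

Lemma Ck_on_cst k D (c : R) : open D -> Ck_on k D (cst c).
Proof.
move=> oD; elim: k c => [|k IH] c; first by move=> x _; exact: cst_continuous.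
split=> [x _|v]; first exact: differentiable_cst.
by apply: (Ck_on_eq (f := cst 0)) => // x _; rewrite derive_cst.
Qed.

Lemma Ck_on_add k D f g : open D -> Ck_on k D f -> Ck_on k D g ->
  Ck_on k D (fun x => f x + g x).
Proof.
move=> oD; elim: k f g => [|k IH] f g.
  by move=> cf cg x Dx; apply: cvgD; [exact: cf|exact: cg].
move=> [df Df] [dg Dg]; split=> [x Dx|v].
  by apply: differentiableD; [exact: df|exact: dg].
apply: (Ck_on_eq oD _ (IH _ _ (Df v) (Dg v))) => x Dx.
by rewrite deriveD//; apply: diff_derivable; [exact: df|exact: dg].
Qed.

Lemma Ck_on_mul k D f g : open D -> Ck_on k D f -> Ck_on k D g ->
  Ck_on k D (fun x => f x * g x).
Proof.
move=> oD; elim: k f g => [|k IH] f g cf cg.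
  by move=> x Dx; apply: cvgM; [exact: cf|exact: cg].
have cf' := Ck_onW cf; have cg' := Ck_onW cg.
move: cf cg => [df Df] [dg Dg]; split=> [x Dx|v].
  by apply: differentiableM; [exact: df|exact: dg].
apply: (Ck_on_eq oD _ (Ck_on_add oD (IH _ _ cf' (Dg v)) (IH _ _ cg' (Df v)))) => x Dx.
by rewrite deriveM//; apply: diff_derivable; [exact: df|exact: dg].
Qed.

Lemma Ck_on_opp k D f : open D -> Ck_on k D f -> Ck_on k D (fun x => - f x).
Proof.
move=> oD cf; have := Ck_on_mul oD (Ck_on_cst k (-1) oD) cf.
by apply: Ck_on_eq => // x _; rewrite mulN1r.
Qed.

Lemma Ck_on_sub_fun k D f g : open D -> Ck_on k D f -> Ck_on k D g ->
  Ck_on k D (fun x => f x - g x).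
Proof. by move=> oD cf cg; apply: Ck_on_add => //; exact: Ck_on_opp. Qed.

Lemma Ck_on_sum k D n (f : 'I_n -> U -> R) : open D ->
  (forall i, Ck_on k D (f i)) -> Ck_on k D (fun x => \sum_(i < n) f i x).
Proof.
move=> oD; elim: n f => [|n IH] f cf.
  by apply: (Ck_on_eq oD _ (Ck_on_cst k 0 oD)) => x _; rewrite big_ord0.
apply: (Ck_on_eq oD _ (Ck_on_add oD (IH _ (fun i => cf (widen_ord (leqnSn n) i))) (cf ord_max))) => x _.
by rewrite big_ord_recr.
Qed.

End Ck_on.

Section Ck_on_R.
Context (R : realType).
Implicit Types (D E : set R) (f g : R -> R) (k : nat).

Lemma is_derive_deriveE f (x d v : R) : is_derive x 1 f d -> 'D_v f x = v * d.
Proof.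
move=> fd; have [df E] := fd; have df' : differentiable f x by exact/derivable1_diffP.
rewrite deriveE// diff1E// derive1E E.
by rewrite /GRing.scale/=.
Qed.

Lemma Ck_on_derive k D f f' : open D -> (forall x, D x -> is_derive x 1 f (f' x)) ->
  Ck_on k D f' -> Ck_on k.+1 D f.
Proof.
move=> oD df cf'; split=> [x Dx|v].
  by apply/derivable1_diffP; have [] := df x Dx.
apply: (Ck_on_eq oD _ (Ck_on_mul oD (Ck_on_cst k v oD) cf')) => x Dx.
by rewrite (is_derive_deriveE v (df x Dx)).
Qed.

Lemma Ck_on_id k D : open D -> Ck_on k D id.
Proof.
move=> oD; case: k => [|k]; first by move=> x _; exact: cvg_id.
apply: (Ck_on_derive oD _ (Ck_on_cst k 1 oD)) => x _; exact: is_derive_id.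
Qed.

Lemma Ck_on_expR k D : open D -> Ck_on k D (@expR R).
Proof.
move=> oD; elim: k => [|k IH]; first by move=> x _; exact: continuous_expR.
by apply: (Ck_on_derive oD _ IH) => x _; exact: is_derive_expR.
Qed.

Lemma Ck_on_powR k D q : open D -> (forall x, D x -> 0 < x) ->
  Ck_on k D (fun x => x `^ q).
Proof.
move=> oD D0; elim: k q => [|k IH] q.
  by move=> x /D0 x0; exact: is_derive_continuous (is_derive1_powR q x0).
apply: (Ck_on_derive oD _ (Ck_on_mul oD (Ck_on_cst k q oD) (IH (q - 1)))) => x /D0.
exact: is_derive1_powR.
Qed.

Lemma Ck_on_comp (U : normedModType R) k (D : set U) (E : set R) (f : U -> R) g :
  open D -> open E -> (forall x, D x -> E (f x)) ->
  Ck_on k E g -> Ck_on k D f -> Ck_on k D (g \o f).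
Proof.
move=> oD oE DE; elim: k g => [|k IH] g cg cf.
  by move=> x Dx; apply: continuous_comp; [exact: cf|exact/cg/DE].
have cf' := Ck_onW cf.
move: cg cf => [dg Dg] [df Df]; split=> [x Dx|v].
  by apply: differentiable_comp; [exact: df|exact/dg/DE].
apply: (Ck_on_eq oD _ (Ck_on_mul oD (Df v) (IH _ (Dg 1) cf'))) => x Dx.
have dfx := df x Dx; have dgx := dg _ (DE x Dx).
rewrite [RHS]deriveE; last exact: differentiable_comp.
rewrite (diff_comp dfx dgx)/= -[RHS]deriveE//.
have dg1 : derivable g (f x) 1 by exact: diff_derivable.
by rewrite (is_derive_deriveE ('d f x v) (derivableP dg1)) (deriveE v dfx).
Qed.

Lemma Ck_on_lipschitz f D (a b : R) : open D -> Ck_on 1 D f ->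
  (forall x, a <= x <= b -> D x) -> exists2 C, 0 <= C &
  forall x y, a <= x <= b -> a <= y <= b -> `|f x - f y| <= C * `|x - y|.
Proof.
move=> oD [df Df] abD.
have [ab|ba] := leP a b; last first.
  exists 0 => // x y /andP[ax xb]; exfalso.
  by move: (le_lt_trans (le_trans ax xb) ba); rewrite ltxx.
have cD : {within `[a, b], continuous (fun x => `|'D_1 f x|)}.
  apply: continuous_in_subspaceT => x; rewrite inE/= in_itv/= => xab.
  apply: (@continuous_comp _ _ _ ('D_1 f) (fun x : R => `|x|)).
    exact: (Df 1 x (abD x xab)).
  exact: norm_continuous.
have [c _ Hc] := EVT_max ab cD.
have Hd x : a <= x <= b -> is_derive x 1 f ('D_1 f x).
  by move=> xab; apply/derivableP; apply: diff_derivable; exact/df/abD.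
exists `|'D_1 f c| => //.
suff W x y : a <= x <= b -> a <= y <= b -> x <= y -> `|f x - f y| <= `|'D_1 f c| * `|x - y|.
  move=> x y hx hy; have [xy|/ltW yx] := leP x y; first exact: W.
  by rewrite distrC (distrC x); exact: W.
move=> /andP[ax xb] /andP[ay yb] xy.
have W s : x <= s <= y -> a <= s <= b.
  by move=> /andP[xs sy]; rewrite (le_trans ax)// (le_trans sy).
have HB s : x <= s <= y -> `|'D_1 f s| <= `|'D_1 f c|.
  by move=> /W h; apply: Hc; rewrite in_itv.
have h1 := MVT_leT xy (fun s h => Hd s (W s h)) (fun s _ => is_derive_mull (`|'D_1 f c|) s)
  (fun s h => le_trans (ler_norm _) (HB s h)).
have h2 := MVT_leT xy (fun s _ => is_derive_mull (- `|'D_1 f c|) s) (fun s h => Hd s (W s h))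
  (fun s h => lerN_normlW (HB s h)).
rewrite distrC (distrC x) (ger0_norm (_ : 0 <= y - x)) ?subr_ge0//.
by rewrite ler_norml; apply/andP; split; lra.
Qed.

End Ck_on_R.

(** * Flat functions and the smooth step *)

Section smooth_step.
Context (R : realType).

(** The derivative of a member of this family is a combination of two other members, so one
    computation at the origin settles smoothness of all orders. *)
Definition flat (n : nat) (s : R) : R := if 0 < s then s^-1 ^+ n * expR (- s^-1) else 0.

(** From [expR y >= y^(n+2) / (n+2)!] at [y = 1 / s]. The bound is quadratic so that it forces the
    derivative 0 at the origin. *)
Lemma flat_le (n : nat) (s : R) : 0 <= flat n s <= (n.+2)`!%:R * s ^+ 2.
Proof.
rewrite /flat; case: ifPn => [s0|_]; last first.
  by rewrite lexx mulr_ge0// ?sqr_ge0// ler0n.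
have i0 : 0 < s^-1 by rewrite invr_gt0.
rewrite mulr_ge0 ?exprn_ge0 ?expR_ge0 ?(ltW i0)//= expRN.
have F0 : 0 < (n.+2)`!%:R :> R by rewrite ltr0n fact_gt0.
have H := expR_ge1Dxn n.+1 (ltW i0).
have {}H : s^-1 ^+ n.+2 / (n.+2)`!%:R <= expR s^-1 by lra.
rewrite ler_pdivrMr ?expR_gt0//.
apply: (@le_trans _ _ ((n.+2)`!%:R * s ^+ 2 * (s^-1 ^+ n.+2 / (n.+2)`!%:R))); last first.
  by apply: ler_wpM2l => //; rewrite mulr_ge0 ?sqr_ge0 ?ltW.
rewrite le_eqVlt; apply/orP; left; apply/eqP.
rewrite !exprS expr0 !exprVn; field.
by rewrite !gt_eqF ?exprn_gt0.
Qed.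

Lemma is_derive_flat n (s : R) :
  is_derive s 1 (flat n) (flat n.+2 s - n%:R * flat n.+1 s).
Proof.
have [s0|s0|->] := ltrgtP s 0.
- have E m : flat m s = 0 by rewrite /flat ltNge ltW.
  rewrite !E mulr0 subr0.
  apply: (@near_eq_is_derive _ R^o R^o (cst 0)).
  near=> t; rewrite /flat ltNge ltW//; near: t; exact: lt_nbhsl.
- have E m : flat m s = s^-1 ^+ m * expR (- s^-1) by rewrite /flat s0.
  rewrite !E.
  apply: (@near_eq_is_derive _ R^o R^o (fun s => s^-1 ^+ n * expR (- s^-1))).
    by near=> t; rewrite /flat ifT//; near: t; exact: lt_nbhsr.
  have dV : is_derive s 1 (fun s : R => s^-1) (- s^-1 ^+ 2).
    have sN0 : s != 0 by rewrite gt_eqF.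
    apply: DeriveDef; first by apply: (@derivableV _ _ id) => //; exact: derivable_id.
    have did : derivable (@id R) s 1 by exact: derivable_id.
    rewrite (@deriveV _ _ id s 1 sN0 did) derive_id.
    by rewrite /GRing.scale/= mulr1 exprVn.
  have d1 : is_derive s 1 (fun s : R => s^-1 ^+ n) (n%:R * s^-1 ^+ n.-1 * - s^-1 ^+ 2).
    have := @is_deriveX _ _ (fun s : R => s^-1) n s 1 _ dV.
    rewrite (_ : (fun s : R => s^-1) ^+ n = fun s => s^-1 ^+ n); last by apply/funext => t; rewrite exprfctE.
    by [].
  have d2 : is_derive s 1 (fun s : R => expR (- s^-1)) (expR (- s^-1) * s^-1 ^+ 2).
    have dN := is_deriveN dV; rewrite opprK in dN.
    exact: (@is_derive1_comp R expR (fun s => - s^-1) s _ _ (is_derive_expR _) dN).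
  have := is_deriveM d1 d2.
  rewrite /GRing.scale/= => h; apply: is_derive_eq h _.
  by case: n d1 => [|n] _ /=; rewrite ?mul0r ?mulr0 ?expr0 ?exprS; ring.
- have E m : flat m 0 = 0 by rewrite /flat ltxx.
  rewrite !E mulr0 subr0.
  have H : (fun h : R => h^-1 *: ((flat n \o shift (0 : R)) (h *: (1 : R)) - flat n 0)) h @[h --> (0:R)^'] --> (0 : R).
    apply/cvgrPdist_lt => e e0; near=> h.
    have h0 : h != 0 by near: h; exact: nbhs_dnbhs_neq.
    have F0 : 0 < (n.+2)`!%:R :> R by rewrite ltr0n fact_gt0.
    have he : `|h| < e / (n.+2)`!%:R.
      near: h; apply: nbhs_dnbhs; apply/nbhs_ballP; exists (e / (n.+2)`!%:R) => /=.
        by rewrite divr_gt0.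
      by move=> t; rewrite /ball/= sub0r normrN.
    rewrite E /= addr0 subr0 /GRing.scale/= mulr1 sub0r normrN normrM normfV.
    have /andP[f0 fle] := flat_le n h.
    rewrite (ger0_norm f0) mulrC ltr_pdivrMr ?normr_gt0//.
    apply: (le_lt_trans fle).
    rewrite -(real_normK (num_real h)) expr2 mulrA ltr_pM2r ?normr_gt0//.
    by rewrite mulrC -ltr_pdivlMr.
  apply: DeriveDef; first by apply/cvg_ex; exists 0.
  exact: (cvg_lim _ H).
Unshelve. all: by end_near. Qed.

Lemma Ck_on_flat k n : Ck_on k setT (flat n).
Proof.
elim: k n => [|k IH] n; first by move=> x _; exact: is_derive_continuous (is_derive_flat n x).
apply: (Ck_on_derive openT (fun x _ => is_derive_flat n x)).
apply: Ck_on_sub_fun; [exact: openT|exact: IH|].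
by apply: Ck_on_mul; [exact: openT|exact/Ck_on_cst/openT|exact: IH].
Qed.

Definition smooth_step (s : R) : R := flat 0 s / (flat 0 s + flat 0 (1 - s)).

Lemma flat_gt0 n s : 0 < s -> 0 < flat n s.
Proof. by move=> s0; rewrite /flat s0 mulr_gt0 ?expR_gt0// exprn_gt0// invr_gt0. Qed.

Lemma flat_ge0 n s : 0 <= flat n s.
Proof. by have /andP[] := flat_le n s. Qed.

Lemma smooth_step_den s : 0 < flat 0 s + flat 0 (1 - s).
Proof.
have [s0|s0] := leP s 0; last by rewrite ltr_pwDl ?flat_ge0 ?flat_gt0.
by rewrite ltr_wpDl ?flat_ge0 ?flat_gt0//; lra.
Qed.

Lemma smooth_step0 s : s <= 0 -> smooth_step s = 0.
Proof. by move=> s0; rewrite /smooth_step {1}/flat ltNge s0 mul0r. Qed.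

Lemma smooth_step1 s : 1 <= s -> smooth_step s = 1.
Proof.
move=> s1; rewrite /smooth_step {3}/flat ltNge (_ : 1 - s <= 0) ?addr0; last lra.
by rewrite divff// gt_eqF// flat_gt0//; lra.
Qed.

Lemma smooth_step_itv s : 0 <= smooth_step s <= 1.
Proof.
have h := smooth_step_den s.
rewrite /smooth_step divr_ge0 ?flat_ge0 ?(ltW h)//=.
by rewrite ler_pdivrMr ?smooth_step_den// mul1r lerDl flat_ge0.
Qed.

Lemma Ck_on_smooth_step k : Ck_on k setT smooth_step.
Proof.
have cE : Ck_on k setT (fun s => flat 0 s + flat 0 (1 - s)).
  apply: Ck_on_add; [exact: openT|exact: Ck_on_flat|].
  apply: (@Ck_on_comp R _ k setT setT (fun s : R => 1 - s) (flat 0)) => //; try exact: openT.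
    exact: Ck_on_flat.
  by apply: Ck_on_sub_fun; [exact: openT|exact/Ck_on_cst/openT|exact/Ck_on_id/openT].
have o0 : open [set x : R | 0 < x] by exact: open_gt.
have cV : Ck_on k setT (fun s => (flat 0 s + flat 0 (1 - s)) `^ (-1)).
  apply: (@Ck_on_comp R _ k setT [set x | 0 < x] (fun s : R => flat 0 s + flat 0 (1 - s)) (fun x => x `^ (-1))) => //.
  - exact: openT.
  - by move=> x _ /=; exact: smooth_step_den.
  - exact: Ck_on_powR.
apply: (Ck_on_eq openT _ (Ck_on_mul openT (Ck_on_flat k 0) cV)) => x _.
by rewrite powR_inv1// ltW// smooth_step_den.
Qed.

End smooth_step.

(** * Integration on spheres *)

Section balls.
Context (R : realType).

(** Cubes are the sets whose volume the iterated product yields at once. Compared with balls from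
    both sides, they show that the punctured ball has finite positive volume. *)
Definition box n (r : R) : set 'rV[R]_n := [set x | forall i, `|x ord0 i| <= r].
Arguments box : clear implicits.

Lemma measurable_box m (r : R) : measurable (box m r).
Proof.
rewrite (_ : box m r = \bigcap_(i in [set: 'I_m]) (fun y : 'rV[R]_m => y ord0 i : measurableTypeR R) @^-1` `[- r, r]); last first.
  apply/seteqP; split => [x /= H i _ /=|x /= H i].
    by rewrite in_itv/= -ler_norml.
  by have := H i Logic.I; rewrite /= in_itv/= -ler_norml.
apply: fin_bigcap_measurable => // i _.
by rewrite -[X in measurable X]setTI; apply: measurable_coord.
Qed.

Lemma lebesgue_box n (r : R) : 0 <= r ->
  lebesgue_rV R n (box n r) = ((r + r) ^+ n)%:E.
Proof.
move=> r0; elim: n => [|n IH].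
  rewrite expr0 /= diracE mem_set//= => -[]//.
rewrite -[LHS]mul1e -integral_cst; last exact: measurable_box.
rewrite integral_mkcond integral_rV_S; first last.
- by move=> x; rewrite patchE; case: ifP.
- by apply/(measurable_restrictT _ (@measurable_box n.+1 r)).
transitivity (\int[@lebesgue_measure R]_(a in `[(- r)%R, r]) ((r + r) ^+ n)%:E)%E; last first.
  rewrite integral_cst//.
  transitivity (((r + r) ^+ n)%:E * @lebesgue_measure R `[(- r)%R, r])%E; first by [].

  rewrite lebesgue_measure_itv/= lte_fin.
  case: ltP => h; first by rewrite -EFinB -EFinM opprK exprSr.
  have -> : r = 0 by lra.
  by rewrite mule0 addr0 expr0n.
rewrite [RHS]integral_mkcond; apply: eq_integral => a _.
rewrite [RHS]patchE mem_setE in_itv/= -ler_norml; case: ifPn => ar; last first.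
  apply: integral0_eq => y _; rewrite patchE; case: ifPn => // /set_mem/= /(_ ord0).
  by rewrite mxE unlift_none/= (negbTE ar).
rewrite -IH -[RHS]mul1e -integral_cst; last exact: measurable_box.
rewrite [RHS]integral_mkcond.
apply: eq_integral => y _; rewrite !patchE.
congr (if _ then _ else _); apply/idP/idP => /set_mem/= H; apply/mem_set => /= i.
  by have := H (lift ord0 i); rewrite mxE liftK.
by rewrite mxE; case: (unliftP ord0 i) => [j _|_] /=.
Qed.

Lemma lebesgue_eball_lty n (rho : R) : (lebesgue_rV R n (eball n rho) < +oo)%E.
Proof.
have [r0|r0] := ltP rho 0.
  rewrite (_ : eball n rho = set0) ?measure0// -subset0 => x /= h.
  by have := le_lt_trans (enorm_ge0 x) (lt_trans h r0); rewrite ltxx.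
apply: (@le_lt_trans _ _ (lebesgue_rV R n (box n rho))).
  apply: le_measure; rewrite ?inE; [exact: measurable_eball|exact: measurable_box|].
  move=> x /= xr i; rewrite (le_trans (normr_coord_enorm x i))// ltW//.
by rewrite lebesgue_box// ltry.
Qed.

Context (n : nat) (rho : R).
Hypothesis rho0 : 0 < rho.
Local Notation N := n.+1.
Local Notation leb := (lebesgue_rV R N).
Local Notation D := (@punctured_ball R n rho).

Lemma lebesgue_punctured_ball_lty : (leb D < +oo)%E.
Proof.
apply: (le_lt_trans _ (lebesgue_eball_lty N (rho + 1))).
apply: le_measure; rewrite ?inE.
- exact: measurable_punctured_ball.
- exact: measurable_eball.
- by move=> x /= /andP[_ xr]; apply: (le_lt_trans xr); rewrite ltrDl.
Qed.

Lemma lebesgue_punctured_ball_gt0 : (0 < leb D)%E.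
Proof.
(* A cube of half-side [rho / N] fits into the closed ball by [enorm_le_normr]. *)
pose r := rho / N%:R.
have N0 : 0 < N%:R :> R by rewrite ltr0n.
have r0 : 0 < r by rewrite divr_gt0.
have H : (leb (box N r) <= leb (D `|` [set (0 : 'rV[R]_N)%R]))%E.
  apply: le_measure; rewrite ?inE.
  - exact: measurable_box.
  - by apply: measurableU; [exact: measurable_punctured_ball|exact: measurable_set1_rV].
  - move=> x /= xr; have [->|x0] := eqVneq x 0; first by right.
    left; rewrite /punctured_ball/= enorm_gt0 x0/= (le_trans (enorm_le_normr x))//.
    rewrite -ler_pdivlMl// mulrC.
    have -> : `|x| = mx_norm x by [].
    rewrite mx_normrE; elim/big_ind : _ => //.
    + exact: ltW.
    + by move=> a b ha hb; rewrite ge_max ha.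
    + by move=> i _; rewrite (ord1 i.1).
rewrite lebesgue_box ?(ltW r0)// in H.
have : (0 < leb (D `|` [set (0 : 'rV[R]_N)%R]))%E.
  by apply: lt_le_trans H; rewrite lte_fin exprn_gt0// addr_gt0.
rewrite measureU.
- have E := @lebesgue_rV_set0 R n; move=> h.
  by apply: (lt_le_trans h); rewrite -[X in (_ <= X)%E]adde0; apply: leeD => //; rewrite le_eqVlt; apply/orP; left; apply/eqP; exact: E.
- exact: measurable_punctured_ball.
- exact: measurable_set1_rV.
- by rewrite -subset0 => x [/= /andP[+ _] x0]; rewrite x0 enorm0 ltxx.
Qed.

Lemma enorm_ray (x : 'rV[R]_N) (s : R) : x != 0 -> 0 <= s -> enorm (ray x s) = s.
Proof.
by move=> x0 s0; rewrite /ray enormZ ger0_norm ?divr_ge0 ?enorm_ge0// divfK// enorm_eq0.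
Qed.

Lemma punctured_ball_neq0 (x : 'rV[R]_N) : D x -> x != 0.
Proof. by move=> /andP[+ _]; rewrite enorm_gt0. Qed.

Lemma ray_ray (x : 'rV[R]_N) (s t : R) : x != 0 -> 0 < s -> ray (ray x s) t = ray x t.
Proof.
move=> x0 s0; rewrite /ray -/(ray x s) enorm_ray ?ltW// scalerA; congr (_ *: _).
by field; rewrite enorm_eq0 x0 gt_eqF.
Qed.

Lemma measurable_ray (s : R) : measurable_fun [set: 'rV[R]_N] (fun x => ray x s).
Proof.
apply: measurable_fun_scale_rV => //; apply: measurable_funM => //.
by apply: (measurableT_comp (@measurable_invr R)); exact: measurable_enorm.
Qed.

Lemma measurable_ray2 : measurable_fun [set: 'rV[R]_N * measurableTypeR R]
  (fun p : 'rV[R]_N * measurableTypeR R => ray p.1 p.2).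
Proof.
apply: measurable_fun_scale_rV => //; apply: measurable_funM => //.
apply: (measurableT_comp (@measurable_invr R)).
apply: (measurableT_comp (@measurable_enorm R N)); exact: measurable_fst.
Qed.

Theorem polar_eball (g : 'rV[R]_N -> R) :
  measurable_fun setT g -> (forall x, 0 <= g x) ->
  (\int[leb]_(x in eball N rho) (g x)%:E = (N%:R / rho ^+ N)%:E *
    \int[leb]_(x in D)
      \int[@lebesgue_measure R]_(s in `[0%R, rho]) (g (ray x s) * s ^+ n)%:E)%E.
Proof.
move=> mg g0; pose G x := \1_(eball N rho) x * g x.
have mG : measurable_fun setT G.
  by apply: measurable_funM => //; apply: measurable_indic; exact: measurable_eball.
have G0 x : 0 <= G x by rewrite mulr_ge0.
transitivity (\int[leb]_x (G x)%:E)%E.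
  rewrite integral_mkcond; apply: eq_integral => x _.
  by rewrite patchE /G indicE; case: ifP => _; rewrite ?mul1r ?mul0r.
rewrite (polar_coordinates rho0 mG G0); congr (_ * _)%E.
apply: eq_integral => x xD; have x0 := punctured_ball_neq0 (set_mem xD).
transitivity (\int[@lebesgue_measure R]_(s in `]0%R, rho[) (g (ray x s) * s ^+ n)%:E)%E.
  rewrite [LHS]integral_mkcond [RHS]integral_mkcond; apply: eq_integral => s _.
  rewrite !patchE !mem_setE !in_itv/= andbT /G indicE.
  have [s0|s0] := ltP 0 s => //=.
  rewrite (_ : (_ \in eball N rho) = (s < rho)); last first.
    by apply/idP/idP; rewrite inE /eball/= enorm_ray// ltW.
  by case: ifP => _; rewrite ?mul1r ?mul0r.
rewrite (@integral_itv_bndoo R 0 rho _ true false)//.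
apply/measurable_EFinP; apply: measurable_funTS.
apply: measurable_funM; last by apply: measurable_funX.
apply: (measurableT_comp mg).
by apply: measurable_fun_scale_rV => //; exact: measurable_funM.
Qed.

Lemma bdry_eball : bdry (eball N rho) = [set x : 'rV[R]_N | enorm x = rho].
Proof.
have iE : interior (eball N rho) = (eball N rho : set 'rV[R]_N).
  apply/seteqP; split; first exact: interior_subset.
  by move=> x xr; apply: open_nbhs_nbhs; split => //; exact: open_eball.
rewrite /bdry iE; apply/seteqP; split => x.
  move=> [clx /negP]; rewrite -leNgt => xr; apply/eqP; rewrite eq_le xr andbT.
  rewrite leNgt; apply/negP => rx.
  have o : open [set y : 'rV[R]_N | rho < enorm y].
    rewrite (_ : [set _ | _] = @enorm R N @^-1` [set y | rho < y])//.
    by apply: open_comp; [move=> y _; exact: continuous_enorm|exact: open_gt].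
  have [|y [/= yr ry]] := clx [set y : 'rV[R]_N | rho < enorm y].
    exact: open_nbhs_nbhs.
  by have := lt_trans yr ry; rewrite ltxx.
move=> /= xr; split; last by rewrite /eball/= xr ltxx.
move=> B Bx.
have : (t *: x) @[t --> (1 : R)] --> x.
  rewrite -[X in _ --> X]scale1r; apply: cvgZl; exact: cvg_id.
move=> /(_ B Bx)/nbhs_ballP[e /= e0 He].
pose d := Num.min e 1 / 2; have d0 : 0 < d by rewrite divr_gt0// lt_min e0 ltr01.
have d1 : d <= 2^-1 by rewrite /d ler_pdivrMr// mulVf// ge_min lexx orbT.
have de : d < e.
  by rewrite /d ltr_pdivrMr// (@le_lt_trans _ _ e)// ?ge_min ?lexx//; lra.
exists ((1 - d) *: x); split.
  rewrite /eball/= enormZ xr ger0_norm; last lra.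
  by rewrite gtr_pMl//; lra.
by apply: (He (1 - d)); rewrite /ball/= opprB addrC subrK gtr0_norm.
Qed.

(** [sphere_measure] is a bare set function. Its integral is first rewritten as one against a
    bundled measure, a multiple of the pushforward of Lebesgue measure under the radial
    projection. *)
Lemma integral_sphere (F : 'rV[R]_N -> R) :
  measurable_fun (bdry (eball N rho)) F -> (forall x, 0 <= F x) ->
  (\int[sphere_measure N rho]_(x in bdry (eball N rho)) (F x)%:E =
   (N%:R / rho)%:E * \int[leb]_(x in D) (F (ray x rho))%:E)%E.
Proof.
move=> mF F0.
have mD := @measurable_punctured_ball R n rho.
have c0 : 0 <= N%:R / rho by rewrite divr_ge0// ltW.
(* Points outside [D] are sent to the origin, which is not on the sphere; one total map thus
   replaces the restriction to [D]. *)
pose phi (x : 'rV[R]_N) : 'rV[R]_N := \1_D x *: ray x rho.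
have mphi : measurable_fun setT phi.
  apply: measurable_fun_scale_rV; last exact: measurable_ray.
  exact: measurable_indic.
have mS : measurable (bdry (eball N rho) : set 'rV[R]_N).
  rewrite bdry_eball (_ : [set _ | _] = @enorm R N @^-1` [set rho])//.
  by rewrite -[X in measurable X]setTI; apply: measurable_enorm.
have phiS (A : set 'rV[R]_N) (x : 'rV[R]_N) : A `<=` bdry (eball N rho) ->
    A (phi x) <-> (D x /\ A (ray x rho)).
  move=> AS; rewrite /phi indicE; split; have [xD|xD] := boolP (x \in D).
  - by rewrite scale1r; split => //; exact: set_mem.
  - rewrite scale0r => /AS; rewrite bdry_eball /= enorm0 => r0.
    by move: rho0; rewrite -r0 ltxx.
  - by rewrite scale1r => -[].
  - by case=> /mem_set; rewrite (negbTE xD).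
pose nu := mscale (NngNum c0) (measure_function_pushforward__canonical__measure_function_Measure leb mphi).
transitivity (\int[nu]_(x in bdry (eball N rho)) (F x)%:E)%E.
  pose nu0 := mscale (NngNum c0) (measure_function_pushforward__canonical__measure_function_Measure
    (mrestr leb mD) (measurable_ray rho)).
  have -> : sphere_measure N rho = nu0 :> (set _ -> _).
    apply/funext => E; rewrite /nu0 /mscale/= /pushforward /mrestr /sphere_measure/=.
    congr (_ * _)%E; congr (lebesgue_step _ _).
    by apply/seteqP; split => x /= [h1 h2].
  apply: eq_measure_integral => A mA AS.
  rewrite /nu0 /nu /mscale/= /pushforward /mrestr.
  congr (_ * _)%E; congr (lebesgue_step _ _).
  apply/seteqP; split => x; first by move=> [h1 h2]; apply/(phiS A x AS).
  by move/(phiS A x AS) => [h1 h2].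
have F0' x : bdry (eball N rho) x -> (0 <= (F x)%:E)%E by rewrite lee_fin.
apply: (etrans (ge0_integral_mscale _ mS (NngNum c0) (proj2 (measurable_EFinP _ _) mF) F0')).
apply: (congr1 (fun t => (N%:R / rho)%:E * t)%E).
rewrite ge0_integral_pushforward//; first last.
- by move=> x _; rewrite lee_fin.
- exact/measurable_EFinP.
rewrite (_ : phi @^-1` _ = D); last first.
  apply/seteqP; split => x; first by move/(phiS _ x (@subset_refl _ _)) => -[].
  move=> xD; apply/(phiS _ x (@subset_refl _ _)); split => //.
  by rewrite bdry_eball /= enorm_ray ?(ltW rho0)// punctured_ball_neq0.
apply: eq_integral => x xD /=; congr EFin; congr F.
by rewrite /phi indicE xD scale1r.
Qed.

End balls.

(** * Gradients of smooth functions *)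

Section gradient.
Context (R : realType) (N : nat).
Implicit Types (u w : 'rV[R]_N -> R) (x v g e : 'rV[R]_N).

Lemma rV_sum_delta v : v = \sum_(i < N) v ord0 i *: delta_mx ord0 i.
Proof. by rewrite {1}(row_sum_delta v). Qed.

Lemma deriveE_grad u x v : differentiable u x -> 'D_v u x = dot (grad u x) v.
Proof.
move=> du; rewrite {1}(rV_sum_delta v) deriveE// linear_sum/=.
by apply: eq_bigr => i _; rewrite linearZ/= -deriveE// mxE mulrC.
Qed.

Lemma is_derive_curve u (c : R -> 'rV[R]_N) (c' : 'rV[R]_N) (t : R) :
  differentiable u (c t) -> is_derive t 1 c c' ->
  is_derive t 1 (u \o c) (dot (grad u (c t)) c').
Proof.
move=> du [dc <-]; have dc' : differentiable c t by exact/derivable1_diffP.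
have duc : differentiable (u \o c) t by exact: differentiable_comp.
apply: DeriveDef; first exact/derivable1_diffP.
by rewrite deriveE// diff_comp//= -!deriveE// deriveE_grad.
Qed.

Lemma is_CkP k u : is_Ck k u <-> Ck_on k setT u.
Proof.
elim: k u => [|k IH] u /=.
  by split => [cu x _|cu x]; [exact: cu|exact: cu].
split=> -[du Du]; split => [x|v]; try (by move=> _; exact: du); try exact/IH.
  exact: du.
Qed.

Lemma smooth_differentiable u : smooth u -> forall x, differentiable u x.
Proof. by move=> su x; have [/(_ x)] := su 1%N. Qed.

Lemma smooth_derive u v : smooth u -> smooth ('D_v u).
Proof. by move=> su k; have [_] := su k.+1; apply. Qed.

Lemma smooth_continuous u : smooth u -> continuous u.
Proof. by move=> su; exact: (su 0%N). Qed.

Lemma grad_coord u i x : grad u x ord0 i = 'D_(delta_mx ord0 i) u x.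
Proof. by rewrite mxE. Qed.

Lemma continuous_grad_coord u i : smooth u -> continuous (fun x => grad u x ord0 i).
Proof.
move=> su; rewrite (_ : (fun _ => _) = 'D_(delta_mx ord0 i) u); last first.
  by apply/funext => x; rewrite mxE.
exact/smooth_continuous/smooth_derive.
Qed.

Lemma continuous_enorm_grad u : smooth u -> continuous (fun x => enorm (grad u x)).
Proof.
move=> su x; rewrite /enorm; apply: (@continuous_comp _ _ _ _ Num.sqrt); last exact: sqrt_continuous.
have C i : {for x, continuous (fun x => grad u x ord0 i ^+ 2)}.
  by apply: (@continuous_comp _ _ _ (fun x => grad u x ord0 i) (fun y => y ^+ 2)); [exact: continuous_grad_coord|exact: exprn_continuous].
rewrite (_ : (fun _ => _) = \sum_(i < N) (fun x => grad u x ord0 i ^+ 2)); last first.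
  by apply/funext => y; rewrite fct_sumE.
elim/big_ind : _ => [|f g cf cg|i _]; [exact: cst_continuous|exact: continuousD|exact: C].
Qed.

Lemma measurable_grad u : smooth u -> measurable_fun setT (grad u).
Proof.
move=> su; apply: measurable_fun_coordP => i.
apply: continuous_measurable_rV; exact: continuous_grad_coord.
Qed.

Lemma gradB u w x : differentiable u x -> differentiable w x ->
  grad (fun x => u x - w x) x = grad u x - grad w x.
Proof.
move=> du dw; apply/rowP => i; rewrite !mxE.
by apply: deriveB; exact: diff_derivable.
Qed.

Lemma smoothB u w : smooth u -> smooth w -> smooth (fun x => u x - w x).
Proof.
move=> su sw k; apply/is_CkP; apply: Ck_on_sub_fun; [exact: openT| |]; exact/is_CkP.
Qed.

Lemma smooth_cst (c : R) : smooth (fun _ : 'rV[R]_N => c).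
Proof. by move=> k; apply/is_CkP; apply: Ck_on_cst; exact: openT. Qed.

Lemma smoothM u w : smooth u -> smooth w -> smooth (fun x => u x * w x).
Proof.
move=> su sw k; apply/is_CkP; apply: Ck_on_mul; [exact: openT| |]; exact/is_CkP.
Qed.

(** For a unit vector [e], the length of the component of [g] orthogonal to [e], in the form given
    by Pythagoras. *)
Definition tang g e : R := Num.sqrt (dot g g - dot g e ^+ 2).

Lemma tang_ge0 g e : 0 <= tang g e. Proof. exact: sqrtr_ge0. Qed.

Lemma tangE g e : enorm e = 1 -> tang g e = enorm (g - dot g e *: e).
Proof.
move=> e1; rewrite enormE /tang; congr Num.sqrt.
have ee : dot e e = 1 by rewrite -enorm2 e1 expr1n.
rewrite -(scaleNr (dot g e) e) dotDl !dotZl !dotDr !dotZr ee (dotC e g); ring.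
Qed.

Lemma tang2 g e : enorm e = 1 -> enorm g ^+ 2 = dot g e ^+ 2 + tang g e ^+ 2.
Proof.
move=> e1; rewrite tangE// !enorm2 -(scaleNr (dot g e) e) dotDl !dotZl !dotDr !dotZr.
have ee : dot e e = 1 by rewrite -enorm2 e1 expr1n.
rewrite ee (dotC e g); ring.
Qed.

Lemma dot_tang g e v : enorm e = 1 -> dot v e = 0 -> `|dot g v| <= tang g e * enorm v.
Proof.
move=> e1 ve; rewrite tangE// -[X in `|X|](_ : dot (g - dot g e *: e) v = _).
  exact: normr_dot_le_enorm.
by rewrite -(scaleNr (dot g e) e) dotDl dotZl (dotC e) ve mulr0 addr0.
Qed.

Lemma is_derive_coord (c : R -> 'rV[R]_N) c' i (t : R) : is_derive t 1 c c' ->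
  is_derive t 1 (fun t => c t ord0 i) (c' ord0 i).
Proof.
move=> [dc <-]; apply: DeriveDef; first by move/derivable_mxP: dc; apply.
by rewrite derive_mx// mxE.
Qed.

Lemma is_derive_row (c : R -> 'rV[R]_N) (c' : 'rV[R]_N) (t : R) :
  (forall i, is_derive t 1 (fun t => c t ord0 i) (c' ord0 i)) -> is_derive t 1 c c'.
Proof.
move=> h; have dc : derivable c t 1 by apply/derivable_mxP => i j; rewrite (ord1 i); have [] := h j.
apply: DeriveDef => //; rewrite derive_mx//; apply/rowP => i; rewrite !mxE.
by have [] := h i.
Qed.

Lemma is_derive_dot (c d : R -> 'rV[R]_N) c' d' (t : R) : is_derive t 1 c c' ->
  is_derive t 1 d d' -> is_derive t 1 (fun t => dot (c t) (d t)) (dot c' (d t) + dot (c t) d').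
Proof.
move=> hc hd; have H i : is_derive t 1 (fun t => c t ord0 i * d t ord0 i)
    (c' ord0 i * d t ord0 i + c t ord0 i * d' ord0 i).
  have := @is_deriveM _ _ _ _ _ _ _ _ (is_derive_coord i hc) (is_derive_coord i hd).
  by move/is_derive_eq; apply; rewrite addrC /GRing.scale/= (mulrC (d t _ _)).
rewrite /dot -big_split/=.
rewrite (_ : (fun _ => _) = \sum_(i < N) (fun t => c t ord0 i * d t ord0 i)); last first.
  by apply/funext => s; rewrite fct_sumE.
exact: is_derive_sum.
Qed.

Lemma is_derive_enorm (c : R -> 'rV[R]_N) c' (t : R) : is_derive t 1 c c' ->
  c t != 0 -> is_derive t 1 (fun t => enorm (c t)) (dot (c t) c' / enorm (c t)).
Proof.
move=> hc c0; have c1 : 0 < enorm (c t) by rewrite enorm_gt0.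
rewrite (_ : (fun _ => _) = Num.sqrt \o (fun t => dot (c t) (c t))); last first.
  by apply/funext => s; rewrite /= enormE.
have d0 : 0 < dot (c t) (c t) by rewrite -enorm2 exprn_gt0.
have := @is_derive1_comp R _ _ _ _ _ (is_derive1_sqrt d0) (is_derive_dot hc hc).
move/is_derive_eq; apply; rewrite -enormE (dotC c').
by field; rewrite gt_eqF.
Qed.

Lemma is_derive_scale (c : R -> 'rV[R]_N) (c' : 'rV[R]_N) (a : R -> R) (a' t : R) :
  is_derive t 1 c c' -> is_derive t 1 a a' ->
  is_derive t 1 (fun t => a t *: c t) (a' *: c t + a t *: c').
Proof.
move=> hc ha; apply: is_derive_row => i.
rewrite (_ : (fun _ => _) = (fun t => a t * c t ord0 i)); last first.
  by apply/funext => s; rewrite mxE.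
have := @is_deriveM _ _ _ _ _ _ _ _ ha (is_derive_coord i hc).
by move/is_derive_eq; apply; rewrite !mxE addrC /GRing.scale/= (mulrC a').
Qed.

End gradient.

Section integral_ineq.
Context d (T : measurableType d) (R : realType) (mu : {measure set T -> \bar R}).
Variables (D : set T) (mD : measurable D).

Lemma integral_le_lincomb (F G H : T -> R) (a b : R) :
  measurable_fun D G -> measurable_fun D H -> measurable_fun D F ->
  (forall x, D x -> 0 <= F x) -> (forall x, D x -> 0 <= G x) ->
  (forall x, D x -> 0 <= H x) -> 0 <= a -> 0 <= b ->
  (forall x, D x -> F x <= a * G x + b * H x) ->
  (\int[mu]_(x in D) (F x)%:E <=
   a%:E * \int[mu]_(x in D) (G x)%:E + b%:E * \int[mu]_(x in D) (H x)%:E)%E.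
Proof.
move=> mG mH mF F0 G0 H0 a0 b0 FGH.
rewrite -!ge0_integralZl//; last first.
- exact/measurable_EFinP.
- exact/measurable_EFinP.
rewrite -ge0_integralD//; first last.
- by apply/measurable_EFinP; apply: measurable_funM.
- by move=> x /H0 h; rewrite -EFinM lee_fin mulr_ge0.
- by apply/measurable_EFinP; apply: measurable_funM.
- by move=> x /G0 h; rewrite -EFinM lee_fin mulr_ge0.
apply: ge0_le_integral => //.
- exact/measurable_EFinP.
- apply/measurable_EFinP; apply: (@measurable_funD _ _ _ _ (fun x => a * G x) (fun x => b * H x)); exact: measurable_funM.
Qed.

End integral_ineq.

(** * Tonelli's theorem on subsets and integrals depending on a parameter *)

Section parametric_integral.
Context d1 d2 (T1 : measurableType d1) (T2 : measurableType d2) (R : realType).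
Context (m1 : {sigma_finite_measure set T1 -> \bar R}).
Context (m2 : {sigma_finite_measure set T2 -> \bar R}).
Variables (G : T1 * T2 -> \bar R) (A : set T1) (B : set T2).
Hypotheses (mG : measurable_fun setT G) (mA : measurable A) (mB : measurable B).

Lemma measurable_integral_param : (forall p, B p.2 -> (0 <= G p)%E) ->
  measurable_fun setT (fun x => \int[m2]_(y in B) G (x, y))%E.
Proof.
move=> G0; rewrite (_ : (fun _ => _) = (fun x => \int[m2]_y ((\1_B y)%:E * G (x, y)))%E).
  apply: (@measurable_fun_fubini_tonelli_F _ _ _ _ _ m2
    (fun p : T1 * T2 => ((\1_B p.2)%:E * G p)%E)).
    apply: emeasurable_funM => //; apply/measurable_EFinP.
    by apply: (measurableT_comp _ measurable_snd); exact: measurable_indic.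
  move=> p; rewrite indicE; case: (boolP (p.2 \in B)) => [/set_mem/G0 h|_].
    by rewrite mul1e.
  by rewrite mul0e.
apply/funext => x; rewrite integral_mkcond; apply: eq_integral => s _.
by rewrite patchE indicE; case: (s \in B); rewrite ?mul1e ?mul0e.
Qed.

Lemma tonelli_on : (forall x y, A x -> B y -> (0 <= G (x, y))%E) ->
  (\int[m1]_(x in A) \int[m2]_(y in B) G (x, y) =
   \int[m2]_(y in B) \int[m1]_(x in A) G (x, y))%E.
Proof.
move=> G0; pose H p := ((\1_A p.1)%:E * (\1_B p.2)%:E * G p)%E.
have mH : measurable_fun setT H.
  apply: emeasurable_funM => //; apply: emeasurable_funM; apply/measurable_EFinP.
    by apply: (measurableT_comp _ measurable_fst); exact: measurable_indic.
  by apply: (measurableT_comp _ measurable_snd); exact: measurable_indic.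
have H0 p : (0 <= H p)%E.
  rewrite /H !indicE; case: p => x y /=.
  case: (boolP (x \in A)) => [/set_mem xA|_]; last by rewrite !mul0e.
  case: (boolP (y \in B)) => [/set_mem yB|_]; last by rewrite mule0 mul0e.
  by rewrite !mul1e; exact: G0.
transitivity (\int[m1]_x \int[m2]_y H (x, y))%E.
  rewrite integral_mkcond; apply: eq_integral => x _; rewrite patchE /H/= indicE.
  case: ifPn => _; last by rewrite integral0_eq// => y _; rewrite !mul0e.
  rewrite integral_mkcond; apply: eq_integral => y _; rewrite patchE indicE.
  by case: ifP => _; rewrite ?mul0e ?mule0 ?mul0e ?mul1e.
rewrite (@fubini_tonelli _ _ _ _ _ m1 m2 H)//.
rewrite [RHS]integral_mkcond; apply: eq_integral => y _; rewrite patchE.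
case: ifPn => yB; last first.
  by rewrite integral0_eq// => x _; rewrite /H/= !indicE (negbTE yB) mule0 mul0e.
rewrite [RHS]integral_mkcond; apply: eq_integral => x _; rewrite patchE /H/= !indicE yB mule1.
by case: ifP => _; rewrite ?mul0e ?mul1e.
Qed.

End parametric_integral.

(** * Comparison of integrals over spheres and balls *)

Section spheres.
Context (R : realType) (n : nat) (rho : R) (rho0 : 0 < rho).
Local Notation N := n.+1.
Local Notation leb := (lebesgue_rV R N).
Local Notation D := (@punctured_ball R n rho).
Local Notation bd := (bdry (eball N rho) : set 'rV[R]_N).

Lemma measurable_bdry_eball : measurable bd.
Proof.
rewrite (bdry_eball _ rho0) (_ : [set _ | _] = @enorm R N @^-1` [set rho])//.
by rewrite -[X in measurable X]setTI; apply: measurable_enorm.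
Qed.

Lemma bdry_ray x : D x -> bd (ray x rho).
Proof.
by move=> Dx; rewrite (bdry_eball _ rho0) /= enorm_ray ?(ltW rho0)// (punctured_ball_neq0 Dx).
Qed.

Lemma measurable_fun_bdry_ray (F : 'rV[R]_N -> R) : measurable_fun bd F ->
  measurable_fun D (fun x => F (ray x rho)).
Proof.
move=> mF; apply: (@measurable_comp _ _ _ _ _ _ bd F _ (fun x => ray x rho)) => //.
- exact: measurable_bdry_eball.
- by move=> _ [x Dx <-]; exact: bdry_ray.
- exact: measurable_funTS (measurable_ray _).
Qed.

Lemma sphere_integral_le_lincomb (F G H : 'rV[R]_N -> R) (a b : R) :
  measurable_fun bd G -> measurable_fun bd H -> measurable_fun bd F ->
  (forall x, 0 <= F x) -> (forall x, 0 <= G x) ->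
  (forall x, 0 <= H x) -> 0 <= a -> 0 <= b ->
  (forall x, bd x -> F x <= a * G x + b * H x) ->
  (\int[sphere_measure N rho]_(x in bd) (F x)%:E <=
   a%:E * \int[sphere_measure N rho]_(x in bd) (G x)%:E +
   b%:E * \int[sphere_measure N rho]_(x in bd) (H x)%:E)%E.
Proof.
move=> mG mH mF F0 G0 H0 a0 b0 FGH.
have c0 : (0 <= (N%:R / rho)%:E)%E by rewrite lee_fin divr_ge0// ltW.
rewrite !integral_sphere// !(muleCA _ (N%:R / rho)%:E) -ge0_muleDr//; last 2 first.
- by apply: mule_ge0; rewrite ?lee_fin//; apply: integral_ge0 => x _; rewrite lee_fin.
- by apply: mule_ge0; rewrite ?lee_fin//; apply: integral_ge0 => x _; rewrite lee_fin.
apply: lee_wpmul2l => //.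
apply: integral_le_lincomb => //; try exact: measurable_fun_bdry_ray.
- exact: measurable_punctured_ball.
- by move=> x /bdry_ray; exact: FGH.
Qed.

(** An inequality between a boundary and a volume integral follows from its one-dimensional version
    on every ray. Both the trace inequality and the calibration are proved in this way. *)
Lemma sphere_le_ball (F g : 'rV[R]_N -> R) (c : R) : 0 <= c ->
  measurable_fun bd F -> (forall x, 0 <= F x) ->
  measurable_fun setT g -> (forall x, 0 <= g x) ->
  (forall x, D x -> ((c * rho ^+ n * F (ray x rho))%:E <=
    \int[@lebesgue_measure R]_(s in `[0%R, rho]) (g (ray x s) * s ^+ n)%:E)%E) ->
  (c%:E * \int[sphere_measure N rho]_(x in bd) (F x)%:E <=
   \int[leb]_(x in eball N rho) (g x)%:E)%E.
Proof.
move=> c0 mF F0 mg g0 Fg.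
have d0 : 0 <= N%:R / rho ^+ N by rewrite divr_ge0// exprn_ge0// ltW.
rewrite integral_sphere// (polar_eball rho0 mg g0).
have mFr := measurable_fun_bdry_ray mF.
have mD := @measurable_punctured_ball R n rho.
have -> : (c%:E * ((N%:R / rho)%:E * \int[leb]_(x in D) (F (ray x rho))%:E) =
   (N%:R / rho ^+ N)%:E * \int[leb]_(x in D) (c * rho ^+ n * F (ray x rho))%:E)%E.
  under [in RHS]eq_integral do rewrite EFinM.
  rewrite ge0_integralZl//; last 3 first.
  - exact/measurable_EFinP.
  - by move=> x _; rewrite lee_fin.
  - by rewrite lee_fin mulr_ge0// exprn_ge0// ltW.
  rewrite !muleA -!EFinM; congr (_%:E * _)%E.
  by rewrite exprS; field; rewrite ?expf_neq0 gt_eqF.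
apply: lee_wpmul2l; first by rewrite lee_fin.
apply: ge0_le_integral => //.
- by move=> x _; rewrite lee_fin mulr_ge0// mulr_ge0// exprn_ge0// ltW.
- by apply/measurable_EFinP; exact: measurable_funM.
apply: measurable_funTS.
refine (@measurable_integral_param _ _ _ _ R (@lebesgue_measure R)
  (fun p : 'rV[R]_N * measurableTypeR R => (g (ray p.1 p.2) * p.2 ^+ n)%:E) `[0%R, rho] _ _ _) => //.
- apply/measurable_EFinP; apply: measurable_funM; first exact: (measurableT_comp mg (@measurable_ray2 R n)).
  by apply: measurable_funX; exact: measurable_snd.
- by move=> p /=; rewrite in_itv/= => /andP[s0 _]; rewrite lee_fin mulr_ge0// exprn_ge0.
Qed.

Definition sphere_area : R := N%:R / rho * fine (leb D).

Lemma sphere_area_gt0 : 0 < sphere_area.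
Proof.
rewrite mulr_gt0// ?divr_gt0//.
by rewrite fine_gt0// lebesgue_punctured_ball_gt0//= lebesgue_punctured_ball_lty.
Qed.

Lemma integral_sphere_cst (c : R) : 0 <= c ->
  (\int[sphere_measure N rho]_(x in bd) c%:E = (c * sphere_area)%:E)%E.
Proof.
move=> c0; rewrite integral_sphere// integral_cst; last exact: measurable_punctured_ball.
have E : leb D = (fine (leb D))%:E.
  by rewrite fineK// ge0_fin_numE// lebesgue_punctured_ball_lty.
rewrite [X in (_ * (_ * X))%E]E.
by rewrite -!EFinM; congr EFin; rewrite /sphere_area; ring.
Qed.

Lemma is_derive_ray (x : 'rV[R]_N) (s : R) : is_derive s 1 (ray x) ((enorm x)^-1 *: x).
Proof.
have h : is_derive s 1 (fun s : R => s / enorm x) (enorm x)^-1.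
  rewrite (_ : (fun _ => _) = ( *%R (enorm x)^-1)); last by apply/funext => t; rewrite mulrC.
  exact: is_derive_mull.
have := is_derive_scale (is_derive_cst x s 1) h.
by move/is_derive_eq; apply; rewrite scaler0 addr0.
Qed.

Lemma is_derive_comp_ray (u : 'rV[R]_N -> R) x (s : R) : smooth u ->
  is_derive s 1 (fun s => u (ray x s)) (dot (grad u (ray x s)) ((enorm x)^-1 *: x)).
Proof.
move=> su; apply: (is_derive_curve (c := ray x)); last exact: is_derive_ray.
exact: smooth_differentiable.
Qed.

Lemma enorm_unit (x : 'rV[R]_N) : x != 0 -> enorm ((enorm x)^-1 *: x) = 1.
Proof.
by move=> x0; rewrite enormZ ger0_norm ?invr_ge0 ?enorm_ge0// mulVf// enorm_eq0.
Qed.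

Lemma continuous_ray (x : 'rV[R]_N) : continuous (ray x).
Proof.
move=> s; have [h _] := is_derive_ray x s.
by apply: differentiable_continuous; exact/derivable1_diffP.
Qed.

End spheres.

(** * The trace inequality *)

Lemma is_derive_affine (R : realType) (a b s : R) : is_derive s 1 (fun s => a * s + b) a.
Proof.
have := @is_deriveD _ _ _ _ _ _ _ _ _ (is_derive_mull a s) (is_derive_cst b s 1).
by rewrite addr0.
Qed.

Section trace.
Context (R : realType) (n : nat) (rho p : R) (rho0 : 0 < rho) (p1 : 1 < p).
Local Notation N := n.+1.
Local Notation leb := (lebesgue_rV R N).
Local Notation D := (@punctured_ball R n rho).
Local Notation ball := (eball N rho : set 'rV[R]_N).
Local Notation bd := (bdry (eball N rho) : set 'rV[R]_N).
Local Notation surf := (sphere_measure N rho : set 'rV[R]_N -> \bar R).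
Local Notation en := (@energy R N p ball).

Let p0 : 0 < p. Proof. exact: lt_trans ltr01 p1. Qed.

Lemma young_ge (a b : R) : 0 <= a -> 0 <= b ->
  p * (a * b `^ (p - 1)) <= a `^ p + (p - 1) * b `^ p.
Proof.
move=> a0 b0; have := young p1 a0 (powR_ge0 b (p - 1)).
have -> : (b `^ (p - 1)) `^ (p / (p - 1)) = b `^ p by rewrite -powRrM mulrC divfK// gt_eqF// subr_gt0.
by [].
Qed.

Lemma is_derive_powR_ray (u : 'rV[R]_N -> R) x (s : R) : smooth u ->
  is_derive s 1 (fun s => `|u (ray x s)| `^ p)
    (p * Num.sg (u (ray x s)) * `|u (ray x s)| `^ (p - 1) *
     dot (grad u (ray x s)) ((enorm x)^-1 *: x)).
Proof.
move=> su; have := @is_derive1_comp R _ _ _ _ _ (is_derive_norm_powR (u (ray x s)) p1) (is_derive_comp_ray x s su).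
by move/is_derive_eq; apply; rewrite mulrC.
Qed.

(** The divergence theorem for [|u|^p Phi(|x|) x / |x|], read on one ray: [dPhi s + n * Phi s / s]
    is the divergence of the radial field. Starting where [|u|^p * Phi] vanishes removes the inner
    boundary term. *)
Lemma ray_ineq (u : 'rV[R]_N -> R) (x : 'rV[R]_N) (a : R) (Phi dPhi K : R -> R) : smooth u ->
  0 < a <= rho -> x != 0 -> `|u (ray x a)| `^ p * Phi a = 0 ->
  (forall s, a <= s <= rho -> is_derive s 1 Phi (dPhi s)) ->
  continuous K -> (forall s, 0 <= s <= rho -> 0 <= K s) ->
  (forall s, a < s < rho ->
    p * `|u (ray x s)| `^ (p - 1) * `|dot (grad u (ray x s)) ((enorm x)^-1 *: x)| * `|Phi s| * s ^+ n
    + `|u (ray x s)| `^ p * (dPhi s + n%:R * Phi s / s) * s ^+ n <= K s) ->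
  ((Phi rho * rho ^+ n * `|u (ray x rho)| `^ p)%:E <=
    \int[@lebesgue_measure R]_(s in `[0%R, rho]) (K s)%:E)%E.
Proof.
move=> su /andP[a0 ar] x0 ua dP cK K0 HK.
pose W s := `|u (ray x s)| `^ p.
have cW : continuous W by move=> s; exact: is_derive_continuous (is_derive_powR_ray x s su).
pose g s := W s * (Phi s * s ^+ n).
have dg s : a <= s <= rho -> is_derive s 1 g
   (p * Num.sg (u (ray x s)) * `|u (ray x s)| `^ (p - 1) *
     dot (grad u (ray x s)) ((enorm x)^-1 *: x) * (Phi s * s ^+ n) +
    W s * (dPhi s * s ^+ n + Phi s * (n%:R * s ^+ n.-1))).
  move=> sa.
  have h1 := @is_deriveX _ _ id n s 1 1 (is_derive_id s 1).
  have h2 := @is_deriveM _ _ _ _ _ _ _ _ (dP s sa) h1.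
  have := @is_deriveM _ _ _ _ _ _ _ _ (is_derive_powR_ray x s su) h2.
  set d := dot _ _; rewrite !exprfctE => /is_derive_eq; apply.
  rewrite /W /GRing.scale/= !fctE; ring.
have := @FTC_le R g _ K a rho ar cK (fun s h => dg s (let h' := andP h in introT andP (conj (ltW h'.1) (ltW h'.2)))).
have -> : g a = 0 by rewrite /g mulrA [X in X * _]ua mul0r.
rewrite subr0 /g mulrC => H.
apply: (@le_trans _ _ (\int[@lebesgue_measure R]_(s in `[a, rho]) (K s)%:E)%E).
  apply: H.
    move=> s /andP[as' sr]; apply: le_trans (HK s _); last by rewrite as'.
    have s0 : 0 < s by exact: lt_trans as'.
    have -> : W s * (dPhi s * s ^+ n + Phi s * (n%:R * s ^+ n.-1)) =
       W s * (dPhi s + n%:R * Phi s / s) * s ^+ n.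
      rewrite -mulrA; congr (_ * _); case: (n) => [|m] /=; first by rewrite !mul0r !mulr0 !addr0.
      by rewrite exprS; field; rewrite gt_eqF.
    rewrite lerD2r -!mulrA ler_wpM2l ?(ltW p0)//.
    rewrite (mulrCA (Num.sg _)) ler_wpM2l ?powR_ge0// !mulrA ler_wpM2r ?exprn_ge0 ?(ltW s0)//.
    rewrite (le_trans (ler_norm _))// !normrM normr_sg.
    by case: (u (ray x s) != 0); rewrite ?mul0r ?mul1r// mulr_ge0.
  apply: continuous_in_subspaceT => s; rewrite inE/= in_itv/= => /dg.
  exact: is_derive_continuous.
apply: ge0_subset_integral => //.
- apply/measurable_EFinP; apply: measurable_funTS; exact: continuous_measurable_fun.
- by move=> s /=; rewrite !in_itv/= => /andP[as' ->]; rewrite (le_trans (ltW a0)).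
Qed.

Lemma energy_density_ge0 (w : sobolev_pair R N) x : 0 <= enorm (w.2 x) `^ p + `|w.1 x| `^ p.
Proof. by rewrite addr_ge0 ?powR_ge0. Qed.

Lemma continuous_energy_density (u : 'rV[R]_N -> R) : smooth u ->
  continuous (fun x => enorm (grad u x) `^ p + `|u x| `^ p).
Proof.
move=> su.
rewrite (_ : (fun _ => _) = ((fun y => `|y| `^ p) \o (fun x => enorm (grad u x))) \+
    ((fun y => `|y| `^ p) \o u)); last first.
  by apply/funext => y; rewrite /= (ger0_norm (enorm_ge0 _)).
move=> x; apply: continuousD; apply: continuous_comp.
- exact: continuous_enorm_grad.
- exact: continuous_norm_powR.
- exact: smooth_continuous.
- exact: continuous_norm_powR.
Qed.

Lemma measurable_powR_smooth (u : 'rV[R]_N -> R) : smooth u ->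
  measurable_fun setT (fun x => `|u x| `^ p).
Proof.
move=> su; apply: continuous_measurable_rV => x.
apply: (@continuous_comp _ _ _ u (fun y => `|y| `^ p)); first exact: smooth_continuous.
exact: continuous_norm_powR.
Qed.

(** [ray_ineq] with a linear weight vanishing at [rho / 2]. Its slope [1 / C] is small enough for
    the energy density to absorb the gradient term and the divergence term together. *)
Theorem trace_inequality : exists2 C, 0 <= C & forall u : 'rV[R]_N -> R, smooth u ->
  (\int[surf]_(x in bd) (`|u x| `^ p)%:E <= C%:E * en (u, grad u))%E.
Proof.
pose C := rho * p + 1 + 2 * n%:R.
have rp : 0 < rho * p by rewrite mulr_gt0.
have C0 : 0 < C by rewrite /C -addrA addr_gt0// ltr_wpDr// mulr_ge0.
exists (C / (rho / 2)); first by rewrite divr_ge0 ?ltW// divr_gt0.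
move=> u su.
have c0 : 0 < rho / 2 / C by rewrite !divr_gt0.
rewrite -(invf_div (rho / 2) C) lee_pdivlMl//.
apply: (@sphere_le_ball R n rho rho0 (fun x => `|u x| `^ p)) => //.
- by rewrite ltW.
- exact: measurable_funTS (measurable_powR_smooth su).
- exact: continuous_measurable_rV (continuous_energy_density su).
- by move=> x; exact: energy_density_ge0 (u, grad u) x.
move=> x Dx; have x0 := punctured_ball_neq0 Dx.
pose G s := enorm (grad u (ray x s)) `^ p + `|u (ray x s)| `^ p.
have G0 s : 0 <= G s by rewrite addr_ge0 ?powR_ge0.
have cG : continuous (fun s => G s * s ^+ n).
  move=> s; apply: cvgM; last exact: exprn_continuous.
  apply: (@continuous_comp _ _ _ (ray x) (fun x => enorm (grad u x) `^ p + `|u x| `^ p)).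
    exact: continuous_ray.
  exact: continuous_energy_density.
have := @ray_ineq u x (rho / 2) (fun s => (s - rho / 2) / C) (fun _ => C^-1) (fun s => G s * s ^+ n) su.
have -> : (rho - rho / 2) / C = rho / 2 / C by congr (_ / _); field.
apply => //.
- by rewrite divr_gt0//= ler_pdivrMr// ler_pMr// ler1n.
- by rewrite subrr mul0r mulr0.
- move=> s _.
  rewrite (_ : (fun _ => _) = (fun s => C^-1 * s + - (rho / 2 / C))); last first.
    by apply/funext => t; rewrite mulrBl mulrC.
  exact: is_derive_affine.
- by move=> s /andP[s0 _]; rewrite mulr_ge0// exprn_ge0.
move=> s /andP[s1 s2]; have s0 : 0 < s by apply: lt_trans s1; rewrite divr_gt0.
rewrite -mulrDl ler_wpM2r ?exprn_ge0 ?(ltW s0)//.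
set g := grad u _; set U := `|u _|; set e := (enorm x)^-1 *: x.
have U0 : 0 <= U by exact: normr_ge0.
have Y : p * U `^ (p - 1) * `|dot g e| <= enorm g `^ p + (p - 1) * U `^ p.
  apply: le_trans (young_ge (enorm_ge0 g) U0).
  rewrite -mulrA ler_wpM2l ?(ltW p0)// mulrC ler_wpM2r ?powR_ge0//.
  by apply: le_trans (normr_dot_le_enorm _ _) _; rewrite enorm_unit// mulr1.
have ph : 0 <= (s - rho / 2) / C <= rho / C.
  apply/andP; split; first by rewrite divr_ge0 ?(ltW C0)// subr_ge0 ltW.
  by rewrite ler_wpM2r ?invr_ge0 ?(ltW C0)//; lra.
have {ph}[ph1 ph2] := andP ph.
rewrite (ger0_norm ph1).
have s2' : (s - rho / 2) / s <= 1 by rewrite ler_pdivrMr//; lra.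
have B1 : C^-1 + n%:R * ((s - rho / 2) / C) / s <= (1 + n%:R) / C.
  have -> : n%:R * ((s - rho / 2) / C) / s = n%:R * ((s - rho / 2) / s) / C.
    by field; rewrite !gt_eqF.
  by rewrite -[X in X + _]mul1r -mulrDl ler_wpM2r ?invr_ge0 ?(ltW C0)// lerD2l ler_piMr.
have Up := powR_ge0 U p; have gp := powR_ge0 (enorm g) p.
have H1 : p * U `^ (p - 1) * `|dot g e| * ((s - rho / 2) / C) <= (enorm g `^ p + (p - 1) * U `^ p) * (rho / C).
  apply: ler_pM => //.
  by rewrite !mulr_ge0 ?powR_ge0 ?(ltW p0).
have H2 := ler_wpM2l Up B1.
apply: le_trans (lerD H1 H2) _.
rewrite /G -/g -/U.
rewrite -subr_ge0.
have -> : enorm g `^ p + U `^ p - ((enorm g `^ p + (p - 1) * U `^ p) * (rho / C) + U `^ p * ((1 + n%:R) / C)) =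
  (enorm g `^ p * (C - rho) + U `^ p * (C - (p - 1) * rho - 1 - n%:R)) / C by field; rewrite gt_eqF.
have n0 : 0 <= n%:R :> R by [].
have rpp : rho <= rho * p by rewrite ler_peMr ?(ltW rho0)// ltW.
have A1 : 0 <= C - rho by rewrite /C; lra.
have A2 : 0 <= C - (p - 1) * rho - 1 - n%:R by rewrite /C; lra.
by apply: divr_ge0 (ltW C0); apply: addr_ge0; exact: mulr_ge0.
Qed.

End trace.

(** * Lower bounds for the Steklov quotient *)

Lemma measurable_fun_rV_on d (T : measurableType d) (R : realType) m (A : set T) (f : T -> 'rV[R]_m) :
  measurable A -> (forall i, measurable_fun A (fun t => f t ord0 i : measurableTypeR R)) ->
  measurable_fun A f.
Proof.
move=> mA mf.
apply: (@measurability _ _ _ _ A f (\big[setU/set0]_(i < m) preimage_set_system setT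
    (fun x : 'rV[R]_m => x ord0 i : measurableTypeR R) measurable)) => //.
move=> _ [B + <-]; rewrite -bigcup_seq => -[i _ [C mC <-]].
by rewrite setTI; exact: (mf i).
Qed.

Section closure.
Context (R : realType) (n : nat) (rho p : R) (rho0 : 0 < rho) (p1 : 1 < p).
Local Notation N := n.+1.
Local Notation leb := (lebesgue_rV R N).
Local Notation D := (@punctured_ball R n rho).
Local Notation ball := (eball N rho : set 'rV[R]_N).
Local Notation bd := (bdry (eball N rho) : set 'rV[R]_N).
Local Notation surf := (sphere_measure N rho : set 'rV[R]_N -> \bar R).
Local Notation en := (@energy R N p ball).

Let p0 : 0 < p. Proof. exact: lt_trans ltr01 p1. Qed.

Lemma measurable_powR_normr d (T : measurableType d) (B : set T) (f : T -> R) (s : R) :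
  measurable_fun B f -> measurable_fun B (fun x => `|f x| `^ s).
Proof.
move=> mf; apply: (@measurableT_comp _ _ _ _ _ _ (fun y : R => y `^ s)).
  exact: measurable_powR.
exact: (measurableT_comp (@normr_measurable R setT) mf).
Qed.

Lemma measurable_smooth (u : 'rV[R]_N -> R) (B : set 'rV[R]_N) : smooth u -> measurable_fun B u.
Proof.
move=> su; apply: measurable_funTS; apply: continuous_measurable_rV.
exact: smooth_continuous.
Qed.

Definition pair_measurable (w : sobolev_pair R N) :=
  measurable_fun ball w.1 /\ measurable_fun ball w.2.

Lemma smooth_pair_measurable (u : 'rV[R]_N -> R) : smooth u -> pair_measurable (u, grad u).
Proof.
move=> su; split; apply: measurable_funTS; last exact: measurable_grad.
by apply: continuous_measurable_rV => /=; exact: smooth_continuous.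
Qed.

Lemma pair_measurableB (a b : sobolev_pair R N) : pair_measurable a -> pair_measurable b ->
  pair_measurable (fun x => a.1 x - b.1 x, fun x => a.2 x - b.2 x).
Proof.
move=> [a1 a2] [b1 b2]; split; rewrite /=; first exact: measurable_funB.
apply: measurable_fun_rV_on; first exact: measurable_eball.
move=> i; rewrite (_ : (fun _ => _) = (fun x => a.2 x ord0 i - b.2 x ord0 i)); last first.
  by apply/funext => x; rewrite !mxE.
by apply: measurable_funB; [exact: (measurableT_comp (measurable_coord i) a2)|
  exact: (measurableT_comp (measurable_coord i) b2)].
Qed.

Lemma measurable_energy_density (w : sobolev_pair R N) : pair_measurable w ->
  measurable_fun ball (fun x => enorm (w.2 x) `^ p + `|w.1 x| `^ p).
Proof.
move=> [w1 w2]; apply: measurable_funD; last exact: measurable_powR_normr.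
apply: (@measurableT_comp _ _ _ _ _ _ (fun y : R => y `^ p)).
  exact: measurable_powR.
by apply: (@measurableT_comp _ _ _ _ _ _ (@enorm R N)) => //; exact: measurable_enorm.
Qed.

Lemma energy_ge0 w : (0 <= en w)%E.
Proof. by apply: integral_ge0 => x _; rewrite lee_fin addr_ge0 ?powR_ge0. Qed.

(** The parameter [m] stays free: it is small when [b] is a vanishing error and [a] must keep its
    constant, and it is 1/2 for a rough bound. *)
Lemma energy_split (a b c : sobolev_pair R N) (m : R) : 0 < m < 1 ->
  pair_measurable a -> pair_measurable b -> pair_measurable c ->
  (forall x, `|c.1 x| <= `|a.1 x| + `|b.1 x|) ->
  (forall x, enorm (c.2 x) <= enorm (a.2 x) + enorm (b.2 x)) ->
  (en c <= ((1 - m) `^ (1 - p))%:E * en a + (m `^ (1 - p))%:E * en b)%E.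
Proof.
move=> m01 ma mb mc h1 h2.
apply: integral_le_lincomb; try exact: measurable_energy_density.
- exact: measurable_eball.
- by move=> x _; rewrite addr_ge0 ?powR_ge0.
- by move=> x _; rewrite addr_ge0 ?powR_ge0.
- by move=> x _; rewrite addr_ge0 ?powR_ge0.
- exact: powR_ge0.
- exact: powR_ge0.
move=> x _.
have A (s t r : R) : 0 <= s -> 0 <= t -> 0 <= r -> r <= s + t ->
    r `^ p <= (1 - m) `^ (1 - p) * s `^ p + m `^ (1 - p) * t `^ p.
  by move=> s0 t0 r0 rst; apply: le_trans (powR_split p1 s0 t0 m01); exact: powR_ge_le (ltW p0) r0 rst.
have H1 := A _ _ _ (enorm_ge0 _) (enorm_ge0 _) (enorm_ge0 _) (h2 x).
have H2 := A _ _ _ (normr_ge0 _) (normr_ge0 _) (normr_ge0 _) (h1 x).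
by rewrite !mulrDr; move: H1 H2; clear -R n rho p rho0 p1 p0; lra.
Qed.

Lemma surf_integral_ge0 (F : 'rV[R]_N -> R) : measurable_fun bd F -> (forall x, 0 <= F x) ->
  (0 <= \int[surf]_(x in bd) (F x)%:E)%E.
Proof.
move=> mF F0; rewrite integral_sphere//; apply: mule_ge0.
  by rewrite lee_fin divr_ge0// ltW.
by apply: integral_ge0 => x _; rewrite lee_fin.
Qed.

Lemma surf_split (f g h : 'rV[R]_N -> R) (m : R) : 0 < m < 1 ->
  measurable_fun bd f -> measurable_fun bd g -> measurable_fun bd h ->
  (forall x, `|h x| <= `|f x| + `|g x|) ->
  (\int[surf]_(x in bd) (`|h x| `^ p)%:E <=
   ((1 - m) `^ (1 - p))%:E * \int[surf]_(x in bd) (`|f x| `^ p)%:E +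
   (m `^ (1 - p))%:E * \int[surf]_(x in bd) (`|g x| `^ p)%:E)%E.
Proof.
move=> m01 mf mg mh h1; apply: sphere_integral_le_lincomb => //; try exact: measurable_powR_normr.
- exact: powR_ge0.
- exact: powR_ge0.
move=> x _; apply: le_trans (powR_split p1 _ _ m01) => //.
exact: powR_ge_le (ltW p0) (normr_ge0 _) (h1 x).
Qed.

Lemma ereal_cvg0_lt (f : nat -> \bar R) (e : R) : 0 < e -> f k @[k --> \oo] --> 0%E ->
  \forall k \near \oo, (f k < e%:E)%E.
Proof.
move=> e0 h; apply: (h [set y | (y < e%:E)%E]); apply: open_nbhs_nbhs; split.
  exact: open_ereal_lt_ereal.
by rewrite /= lte_fin.
Qed.

Lemma powR_near1 (q e a : R) : 0 < e -> 0 <= a ->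
  exists2 m, 0 < m < 1 & (1 - m) `^ q * a <= a + e.
Proof.
move=> e0 a0; have [C C0 HC] := powR_quadratic q.
pose K := (`|q| + C) * a + 1.
have K0 : 0 < K by rewrite ltr_wpDl// mulr_ge0// addr_ge0.
pose m := Num.min 2^-1 (e / K).
have m0 : 0 < m by rewrite lt_min invr_gt0 ltr0n/= divr_gt0.
have m2 : m <= 2^-1 by rewrite ge_min lexx.
have mK : m * K <= e by rewrite -ler_pdivlMr// ge_min lexx orbT.
exists m; first by rewrite m0/=; lra.
have := HC (- m); rewrite normrN gtr0_norm// => /(_ m2).
rewrite ler_norml => /andP[_ h].
have q1 : - q <= `|q| by rewrite -normrN ler_norm.
have m22 : m ^+ 2 <= m by rewrite expr2 ler_piMl ?(ltW m0)//; lra.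
have h2 : (1 - m) `^ q <= 1 + (`|q| + C) * m.
  have : - q * m <= `|q| * m by rewrite ler_wpM2r// ltW.
  have : C * (- m) ^+ 2 <= C * m by rewrite sqrrN ler_wpM2l.
  lra.
apply: (le_trans (ler_wpM2r a0 h2)).
have : (`|q| + C) * m * a <= m * K.
  by rewrite /K mulrDr mulr1 -mulrA mulrCA -subr_ge0; lra.
lra.
Qed.

Lemma lee_lincomb (a b c d : R) (x y : \bar R) : 0 <= a -> 0 <= b ->
  (x <= c%:E)%E -> (y <= d%:E)%E -> (a%:E * x + b%:E * y <= (a * c + b * d)%:E)%E.
Proof.
by move=> a0 b0 xc yd; rewrite EFinD !EFinM; apply: leeD; apply: lee_wpmul2l; rewrite ?lee_fin.
Qed.

(** Membership in [W1pA] and the trace are witnessed by unrelated sequences: the [phi] vanish on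
    [A], the [psi] approximate [tr] on the boundary. The trace inequality for [psi k - phi k] shows
    that the [phi] approximate [tr] as well, and the bound for smooth functions passes to the
    limit. *)
Theorem trace_lower_bound (A : set 'rV[R]_N) (L : R) : 0 <= L ->
  (forall u : 'rV[R]_N -> R, smooth u -> (forall x, A x -> u x = 0) ->
    (L%:E * \int[surf]_(x in bd) (`|u x| `^ p)%:E <= en (u, grad u))%E) ->
  forall w tr, W1pA p ball A w -> is_trace p ball surf w tr ->
  (L%:E * \int[surf]_(x in bd) (`|tr x| `^ p)%:E <= en w)%E.
Proof.
move=> L0 HL w tr [[mw1 mw2 wfin _] [phi phiA phiw]] [mtr trfin [psi [spsi psiw psitr]]].
have mw : pair_measurable w by [].
have [C C0 HC] := trace_inequality n rho0 p1.
have half1 : (2^-1 : R) < 1 by rewrite invf_lt1 ?ltr1n.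
have half : 0 < (2^-1 : R) < 1 by apply/andP; split; [rewrite invr_gt0|exact: half1].
pose c := Num.max ((1 - 2^-1) `^ (1 - p)) (2^-1 `^ (1 - p)) : R.
have c0 : 0 <= c by rewrite le_max powR_ge0.
apply/lee_addgt0Pr => e e0.
have wE : en w = (fine (en w))%:E by rewrite fineK// ge0_fin_numE ?energy_ge0.
set a := fine (en w) in wE.
have a0 : 0 <= a by rewrite -lee_fin -wE energy_ge0.
have e20 : 0 < e / 2 by rewrite divr_gt0.
(* The factor [(1 - m)^(1 - p)] is lost twice, once in the energy and once on the boundary; hence
   the doubled exponent. *)
have [m m01 Hm] := powR_near1 ((1 - p) * 2) e20 a0.
pose Am := (1 - m) `^ (1 - p); pose Bm := m `^ (1 - p).
have Am0 : 0 <= Am by exact: powR_ge0.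
have Bm0 : 0 <= Bm by exact: powR_ge0.
(* Apart from the 1 that makes it positive, [K] is the coefficient of [d] in the final estimate, so
   that [d * K = e / 2] pays for all approximation errors. *)
pose K := Am * Bm + L * Bm * (c + c * (C * (c + c))) + 1.
have K0 : 0 < K by rewrite ltr_wpDl// addr_ge0// ?mulr_ge0// !(addr_ge0, mulr_ge0).
pose d := e / 2 / K; have d0 : 0 < d by rewrite divr_gt0.
have h1 := ereal_cvg0_lt d0 phiw; have h2 := ereal_cvg0_lt d0 psiw; have h3 := ereal_cvg0_lt d0 psitr.
pose dif (u : 'rV[R]_N -> R) : sobolev_pair R N := (fun x => u x - w.1 x, fun x => grad u x - w.2 x).
have [k [{}h1 {}h2 {}h3]] : exists k, [/\ (en (dif (phi k)) < d%:E)%E,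
   (en (dif (psi k)) < d%:E)%E &
   (\int[surf]_(x in bd) (`|psi k x - tr x| `^ p)%:E < d%:E)%E].
  have [k _ H] := filterI h1 (filterI h2 h3).
  by exists k; have [a1 [a2 a3]] := H k (leqnn k); split; [exact: a1|exact: a2|exact: a3].
have [sphi phi0] := phiA k.
have sp := spsi k.
have mphi := smooth_pair_measurable sphi; have mpsi := smooth_pair_measurable sp.
have sb (u : 'rV[R]_N -> R) : smooth u -> measurable_fun bd u.
  by move=> su; exact: measurable_smooth.
have E1 : (en (phi k, grad (phi k)) <= (Am * a + Bm * d)%:E)%E.
  apply: le_trans (energy_split m01 mw (pair_measurableB mphi mw) mphi _ _) _.
  - by move=> x /=; rewrite -{1}(subrK (w.1 x) (phi k x)) addrC ler_normD.
  - by move=> x /=; rewrite -{1}(subrK (w.2 x) (grad (phi k) x)) addrC enormD.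
  by apply: lee_lincomb Am0 Bm0 _ (ltW h1); rewrite wE.
have cA (x y : \bar R) b b' : (0 <= x)%E -> (0 <= y)%E -> (x <= b%:E)%E -> (y <= b'%:E)%E ->
   (((1 - 2^-1) `^ (1 - p))%:E * x + (2^-1 `^ (1 - p))%:E * y <= (c * (b + b'))%:E)%E.
  move=> x0 y0 xb yb; rewrite mulrDr.
  have b0 : 0 <= b by rewrite -lee_fin (le_trans x0).
  have b0' : 0 <= b' by rewrite -lee_fin (le_trans y0).
  apply: le_trans (lee_lincomb (powR_ge0 _ _) (powR_ge0 _ _) xb yb) _.
  by rewrite lee_fin lerD// ler_wpM2r// le_max lexx ?orbT.
pose dpp x := psi k x - phi k x.
have E2 : (en (dpp, grad dpp) <= (c * (d + d))%:E)%E.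
  have gE x : grad dpp x = grad (psi k) x - grad (phi k) x.
    by apply: gradB; exact: smooth_differentiable.
  apply: le_trans (energy_split half (pair_measurableB mpsi mw) (pair_measurableB mphi mw) _ _ _) _.
  - exact/smooth_pair_measurable/smoothB.
  - move=> x /=; rewrite /dpp (_ : psi k x - phi k x = (psi k x - w.1 x) - (phi k x - w.1 x)); last ring.
    exact: ler_normB.
  - move=> x /=; rewrite gE (_ : grad (psi k) x - grad (phi k) x = (grad (psi k) x - w.2 x) - (grad (phi k) x - w.2 x)).
      exact: enormB.
    by rewrite opprB addrA subrK.
  exact: cA (energy_ge0 _) (energy_ge0 _) (ltW h2) (ltW h1).
have E3 : (\int[surf]_(x in bd) (`|psi k x - phi k x| `^ p)%:E <= (C * (c * (d + d)))%:E)%E.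
  apply: le_trans (HC _ (smoothB sp sphi)) _.
  by rewrite (EFinM C) lee_wpmul2l ?lee_fin.
have i0 (f : 'rV[R]_N -> R) : measurable_fun bd f -> (0 <= \int[surf]_(x in bd) (`|f x| `^ p)%:E)%E.
  by move=> mf; apply: surf_integral_ge0 => [|x]; [exact: measurable_powR_normr|exact: powR_ge0].
have E4 : (\int[surf]_(x in bd) (`|tr x - phi k x| `^ p)%:E <= (c * (d + C * (c * (d + d))))%:E)%E.
  apply: le_trans (@surf_split (fun x => psi k x - tr x) (fun x => psi k x - phi k x) _ _ half _ _ _ _) _.
  - by apply: measurable_funB => //; exact: sb.
  - exact: sb (smoothB sp sphi).
  - by apply: measurable_funB => //; exact: sb.
  - move=> x; rewrite (_ : tr x - phi k x = (psi k x - phi k x) - (psi k x - tr x)); last ring.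
    rewrite [leRHS]addrC; exact: ler_normB.
  apply: cA (ltW h3) E3; apply: i0.
    by apply: measurable_funB => //; exact: sb.
  exact: sb (smoothB sp sphi).
have E5 : (L%:E * \int[surf]_(x in bd) (`|phi k x| `^ p)%:E <= (Am * a + Bm * d)%:E)%E.
  exact: le_trans (HL _ sphi phi0) E1.
have E6 : (\int[surf]_(x in bd) (`|tr x| `^ p)%:E <=
    Am%:E * \int[surf]_(x in bd) (`|phi k x| `^ p)%:E +
    Bm%:E * \int[surf]_(x in bd) (`|tr x - phi k x| `^ p)%:E)%E.
  apply: (@surf_split (phi k) (fun x => tr x - phi k x) tr m m01 (sb _ sphi) _ mtr).
    exact: (measurable_funB mtr (sb _ sphi)).
  by move=> x; rewrite -{1}(subrK (phi k x) (tr x)) addrC ler_normD.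
have L0' : (0 <= L%:E)%E by rewrite lee_fin.
have := i0 _ (sb _ sphi); have := i0 _ (measurable_funB mtr (sb _ sphi)).
move: E6 E5 E4.
set X := (\int[surf]_(x in bd) (`|phi k x| `^ p)%:E)%E.
set Y := (\int[surf]_(x in bd) (`|tr x - phi k x| `^ p)%:E)%E.
set T := (\int[surf]_(x in bd) (`|tr x| `^ p)%:E)%E.
move=> E6 E5 E4 Y0 X0.
apply: (@le_trans _ _ (Am%:E * (Am * a + Bm * d)%:E + (L%:E * Bm%:E) * (c * (d + C * (c * (d + d))))%:E)%E).
  apply: (@le_trans _ _ (L%:E * (Am%:E * X + Bm%:E * Y))%E).
    exact: lee_wpmul2l.
  rewrite ge0_muleDr; last 2 first.
  - by apply: mule_ge0; [rewrite lee_fin; exact: Am0|exact: X0].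
  - by apply: mule_ge0; [rewrite lee_fin; exact: Bm0|exact: Y0].
  rewrite (muleCA L%:E Am%:E) (muleA L%:E Bm%:E).
  rewrite -!EFinM -!EFinD; exact: lee_lincomb Am0 (mulr_ge0 L0 Bm0) E5 E4.
rewrite wE -!EFinM -!EFinD lee_fin.
have AA : Am * Am = (1 - m) `^ ((1 - p) * 2).
  by rewrite powRrM powR_mulrn ?powR_ge0// expr2.
have dK : d * K = e / 2 by rewrite /d divfK// gt_eqF.
have : Am * (Am * a + Bm * d) + L * Bm * (c * (d + C * (c * (d + d)))) = Am * Am * a + (d * K - d).
  by rewrite /K; ring.
move=> ->; rewrite AA dK; lra.
Qed.

End closure.

Section steklov_lower.
Context (R : realType) (n : nat) (rho p : R) (rho0 : 0 < rho) (p1 : 1 < p).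
Local Notation N := n.+1.
Local Notation leb := (lebesgue_rV R N).
Local Notation ball := (eball N rho : set 'rV[R]_N).
Local Notation bd := (bdry (eball N rho) : set 'rV[R]_N).
Local Notation surf := (sphere_measure N rho : set 'rV[R]_N -> \bar R).
Local Notation en := (@energy R N p ball).
Local Notation area := (@sphere_area R n rho).

Lemma grad_cst (c : R) (x : 'rV[R]_N) : grad (fun _ : 'rV[R]_N => c) x = 0.
Proof. by apply/rowP => i; rewrite !mxE derive_cst. Qed.

(** Admissible pairs lie outside [W1p0], hence have positive energy; this settles the quotients
    whose boundary integral is 0. *)
Lemma energy_eq0_W1p0 (w : sobolev_pair R N) : W1p p ball w -> en w = 0%E -> W1p0 p ball w.
Proof.
move=> Ww w0; split => //; exists (fun _ _ => 0).
  move=> k; split; first exact: smooth_cst.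
    rewrite /supp (_ : [set _ | _] = set0) ?closure0; first exact: compact0.
    by rewrite -subset0 => x /=; rewrite eqxx.
  by rewrite /supp (_ : [set _ | _] = set0) ?closure0// -subset0 => x /=; rewrite eqxx.
rewrite /W1p_cvg (_ : (fun _ => _) = cst 0%E); first exact: cvg_cst.
apply/funext => k; rewrite -w0; apply: eq_integral => x _ /=.
by rewrite grad_cst !sub0r enormN normrN.
Qed.

(** The tangent of [y^k] at [M] lies below the graph. The case [k = 1], that is [q = p], falls
    outside Young's inequality. *)
Lemma powR_tangent (k a M : R) : 1 <= k -> 0 <= a -> 0 <= M ->
  k * (a * M `^ (k - 1)) <= a `^ k + (k - 1) * M `^ k.
Proof.
rewrite le_eqVlt => /predU1P[<- a0 M0|k1 a0 M0]; last exact: young_ge.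
by rewrite subrr powRr0 mul0r addr0 mulr1 mul1r powRr1.
Qed.

(** Jensen's inequality for the exponent [k = p / q >= 1], by integrating the tangent inequality at
    height [M]; the best [M] is the mean [Q / area]. When the integral of [|tr|^p] is infinite,
    [Q = 0] is a dummy value. *)
Lemma surf_jensen (q : R) (tr : 'rV[R]_N -> R) : 0 < q -> q <= p -> measurable_fun bd tr ->
  exists Q : R, [/\ 0 <= Q, (\int[surf]_(x in bd) (`|tr x| `^ p)%:E < +oo)%E ->
   (\int[surf]_(x in bd) (`|tr x| `^ q)%:E = Q%:E)%E &
   ((area `^ (1 - p / q) * Q `^ (p / q))%:E <= \int[surf]_(x in bd) (`|tr x| `^ p)%:E)%E].
Proof.
move=> q0 qp mtr.
pose k := p / q.
have k1 : 1 <= k by rewrite ler_pdivlMr// mul1r.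
have k0 : 0 < k by exact: lt_le_trans k1.
have A0 := @sphere_area_gt0 R n rho rho0.
have mq s : measurable_fun bd (fun x => `|tr x| `^ s) by exact: measurable_powR_normr.
set T := (\int[surf]_(x in bd) (`|tr x| `^ p)%:E)%E.
have T0 : (0 <= T)%E by apply: surf_integral_ge0 => // x; exact: powR_ge0.
have Q0 : (0 <= \int[surf]_(x in bd) (`|tr x| `^ q)%:E)%E.
  by apply: surf_integral_ge0 => // x; exact: powR_ge0.
have [Too|] := ltP T +oo%E; last first.
  rewrite leye_eq => /eqP ToE; exists 0; rewrite ToE; split => //.
  exact: leey.
have TE : T = (fine T)%:E by rewrite fineK// ge0_fin_numE.
have tang M : 0 < M -> (\int[surf]_(x in bd) (`|tr x| `^ q)%:E <=
    ((k * M `^ (k - 1))^-1 * fine T + ((k - 1) * M `^ k / (k * M `^ (k - 1))) * area)%:E)%E.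
  move=> M0; have Mk : 0 < k * M `^ (k - 1) by rewrite mulr_gt0// powR_gt0.
  have := @sphere_integral_le_lincomb R n rho rho0 (fun x => `|tr x| `^ q) (fun x => `|tr x| `^ p)
     (fun _ => 1) (k * M `^ (k - 1))^-1 ((k - 1) * M `^ k / (k * M `^ (k - 1))).
  rewrite (integral_sphere_cst n rho0 ler01) mul1r -/T TE -!EFinM -EFinD; apply.
  - exact: mq.
  - exact: measurable_cst.
  - exact: mq.
  - by move=> x; exact: powR_ge0.
  - by move=> x; exact: powR_ge0.
  - by [].
  - by rewrite invr_ge0 ltW.
  - by rewrite divr_ge0 ?(ltW Mk)// mulr_ge0 ?powR_ge0// subr_ge0.
  move=> x _; rewrite mulr1 [X in X + _]mulrC -mulrDl ler_pdivlMr//.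
  have := powR_tangent k1 (powR_ge0 `|tr x| q) (ltW M0).
  by rewrite -powRrM (_ : q * k = p) ?[q * k]mulrC ?divfK ?gt_eqF// mulrCA.
(* The tangent at 1 already gives finiteness, before [Q] and its mean can be named. *)
have Qfin : (\int[surf]_(x in bd) (`|tr x| `^ q)%:E < +oo)%E by apply: le_lt_trans (tang 1 ltr01) (ltry _).
have QE : (\int[surf]_(x in bd) (`|tr x| `^ q)%:E)%E = (fine (\int[surf]_(x in bd) (`|tr x| `^ q)%:E))%:E%E.
  by rewrite fineK// ge0_fin_numE.
set Q := fine _ in QE; exists Q; split => //.
  by rewrite -lee_fin -QE.
rewrite TE lee_fin.
have : 0 <= Q by rewrite -lee_fin -QE.
rewrite le_eqVlt => /predU1P[<-|Qp].
  by rewrite powR0 ?mulr0 ?gt_eqF// -lee_fin -TE.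
pose M := Q / area; have M0 : 0 < M by rewrite divr_gt0.
have Mk : 0 < M `^ (k - 1) by rewrite powR_gt0.
have := tang M M0; rewrite QE lee_fin.
have MM : M `^ k = M * M `^ (k - 1) by rewrite -{2}(powRr1 (ltW M0)) -powRD ?gt_eqF// ?implybT// addrC subrK.
have -> : (k * M `^ (k - 1))^-1 * fine T + (k - 1) * M `^ k / (k * M `^ (k - 1)) * area =
   (fine T / M `^ (k - 1) + (k - 1) * Q) / k.
  by rewrite MM /M; field; rewrite !gt_eqF.
rewrite ler_pdivlMr// => H.
have {}H : Q * M `^ (k - 1) <= fine T by rewrite -ler_pdivlMr//; lra.
apply: le_trans H; rewrite -/k.
rewrite le_eqVlt; apply/orP; left; apply/eqP.
have aK : M `^ (k - 1) * area `^ (k - 1) = Q `^ (k - 1).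
  by rewrite -(@powRM _ M area) ?(ltW M0) ?(ltW A0)// /M divfK// gt_eqF.
have QQ : Q `^ k = Q * Q `^ (k - 1) by rewrite -{2}(powRr1 (ltW Qp)) -powRD ?gt_eqF// ?implybT// addrC subrK.
have ak : 0 < area `^ (k - 1) by rewrite powR_gt0.
rewrite (_ : 1 - k = - (k - 1)); last by rewrite opprB.
by rewrite powRN QQ -aK; field; rewrite gt_eqF.
Qed.

Theorem steklov_lower_bound (q : R) (A : set 'rV[R]_N) (L : R) : 0 < q -> q <= p -> 0 <= L ->
  (forall u : 'rV[R]_N -> R, smooth u -> (forall x, A x -> u x = 0) ->
    (L%:E * \int[surf]_(x in bd) (`|u x| `^ p)%:E <= en (u, grad u))%E) ->
  ((L * area `^ (1 - p / q))%:E <= steklov p ball q surf A)%E.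
Proof.
move=> q0 qp L0 HL; apply/ereal_infP => _ [w [tr [wA nw0 trw ->]]].
have H := trace_lower_bound rho0 p1 L0 HL wA trw.
have k0 : 0 < p / q by rewrite divr_gt0// (lt_trans ltr01).
have [mtr Tfin _] := trw.
have [Q [Q0 /(_ Tfin) QE QT]] := surf_jensen q0 qp mtr.
rewrite QE poweR_EFin.
(* For [Q = 0] the quotient is [+oo], the extended inverse of 0 being [+oo], because the energy is
   positive. *)
move: Q0; rewrite le_eqVlt => /predU1P[<-|Qp].
  rewrite powR0 ?gt_eqF// inve0 gt0_muley ?leey//.
  rewrite lt_neqAle energy_ge0 andbT; apply/eqP => E0; apply: nw0.
  by apply: energy_eq0_W1p0 => //; case: wA.
have Qk : 0 < Q `^ (p / q) by rewrite powR_gt0.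
rewrite inver gt_eqF// lee_pdivlMr//.
apply: le_trans H; apply: le_trans (lee_wpmul2l _ QT); last by rewrite lee_fin.
by rewrite -!EFinM mulrA.
Qed.

End steklov_lower.

(** * A Poincare inequality on the sphere *)

Lemma lebesgue_rV_set1 (R : realType) m (b : 'rV[R]_m.+1) : lebesgue_rV R m.+1 [set b] = 0%E.
Proof.
have := @integral_affine_rV R m.+1 1 b (fun z : 'rV[R]_m.+1 => (\1_[set b] z)%:E) ltr01.
have E (c : 'rV[R]_m.+1) : (\int[lebesgue_rV R m.+1]_x (\1_[set c] x)%:E)%E = lebesgue_rV R m.+1 [set c].
  by rewrite integral_indic ?setIT//; exact: measurable_set1_rV.
rewrite E invr1 expr1n mul1e => <-; first last.
- by move=> z; rewrite lee_fin.
- apply/measurable_EFinP; apply: measurable_indic; exact: measurable_set1_rV.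
rewrite (_ : (fun _ => _) = (fun z : 'rV[R]_m.+1 => (\1_[set (0 : 'rV[R]_m.+1)%R] z)%:E)).
  by rewrite E; exact: lebesgue_rV_set0.
apply/funext => z; rewrite !indicE scale1r; congr (_ %:R %:E); congr nat_of_bool.
by apply/idP/idP => /set_mem/= h; apply/mem_set => /=; [rewrite -(addrK b z) h subrr|rewrite h add0r].
Qed.

Section parallel.
Context (R : realType) (n : nat).
Local Notation N := n.+1.
Local Notation leb := (lebesgue_rV R N).
Implicit Types x y z : 'rV[R]_N.

(** Equality in the Cauchy-Schwarz inequality. For [y] outside this set the line through [x] and [y]
    avoids the origin, so the chord can be projected to a sphere. *)
Definition parallel x : set 'rV[R]_N := [set y | `|dot x y| = enorm x * enorm y].

Lemma measurable_parallel x : measurable (parallel x).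
Proof.
pose f y := `|dot x y| - enorm x * enorm y.
rewrite (_ : parallel x = f @^-1` [set 0]).
  rewrite -[X in measurable X]setTI.
  have mf : measurable_fun setT f.
    apply: continuous_measurable_rV.
    rewrite (_ : f = ((fun r : R => `|r|) \o dot x) \- (fun y => enorm x * enorm y)); last first.
      by apply/funext.
    move=> y; apply: continuousB; first apply: continuous_comp.
    - have h : continuous (fun t : 'rV[R]_N => dot x t).
        by apply: continuous_dot => t; [exact: cst_continuous|exact: cvg_id].
      exact: h.
    - exact: norm_continuous.
    - by apply: (@continuousM _ _ (fun _ => enorm x)); [exact: cst_continuous|exact: continuous_enorm].
  by apply: mf => //; exact: measurable_set1.
apply/seteqP; split => y; rewrite /parallel /f /=; first by move=> ->; rewrite subrr.
by move/eqP; rewrite subr_eq0 => /eqP.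
Qed.

Lemma parallelP x y : x != 0 -> parallel x y -> y = (dot x y / dot x x) *: x.
Proof.
move=> x0 xy; have xx : 0 < dot x x by rewrite -enorm2 exprn_gt0// enorm_gt0.
apply/eqP; rewrite -subr_eq0 -enorm_eq0 -sqrf_eq0 enorm2 -(scaleNr _ x).
rewrite dotDl !dotDr dotZl !dotZr dotZl (dotC y x).
have h : dot x y ^+ 2 = dot x x * dot y y.
  by rewrite -(real_normK (num_real (dot x y))) xy exprMn !enorm2.
have -> : dot y y + - (dot x y / dot x x) * dot x y +
  (- (dot x y / dot x x) * dot x y + - (dot x y / dot x x) * (- (dot x y / dot x x) * dot x x))
  = (dot x x * dot y y - dot x y ^+ 2) / dot x x by field; rewrite gt_eqF.
by rewrite h subrr mul0r.
Qed.

Lemma segment_neq0 x y (s : R) : x != 0 -> ~ parallel x y -> x + s *: (y - x) != 0.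
Proof.
move=> x0 nxy; apply/eqP => h; apply: nxy.
have sy : s *: y = (s - 1) *: x.
  have -> : s *: y = s *: (y - x) + s *: x by rewrite -scalerDr subrK.
  by rewrite -(addr0_eq h) scalerBl scale1r addrC.
have s0 : s != 0.
  apply/eqP => s0; move: sy; rewrite s0 scale0r sub0r scaleN1r => /eqP.
  by rewrite eq_sym oppr_eq0 (negbTE x0).
have -> : y = ((s - 1) / s) *: x.
  by rewrite mulrC -scalerA -sy scalerA mulVf// scale1r.
by rewrite /parallel/= dotZr enormZ normrM -enorm2 [X in _ * X](ger0_norm (sqr_ge0 _)); ring.
Qed.

End parallel.

(** A line is null in dimension at least 2: a slice with nonzero first coordinate meets it in at
    most one point, which is null in the remaining [m + 1] dimensions. *)
Lemma lebesgue_parallel (R : realType) (m : nat) (x : 'rV[R]_m.+2) : x != 0 ->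
  lebesgue_rV R m.+2 (parallel x) = 0%E.
Proof.
move=> x0.
rewrite -[LHS]mul1e -integral_cst; last exact: measurable_parallel.
have mI : measurable_fun setT ((cst 1%E) \_ (parallel x) : 'rV[R]_m.+2 -> \bar R).
  by apply/(measurable_restrictT _ (measurable_parallel x)).
have I0 y : (0 <= ((cst 1%E) \_ (parallel x) : 'rV[R]_m.+2 -> \bar R) y)%E.
  by rewrite patchE; case: ifP.
rewrite integral_mkcond integral_rV_S//.
rewrite (_ : (fun a => _) = (fun a => \int[lebesgue_rV R m.+1]_y
   ((cst 1%E) \_ (parallel x)) (rV_cons (a, y)))%E \_ [set 0]).
  by rewrite -integral_mkcond integral_set1.
apply/funext => a; rewrite patchE; case: ifPn => // /negP a0'.
have a0 : a != 0 by apply/eqP => a0; apply: a0'; rewrite inE.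
pose b : 'rV[R]_m.+1 := \row_i (a / x ord0 ord0 * x ord0 (lift ord0 i)).
have H y : parallel x (rV_cons (a, y)) -> y = b.
  move=> /(parallelP x0); set c := (_ / _) => h.
  have ha : a = c * x ord0 ord0.
    by have := congr1 (fun z : 'rV[R]_m.+2 => z ord0 ord0) h; rewrite !mxE unlift_none.
  have xx : x ord0 ord0 != 0 by apply: contra_neq a0 => xE; rewrite ha xE mulr0.
  apply/rowP => i; have := congr1 (fun z : 'rV[R]_m.+2 => z ord0 (lift ord0 i)) h.
  by rewrite !mxE liftK /= => ->; rewrite ha mulfK.
apply/eqP; rewrite eq_le; apply/andP; split; last exact: integral_ge0.
apply: (@le_trans _ _ (lebesgue_rV R m.+1 [set b])); last first.
  by have -> := lebesgue_rV_set1 b.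
rewrite -[X in (_ <= X)%E]mul1e -integral_cst; last exact: measurable_set1_rV.
rewrite [X in (_ <= X)%E]integral_mkcond; apply: ge0_le_integral => //.
- apply: (measurableT_comp mI); apply: (measurableT_comp (@measurable_rV_cons R m.+1)).
  exact: measurable_pair1.
- by apply/(measurable_restrictT _ (measurable_set1_rV b)).
move=> y _; rewrite !patchE; case: ifPn => [/set_mem/H/= ->|_]; last by case: ifP.
by rewrite ifT// inE.
Qed.

(** * Averages along chords of the ball *)

Section poincare.
Context (R : realType) (n : nat) (rho : R) (rho0 : 0 < rho).
Local Notation N := n.+1.
Local Notation leb := (lebesgue_rV R N).
Local Notation D := (@punctured_ball R n rho).
Local Notation rV := ('rV[R]_N).

(* For s <= 1/2 the map x |-> x + s (y - x) contracts volumes by at most 2^N, for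
   s >= 1/2 the map y |-> x + s (y - x) does. *)
Lemma segment_average (G : rV -> R) (s : R) : measurable_fun setT G -> (forall x, 0 <= G x) ->
  0 <= s <= 1 ->
  (\int[leb]_(x in D) \int[leb]_(y in D) (G (x + s *: (y - x)))%:E <=
   (2 ^+ N)%:E * leb D * \int[leb]_z (G z)%:E)%E.
Proof.
move=> mG G0 /andP[s0 s1].
have mD := @measurable_punctured_ball R n rho.
have mGs : measurable_fun setT (fun p : rV * rV => G (p.1 + s *: (p.2 - p.1))).
  apply: (measurableT_comp mG).
  rewrite (_ : (fun _ => _) = (fun p : rV * rV => (1 - s) *: p.1 + s *: p.2)); last first.
    by apply/funext => p; rewrite scalerBr scalerBl scale1r addrAC addrA.
  by apply: measurable_fun_add_rV; apply: measurable_fun_scale_rV.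
have key (c : R) (b : rV) : 2^-1 <= c -> (\int[leb]_(x in D) (G (c *: x + b))%:E <=
    (2 ^+ N)%:E * \int[leb]_z (G z)%:E)%E.
  move=> c2; have c0 : 0 < c by apply: lt_le_trans c2; rewrite invr_gt0.
  apply: (@le_trans _ _ (\int[leb]_x (G (c *: x + b))%:E)%E).
    apply: ge0_subset_integral => //.
    - apply/measurable_EFinP; apply: (measurableT_comp mG).
      by apply: measurable_fun_add_rV => //; exact: measurable_fun_scale_rV.
    - by move=> x _; rewrite lee_fin.
  rewrite (@integral_affine_rV R N c b (fun z => (G z)%:E))//; last 1 first.
  - exact/measurable_EFinP.
  apply: lee_wpmul2r; first by apply: integral_ge0 => z _; rewrite lee_fin.
  rewrite lee_fin lerXn2r ?nnegrE ?invr_ge0 ?(ltW c0)//.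
  by rewrite -[leRHS]invrK lef_pV2 ?posrE// invr_gt0.
have const (F : rV -> \bar R) (K : \bar R) : measurable_fun setT F -> (forall x, 0 <= F x)%E ->
    (0 <= K)%E -> (forall x, D x -> F x <= K)%E -> (\int[leb]_(x in D) F x <= K * leb D)%E.
  move=> mF F0 K0 FK; rewrite -integral_cst//; apply: ge0_le_integral => //.
  exact: measurable_funTS.
have K0 : (0 <= (2 ^+ N)%:E * \int[leb]_z (G z)%:E)%E.
  by apply: mule_ge0; [rewrite lee_fin exprn_ge0|apply: integral_ge0 => z _; rewrite lee_fin].
rewrite muleAC.
have [s2|s2] := leP s 2^-1.
  rewrite (@tonelli_on _ _ _ _ R leb leb (fun p => (G (p.1 + s *: (p.2 - p.1)))%:E) D D)//; last 2 first.
  - exact/measurable_EFinP.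
  - by move=> x y _ _; rewrite lee_fin.
  apply: const => //.
  - refine (@measurable_integral_param _ _ _ _ R leb (fun p : rV * rV => (G (p.2 + s *: (p.1 - p.2)))%:E) D _ _ _) => //.
    apply/measurable_EFinP; exact: (measurableT_comp mGs (@measurable_swap _ _ rV rV)).
    by move=> p _; rewrite lee_fin.
  - by move=> y; apply: integral_ge0 => x _; rewrite lee_fin.
  move=> y _; rewrite (_ : (fun x => _) = (fun x => (G ((1 - s) *: x + s *: y))%:E)); last first.
    by apply/funext => x; rewrite /= scalerBr scalerBl scale1r addrAC addrA.
  by apply: key; lra.
apply: const => //.
- refine (@measurable_integral_param _ _ _ _ R leb (fun p : rV * rV => (G (p.1 + s *: (p.2 - p.1)))%:E) D _ _ _) => //.
    exact/measurable_EFinP.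
  by move=> p _; rewrite lee_fin.
- by move=> y; apply: integral_ge0 => x _; rewrite lee_fin.
move=> x _; rewrite (_ : (fun y => _) = (fun y => (G (s *: y + (1 - s) *: x))%:E)); last first.
  by apply/funext => y; rewrite /= scalerBr scalerBl scale1r addrCA.
by apply: key; exact: ltW.
Qed.

(** In polar coordinates the factor [1 / |z|] costs one power of [s], which [s ^+ n] supplies as
    [n >= 1]. *)
Lemma homogeneous_average (T : rV -> R) : (1 <= n)%N -> measurable_fun setT T -> (forall x, 0 <= T x) ->
  (forall x s, x != 0 -> 0 < s -> T (ray x s) = T x) ->
  (\int[leb]_z (\1_D z * ((enorm z)^-1 * T z))%:E <= (N%:R / rho)%:E * \int[leb]_(x in D) (T x)%:E)%E.
Proof.
move=> n1 mT T0 hT.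
have mD := @measurable_punctured_ball R n rho.
rewrite (polar_coordinates rho0); last 2 first.
- apply: measurable_funM; first exact: measurable_indic.
  apply: measurable_funM => //.
  by apply: (measurableT_comp (@measurable_invr R)); exact: measurable_enorm.
- by move=> x; rewrite !mulr_ge0// invr_ge0 enorm_ge0.
have -> : ((N%:R / rho)%:E = (N%:R / rho ^+ N)%:E * (rho ^+ n)%:E)%E.
  by rewrite -EFinM; congr EFin; rewrite exprS; field; rewrite ?expf_neq0 gt_eqF.
rewrite -muleA; apply: lee_wpmul2l; first by rewrite lee_fin divr_ge0// exprn_ge0// ltW.
rewrite -ge0_integralZl//; last 3 first.
- by apply/measurable_EFinP; exact: measurable_funTS.
- by move=> x _; rewrite lee_fin.
- by rewrite lee_fin exprn_ge0// ltW.
have mR : measurable_fun setT (fun p : rV * measurableTypeR R => \1_D (ray p.1 p.2) * ((enorm (ray p.1 p.2))^-1 * T (ray p.1 p.2)) * p.2 ^+ n).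
  apply: measurable_funM; last by apply: measurable_funX; exact: measurable_snd.
  apply: (measurableT_comp _ (@measurable_ray2 R n) (f := fun z => \1_D z * ((enorm z)^-1 * T z))).
  apply: measurable_funM; first exact: measurable_indic.
  apply: measurable_funM => //.
  by apply: (measurableT_comp (@measurable_invr R)); exact: measurable_enorm.
apply: ge0_le_integral => //.
- move=> x Dx; apply: integral_ge0 => s; rewrite /= in_itv/= andbT => s0.
  by rewrite lee_fin !mulr_ge0// ?invr_ge0 ?enorm_ge0// exprn_ge0// ltW.
- apply: measurable_funTS.
  refine (@measurable_integral_param _ _ _ _ R (@lebesgue_measure R) (fun p : rV * measurableTypeR R => (\1_D (ray p.1 p.2) * ((enorm (ray p.1 p.2))^-1 * T (ray p.1 p.2)) * p.2 ^+ n)%:E) `]0, +oo[ _ _ _) => //.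
    exact/measurable_EFinP.
  move=> p; rewrite /= in_itv/= andbT => s0.
  by rewrite lee_fin !mulr_ge0// ?invr_ge0 ?enorm_ge0// exprn_ge0// ltW.
- by apply: measurable_funeM; apply/measurable_EFinP; exact: measurable_funTS.
move=> x Dx; have x0 := punctured_ball_neq0 Dx.
apply: (@le_trans _ _ (\int[@lebesgue_measure R]_(s in `]0%R, rho]) (rho ^+ n.-1 * T x)%:E)%E).
  rewrite [leLHS]integral_mkcond [leRHS]integral_mkcond; apply: ge0_le_integral => //.
  - move=> s _; rewrite patchE; case: ifPn => //; rewrite mem_setE in_itv/= andbT => s0.
    by rewrite lee_fin !mulr_ge0// ?invr_ge0 ?enorm_ge0// exprn_ge0// ltW.
  - apply/(measurable_restrictT _ (measurable_itv `]0%R, +oo[)).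
    apply/measurable_EFinP; apply: measurable_funTS.
    exact: (measurableT_comp mR (@measurable_pair1 _ _ rV (measurableTypeR R) x)).
  - by apply/(measurable_restrictT _ (measurable_itv `]0%R, rho])); exact: measurable_cst.
  move=> s _; rewrite !patchE !mem_setE !in_itv/= andbT.
  have [s0|//] := ltP 0 s; rewrite enorm_ray ?(ltW s0)// hT// indicE.
  have -> : (ray x s \in D) = (s <= rho).
    by apply/idP/idP; rewrite inE /punctured_ball/= enorm_ray ?(ltW s0)// s0.
  case: (boolP (s <= rho)) => sr /=; last by rewrite !mul0r.
  rewrite mul1r lee_fin.
  have -> : s^-1 * T x * s ^+ n = s ^+ n.-1 * T x.
    by rewrite -{1}(prednK n1) exprS; field; rewrite gt_eqF.
  by rewrite ler_wpM2r// lerXn2r ?nnegrE ?(ltW rho0) ?(ltW s0).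
rewrite integral_cst//= lebesgue_measure_itv/= lte_fin rho0 -EFinB subr0 -!EFinM lee_fin.
by rewrite -{2}(prednK n1) exprS mulrAC (mulrC (rho ^+ _)).
Qed.

End poincare.

(** * A weighted Poincare inequality for functions of the direction *)

Section sphere_poincare.
Context (R : realType) (m : nat) (rho : R) (rho0 : 0 < rho).
Local Notation N := m.+2.
Local Notation leb := (lebesgue_rV R N).
Local Notation D := (@punctured_ball R m.+1 rho).
Local Notation rV := ('rV[R]_N).
Variables (W T g : rV -> R) (M K : R).
Hypotheses (mW : measurable_fun setT W) (W0 : forall x, 0 <= W x).
Hypotheses (mT : measurable_fun setT T) (T0 : forall x, 0 <= T x).
Hypothesis hT : forall x s, x != 0 -> 0 < s -> T (ray x s) = T x.
Hypotheses (K0 : 0 <= K) (M0 : 0 <= M).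
Hypotheses (mg : measurable_fun setT g) (gM : forall x, `|g x| <= M).
Hypothesis gint : (\int[leb]_(x in D) (M + g x)%:E = M%:E * leb D)%E.
Let G (z : rV) := \1_D z * ((enorm z)^-1 * T z).
Hypothesis HW : forall x y, D x -> D y -> ~ parallel x y ->
  ((W y)%:E <= (W x)%:E + \int[@lebesgue_measure R]_(s in `[0%R, 1%R]) (K * G (x + s *: (y - x)))%:E)%E.

Let mD := @measurable_punctured_ball R m.+1 rho.

Let mG : measurable_fun setT G.
Proof.
apply: measurable_funM; first exact: measurable_indic.
apply: measurable_funM => //.
by apply: (measurableT_comp (@measurable_invr R)); exact: measurable_enorm.
Qed.

Let G0 x : 0 <= G x. Proof. by rewrite !mulr_ge0// invr_ge0 enorm_ge0. Qed.

Let H (q : (rV * rV) * measurableTypeR R) := K * G (q.1.1 + q.2 *: (q.1.2 - q.1.1)).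

Let mH : measurable_fun setT H.
Proof.
apply: measurable_funM => //; apply: (measurableT_comp mG).
rewrite (_ : (fun _ => _) = (fun q : (rV * rV) * measurableTypeR R => (1 - q.2) *: q.1.1 + q.2 *: q.1.2)); last first.
  by apply/funext => q; rewrite scalerBr scalerBl scale1r addrAC addrA.
apply: measurable_fun_add_rV; apply: measurable_fun_scale_rV => //.
- by apply: measurable_funB => //; exact: measurable_snd.
- exact: (measurableT_comp measurable_fst measurable_fst).
- exact: (measurableT_comp measurable_snd measurable_fst).
Qed.

Let H0 q : 0 <= H q. Proof. by rewrite mulr_ge0. Qed.

Let I (x y : rV) : \bar R := (\int[@lebesgue_measure R]_(s in `[0%R, 1%R]) (H ((x, y), s))%:E)%E.

Let I0 x y : (0 <= I x y)%E.
Proof. by apply: integral_ge0 => s _; rewrite lee_fin. Qed.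

Let mI : measurable_fun setT (fun p : rV * rV => I p.1 p.2).
Proof.
refine (@measurable_integral_param _ _ _ _ R (@lebesgue_measure R) (fun q : (rV * rV) * measurableTypeR R => (H ((q.1.1, q.1.2), q.2))%:E) `[0, 1] _ _ _) => //.
  exact/measurable_EFinP.
by move=> p _; rewrite lee_fin.
Qed.

(** After swapping, each [s] in [[0, 1]] contributes an average of [G] along chords, bounded
    uniformly by [segment_average]; [homogeneous_average] then removes the factor [1 / |z|]. *)
Let double : (\int[leb]_(x in D) \int[leb]_(y in D) I x y <=
  (K * 2 ^+ N * (N%:R / rho))%:E * leb D * \int[leb]_(x in D) (T x)%:E)%E.
Proof.
have mxs : measurable_fun setT (fun p : rV * measurableTypeR R => \int[leb]_(y in D) (H ((p.1, y), p.2))%:E)%E.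
  refine (@measurable_integral_param _ _ _ _ R leb (fun q : (rV * measurableTypeR R) * rV => (H ((q.1.1, q.2), q.1.2))%:E) D _ _ _) => //.
    have mq : measurable_fun setT (fun q : (rV * measurableTypeR R) * rV => ((q.1.1, q.2), q.1.2)).
      apply/measurable_fun_pair => /=; last exact: (measurableT_comp measurable_snd measurable_fst).
      apply/measurable_fun_pair => /=; last exact: measurable_snd.
      exact: (measurableT_comp measurable_fst measurable_fst).
    by apply/measurable_EFinP; exact: (measurableT_comp mH mq).
  by move=> q _; rewrite lee_fin.
have E x : (\int[leb]_(y in D) I x y = \int[@lebesgue_measure R]_(s in `[0%R, 1%R]) \int[leb]_(y in D) (H ((x, y), s))%:E)%E.
  apply: (@tonelli_on _ _ _ _ R leb (@lebesgue_measure R) (fun q : rV * measurableTypeR R => (H ((x, q.1), q.2))%:E) D `[0, 1]) => //.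
    have mq : measurable_fun setT (fun q : rV * measurableTypeR R => ((x, q.1), q.2)).
      by apply/measurable_fun_pair => //=; apply/measurable_fun_pair.
    by apply/measurable_EFinP; exact: (measurableT_comp mH mq).
  by move=> y s _ _; rewrite lee_fin.
under eq_integral do rewrite E.
rewrite (@tonelli_on _ _ _ _ R leb (@lebesgue_measure R) (fun p : rV * measurableTypeR R => \int[leb]_(y in D) (H ((p.1, y), p.2))%:E)%E D `[0, 1])//; last first.
  by move=> x s _ _; apply: integral_ge0 => y _; rewrite lee_fin.
have mKG : measurable_fun setT (fun z => K * G z) by exact: measurable_funM.
have KG0 z : 0 <= K * G z by rewrite mulr_ge0.
pose B := ((2 ^+ N)%:E * leb D * \int[leb]_z (K * G z)%:E)%E.
have iG : (0 <= \int[leb]_z (G z)%:E)%E by apply: integral_ge0 => z _; rewrite lee_fin.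
have KE : (\int[leb]_z (K * G z)%:E = K%:E * \int[leb]_z (G z)%:E)%E.
  under eq_integral do rewrite EFinM.
  rewrite ge0_integralZl//; first exact/measurable_EFinP.
  by move=> z _; rewrite lee_fin.
have B0 : (0 <= B)%E by rewrite /B KE !mule_ge0// ?lee_fin// exprn_ge0.
apply: (@le_trans _ _ (\int[@lebesgue_measure R]_(s in `[0%R, 1%R]) B)%E).
  apply: ge0_le_integral => //.
  - by move=> s _; apply: integral_ge0 => x _; apply: integral_ge0 => y _; rewrite lee_fin.
  - apply: measurable_funTS.
    refine (@measurable_integral_param _ _ _ _ R leb (fun q : measurableTypeR R * rV => \int[leb]_(y in D) (H ((q.2, y), q.1))%:E)%E D _ _ _) => //.
      exact: (measurableT_comp mxs (@measurable_swap _ _ (measurableTypeR R) rV)).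
    by move=> q _; apply: integral_ge0 => y _; rewrite lee_fin.
  move=> s; rewrite /= in_itv/= => s01.
  exact: segment_average mKG KG0 s01.
rewrite integral_cst//= lebesgue_measure_itv/= lte_fin ltr01 -EFinB subr0 mule1 /B KE.
have := homogeneous_average rho0 (isT : (1 <= m.+1)%N) mT T0 hT => h.
have c0 : (0 <= (2 ^+ N)%:E * leb D * K%:E)%E by rewrite !mule_ge0// ?lee_fin// exprn_ge0.
rewrite muleA; apply: le_trans (lee_wpmul2l c0 h) _.
rewrite (muleC _ (leb D)) -!muleA -(muleCA (leb D)) !muleA.
rewrite le_eqVlt; apply/orP; left; apply/eqP; congr (_ * _)%E.
by rewrite -!muleA -!EFinM; congr (_ * _%:E)%E; ring.
Qed.

(** Integrate [W y <= W x + ...] over all pairs with the weight [M + g x], which is nonnegative and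
    has mean [M]. In effect the integral of [- g W] is controlled by that of [T]; adding [M] keeps
    every integrand nonnegative, so that no integrability question arises. *)
Theorem sphere_poincare : (M%:E * \int[leb]_(x in D) (W x)%:E <=
  \int[leb]_(x in D) ((M + g x) * W x)%:E +
  (2 * M * (K * 2 ^+ N * (N%:R / rho)))%:E * \int[leb]_(x in D) (T x)%:E)%E.
Proof.
have Mg x : 0 <= M + g x.
  by have := gM x; rewrite ler_norml => /andP[]; lra.
have Mg2 x : M + g x <= 2 * M.
  by have := gM x; rewrite ler_norml => /andP[]; lra.
have iW : (0 <= \int[leb]_(x in D) (W x)%:E)%E.
  by apply: integral_ge0 => x _; rewrite lee_fin.
have D0 := @lebesgue_punctured_ball_gt0 R m.+1 rho rho0.
have Doo := @lebesgue_punctured_ball_lty R m.+1 rho.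
have DE : leb D = (fine (leb D))%:E by rewrite fineK// ge0_fin_numE// ltW.
have d0 : 0 < fine (leb D) by rewrite fine_gt0// D0.
have mW' : measurable_fun D (fun x => (W x)%:E) by apply/measurable_EFinP; exact: measurable_funTS.
have mI1 : measurable_fun setT (fun x => \int[leb]_(y in D) I x y)%E.
  refine (@measurable_integral_param _ _ _ _ R leb (fun q : rV * rV => I q.1 q.2) D _ _ _) => //.
have row x : D x -> ((M + g x)%:E * \int[leb]_(y in D) (W y)%:E <=
    ((M + g x) * W x)%:E * leb D + (2 * M)%:E * \int[leb]_(y in D) I x y)%E.
  move=> Dx; have x0 := punctured_ball_neq0 Dx.
  have mIx : measurable_fun D (I x).
    apply: measurable_funTS; exact: (measurableT_comp mI (@measurable_pair1 _ _ rV rV x)).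
  have M2 : 0 <= 2 * M by rewrite mulr_ge0.
  have a0 : (0 <= ((M + g x) * W x)%:E)%E by rewrite lee_fin mulr_ge0.
  have b0 y : (0 <= (2 * M)%:E * I x y)%E by apply: mule_ge0; rewrite ?lee_fin.
  have mb : measurable_fun D (fun y => (2 * M)%:E * I x y)%E by exact: measurable_funeM.
  have -> : ((M + g x)%:E * \int[leb]_(y in D) (W y)%:E = \int[leb]_(y in D) ((M + g x)%:E * (W y)%:E))%E.
    by rewrite ge0_integralZl// ?lee_fin// => y _; rewrite lee_fin.
  have -> : (((M + g x) * W x)%:E * leb D + (2 * M)%:E * \int[leb]_(y in D) I x y =
     \int[leb]_(y in D) (((M + g x) * W x)%:E + (2 * M)%:E * I x y))%E.
    rewrite [RHS]ge0_integralD//.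
    rewrite integral_cst//; congr (_ + _)%E.
    by rewrite ge0_integralZl// lee_fin.
  apply: ae_ge0_le_integral => //.
  - by move=> y _; rewrite -EFinM lee_fin mulr_ge0.
  - by apply: measurable_funeM.
  - by move=> y _; apply: adde_ge0.
  - by apply: emeasurable_funD => //; exact: measurable_cst.
  (* Chords that may pass through the origin end in this null set. *)
  exists (parallel x); split.
  - exact: measurable_parallel.
  - exact: lebesgue_parallel.
  move=> y /= /not_implyP[Dy]; apply: contra_notP => nxy.
  apply: (@le_trans _ _ ((M + g x)%:E * ((W x)%:E + I x y))%E).
    by apply: lee_wpmul2l; [rewrite lee_fin|exact: HW].
  rewrite ge0_muleDr//; last by rewrite lee_fin.
  rewrite -EFinM leeD2l//; apply: lee_wpmul2r => //; by rewrite lee_fin.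
have mgW : measurable_fun D (fun x => ((M + g x) * W x)%:E).
  by apply/measurable_EFinP; apply: measurable_funTS; apply: measurable_funM => //; exact: measurable_funD.
have A : ((M%:E * leb D) * \int[leb]_(x in D) (W x)%:E <=
   leb D * \int[leb]_(x in D) ((M + g x) * W x)%:E + (2 * M)%:E * \int[leb]_(x in D) \int[leb]_(y in D) I x y)%E.
  have i0 x : (0 <= \int[leb]_(y in D) I x y)%E by exact: integral_ge0.
  have M2 : 0 <= 2 * M by rewrite mulr_ge0.
  have mg' : measurable_fun D (fun x => (M + g x)%:E).
    by apply/measurable_EFinP; apply: measurable_funTS; exact: measurable_funD.
  have mi : measurable_fun D (fun x => \int[leb]_(y in D) I x y)%E by exact: measurable_funTS.
  have a0 x : (0 <= ((M + g x) * W x)%:E)%E by rewrite lee_fin mulr_ge0.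
  have ma : measurable_fun D (fun x => leb D * ((M + g x) * W x)%:E)%E by exact: measurable_funeM.
  have mb : measurable_fun D (fun x => (2 * M)%:E * \int[leb]_(y in D) I x y)%E by exact: measurable_funeM.
  rewrite -gint.
  have -> : ((\int[leb]_(x in D) (M + g x)%:E) * (\int[leb]_(x in D) (W x)%:E) =
     \int[leb]_(x in D) ((M + g x)%:E * \int[leb]_(x in D) (W x)%:E))%E.
    by rewrite ge0_integralZr// => x _; rewrite lee_fin.
  have -> : (leb D * \int[leb]_(x in D) ((M + g x) * W x)%:E +
      (2 * M)%:E * \int[leb]_(x in D) \int[leb]_(y in D) I x y =
     \int[leb]_(x in D) (leb D * ((M + g x) * W x)%:E + (2 * M)%:E * \int[leb]_(y in D) I x y))%E.
    rewrite [RHS]ge0_integralD//; last 2 first.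
    - by move=> x _; apply: mule_ge0.
    - by move=> x _; apply: mule_ge0; rewrite ?lee_fin.
    by congr (_ + _)%E; rewrite ge0_integralZl// lee_fin.
  apply: ge0_le_integral => //.
  - by move=> x _; apply: mule_ge0 => //; rewrite lee_fin.
  - under [X in measurable_fun _ X]eq_fun do rewrite muleC.
    exact: measurable_funeM.
  - exact: emeasurable_funD.
  by move=> x Dx; rewrite (muleC (leb D)); exact: row.
have {}A := le_trans A (leeD2l _ (lee_wpmul2l _ double)).
have M2 : (0 <= (2 * M)%:E)%E by rewrite lee_fin mulr_ge0.
move: (A M2); rewrite DE (muleC M%:E) -muleA => B.
rewrite -(@lee_pmul2l _ (fine (leb D))%:E)//; apply: (le_trans B).
have i1 : (0 <= \int[leb]_(x in D) ((M + g x) * W x)%:E)%E.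
  by apply: integral_ge0 => x _; rewrite lee_fin mulr_ge0.
have i2 : (0 <= (2 * M * (K * 2 ^+ N * (N%:R / rho)))%:E * \int[leb]_(x in D) (T x)%:E)%E.
  have rN : 0 <= N%:R / rho by rewrite divr_ge0// ltW.
  have e0 : 0 <= (2 : R) ^+ N by rewrite exprn_ge0.
  apply: mule_ge0; first by rewrite lee_fin; exact: mulr_ge0 (mulr_ge0 (ler0n R 2) M0) (mulr_ge0 (mulr_ge0 K0 e0) rN).
  by apply: integral_ge0 => x _; rewrite lee_fin.
rewrite [leRHS](ge0_muleDr _ i1 i2).
apply: leeD => //; rewrite !muleA -!EFinM le_eqVlt; apply/orP; left; apply/eqP.
by congr (_%:E * _)%E; ring.
Qed.

End sphere_poincare.

Section measurability.
Context (R : realType) (N : nat) d (T : measurableType d).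

Lemma measurable_dot (f g : T -> 'rV[R]_N) : measurable_fun setT f -> measurable_fun setT g ->
  measurable_fun setT (fun t => dot (f t) (g t)).
Proof.
move=> mf mg; apply: measurable_sum => i.
by apply: measurable_funM; apply: (measurableT_comp (measurable_coord i)).
Qed.

Lemma measurable_tang (f g : T -> 'rV[R]_N) : measurable_fun setT f -> measurable_fun setT g ->
  measurable_fun setT (fun t => tang (f t) (g t)).
Proof.
move=> mf mg; apply: (@measurableT_comp _ _ _ _ _ _ (@Num.sqrt R)).
  by apply: continuous_measurable_fun; exact: sqrt_continuous.
apply: measurable_funB; first exact: measurable_dot.
by apply: measurable_funX; exact: measurable_dot.
Qed.

End measurability.

Lemma continuous_dot_grad (R : realType) (N : nat) (T : topologicalType) (u : 'rV[R]_N -> R)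
    (f g : T -> 'rV[R]_N) : smooth u -> continuous f -> continuous g ->
  continuous (fun t => dot (grad u (f t)) (g t)).
Proof.
move=> su cf cg t; apply: (@cvg_big _ _ _ 0); first exact: add_continuous.
move=> i _; apply: cvgM.
- apply: (@continuous_comp _ _ _ f (fun x => grad u x ord0 i)); first exact: cf.
  exact: continuous_grad_coord.
- by apply: (@continuous_comp _ _ _ g (fun x => x ord0 i)); [exact: cg|exact: coord_continuous].
Qed.

Lemma continuous_tang_grad (R : realType) (N : nat) (T : topologicalType) (u : 'rV[R]_N -> R)
    (f g : T -> 'rV[R]_N) : smooth u -> continuous f -> continuous g ->
  continuous (fun t => tang (grad u (f t)) (g t)).
Proof.
move=> su cf cg.
rewrite (_ : (fun _ => _) = Num.sqrt \o ((fun t => enorm (grad u (f t)) ^+ 2) \-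
    (fun t => dot (grad u (f t)) (g t) ^+ 2))); last first.
  by apply/funext => t; rewrite /tang /= enorm2.
have cs (h : T -> R) : continuous h -> continuous (fun t => h t ^+ 2).
  by move=> ch t; apply: (@continuous_comp _ _ _ h (fun y => y ^+ 2)); [exact: ch|exact: exprn_continuous].
move=> t; apply: continuous_comp; last exact: sqrt_continuous.
apply: continuousB; apply: cs; last exact: continuous_dot_grad.
move=> y; apply: (@continuous_comp _ _ _ f (fun x => enorm (grad u x))); first exact: cf.
exact: continuous_enorm_grad.
Qed.

(** * The inequality for [|u|^p] on a sphere of radius [s] *)

Section ray_poincare.
Context (R : realType) (m : nat) (rho p : R) (rho0 : 0 < rho) (p1 : 1 < p).
Local Notation N := m.+2.
Local Notation leb := (lebesgue_rV R N).
Local Notation D := (@punctured_ball R m.+1 rho).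
Local Notation rV := ('rV[R]_N).

Definition dir (x : rV) : rV := (enorm x)^-1 *: x.

Lemma enorm_dir x : x != 0 -> enorm (dir x) = 1. Proof. exact: enorm_unit. Qed.

Lemma dir_ray x (s : R) : x != 0 -> 0 < s -> dir (ray x s) = dir x.
Proof.
move=> x0 s0; rewrite /dir enorm_ray ?(ltW s0)// /ray scalerA; congr (_ *: _).
by field; rewrite enorm_eq0 x0 gt_eqF.
Qed.

Lemma measurable_dir : measurable_fun setT dir.
Proof.
apply: measurable_fun_scale_rV => //.
by apply: (measurableT_comp (@measurable_invr R)); exact: measurable_enorm.
Qed.

Variables (u : rV -> R) (su : smooth u) .

(** A bound for the tangential derivative of [|u|^p]. *)
Definition tang_density (y : rV) : R := p * (`|u y| `^ (p - 1) * tang (grad u y) (dir y)).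

Lemma tang_density_ge0 y : 0 <= tang_density y.
Proof. by rewrite !mulr_ge0 ?powR_ge0 ?tang_ge0// ltW// (lt_trans ltr01). Qed.

Lemma measurable_tang_density : measurable_fun setT tang_density.
Proof.
apply: measurable_funM => //; apply: measurable_funM.
  apply: continuous_measurable_rV => x; apply: (@continuous_comp _ _ _ u (fun y => `|y| `^ (p - 1))).
    exact: smooth_continuous.
  by apply: continuous_norm_powR; rewrite subr_gt0.
by apply: measurable_tang; [exact: measurable_grad|exact: measurable_dir].
Qed.

(** The projected segment moves tangentially to the sphere. Its velocity [a] is [s / |c|] times an
    orthogonal projection of [v], so [a . a = (s / |c|) (a . v)], and Cauchy-Schwarz gives the
    bound. *)
Lemma segment_derivative (x v : rV) (s t : R) : 0 <= s -> x + t *: v != 0 ->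
  exists2 a, is_derive t 1 (fun t => ray (x + t *: v) s) a &
   dot a (dir (x + t *: v)) = 0 /\ enorm a <= s / enorm (x + t *: v) * enorm v.
Proof.
move=> s0 c0; set c := x + t *: v; have e0 : 0 < enorm c by rewrite enorm_gt0.
have dc : is_derive t 1 (fun t => x + t *: v) v.
  have h := is_derive_scale (is_derive_cst v t 1) (is_derive_id t 1).
  have := @is_deriveD _ _ _ _ _ _ _ _ _ (is_derive_cst x t 1) h.
  by move/is_derive_eq; apply; rewrite scaler0 addr0 scale1r add0r.
have de := is_derive_enorm dc c0; rewrite -/c in de.
pose a := - (s * (dot c v / enorm c) / enorm c ^+ 2) *: c + (s / enorm c) *: v.
have dinv : is_derive t 1 (fun t => s / enorm (x + t *: v)) (- (s * (dot c v / enorm c) / enorm c ^+ 2)).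
  have hV := @is_deriveV R (fun t => enorm (x + t *: v)) t _ 1 (lt0r_neq0 e0) de.
  have := @is_derive1_comp R _ _ t _ _ (is_derive_mull s _) hV.
  move/is_derive_eq; apply; rewrite /GRing.scale/= -/c; field; exact: lt0r_neq0.
exists a.
  have := is_derive_scale dc dinv.
  by move/is_derive_eq; apply.
have cc : dot c c = enorm c ^+ 2 by rewrite enorm2.
have ac : dot a c = 0.
  rewrite /a dotDl !dotZl (dotC v) cc; field; exact: lt0r_neq0.
split; first by rewrite /dir dotZr ac mulr0.
have aa : enorm a ^+ 2 = (s / enorm c) * dot a v.
  by rewrite enorm2 {2}/a dotDr !dotZr ac mulr0 add0r.
have [->|a0] := eqVneq a 0.
  by rewrite enorm0 mulr_ge0 ?enorm_ge0// divr_ge0 ?(ltW e0).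
have ea : 0 < enorm a by rewrite enorm_gt0.
rewrite -(@ler_pM2r _ (enorm a))// -expr2 aa.
apply: le_trans (ler_wpM2l (divr_ge0 s0 (ltW e0)) (dot_le_enorm a v)) _.
by rewrite (mulrC (enorm a)) mulrA.
Qed.

(** Only the tangential gradient is seen along the projected chord; [2 * rho] bounds the length of
    the chord. *)
Lemma segment_bound x y (s : R) : 0 <= s -> D x -> D y -> ~ parallel x y ->
  ((`|u (ray y s)| `^ p)%:E <= (`|u (ray x s)| `^ p)%:E +
   \int[@lebesgue_measure R]_(t in `[0%R, 1%R])
     (2 * rho * s * (\1_D (x + t *: (y - x)) *
        ((enorm (x + t *: (y - x)))^-1 * tang_density (ray (x + t *: (y - x)) s))))%:E)%E.
Proof.
move=> s0 Dx Dy nxy; pose c t := x + t *: (y - x).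
have x0 := punctured_ball_neq0 Dx.
have c0 t : c t != 0 by exact: segment_neq0.
have e0 t : 0 < enorm (c t) by rewrite enorm_gt0.
pose W t := `|u (ray (c t) s)| `^ p.
pose K t := 2 * rho * s * ((enorm (c t))^-1 * (p * (`|u (ray (c t) s)| `^ (p - 1) * tang (grad u (ray (c t) s)) (dir (c t))))).
have [A dA A2] : exists2 A : R -> rV, (forall t : R, is_derive t (1 : R) (fun t => ray (c t) s) (A t)) &
    forall t, dot (A t) (dir (c t)) = 0 /\ enorm (A t) <= s / enorm (c t) * enorm (y - x).
  have /choice[A HA] : forall t : R, exists a, is_derive t (1 : R) (fun t => ray (c t) s) a /\
      (dot a (dir (c t)) = 0 /\ enorm a <= s / enorm (c t) * enorm (y - x)).
    by move=> t; have [a a1 a2] := segment_derivative s0 (c0 t); exists a.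
  by exists A => t; have [] := HA t.
have dW (t : R) : is_derive t 1 W (p * Num.sg (u (ray (c t) s)) * `|u (ray (c t) s)| `^ (p - 1) * dot (grad u (ray (c t) s)) (A t)).
  have h := is_derive_curve (smooth_differentiable su _) (dA t).
  have := @is_derive1_comp R _ _ _ _ _ (is_derive_norm_powR (u (ray (c t) s)) p1) h.
  by move/is_derive_eq; apply; rewrite mulrC.
have cont_ray : continuous (fun t => ray (c t) s).
  by move=> t; have [h _] := dA t; apply: differentiable_continuous; exact/derivable1_diffP.
have cc : continuous c.
  move=> t; apply: cvgD; first exact: cvg_cst.
  by apply: cvgZl; exact: cvg_id.
have ce : continuous (fun t => enorm (c t)).
  by move=> t; apply: (@continuous_comp _ _ _ c (@enorm R N)); [exact: cc|exact: continuous_enorm].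
have cei : continuous (fun t => (enorm (c t))^-1).
  by move=> t; apply: cvgV; [exact: lt0r_neq0|exact: ce].
have cdir : continuous (fun t => dir (c t)).
  by move=> t; apply: cvgZ; [exact: cei|exact: cc].
have ctg := continuous_tang_grad su cont_ray cdir.
have cK : continuous K.
  move=> t; apply: cvgMr; apply: cvgM; first exact: cei.
  apply: cvgMr; apply: cvgM.
    apply: (@continuous_comp _ _ _ (fun t => u (ray (c t) s)) (fun y => `|y| `^ (p - 1))).
      by apply: (@continuous_comp _ _ _ (fun t => ray (c t) s) u); [exact: cont_ray|exact: smooth_continuous].
    by apply: continuous_norm_powR; rewrite subr_gt0.
  exact: ctg.
have le t : p * Num.sg (u (ray (c t) s)) * `|u (ray (c t) s)| `^ (p - 1) * dot (grad u (ray (c t) s)) (A t) <= K t.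
  have [A0 An] := A2 t.
  have p0 : 0 < p by exact: lt_trans p1.
  set U := `|u _| `^ _; set g := grad u _.
  have U0 : 0 <= U by exact: powR_ge0.
  have h1 := dot_tang g (enorm_dir (c0 t)) A0.
  have h2 : enorm (y - x) <= 2 * rho.
    move: Dx Dy => /andP[_ xr] /andP[_ yr].
    by apply: le_trans (enormB _ _) _; lra.
  have h3 : `|dot g (A t)| <= tang g (dir (c t)) * (s / enorm (c t) * (2 * rho)).
    apply: le_trans h1 _; rewrite ler_wpM2l ?tang_ge0//; apply: le_trans An _.
    by rewrite ler_wpM2l// divr_ge0// ltW.
  apply: (@le_trans _ _ (p * U * `|dot g (A t)|)).
    apply: le_trans (ler_norm _) _; rewrite !normrM (gtr0_norm p0) normr_sg (ger0_norm U0).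
    apply: ler_wpM2r => //; apply: ler_wpM2r => //; apply: ler_piMr; first exact: ltW.
    by case: (_ != 0).
  apply: le_trans (ler_wpM2l _ h3) _; first by rewrite mulr_ge0// ltW.
  by rewrite /K -/U -/g le_eqVlt; apply/orP; left; apply/eqP; ring.
have := @FTC_le R W _ K 0 1 ler01 cK (fun t _ => dW t) (fun t _ => le t).
have W0 : W 0 = `|u (ray x s)| `^ p by rewrite /W /c scale0r addr0.
have W1 : W 1 = `|u (ray y s)| `^ p by rewrite /W /c scale1r addrC subrK.
rewrite W0 W1 => h; rewrite -leeBlDl//; rewrite -EFinB.
apply: le_trans (h _) _.
  by apply: continuous_in_subspaceT => t _; exact: is_derive_continuous (dW t).
rewrite le_eqVlt; apply/orP; left; apply/eqP; apply: eq_integral => t.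
rewrite inE/= in_itv/= => /andP[t0 t1].
have Dc : D (c t).
  rewrite /punctured_ball/= e0/=.
  have -> : c t = (1 - t) *: x + t *: y by rewrite /c scalerBr scalerBl scale1r addrAC addrA.
  move: Dx Dy => /andP[_ xr] /andP[_ yr].
  apply: le_trans (enormD _ _) _; rewrite !enormZ !ger0_norm ?subr_ge0//.
  have := ler_wpM2l t0 yr; have := @ler_wpM2l _ (1 - t) _ _ _ xr; rewrite subr_ge0 => /(_ t1); lra.
rewrite -/(c t) indicE mem_set//= mul1r /K /tang_density.
have [->|sn0] := eqVneq s 0; first by rewrite mulr0 !mul0r.
by rewrite dir_ray// lt_neqAle eq_sym sn0.
Qed.

(** The constant is the product of [2 M] from the weight, [2 rho s] from the projected chord, and
    [2^N] and [N / rho] from the two averages. *)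
Theorem ray_poincare (g : rV -> R) (M s : R) : 0 <= s -> 0 <= M -> measurable_fun setT g ->
  (forall x, `|g x| <= M) -> (\int[leb]_(x in D) (M + g x)%:E = M%:E * leb D)%E ->
  (M%:E * \int[leb]_(x in D) (`|u (ray x s)| `^ p)%:E <=
   \int[leb]_(x in D) ((M + g x) * `|u (ray x s)| `^ p)%:E +
   (M * (4 * 2 ^+ N * N%:R) * s)%:E * \int[leb]_(x in D) (tang_density (ray x s))%:E)%E.
Proof.
move=> s0 M0 mg gM gint.
have := @sphere_poincare R m rho rho0 (fun x => `|u (ray x s)| `^ p)
  (fun x => tang_density (ray x s)) g M (2 * rho * s).
have -> : 2 * M * (2 * rho * s * 2 ^+ N * (N%:R / rho)) = M * (4 * 2 ^+ N * N%:R) * s.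
  by field; rewrite gt_eqF.
apply => //.
- exact: (measurableT_comp (measurable_powR_smooth p1 su) (measurable_ray s)).
- exact: (measurableT_comp measurable_tang_density (measurable_ray s)).
- by move=> x; exact: tang_density_ge0.
- by move=> x t x0 t0; rewrite ray_ray.
- by rewrite !mulr_ge0// ltW.
- by move=> x y Dx Dy nxy; exact: segment_bound.
Qed.

End ray_poincare.

(** * The calibration *)

Ltac nonneg := repeat first
  [ assumption | apply: ltW; assumption | exact: sqr_ge0 | exact: powR_ge0 | exact: normr_ge0
  | exact: ler0n | exact: ler01 | rewrite invr_ge0 | apply: exprn_ge0 | apply: addr_ge0 | apply: mulr_ge0 ].

Section taylor.
Context (R : realType).

Lemma Ck_on_taylor2 (f : R -> R) (D : set R) (a b : R) : open D -> Ck_on 2 D f ->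
  (forall x, a <= x <= b -> D x) -> exists2 C, 0 <= C &
  forall x y, a <= x <= b -> a <= y <= b -> `|f y - f x - 'D_1 f x * (y - x)| <= C * (y - x) ^+ 2.
Proof.
move=> oD [df Df] abD; have [C C0 HC] := Ck_on_lipschitz oD (Df 1) abD.
have Hd x : a <= x <= b -> is_derive x 1 f ('D_1 f x).
  by move=> xab; apply/derivableP; apply: diff_derivable; exact/df/abD.
exists C => // x y xab yab.
have key u v k : a <= u <= b -> a <= v <= b -> u <= v ->
    (forall s, u <= s <= v -> `|'D_1 f s - k| <= C * (v - u)) ->
    `|f v - f u - k * (v - u)| <= C * (v - u) ^+ 2.
  move=> /andP[au ub] /andP[av vb] uv H.
  have W s : u <= s <= v -> a <= s <= b.
    by move=> /andP[us sv]; rewrite (le_trans au)// (le_trans sv).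
  have h1 : f v - f u <= (k + C * (v - u)) * v - (k + C * (v - u)) * u.
    apply: (MVT_leT uv (fun s h => Hd s (W s h)) (fun s _ => is_derive_mull _ s)) => s h.
    by have := H s h; rewrite ler_norml => /andP[]; lra.
  have h2 : (k - C * (v - u)) * v - (k - C * (v - u)) * u <= f v - f u.
    apply: (MVT_leT uv (fun s _ => is_derive_mull _ s) (fun s h => Hd s (W s h))) => s h.
    by have := H s h; rewrite ler_norml => /andP[]; lra.
  by rewrite ler_norml expr2; apply/andP; split; lra.
have [xy|/ltW yx] := leP x y.
  apply: key => // s /andP[xs sy]; apply: le_trans (HC s x _ xab) _.
    by move: xab yab => /andP[ax _] /andP[_ yb]; rewrite (le_trans ax)// (le_trans sy).
  by rewrite ler_wpM2l// ger0_norm ?subr_ge0//; lra.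
have := key y x ('D_1 f x) yab xab yx.
rewrite (_ : f x - f y - 'D_1 f x * (x - y) = - (f y - f x - 'D_1 f x * (y - x))); last ring.
rewrite normrN (_ : (x - y) ^+ 2 = (y - x) ^+ 2); last ring.
apply=> s /andP[ys sx]; apply: le_trans (HC s x _ xab) _.
  by move: xab yab => /andP[_ xb] /andP[ay _]; rewrite (le_trans ay)// (le_trans sx).
by rewrite ler_wpM2l// distrC ger0_norm ?subr_ge0//; lra.
Qed.

Lemma Ck_on_bounded (f : R -> R) (D : set R) (a b : R) : open D -> Ck_on 1 D f ->
  (forall x, a <= x <= b -> D x) -> exists2 C, 0 <= C & forall x, a <= x <= b -> `|f x| <= C.
Proof.
move=> oD cf abD; have [C C0 HC] := Ck_on_lipschitz oD cf abD.
have [ab|ba] := leP a b; last first.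
  by exists 0 => // x /andP[ax xb]; move: (le_lt_trans (le_trans ax xb) ba); rewrite ltxx.
exists (`|f a| + C * (b - a)).
  by rewrite addr_ge0// mulr_ge0// subr_ge0.
move=> x xab; rewrite -{1}(subrK (f a) (f x)) addrC; apply: le_trans (ler_normD _ _) _.
rewrite lerD2l; apply: le_trans (HC x a xab _) _; first by rewrite lexx.
by move: xab => /andP[ax xb]; rewrite ler_wpM2l// ger0_norm ?subr_ge0// lerD2r.
Qed.

End taylor.

Lemma powR_mulD (R : realType) (x a : R) : 0 < x -> x * x `^ a = x `^ (1 + a).
Proof. by move=> x0; rewrite powRD ?powRr1 ?(ltW x0)// (gt_eqF x0) implybT. Qed.

Section profile.
Context (R : realType) (p r rho : R) (n : nat).
Hypotheses (p1 : 1 < p) (r0 : 0 < r) (rrho : r < rho).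
Variables (z : R -> R) (M : R).
Hypothesis M0 : 0 < M.
Hypothesis dz : forall x, r < x -> is_derive x 1 z (1 + n%:R / (p - 1) * z x / x - z x `^ p / (p - 1)).
Hypothesis zM : forall x, r < x -> 0 < z x <= M.

Let p10 : 0 < p - 1. Proof. by rewrite subr_gt0. Qed.
Let p0 : 0 < p. Proof. exact: lt_trans p1. Qed.
Let rho0 : 0 < rho. Proof. exact: lt_trans rrho. Qed.
Let z0 x : r < x -> 0 < z x. Proof. by move=> /zM/andP[]. Qed.

Definition beyond : set R := [set x | r < x].

Lemma open_beyond : open beyond. Proof. exact: open_gt. Qed.
Let ob := open_beyond.

Let open_pos : open [set x : R | 0 < x]. Proof. exact: open_gt. Qed.

Lemma Ck_on_riccati k : Ck_on k beyond z.
Proof.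
elim: k => [|k IH]; first by move=> x xr; exact: is_derive_continuous (dz xr).
apply: (Ck_on_derive ob (fun x xr => dz xr)).
have cV : Ck_on k beyond (fun x => x `^ (-1)).
  by apply: Ck_on_powR => // x /= rx; exact: lt_trans rx.
have cp : Ck_on k beyond (fun x => z x `^ p).
  apply: (@Ck_on_comp R _ k beyond [set x | 0 < x] z (fun x => x `^ p)) => //.
  exact: Ck_on_powR.
have c1 := Ck_on_add ob (Ck_on_cst k 1 ob) (Ck_on_mul ob (Ck_on_mul ob (Ck_on_cst k (n%:R / (p - 1)) ob) IH) cV).
have c2 := Ck_on_sub_fun ob c1 (Ck_on_mul ob cp (Ck_on_cst k (p - 1)^-1 ob)).
apply: (Ck_on_eq ob _ c2) => x /= rx.
by rewrite powR_inv1// ltW// (lt_trans r0).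
Qed.

(** This is [(v' / v)^(p-1)] for the radial extremal. For it the Riccati equation becomes
    [w' + n w / x + (p - 1) w^(p/(p-1)) = 1], the form in which Young's inequality turns [ray_ineq]
    into an energy bound; [flux rho] is [L] up to a power of the area. *)
Definition flux (x : R) : R := z x `^ (1 - p).

Lemma Ck_on_flux k : Ck_on k beyond flux.
Proof.
apply: (@Ck_on_comp R _ k beyond [set x | 0 < x] z (fun x => x `^ (1 - p))) => //.
  exact: Ck_on_powR.
exact: Ck_on_riccati.
Qed.

Lemma flux_powR x : r < x -> flux x `^ (p / (p - 1)) = z x `^ (- p).
Proof.
by move=> rx; rewrite /flux -powRrM; congr (_ `^ _); field; rewrite gt_eqF.
Qed.

Lemma is_derive_flux x : r < x ->
  is_derive x 1 flux (1 - n%:R * flux x / x - (p - 1) * flux x `^ (p / (p - 1))).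
Proof.
move=> rx; rewrite flux_powR//.
have := @is_derive1_comp R _ _ _ _ _ (is_derive1_powR (1 - p) (z0 rx)) (dz rx).
move/is_derive_eq; apply; have zx := z0 rx.
rewrite (_ : 1 - p - 1 = - p); last by lra.
have E1 : z x `^ (1 - p) = z x * z x `^ (- p).
  by rewrite powR_mulD.
have E2 : z x `^ p * z x `^ (- p) = 1.
  by rewrite powRN mulfV// gt_eqF// powR_gt0.
rewrite /flux E1.
transitivity ((p - 1) ^-1 * (p - 1) * (z x `^ p * z x `^ (- p)) - n%:R * (z x * z x `^ (- p)) / x - (p - 1) * z x `^ (- p)).
  by field; rewrite !gt_eqF// (lt_trans r0).
by rewrite E2 mulVf ?gt_eqF// mulr1.
Qed.

Lemma flux_ge x : r < x -> M `^ (1 - p) <= flux x.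
Proof.
move=> /zM/andP[zx zxM]; rewrite /flux -(opprB p 1) !powRN lef_pV2 ?posrE ?powR_gt0//.
by apply: powR_ge_le => //; exact: ltW.
Qed.

(* [lra] looks at every hypothesis, which is slow in the large contexts below; [isolate] keeps only the section. *)
Ltac isolate := clear -R p r rho n p1 r0 rrho z M M0 dz zM p10 p0 rho0 z0 ob open_pos.

(** [Phi] belongs to an extremal whose zero has moved to [r / (1 - k)]. The dilate
    [c^(p-1) flux (c s)], [c = 1 - k], solves the flux equation with right-hand side [c^p] but has
    the wrong value at [rho]; adding [b * g], with [g] rising from 0 to 1 in the outer half of the
    annulus, restores it. [k * mm] is the first-order part of the resulting defect. That [mm] does
    not depend on [k] is essential: [h * mm s] must have mean zero on each sphere. *)
Theorem lower_profile : exists mm k0 C Mm phi, [/\ continuous mm,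
  [/\ 0 < k0, k0 <= 2^-1, 0 <= C, 0 <= Mm & 0 < phi], forall s, `|mm s| <= Mm &
  forall k, `|k| <= k0 -> exists Phi dPhi, Phi rho = flux rho /\
   forall s, r / (1 - k) < s -> s <= rho ->
    [/\ is_derive s 1 Phi (dPhi s), phi <= Phi s &
     dPhi s + n%:R * Phi s / s + (p - 1) * Phi s `^ (p / (p - 1)) <= 1 + k * mm s + C * k ^+ 2]].
Proof.
have pp := p1; have rr0 := r0; have rrr := rrho.
(* The correction lives beyond [r2]; the smaller [r3] leaves room for [c * s] to stay at a fixed
   distance from the singularity at [r]. *)
pose r2 := (r + rho) / 2; pose r3 := (r + r2) / 2.
have r2r : r < r2 by rewrite /r2; lra.
have r2rho : r2 < rho by rewrite /r2; lra.
have r3r : r < r3 by rewrite /r3; lra.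
have r32 : r3 < r2 by rewrite /r3; lra.
have r20 : 0 < r2 by exact: lt_trans r2r.
have r30 : 0 < r3 by exact: lt_trans r3r.
pose w := rho - r2; have w0 : 0 < w by rewrite subr_gt0.
pose g s := smooth_step (w^-1 * s + - (r2 / w)).
pose dg s := 'D_1 (@smooth_step R) (w^-1 * s + - (r2 / w)) * w^-1.
have css := Ck_on_smooth_step R 1.
have dss (s : R) : is_derive s 1 (@smooth_step R) ('D_1 (@smooth_step R) s).
  by apply/derivableP; apply: diff_derivable; case: css => + _; exact.
have dg' (s : R) : is_derive s 1 g (dg s).
  exact: (@is_derive1_comp R _ _ _ _ _ (dss _) (is_derive_affine w^-1 (- (r2 / w)) s)).
have dg0 : forall s, s <= r2 -> dg s = 0.
  move=> s sr2; rewrite /dg.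
  have a0 : w^-1 * s + - (r2 / w) <= 0.
    by rewrite mulrC -mulrBl mulr_le0_ge0 ?invr_ge0 ?(ltW w0)// subr_le0.
  set a := _ + _ in a0 *.
  (* The step is nonnegative and vanishes at [a <= 0], so [a] is a minimum; this includes the
     endpoint [a = 0]. *)
  have h : is_derive a 1 (@smooth_step R) 0.
    apply: (@derive1_at_min R (@smooth_step R) (a - 1) (a + 1) a).
    - lra.
    - by move=> t _; have [] := dss t.
    - by rewrite in_itv/=; lra.
    - by move=> t _; rewrite (smooth_step0 a0); have /andP[] := smooth_step_itv t.
  by have [_ ->] := h; rewrite mul0r.
have g0 s : s <= r2 -> g s = 0.
  move=> sr2; rewrite /g smooth_step0// mulrC -mulrBl mulr_le0_ge0 ?invr_ge0 ?(ltW w0)// subr_le0//.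
have g1 : g rho = 1.
  by rewrite /g smooth_step1// mulrC -mulrBl divff// gt_eqF.
have g01 s : 0 <= g s <= 1 by exact: smooth_step_itv.
have cg : continuous g by move=> s; exact: is_derive_continuous (dg' s).
have cdg : continuous dg.
  move=> s; apply: cvgMl.
  apply: (@continuous_comp _ _ _ (fun s => w^-1 * s + - (r2 / w)) ('D_1 (@smooth_step R))).
    exact: is_derive_continuous (is_derive_affine _ _ s).
  by case: css => _ /(_ 1); exact.
pose H c := c `^ (p - 1) * flux (c * rho).
pose E : set R := [set c | r < c * rho].
have oE : open E.
  rewrite (_ : E = (fun c => c * rho) @^-1` [set x | r < x])//.
  by apply: open_comp; [move=> c _; apply: cvgMl; exact: cvg_id|exact: open_gt].
have Epos c : E c -> 0 < c.
  by rewrite /E/= => h; rewrite -(pmulr_lgt0 _ rho0) (lt_trans r0).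
have cH : Ck_on 2 E H.
  apply: Ck_on_mul => //; first by apply: Ck_on_powR.
  apply: (@Ck_on_comp R _ 2 E beyond (fun c => c * rho) flux) => //.
    exact: Ck_on_flux.
  by apply: Ck_on_mul => //; [exact: Ck_on_id|exact: Ck_on_cst].
pose k1 := (1 - r / rho) / 2.
have rr1 : r / rho < 1 by rewrite ltr_pdivrMr// mul1r.
have k10 : 0 < k1 by rewrite divr_gt0// subr_gt0.
have HE c : 1 - k1 <= c <= 1 + k1 -> E c.
  move=> /andP[h _]; rewrite /E/= -ltr_pdivrMr//; apply: lt_le_trans h.
  by rewrite /k1; lra.
have [C1 C10 HC1] := Ck_on_taylor2 oE cH HE.
(* [H c] is the value of the dilated flux at [rho]; the correction [b = H 1 - H c] with [c = 1 - k]
   is [k * beta] to first order. *)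
pose beta := 'D_1 H 1.
have [C2 C20 HC2] := powR_quadratic p.
have [C3 C30 HC3] := powR_quadratic (p / (p - 1)).
pose W x := z x `^ (-1).
have cW : Ck_on 1 beyond W.
  apply: (@Ck_on_comp R _ 1 beyond [set x | 0 < x] z (fun x => x `^ (-1))) => //.
    exact: Ck_on_powR.
  exact: Ck_on_riccati.
have Wb x : r3 <= x <= 2 * rho -> beyond x by move=> /andP[h _]; exact: lt_le_trans h.
have [CW CW0 HCW] := Ck_on_lipschitz ob cW Wb.
have [W1 W10 HW1] := Ck_on_bounded ob cW Wb.
(* Clamping to [[r2, rho]] makes [mm] bounded and continuous on the whole line. Below [r2] both [g]
   and [dg] vanish, so the constant value of [mm] there is the correct one. *)
pose cl s := Num.min (Num.max s r2) rho.
have cl_itv s : r2 <= cl s <= rho.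
  by rewrite /cl le_min (ltW r2rho) le_max lexx orbT/= ge_min lexx orbT.
have cl_id s : r2 <= s -> s <= rho -> cl s = s by move=> h1 h2; rewrite /cl max_l// min_l.
have cl_lo s : s <= r2 -> cl s = r2 by move=> h; rewrite /cl max_r// min_l// ltW.
have ccl : continuous cl.
  move=> s; apply: (@continuous_min _ _ (fun s => Num.max s r2) (fun=> rho) s); last exact: cvg_cst.
  by apply: continuous_max; [exact: cvg_id|exact: cvg_cst].
(* The terms linear in [k]: [- p] from [c^p], then the divergence of the correction, then
   [p * (g * W)] from expanding [(p - 1) Phi^(p/(p-1))], since [flux^(1/(p-1)) = 1 / z = W]. *)
pose mm0 s := - p + beta * (dg s + n%:R * g s / s + p * (g s * W s)).
have [Q1 Q10 HQ1] : exists2 Q, 0 <= Q & forall s, r2 <= s <= rho -> `|dg s| <= Q.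
  have cnd : {within `[r2, rho], continuous (fun s => `|dg s|)}.
    apply: continuous_subspaceT => s; apply: (@continuous_comp _ _ _ dg (fun y : R => `|y|)).
      exact: cdg.
    exact: norm_continuous.
  have [c _ Hc] := EVT_max (ltW r2rho) cnd.
  by exists `|dg c| => // s sr; apply: Hc; rewrite in_itv.
have Wr s : r2 <= s <= rho -> `|W s| <= W1.
  by move=> /andP[s1 s2]; apply: HW1; lra.
pose Q2 := Q1 + n%:R / r2.
have Q20 : 0 <= Q2 by rewrite addr_ge0// divr_ge0// ltW.
have HQ2 s : r2 <= s <= rho -> `|dg s + n%:R * g s / s| <= Q2.
  move=> sr; apply: le_trans (ler_normD _ _) _; apply: lerD; first exact: HQ1.
  move: sr => /andP[s1 s2]; have s0 : 0 < s by exact: lt_le_trans s1.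
  have /andP[ga gb] := g01 s.
  rewrite ger0_norm; last by rewrite divr_ge0 ?(ltW s0)// mulr_ge0.
  apply: ler_pM => //; first by rewrite mulr_ge0.
  - by rewrite invr_ge0 ltW.
  - by rewrite ler_piMr.
  - by rewrite lef_pV2.
pose Mm := p + `|beta| * (Q2 + p * W1).
have Mm0 : 0 <= Mm by rewrite addr_ge0 ?(ltW p0)// mulr_ge0// addr_ge0// mulr_ge0// ltW.
pose phiF := 2^-1 `^ (p - 1) * M `^ (1 - p).
have phiF0 : 0 < phiF by rewrite mulr_gt0// powR_gt0// invr_gt0.
pose B1 := `|beta| + C1.
have B10 : 0 <= B1 by rewrite addr_ge0.
(* In turn: [c >= 1/2]; [c * rho] stays beyond [r]; [c * s >= r3] whenever [s >= r2]; the correction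
   is at most half of the lower bound [phiF] for the dilated flux. *)
pose k0 := Num.min (Num.min (2^-1) k1) (Num.min ((r2 - r3) / rho) (phiF / (2 * (B1 + 1)))).
have B11 : 0 < 2 * (B1 + 1) by rewrite mulr_gt0// ltr_wpDl.
have k00 : 0 < k0 by rewrite !lt_min invr_gt0 ltr0n/= k10/= divr_gt0 ?subr_gt0//= divr_gt0.
pose F1 := (p - 1) * (2 `^ p * W1 `^ p) * C3 * (B1 / phiF) ^+ 2.
pose C := C2 + C1 * Q2 + p * (C1 * (2 * W1) + `|beta| * (CW * rho + W1)) + F1.
have F10 : 0 <= F1 by rewrite /F1; nonneg.
have C0 : 0 <= C by rewrite /C; nonneg.
exists (fun s => mm0 (cl s)), k0, C, Mm, (phiF / 2); split.
- have cW' : forall s, {for cl s, continuous W}.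
    by move=> s; apply: (Ck_on_continuous cW); have /andP[h _] := cl_itv s; exact: lt_le_trans h.
  move=> s; have /andP[h _] := cl_itv s.
  apply: (@continuous_comp _ _ _ cl mm0); first exact: ccl.
  apply: cvgD; first exact: cvg_cst.
  apply: cvgMr; apply: cvgD.
    apply: cvgD; first exact: cdg.
    apply: cvgM; first by apply: cvgMr; exact: cg.
    by apply: cvgV; [rewrite gt_eqF// (lt_le_trans r20)|exact: cvg_id].
  by apply: cvgMr; apply: cvgM; [exact: cg|exact: cW'].
- split => //; first by rewrite !ge_min lexx.
  by rewrite divr_gt0.
- move=> s; have h := cl_itv s; rewrite /mm0 /Mm; apply: le_trans (ler_normD _ _) _.
  rewrite normrN (gtr0_norm p0) lerD2l normrM ler_wpM2l//.
  apply: le_trans (ler_normD _ _) _; apply: lerD; first exact: HQ2.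
  rewrite normrM (gtr0_norm p0) ler_wpM2l ?(ltW p0)// normrM.
  have /andP[ga gb] := g01 (cl s); rewrite (ger0_norm ga).
  by apply: le_trans (Wr _ h); rewrite ler_piMl.
move=> k; rewrite !le_min -!andbA => /and4P[k2 kk1 kr kphi].
pose c := 1 - k; pose b := H 1 - H c.
have /andP[kl ku] : - 2^-1 <= k <= 2^-1 by rewrite -ler_norml.
have c2 : 2^-1 <= c by rewrite /c; move: ku; isolate; lra.
have c22 : c <= 2 by rewrite /c; move: kl; isolate; lra.
have cpos : 0 < c by rewrite /c; move: ku; isolate; lra.
have bE : `|b - k * beta| <= C1 * k ^+ 2.
  have := HC1 1 c; rewrite /c => /(_ _ _)-/(_ _) h.
  move: kk1; rewrite ler_norml => /andP[u1 u2].
  have := HC1 1 (1 - k) ltac:(move: k10; isolate; lra) ltac:(move: u1 u2; isolate; lra).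
  rewrite -/beta (_ : 1 - k - 1 = - k); last ring.
  rewrite sqrrN => {}h; rewrite -normrN.
  by rewrite (_ : - (b - k * beta) = H (1 - k) - H 1 - beta * - k)// /b /c; ring.
have bB : `|b| <= B1 * `|k|.
  have -> : b = (b - k * beta) + k * beta by ring.
  apply: le_trans (ler_normD _ _) _; rewrite normrM.
  have : C1 * k ^+ 2 <= C1 * `|k|.
    by rewrite -(real_normK (num_real k)) expr2 ler_wpM2l// ler_piMl//; move: k2; isolate; lra.
  by rewrite /B1 mulrDl (mulrC `|k|); move: bE; isolate; lra.
pose F s := c `^ (p - 1) * flux (c * s).
pose dF s := c `^ p * (1 - n%:R * flux (c * s) / (c * s) - (p - 1) * flux (c * s) `^ (p / (p - 1))).
have dF' s : r < c * s -> is_derive s 1 F (dF s).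
  move=> rcs.
  have h := @is_derive1_comp R _ _ _ _ _ (is_derive_flux rcs) (is_derive_mull c s).
  have := @is_derive1_comp R _ _ s _ _ (is_derive_mull (c `^ (p - 1)) _) h.
  move/is_derive_eq; apply.
  rewrite /dF (_ : c `^ p = c `^ (p - 1) * c); last first.
    by rewrite mulrC powR_mulD// addrC subrK.
  by rewrite -!mulrA; congr (_ * _); rewrite mulrC.
have cpE : c `^ (p - 1) `^ (p / (p - 1)) = c `^ p.
  by rewrite -powRrM mulrC divfK// gt_eqF.
have FpE s : r < c * s -> F s `^ (p / (p - 1)) = c `^ p * flux (c * s) `^ (p / (p - 1)).
  by move=> rcs; rewrite /F powRM ?powR_ge0// cpE.
have ccE : c `^ p = c * c `^ (p - 1).
  by rewrite powR_mulD// addrC subrK.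
have Feq s : r < c * s -> 0 < s -> dF s + n%:R * F s / s + (p - 1) * F s `^ (p / (p - 1)) = c `^ p.
  move=> rcs s0; rewrite FpE// /dF /F ccE.
  by field; rewrite !gt_eqF.
have Fge s : r < c * s -> phiF <= F s.
  move=> rcs; apply: ler_pM; rewrite ?powR_ge0//; last exact: flux_ge.
  by apply: powR_ge_le => //; exact: ltW.
have cpk : c `^ p <= 1 - k * p + C2 * k ^+ 2.
  have := HC2 (- k); rewrite normrN => /(_ k2).
  by rewrite ler_norml sqrrN => /andP[_]; rewrite /c; isolate; lra.
have B1k : B1 * `|k| <= phiF / 2.
  have h : `|k| * (2 * (B1 + 1)) <= phiF by rewrite -ler_pdivlMr.
  by have := normr_ge0 k; move: h; isolate; lra.
exists (fun s => F s + b * g s), (fun s => dF s + b * dg s); split.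
  rewrite g1 mulr1 /b /F /H !mul1r powR1 mul1r; ring.
move=> s rs srho.
have rcs : r < c * s by rewrite mulrC -ltr_pdivrMr.
have s0 : 0 < s by rewrite -(pmulr_rgt0 _ cpos) (lt_trans r0).
have /andP[ga gb] := g01 s.
have bg : `|b * g s| <= phiF / 2.
  by rewrite normrM (ger0_norm ga); apply: le_trans B1k; apply: le_trans bB; rewrite ler_piMr.
have Fs := Fge s rcs.
split.
- have h := @is_derive1_comp R _ _ s _ _ (is_derive_mull b _) (dg' s).
  exact: is_deriveD (dF' s rcs) h.
- move: bg; rewrite ler_norml => /andP[b1 _]; move: b1 Fs; isolate; lra.
(* Below [r2] there is no correction, and the left-hand side is exactly [c^p]. *)
have [sr2|/ltW sr2] := leP s r2.
  have r22 : r2 <= r2 <= rho by rewrite lexx ltW.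
  rewrite (g0 _ sr2) (dg0 _ sr2) !mulr0 !addr0 Feq// cl_lo// /mm0 (g0 r2)// (dg0 r2)//.
  rewrite mulr0 !mul0r !mulr0 !addr0 mulr0 addr0.
  apply: le_trans cpk _.
  have : C2 * k ^+ 2 <= C * k ^+ 2.
    by rewrite ler_wpM2r ?sqr_ge0// /C -!addrA lerDl; nonneg.
  by isolate; lra.
have s_itv : r2 <= s <= rho by rewrite sr2.
rewrite cl_id//.
have F0 : 0 < F s by exact: lt_le_trans Fs.
(* The relative size of the correction; as it is at most 1/2, the power of [1 + x] can be
   expanded. *)
pose x := b * g s / F s.
have xk : `|x| <= B1 / phiF * `|k|.
  rewrite /x normrM normfV (gtr0_norm F0) ler_pdivrMr//.
  apply: (@le_trans _ _ (B1 * `|k|)).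
    by rewrite normrM (ger0_norm ga); apply: le_trans bB; rewrite ler_piMr.
  have -> : B1 / phiF * `|k| * F s = B1 * `|k| * (F s / phiF) by field; rewrite gt_eqF.
  by rewrite ler_peMr ?mulr_ge0// ler_pdivlMr// mul1r.
have x2 : `|x| <= 2^-1.
  rewrite /x normrM normfV (gtr0_norm F0) ler_pdivrMr//; apply: le_trans bg _.
  by rewrite mulrC ler_wpM2l// invr_ge0.
have PE : (F s + b * g s) `^ (p / (p - 1)) = F s `^ (p / (p - 1)) * (1 + x) `^ (p / (p - 1)).
  rewrite -powRM ?(ltW F0)//; last by move: x2; rewrite ler_norml => /andP[]; isolate; lra.
  by congr (_ `^ _); rewrite /x; field; rewrite gt_eqF.
have Ple : (1 + x) `^ (p / (p - 1)) <= 1 + p / (p - 1) * x + C3 * x ^+ 2.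
  by have := HC3 x x2; rewrite ler_norml => /andP[_]; isolate; lra.
have ks : `|k * s| <= r2 - r3.
  rewrite normrM (gtr0_norm s0); apply: (@le_trans _ _ (`|k| * rho)); first exact: ler_wpM2l.
  by rewrite -ler_pdivlMr.
have csE : c * s = s - k * s by rewrite /c mulrBl mul1r.
have csr3 : r3 <= c * s <= 2 * rho.
  by move: ks; rewrite csE ler_norml => /andP[h1 h2]; move: h1 h2 sr2 srho r2rho r30; isolate; lra.
have sr3 : r3 <= s <= 2 * rho by move: sr2 srho r32 r20; isolate; lra.
have zcs := z0 rcs.
have WE t : r < t -> W t = (z t)^-1 by move=> rt; rewrite /W powR_inv1// ltW// z0.
have rs' : r < s by exact: lt_le_trans sr2.
have FpW : F s `^ (p / (p - 1)) = F s * (c * W (c * s)).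
  rewrite FpE// flux_powR// /F /flux WE// ccE.
  rewrite -(powR_mulD (- p) zcs); field; exact: lt0r_neq0.
have FpF : (p - 1) * F s `^ (p / (p - 1)) * (C3 * x ^+ 2) <= F1 * k ^+ 2.
  have x2k : x ^+ 2 <= (B1 / phiF) ^+ 2 * k ^+ 2.
    rewrite -exprMn -(real_normK (num_real x)) -[leRHS](real_normK (num_real _)) lerXn2r ?nnegrE//.
    by rewrite [leRHS]normrM (ger0_norm (divr_ge0 B10 (ltW phiF0))).
  have Fp : F s `^ (p / (p - 1)) <= 2 `^ p * W1 `^ p.
    rewrite FpE// flux_powR//; apply: ler_pM; rewrite ?powR_ge0//.
      by apply: powR_ge_le; rewrite ?(ltW p0) ?(ltW cpos).
    have -> : z (c * s) `^ (- p) = W (c * s) `^ p by rewrite /W -powRrM mulN1r.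
    apply: powR_ge_le; rewrite ?powR_ge0 ?(ltW p0)//.
    by apply: le_trans (HW1 _ csr3); exact: ler_norm.
  rewrite /F1.
  have -> : (p - 1) * (2 `^ p * W1 `^ p) * C3 * (B1 / phiF) ^+ 2 * k ^+ 2 =
    ((p - 1) * (2 `^ p * W1 `^ p)) * (C3 * ((B1 / phiF) ^+ 2 * k ^+ 2)) by ring.
  apply: ler_pM; [by nonneg|by nonneg| |].
    by rewrite ler_wpM2l// ltW.
  by rewrite ler_wpM2l.
have Wdiff : `|c * W (c * s) - W s| <= (CW * rho + W1) * `|k|.
  have -> : c * W (c * s) - W s = (W (c * s) - W s) - k * W (c * s) by rewrite /c; ring.
  apply: le_trans (ler_normB _ _) _; rewrite [leRHS]mulrDl; apply: lerD.
    apply: le_trans (HCW _ _ csr3 sr3) _.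
    rewrite csE (_ : s - k * s - s = - (k * s)); last ring.
    rewrite normrN normrM (gtr0_norm s0) -mulrA ler_wpM2l// mulrC ler_wpM2r//.
  by rewrite normrM mulrC ler_wpM2r// HW1.
have k2E : `|k| * `|k| = k ^+ 2 by rewrite -expr2 real_normK// num_real.
pose Q := dg s + n%:R * g s / s.
have bQ : b * Q <= k * beta * Q + C1 * Q2 * k ^+ 2.
  have : `|(b - k * beta) * Q| <= C1 * k ^+ 2 * Q2.
    by rewrite normrM; apply: ler_pM => //; exact: HQ2.
  by rewrite ler_norml => /andP[_]; isolate; lra.
have cW2 : `|c * W (c * s)| <= 2 * W1.
  by rewrite normrM (gtr0_norm cpos); apply: ler_pM; rewrite ?(ltW cpos)// HW1.
have bW : b * g s * (c * W (c * s)) <= k * beta * (g s * W s) + (C1 * (2 * W1) + `|beta| * (CW * rho + W1)) * k ^+ 2.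
  have h1 : `|(b - k * beta) * (c * W (c * s)) * g s| <= C1 * k ^+ 2 * (2 * W1).
    rewrite normrM (ger0_norm ga) normrM.
    apply: le_trans (ler_piMr _ gb) _; first by rewrite mulr_ge0.
    exact: ler_pM.
  have h2 : `|k * beta * (c * W (c * s) - W s) * g s| <= `|k| * `|beta| * ((CW * rho + W1) * `|k|).
    rewrite normrM (ger0_norm ga) !normrM.
    apply: le_trans (ler_piMr _ gb) _; first by rewrite !mulr_ge0.
    by rewrite ler_wpM2l ?mulr_ge0.
  have e2 : `|k| * `|beta| * ((CW * rho + W1) * `|k|) = `|beta| * (CW * rho + W1) * k ^+ 2.
    by rewrite -k2E; ring.
  rewrite e2 in h2.
  move: h1 h2; rewrite !ler_norml => /andP[_ h1] /andP[_ h2].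
  have -> : b * g s * (c * W (c * s)) = k * beta * (g s * W s) +
    ((b - k * beta) * (c * W (c * s)) * g s + k * beta * (c * W (c * s) - W s) * g s) by ring.
  by rewrite mulrDl; move: h1 h2; isolate; lra.
have xF : (p - 1) * F s `^ (p / (p - 1)) * (p / (p - 1) * x) = p * (b * g s * (c * W (c * s))).
  by rewrite FpW /x; field; rewrite !gt_eqF.
have Pbig : (p - 1) * (F s + b * g s) `^ (p / (p - 1)) <=
   (p - 1) * F s `^ (p / (p - 1)) + p * (b * g s * (c * W (c * s))) + F1 * k ^+ 2.
  rewrite PE mulrA; apply: le_trans (ler_wpM2l _ Ple) _.
    by rewrite mulr_ge0 ?powR_ge0// ltW.
  by rewrite !mulrDr mulr1 xF; move: FpF; isolate; lra.
have pbW := ler_wpM2l (ltW p0) bW.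
have FE := Feq s rcs s0.
rewrite /mm0 -/Q.
have E3 : dF s + b * dg s + n%:R * (F s + b * g s) / s = (dF s + n%:R * F s / s) + b * Q.
  by rewrite /Q; field; rewrite gt_eqF.
rewrite E3; rewrite mulrDr in pbW.
have -> : 1 + k * (- p + beta * (Q + p * (g s * W s))) + C * k ^+ 2 =
  1 - k * p + C2 * k ^+ 2 + (k * beta * Q + C1 * Q2 * k ^+ 2) +
  (p * (k * beta * (g s * W s)) + p * ((C1 * (2 * W1) + `|beta| * (CW * rho + W1)) * k ^+ 2)) + F1 * k ^+ 2.
  by rewrite /C; ring.
by move: FE bQ Pbig pbW cpk; isolate; lra.
Qed.

End profile.

Section ge0_integral_fin.
Context d (T : measurableType d) (R : realType) (mu : {measure set T -> \bar R}).
Variables (D : set T) (mD : measurable D) (f : T -> R).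
Hypotheses (mf : measurable_fun D f) (f0 : forall x, 0 <= f x).

Lemma ge0_integralZl_fin (k : R) : 0 <= k ->
  (\int[mu]_(x in D) (k * f x)%:E = k%:E * \int[mu]_(x in D) (f x)%:E)%E.
Proof.
move=> k0; under eq_integral do rewrite EFinM.
rewrite ge0_integralZl//; first exact/measurable_EFinP.
by move=> x _; rewrite lee_fin.
Qed.

Lemma ge0_integralD_fin (g : T -> R) : measurable_fun D g -> (forall x, 0 <= g x) ->
  (\int[mu]_(x in D) (f x + g x)%:E = \int[mu]_(x in D) (f x)%:E + \int[mu]_(x in D) (g x)%:E)%E.
Proof.
move=> mg g0; under eq_integral do rewrite EFinD.
rewrite ge0_integralD//.
- by move=> x _; rewrite lee_fin.
- exact/measurable_EFinP.
- by move=> x _; rewrite lee_fin.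
- exact/measurable_EFinP.
Qed.

Lemma ge0_le_integral_fin (g : T -> R) : measurable_fun D g -> (forall x, D x -> f x <= g x) ->
  (\int[mu]_(x in D) (f x)%:E <= \int[mu]_(x in D) (g x)%:E)%E.
Proof.
move=> mg fg; apply: ge0_le_integral => //.
- by move=> x _; rewrite lee_fin.
- exact/measurable_EFinP.
- exact/measurable_EFinP.
Qed.

End ge0_integral_fin.

Lemma tang_le (R : realType) (N : nat) (g e : 'rV[R]_N) : tang g e <= enorm g.
Proof. by rewrite enormE /tang ler_wsqrtr// gerBl sqr_ge0. Qed.

(** * Ball integrals as integrals over concentric spheres *)

Section polar_swap.
Context (R : realType) (n : nat) (rho : R) (rho0 : 0 < rho).
Local Notation N := n.+1.
Local Notation leb := (lebesgue_rV R N).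
Local Notation D := (@punctured_ball R n rho).

Lemma polar_swap (g : 'rV[R]_N -> R) : measurable_fun setT g -> (forall x, 0 <= g x) ->
  (\int[leb]_(x in eball N rho) (g x)%:E = (N%:R / rho ^+ N)%:E *
    \int[@lebesgue_measure R]_(s in `[0%R, rho]) \int[leb]_(x in D) (g (ray x s) * s ^+ n)%:E)%E.
Proof.
move=> mg g0; rewrite (polar_eball rho0 mg g0); congr (_ * _)%E.
apply: (@tonelli_on _ _ _ _ R leb (@lebesgue_measure R)
  (fun q : 'rV[R]_N * measurableTypeR R => (g (ray q.1 q.2) * q.2 ^+ n)%:E) D `[0, rho]) => //.
- apply/measurable_EFinP; apply: measurable_funM; first exact: (measurableT_comp mg (@measurable_ray2 R n)).
  by apply: measurable_funX; exact: measurable_snd.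
- exact: measurable_punctured_ball.
- by move=> x s _ /=; rewrite in_itv/= => /andP[s0 _]; rewrite lee_fin mulr_ge0// exprn_ge0.
Qed.

Lemma ball_le_sections (f g : 'rV[R]_N -> R) : measurable_fun setT f -> (forall x, 0 <= f x) ->
  measurable_fun setT g -> (forall x, 0 <= g x) ->
  (forall s, 0 < s <= rho -> (\int[leb]_(x in D) (f (ray x s))%:E <= \int[leb]_(x in D) (g (ray x s))%:E)%E) ->
  (0 < n)%N ->
  (\int[leb]_(x in eball N rho) (f x)%:E <= \int[leb]_(x in eball N rho) (g x)%:E)%E.
Proof.
move=> mf f0 mg g0 H n0; rewrite !polar_swap//.
apply: lee_wpmul2l; first by rewrite lee_fin divr_ge0// exprn_ge0// ltW.
have mD := @measurable_punctured_ball R n rho.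
have mS (k : 'rV[R]_N -> R) : measurable_fun setT k -> (forall x, 0 <= k x) ->
    measurable_fun `[0, rho] (fun s : measurableTypeR R => \int[leb]_(x in D) (k (ray x s) * s ^+ n)%:E)%E.
  move=> mk k0.
  apply: (@eq_measurable_fun _ _ _ _ _ (fun s : measurableTypeR R => \int[leb]_(x in D) (k (ray x s) * `|s| ^+ n)%:E)%E).
    move=> s; rewrite inE/= in_itv/= => /andP[s0 _]; by rewrite ger0_norm.
  apply: measurable_funTS.
  refine (@measurable_integral_param _ _ _ _ R leb (fun q : measurableTypeR R * 'rV[R]_N => (k (ray q.2 q.1) * `|q.1| ^+ n)%:E) D _ _ _) => //.
    apply/measurable_EFinP; apply: measurable_funM.
      exact: (measurableT_comp mk (measurableT_comp (@measurable_ray2 R n) (@measurable_swap _ _ (measurableTypeR R) 'rV[R]_N))).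
    apply: measurable_funX; apply: (measurableT_comp (@normr_measurable R setT)).
    exact: measurable_fst.
  by move=> q _; rewrite lee_fin mulr_ge0// exprn_ge0.
apply: ge0_le_integral => //.
- move=> s; rewrite /= in_itv/= => /andP[s0 _]; apply: integral_ge0 => x _.
  by rewrite lee_fin mulr_ge0// exprn_ge0.
- exact: mS.
- exact: mS.
move=> s; rewrite /= in_itv/= => /andP[s0 sr].
move: s0; rewrite le_eqVlt => /predU1P[<-|s0].
  rewrite expr0n eqn0Ngt n0/=; under eq_integral do rewrite mulr0.
  by under [leRHS]eq_integral do rewrite mulr0.
have E (k : 'rV[R]_N -> R) : measurable_fun setT k -> (forall x, 0 <= k x) ->
    (\int[leb]_(x in D) (k (ray x s) * s ^+ n)%:E = (s ^+ n)%:E * \int[leb]_(x in D) (k (ray x s))%:E)%E.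
  move=> mk k0; under eq_integral do rewrite mulrC.
  apply: ge0_integralZl_fin => //; last by rewrite exprn_ge0// ltW.
  by apply: measurable_funTS; exact: (measurableT_comp mk (measurable_ray s)).
rewrite !E//; apply: lee_wpmul2l; first by rewrite lee_fin exprn_ge0// ltW.
by apply: H; rewrite s0.
Qed.

End polar_swap.

(** The way in which the mean value zero enters both bounds: an integrand affine in [h] contributes
    only its constant part. *)
Lemma integral_affine_mean0 (R : realType) (n : nat) (rho : R) (h : 'rV[R]_n.+1 -> R) (Hm a b : R) :
  measurable_fun setT h -> (forall x, `|h x| <= Hm) ->
  (\int[lebesgue_rV R n.+1]_(x in @punctured_ball R n rho) (h x)%:E = 0)%E ->
  (\int[lebesgue_rV R n.+1]_(x in @punctured_ball R n rho) (b + a * h x)%:E =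
   b%:E * lebesgue_rV R n.+1 (@punctured_ball R n rho))%E.
Proof.
move=> mh hH h_int; set D := punctured_ball rho; set leb := lebesgue_rV R n.+1.
have mD : measurable D by exact: measurable_punctured_ball.
have Doo : (leb D < +oo)%E by exact: lebesgue_punctured_ball_lty.
have Hm0 : 0 <= Hm by exact: le_trans (normr_ge0 (h 0)) (hH 0).
have icst (k : R) : leb.-integrable D (EFin \o cst k).
  apply/integrableP; split; first by apply/measurable_EFinP; exact: measurable_cst.
  rewrite (_ : (fun x => _) = cst `|k|%:E)// integral_cst//.
  by rewrite lte_mul_pinfty// lee_fin.
have ih : leb.-integrable D (EFin \o h).
  apply: (@le_integrable _ _ _ _ _ mD _ (EFin \o cst Hm)) => //.
  - by apply/measurable_EFinP; exact: measurable_funTS.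
  - by move=> x _ /=; rewrite lee_fin (ger0_norm Hm0).
under eq_integral do rewrite EFinD EFinM.
rewrite integralD//=; [|exact: (icst b)|exact: integrableZl].
by rewrite integralZl//= h_int mule0 adde0 integral_cst.
Qed.

(** * The calibrated lower bound *)

Section lower_bound.
Context (R : realType) (m : nat) (p r rho : R).
Hypotheses (p1 : 1 < p) (r0 : 0 < r) (rrho : r < rho).
Local Notation N := m.+2.
Local Notation leb := (lebesgue_rV R N).
Local Notation rV := ('rV[R]_N).
Local Notation D := (@punctured_ball R m.+1 rho).
Local Notation ball := (eball N rho : set rV).
Local Notation bd := (bdry (eball N rho) : set rV).
Local Notation surf := (sphere_measure N rho : set rV -> \bar R).
Local Notation en := (@energy R N p ball).
Variables (z : R -> R) (M : R).
Hypothesis M0 : 0 < M.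
Hypothesis dz : forall x, r < x -> is_derive x 1 z (1 + m.+1%:R / (p - 1) * z x / x - z x `^ p / (p - 1)).
Hypothesis zM : forall x, r < x -> 0 < z x <= M.
Variables (h : rV -> R) (Hm : R).
Hypotheses (mh : measurable_fun setT h) (hH : forall x, `|h x| <= Hm).
Hypothesis h_ray : forall x s, x != 0 -> 0 < s -> h (ray x s) = h x.
Hypothesis h_int : (\int[leb]_(x in D) (h x)%:E = 0)%E.

Let p0 : 0 < p. Proof. exact: lt_trans p1. Qed.
Let p10 : 0 < p - 1. Proof. by rewrite subr_gt0. Qed.
Let rho0 : 0 < rho. Proof. exact: lt_trans rrho. Qed.
Let Hm0 : 0 <= Hm. Proof. exact: le_trans (normr_ge0 (h 0)) (hH 0). Qed.
Let mD := @measurable_punctured_ball R m.+1 rho.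

(* [q] absorbs the tangential part [eps] of the calibrating field. *)
Let ray_young (G U T us Phi phi eps K q : R) : 0 <= G -> 0 <= U -> 0 <= T -> 0 < phi -> phi <= Phi ->
  G ^+ 2 = us ^+ 2 + T ^+ 2 -> 0 <= eps -> q = 1 + K * eps ^+ 2 -> q <= 2 ->
  K = (2 * (2 `^ (- p) * phi) ^+ 2)^-1 ->
  p * U `^ (p - 1) * `|us| * (q `^ (- p) * Phi) + p * (U `^ (p - 1) * T) * eps <=
  G `^ p + (p - 1) * (U `^ p * (q `^ (- p) * Phi `^ (p / (p - 1)))).
Proof.
move=> G0 U0 T0 ph0 phP GE e0 qE q2 KE.
have Phi0 : 0 < Phi by exact: lt_le_trans phP.
have f0 : 0 < 2 `^ (- p) * phi by rewrite mulr_gt0// powR_gt0.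
have K0 : 0 < K by rewrite KE invr_gt0 mulr_gt0// exprn_gt0.
have q1 : 1 <= q by rewrite qE lerDl mulr_ge0 ?sqr_ge0// ltW.
have q0 : 0 < q by exact: lt_le_trans q1.
pose P := q `^ (- p) * Phi.
have Pf : 2 `^ (- p) * phi <= P.
  apply: ler_pM; rewrite ?powR_ge0 ?(ltW ph0)//.
  by rewrite !powRN lef_pV2 ?posrE ?powR_gt0//; apply: powR_ge_le; rewrite ?(ltW p0) ?(ltW q0).
have P0 : 0 < P by exact: lt_le_trans Pf.
have Peps : P ^+ 2 + eps ^+ 2 <= (P * q) ^+ 2.
  have h1 : eps ^+ 2 <= 2 * K * eps ^+ 2 * P ^+ 2.
    have : 1 <= 2 * K * P ^+ 2.
      have : (2 `^ (- p) * phi) ^+ 2 <= P ^+ 2 by rewrite lerXn2r ?nnegrE ?(ltW f0) ?(ltW P0).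
      move=> hh; have -> : 2 * K * P ^+ 2 = P ^+ 2 / (2 `^ (- p) * phi) ^+ 2.
        by rewrite KE; field; rewrite !gt_eqF// powR_gt0.
      by rewrite ler_pdivlMr ?mul1r// exprn_gt0.
    by move=> hh; have := ler_wpM2r (sqr_ge0 eps) hh; rewrite mul1r; lra.
  have h2 : 0 <= (K * eps ^+ 2 * P) ^+ 2 by exact: sqr_ge0.
  have -> : (P * q) ^+ 2 = P ^+ 2 + 2 * K * eps ^+ 2 * P ^+ 2 + (K * eps ^+ 2 * P) ^+ 2 by rewrite qE; ring.
  by lra.
have CS : `|us| * P + T * eps <= G * (P * q).
  have Pq : 0 <= P * q by rewrite mulr_ge0// ltW.
  rewrite -(@ler_pXn2r _ 2)// ?nnegrE; last 2 first.
  - by rewrite addr_ge0// mulr_ge0// ltW.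
  - by rewrite mulr_ge0.
  rewrite [leRHS]exprMn GE -(real_normK (num_real us)).
  apply: le_trans (ler_wpM2l _ Peps); last by rewrite addr_ge0 ?sqr_ge0.
  have : 0 <= (`|us| * eps - T * P) ^+ 2 by exact: sqr_ge0.
  rewrite -subr_ge0; congr (0 <= _); ring.
have -> : p * U `^ (p - 1) * `|us| * (q `^ (- p) * Phi) + p * (U `^ (p - 1) * T) * eps =
   p * (U `^ (p - 1)) * (`|us| * P + T * eps) by rewrite /P; ring.
apply: (@le_trans _ _ (p * (G * (U `^ (p - 1) * (P * q))))).
  have := ler_wpM2l (_ : 0 <= p * U `^ (p - 1)) CS.
  rewrite mulr_ge0 ?powR_ge0 ?(ltW p0)// => /(_ isT).
  by congr (_ <= _); ring.
apply: le_trans (young p1 G0 _) _; first by nonneg.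
rewrite lerD2l ler_wpM2l ?(ltW p10)// powRM ?powR_ge0//; last by rewrite mulr_ge0 ?(ltW P0) ?(ltW q0).
rewrite -powRrM (_ : (p - 1) * (p / (p - 1)) = p); last by rewrite mulrC divfK// gt_eqF.
rewrite ler_wpM2l ?powR_ge0//.
have -> : P * q = q `^ (1 - p) * Phi.
  by rewrite /P -(powR_mulD (- p) q0); ring.
rewrite powRM ?powR_ge0 ?(ltW Phi0)// -powRrM.
by rewrite (_ : (1 - p) * (p / (p - 1)) = - p)//; field; rewrite gt_eqF.
Qed.

Section calibration.
Variables (mm : R -> R) (k0 C1 Mm phi t e E3 eps K q : R) (A : set rV) (u : rV -> R).
Hypotheses (cmm : continuous mm) (k02 : k0 <= 2^-1) (C10 : 0 <= C1) (phi0 : 0 < phi).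
Hypothesis mmM : forall s, `|mm s| <= Mm.
Hypothesis Hprof : forall k, `|k| <= k0 -> exists Phi dPhi, Phi rho = flux p z rho /\
   forall s, r / (1 - k) < s -> s <= rho ->
    [/\ is_derive s 1 Phi (dPhi s), phi <= Phi s &
     dPhi s + m.+1%:R * Phi s / s + (p - 1) * Phi s `^ (p / (p - 1)) <= 1 + k * mm s + C1 * k ^+ 2].
Let Mg := Hm * Mm.
Hypotheses (t0 : 0 <= t) (e0 : 0 < e).
Hypothesis tk : (t * Hm + 2 * e) / r <= k0.
Hypothesis tr : r + t * Hm <= rho.
Hypothesis tre : (t * Hm + 2 * e) ^+ 2 < r * e.
Hypothesis tMg : t / r * Mg <= 2^-1.
Hypothesis epsE : eps = t / r * Mg * (4 * 2 ^+ N * N%:R) * rho.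
Hypothesis eps_p : eps * (1 + p) <= 2^-1.
Hypothesis KE : K = (2 * (2 `^ (- p) * phi) ^+ 2)^-1.
Hypothesis qE : q = 1 + K * eps ^+ 2.
Hypothesis q2 : q <= 2.
Hypothesis E3E : E3 = 2 * e * Mm / r + C1 * ((t * Hm + 2 * e) / r) ^+ 2.
Hypothesis HA : forall x, x != 0 -> enorm x < r + t * h x - e -> A x.
Hypotheses (su : smooth u) (uA : forall x, A x -> u x = 0).

Let Mm0 : 0 <= Mm. Proof. exact: le_trans (normr_ge0 _) (mmM 0). Qed.
Let Mg0 : 0 <= Mg. Proof. exact: mulr_ge0. Qed.
Let tr0 : 0 <= t / r. Proof. by rewrite divr_ge0// ltW. Qed.
Let eps0 : 0 <= eps. Proof. by rewrite epsE; nonneg. Qed.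
Let E30 : 0 <= E3. Proof. by rewrite E3E; nonneg. Qed.
Let hmm x s : `|h x * mm s| <= Mg. Proof. by rewrite normrM; apply: ler_pM. Qed.

Let base_ge x s : 2^-1 <= 1 + t / r * (h x * mm s) + E3.
Proof.
have h1 : `|t / r * (h x * mm s)| <= 2^-1.
  by rewrite normrM (ger0_norm tr0); apply: le_trans tMg; apply: ler_wpM2l.
by have E := E30; move: h1; rewrite ler_norml => /andP[]; lra.
Qed.

(** The energy density with its first-order perturbation by the graph, minus a tangential part that
    is set aside for [ray_poincare]. *)
Definition calib (G U T hx s : R) :=
  G `^ p + U `^ p * (1 + t / r * (hx * mm s) + E3) - eps * (p * (U `^ (p - 1) * T)).

(** By Young's inequality and [eps * (1 + p) <= 1/2], the subtracted term is at most half of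
    [G^p + U^p]. Nonnegativity is wanted for polar integration and for extending the ray integral
    down to 0. *)
Let calib_ge0 (G U T : R) x s : 0 <= G -> 0 <= U -> T <= G -> 0 <= calib G U T (h x) s.
Proof.
move=> G0 U0 TG; rewrite /calib.
have h1 : p * (U `^ (p - 1) * T) <= G `^ p + (p - 1) * U `^ p.
  apply: le_trans (young_ge p1 G0 U0); rewrite ler_wpM2l ?(ltW p0)// mulrC.
  by rewrite ler_wpM2r ?powR_ge0.
have h2 := ler_wpM2l eps0 h1.
have b2 := base_ge x s.
have Gp := powR_ge0 G p; have Up := powR_ge0 U p.
have epp : 0 <= eps * p by apply: mulr_ge0 => //; exact: ltW.
have ep := eps_p; rewrite mulrDr mulr1 in ep; have ee0 := eps0.
have h5 : eps * G `^ p <= 2^-1 * G `^ p by apply: ler_wpM2r => //; lra.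
have h6 : eps * (p - 1) * U `^ p <= 2^-1 * U `^ p by apply: ler_wpM2r => //; rewrite mulrBr mulr1; lra.
have h7 := ler_wpM2l Up b2.
rewrite mulrDr mulrA in h2; lra.
Qed.

Let ef y := calib (enorm (grad u y)) `|u y| (tang (grad u y) (dir y)) (h y) (enorm y).

Let ef_ge0 y : 0 <= ef y.
Proof. by apply: calib_ge0; [exact: enorm_ge0|exact: normr_ge0|exact: tang_le]. Qed.

Let mhm : measurable_fun setT (fun y => h y * mm (enorm y)).
Proof.
apply: measurable_funM => //; apply: (measurableT_comp _ (@measurable_enorm R N)).
exact: continuous_measurable_fun.
Qed.

Let mGp : measurable_fun setT (fun y => enorm (grad u y) `^ p).
Proof.
apply: (@measurableT_comp _ _ _ _ _ _ (fun y : R => y `^ p)); first exact: measurable_powR.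
by apply: continuous_measurable_rV; exact: continuous_enorm_grad.
Qed.

Let mUp : measurable_fun setT (fun y => `|u y| `^ p).
Proof. exact: measurable_powR_smooth. Qed.

Let mtd : measurable_fun setT (tang_density p u).
Proof. exact: measurable_tang_density. Qed.

Let mef : measurable_fun setT ef.
Proof.
apply: measurable_funB; last exact: measurable_funM.
apply: measurable_funD; first exact: mGp.
apply: measurable_funM; first exact: mUp.
by apply: measurable_funD => //; apply: measurable_funD => //; exact: measurable_funM.
Qed.

(** [ray_young] combined with the profile inequality for the weight [q^(-p) Phi]. The gap between
    [k] and [t h / r] and the term in [k^2] make up [E3]. *)
Let calib_ineq (x : rV) (G U T us Phi dPhi k s : R) : 0 <= G -> 0 <= U -> 0 <= T -> T <= G ->
  G ^+ 2 = us ^+ 2 + T ^+ 2 -> phi <= Phi -> k = (t * h x - 2 * e) / r ->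
  dPhi + m.+1%:R * Phi / s + (p - 1) * Phi `^ (p / (p - 1)) <= 1 + k * mm s + C1 * k ^+ 2 ->
  p * U `^ (p - 1) * `|us| * `|q `^ (- p) * Phi| + U `^ p * (q `^ (- p) * dPhi + m.+1%:R * (q `^ (- p) * Phi) / s)
   <= calib G U T (h x) s.
Proof.
move=> G0 U0 T0 TG GE phP kE HB.
have q1 : 1 <= q by rewrite qE lerDl mulr_ge0 ?sqr_ge0// KE; nonneg.
have q0 : 0 < q by exact: lt_le_trans q1.
have Y := ray_young G0 U0 T0 phi0 phP GE eps0 qE q2 KE.
have Phi0 : 0 < Phi by exact: lt_le_trans phP.
rewrite (ger0_norm (mulr_ge0 (powR_ge0 q (- p)) (ltW Phi0))).
have Q0 := powR_ge0 q (- p).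
have Q1 : q `^ (- p) <= 1.
  have one : (1 : R) `^ p = 1 by rewrite powR1.
  rewrite powRN invf_le1 ?powR_gt0// -one; apply: powR_ge_le => //; exact: ltW.
pose B := 1 + t / r * (h x * mm s) + E3.
have B0 : 0 <= B by have := base_ge x s; rewrite /B; lra.
have kB : 1 + k * mm s + C1 * k ^+ 2 <= B.
  have h1 : k * mm s <= t / r * (h x * mm s) + 2 * e * Mm / r.
    have -> : k * mm s = t / r * (h x * mm s) + 2 * e / r * (- mm s) by rewrite kE; field; rewrite gt_eqF.
    rewrite lerD2l (mulrAC _ Mm) ler_wpM2l//; first by nonneg.
    by apply: le_trans (mmM s); rewrite -normrN ler_norm.
  have h2 : k ^+ 2 <= ((t * Hm + 2 * e) / r) ^+ 2.
    have b0 : 0 <= (t * Hm + 2 * e) / r by nonneg.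
    rewrite -(real_normK (num_real k)) lerXn2r ?nnegrE//.
    rewrite kE normrM normfV (gtr0_norm r0) ler_wpM2r ?invr_ge0 ?(ltW r0)//.
    apply: le_trans (ler_normB _ _) _; rewrite normrM (ger0_norm t0) (ger0_norm (_ : 0 <= 2 * e)); last by nonneg.
    by rewrite lerD2r ler_wpM2l.
  have := ler_wpM2l C10 h2; rewrite /B E3E; lra.
have BB : q `^ (- p) * (dPhi + m.+1%:R * Phi / s + (p - 1) * Phi `^ (p / (p - 1))) <= B.
  apply: le_trans (ler_wpM2l Q0 (le_trans HB kB)) _.
  by rewrite ler_piMl.
have := ler_wpM2l (powR_ge0 U p) BB.
rewrite /calib -/B => h1.
have -> : U `^ p * (q `^ (- p) * dPhi + m.+1%:R * (q `^ (- p) * Phi) / s) =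
  U `^ p * (q `^ (- p) * (dPhi + m.+1%:R * Phi / s + (p - 1) * Phi `^ (p / (p - 1)))) -
  (p - 1) * (U `^ p * (q `^ (- p) * Phi `^ (p / (p - 1)))) by ring.
rewrite (mulrC eps); lra.
Qed.

Let continuous_ray_calib (x : rV) : continuous (fun s =>
   calib (enorm (grad u (ray x s))) `|u (ray x s)| (tang (grad u (ray x s)) (dir x)) (h x) s * s ^+ m.+1).
Proof.
have cr : continuous (ray x) by exact: continuous_ray.
have cu : continuous (fun s => u (ray x s)).
  by move=> s; apply: (@continuous_comp _ _ _ (ray x) u); [exact: cr|exact: smooth_continuous].
have cup a : 0 < a -> continuous (fun s => `|u (ray x s)| `^ a).
  move=> a0 s; apply: (@continuous_comp _ _ _ (fun s => u (ray x s)) (fun y => `|y| `^ a)); first exact: cu.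
  exact: continuous_norm_powR.
have cG : continuous (fun s => enorm (grad u (ray x s)) `^ p).
  rewrite (_ : (fun _ => _) = (fun s => `|enorm (grad u (ray x s))| `^ p)); last first.
    by apply/funext => s; rewrite (ger0_norm (enorm_ge0 _)).
  move=> s; apply: (@continuous_comp _ _ _ (fun s => enorm (grad u (ray x s))) (fun y => `|y| `^ p)).
    apply: (@continuous_comp _ _ _ (ray x) (fun y => enorm (grad u y))); first exact: cr.
    exact: continuous_enorm_grad.
  exact: continuous_norm_powR.
have cT := continuous_tang_grad su cr (fun s => cvg_cst (dir x) : (fun _ : R => dir x) @ s --> _).
move=> s; apply: cvgM; last exact: exprn_continuous.
apply: cvgB; first apply: cvgD.
- exact: cG.
- apply: cvgM; first exact: cup.
  apply: cvgD; last exact: cvg_cst.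
  apply: cvgD; first exact: cvg_cst.
  by apply: cvgMr; apply: cvgMr; exact: cmm.
apply: cvgMr; apply: cvgMr; apply: cvgM; last exact: cT.
exact: cup.
Qed.

Let ray_estimate x : D x ->
  ((q `^ (- p) * flux p z rho * rho ^+ m.+1 * `|u (ray x rho)| `^ p)%:E <=
    \int[@lebesgue_measure R]_(s in `[0%R, rho]) (ef (ray x s) * s ^+ m.+1)%:E)%E.
Proof.
move=> Dx; have x0 := punctured_ball_neq0 Dx.
(* Aiming at [r + t h - 2 e] puts the singular radius [r / (1 - k)] strictly below the edge [r + d],
   [d = t h - e], of the inner hole: [(r + d)(1 - k) = r + e - d (d - e) / r], and [tre] keeps the
   quadratic term below [e]. *)
pose k := (t * h x - 2 * e) / r.
have := hH x; rewrite ler_norml => /andP[hx1 hx2].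
have th1 : t * h x <= t * Hm by apply: ler_wpM2l.
have th2 : - (t * Hm) <= t * h x by rewrite -mulrN; apply: ler_wpM2l.
have e0' := e0; have tHm : 0 <= t * Hm by exact: mulr_ge0.
have kk : `|k| <= k0.
  apply: le_trans tk; rewrite /k normrM normfV (gtr0_norm r0) ler_wpM2r ?invr_ge0 ?(ltW r0)//.
  by rewrite ler_norml; apply/andP; split; lra.
have k2 := k02.
have /andP[kl ku] : - 2^-1 <= k <= 2^-1 by rewrite -ler_norml; apply: le_trans kk _.
have [Phi [dPhi [PhiR HPhi]]] := Hprof kk.
pose d := t * h x - e; pose H := r + d.
have kd : k = (d - e) / r by rewrite /k /d; congr (_ / _); ring.
have rr := r0; have trr := tr.
have ck : 0 < 1 - k by lra.
have rH : r / (1 - k) < H.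
  rewrite ltr_pdivrMr//.
  have -> : H * (1 - k) = r + e - d * (d - e) / r by rewrite /H kd; field; rewrite gt_eqF.
  suff : d * (d - e) < r * e.
    by rewrite -ltr_pdivrMl// mulrC; lra.
  apply: le_lt_trans tre; rewrite expr2; apply: le_trans (ler_norm _) _; rewrite normrM.
  by apply: ler_pM => //; rewrite ler_norml /d; apply/andP; split; lra.
(* Between the singularity of [Phi] and the edge of the hole, [u] vanishes while [Phi] is finite. *)
pose a := (r / (1 - k) + H) / 2.
have ra : r / (1 - k) < a by rewrite /a; lra.
have aH : a < H by rewrite /a; lra.
have a0 : 0 < a by apply: lt_trans ra; rewrite divr_gt0.
have arho : a <= rho by rewrite (le_trans (ltW aH))// /H /d; lra.
have ua0 : u (ray x a) = 0.
  apply: uA; apply: HA.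
    by rewrite -enorm_eq0 enorm_ray ?(ltW a0)// gt_eqF.
  by rewrite enorm_ray ?(ltW a0)// h_ray//; apply: lt_le_trans aH _; rewrite /H /d; lra.
pose Kf s := calib (enorm (grad u (ray x s))) `|u (ray x s)| (tang (grad u (ray x s)) (dir x)) (h x) s * s ^+ m.+1.
have ex : enorm (dir x) = 1 by exact: enorm_dir.
have -> : (\int[@lebesgue_measure R]_(s in `[0%R, rho]) (ef (ray x s) * s ^+ m.+1)%:E =
   \int[@lebesgue_measure R]_(s in `[0%R, rho]) (Kf s)%:E)%E.
  apply: eq_integral => s; rewrite inE/= in_itv/= => /andP[s0 _].
  move: s0; rewrite le_eqVlt => /predU1P[<-|s0]; first by rewrite /Kf !expr0n !mulr0.
  by rewrite /ef /Kf h_ray// enorm_ray ?(ltW s0)// dir_ray.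
have := @ray_ineq R m.+1 rho p p1 u x a (fun s => q `^ (- p) * Phi s) (fun s => q `^ (- p) * dPhi s) Kf su.
rewrite PhiR; apply => //.
- by rewrite a0.
- by rewrite ua0 normr0 powR0 ?mul0r// gt_eqF.
- move=> s /andP[as' sr]; have [dP _ _] := HPhi s (lt_le_trans ra as') sr.
  exact: (@is_derive1_comp R _ _ s _ _ (is_derive_mull (q `^ (- p)) _) dP).
- exact: continuous_ray_calib.
- move=> s /andP[s0 _]; rewrite mulr_ge0 ?exprn_ge0//; apply: calib_ge0; first exact: enorm_ge0.
    exact: normr_ge0.
  exact: tang_le.
move=> s /andP[as' sr]; have s0 : 0 < s by exact: lt_trans as'.
have [_ phP HB] := HPhi s (lt_trans ra as') (ltW sr).
rewrite -mulrDl /Kf ler_wpM2r ?exprn_ge0 ?(ltW s0)//.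
apply: (@calib_ineq x _ _ _ _ (Phi s) (dPhi s) k s) => //.
- exact: enorm_ge0.
- exact: tang_ge0.
- exact: tang_le.
- by rewrite (tang2 _ ex).
Qed.

(** The identity [ef + f2 = f3 + f4] regroups the energy into nonnegative functions. Once [f4] is
    known to have the smaller integral than [f2], the first-order term is gone and [f3] alone bounds
    [ef]. *)
Let f2 y := t / r * ((Mg - h y * mm (enorm y)) * `|u y| `^ p) + eps * tang_density p u y.
Let f3 y := enorm (grad u y) `^ p + (1 + E3) * `|u y| `^ p.
Let f4 y := t / r * (Mg * `|u y| `^ p).

Let Mgh y s : 0 <= Mg - h y * mm s.
Proof. by rewrite subr_ge0; apply: le_trans (hmm y s); exact: ler_norm. Qed.

Let f2_ge0 y : 0 <= f2 y.
Proof.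
rewrite addr_ge0// mulr_ge0//; first by rewrite mulr_ge0 ?powR_ge0.
exact: tang_density_ge0.
Qed.

Let mf2 : measurable_fun setT f2.
Proof.
apply: measurable_funD; last exact: measurable_funM.
by apply: measurable_funM => //; apply: measurable_funM => //; exact: measurable_funB.
Qed.

Let f4_ge0 y : 0 <= f4 y. Proof. by rewrite /f4; nonneg. Qed.
Let f3_ge0 y : 0 <= f3 y. Proof. by rewrite /f3; nonneg. Qed.
Let mf3 : measurable_fun setT f3.
Proof. by apply: measurable_funD => //; exact: measurable_funM. Qed.
Let mf4 : measurable_fun setT f4.
Proof. by apply: measurable_funM => //; exact: measurable_funM. Qed.

(** On the sphere of radius [s] the weight [- mm s * h] is bounded by [Mg] and has mean zero, so
    [ray_poincare] applies; [eps] is its constant with [s] replaced by [rho]. *)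
Let f4_le_f2 : (\int[leb]_(x in ball) (f4 x)%:E <= \int[leb]_(x in ball) (f2 x)%:E)%E.
Proof.
apply: ball_le_sections => // s /andP[s0 sr].
have mr (k : rV -> R) : measurable_fun setT k -> measurable_fun D (fun x => (k (ray x s))%:E).
  move=> mk; apply/measurable_EFinP; apply: measurable_funTS.
  exact: (measurableT_comp mk (measurable_ray s)).
have gM x : `|- mm s * h x| <= Mg.
  by rewrite mulNr normrN mulrC.
have ab : `|- mm s| * Hm <= Mg by rewrite normrN mulrC ler_wpM2l.
have mg : measurable_fun setT (fun x => - mm s * h x) by exact: measurable_funM.
have P := ray_poincare rho0 p1 su (ltW s0) Mg0 mg gM (integral_affine_mean0 _ _ mh hH h_int).
have tr0' : (0 <= (t / r)%:E)%E by rewrite lee_fin.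
have {}P := lee_wpmul2l tr0' P.
have mW : measurable_fun setT (fun y : rV => `|u y| `^ p) by exact: mUp.
have mW' : measurable_fun D (fun x => `|u (ray x s)| `^ p) by apply/measurable_EFinP; exact: (mr _ mUp).
have mtd' : measurable_fun D (fun x => tang_density p u (ray x s)) by apply/measurable_EFinP; exact: (mr _ mtd).
have mMW : measurable_fun D (fun x => (Mg + - mm s * h x) * `|u (ray x s)| `^ p).
  by apply: measurable_funM => //; apply: measurable_funTS; exact: measurable_funD.
have g0 x : 0 <= Mg + - mm s * h x.
  by have := gM x; rewrite ler_norml => /andP[]; lra.
have td0 x : 0 <= tang_density p u (ray x s) by exact: tang_density_ge0.
have E4 : (\int[leb]_(x in D) (f4 (ray x s))%:E =
    (t / r)%:E * (Mg%:E * \int[leb]_(x in D) (`|u (ray x s)| `^ p)%:E))%E.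
  rewrite muleA -EFinM -ge0_integralZl_fin//; last by exact: mulr_ge0.
  by apply: eq_integral => x _; rewrite /f4 mulrA.
rewrite E4; apply: (le_trans P).
have E2 : (\int[leb]_(x in D) (f2 (ray x s))%:E =
  (t / r)%:E * \int[leb]_(x in D) ((Mg + - mm s * h x) * `|u (ray x s)| `^ p)%:E +
  eps%:E * \int[leb]_(x in D) (tang_density p u (ray x s))%:E)%E.
  rewrite -!ge0_integralZl_fin//; last by move=> x; rewrite mulr_ge0 ?powR_ge0.
  rewrite -ge0_integralD_fin//.
  - apply: eq_integral => x /set_mem Dx; have x0 := punctured_ball_neq0 Dx.
    by rewrite /f2 h_ray// enorm_ray ?(ltW s0)// mulNr (mulrC (mm s)).
  - exact: measurable_funM.
  - by move=> x; rewrite mulr_ge0// mulr_ge0 ?powR_ge0.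
  - exact: measurable_funM.
  - by move=> x; rewrite mulr_ge0.
have i1 : (0 <= \int[leb]_(x in D) ((Mg + - mm s * h x) * `|u (ray x s)| `^ p)%:E)%E.
  by apply: integral_ge0 => x _; rewrite lee_fin mulr_ge0 ?powR_ge0.
have i2 : (0 <= \int[leb]_(x in D) (tang_density p u (ray x s))%:E)%E.
  by apply: integral_ge0 => x _; rewrite lee_fin tang_density_ge0.
have c0 : 0 <= Mg * (4 * 2 ^+ N * N%:R) by nonneg.
rewrite E2 [leLHS]ge0_muleDr//; last by apply: mule_ge0; rewrite // lee_fin mulr_ge0// ltW.
apply: leeD => //; rewrite muleA -EFinM; apply: lee_wpmul2r => //.
rewrite lee_fin epsE (_ : t / r * Mg * (4 * 2 ^+ N * N%:R) * rho = t / r * (Mg * (4 * 2 ^+ N * N%:R) * rho)); last by rewrite !mulrA.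
by apply: ler_wpM2l => //; apply: ler_wpM2l.
Qed.

Lemma calibrated_lower_bound :
  ((q `^ (- p) * flux p z rho)%:E * \int[surf]_(x in bd) (`|u x| `^ p)%:E <=
   (1 + E3)%:E * en (u, grad u))%E.
Proof.
(* Finite energy makes the integral of [f4] finite, which allows it to be cancelled at the end. *)
have [->|enfin] := eqVneq (en (u, grad u)) +oo%E.
  by rewrite gt0_muley ?leey// lte_fin ltr_wpDr.
have enoo : (en (u, grad u) < +oo)%E by rewrite ltey.
have Q0 : 0 <= q `^ (- p) * flux p z rho by rewrite mulr_ge0 ?powR_ge0.
have mb : measurable (ball : set rV) by exact: measurable_eball.
have S1 := sphere_le_ball rho0 Q0 (measurable_funTS mUp) (fun x => powR_ge0 _ _) mef ef_ge0 ray_estimate.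
apply: (le_trans S1).
have SUM : (\int[leb]_(x in ball) (ef x)%:E + \int[leb]_(x in ball) (f2 x)%:E =
   \int[leb]_(x in ball) (f3 x)%:E + \int[leb]_(x in ball) (f4 x)%:E)%E.
  rewrite -!ge0_integralD_fin//; try exact: measurable_funTS.
  apply: eq_integral => y _; congr EFin.
  by rewrite /ef /f2 /f3 /f4 /calib /tang_density; ring.
have mE (c : R) : measurable_fun ball (fun x : rV => c * (enorm (grad u x) `^ p + `|u x| `^ p)).
  by apply: measurable_funTS; apply: measurable_funM => //; exact: measurable_funD.
have enE (c : R) : 0 <= c -> (c%:E * en (u, grad u) = \int[leb]_(x in ball) (c * (enorm (grad u x) `^ p + `|u x| `^ p))%:E)%E.
  move=> c0; rewrite ge0_integralZl_fin//.
    by apply: measurable_funTS; exact: measurable_funD.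
  by move=> x; rewrite addr_ge0 ?powR_ge0.
have f4fin : (\int[leb]_(x in ball) (f4 x)%:E)%E \is a fin_num.
  rewrite ge0_fin_numE; last by apply: integral_ge0 => x _; rewrite lee_fin.
  apply: (@le_lt_trans _ _ ((t / r * Mg)%:E * en (u, grad u))%E).
    rewrite (enE _ (mulr_ge0 tr0 Mg0)); apply: ge0_le_integral_fin => //; first exact: measurable_funTS.
    move=> x _; rewrite /f4 [leLHS]mulrA; apply: ler_wpM2l; first exact: mulr_ge0.
    by rewrite lerDr powR_ge0.
  by apply: lte_mul_pinfty => //; rewrite lee_fin mulr_ge0.
have f3le : (\int[leb]_(x in ball) (f3 x)%:E <= (1 + E3)%:E * en (u, grad u))%E.
  rewrite (enE _ (addr_ge0 ler01 E30)); apply: ge0_le_integral_fin => //; first exact: measurable_funTS.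
  by move=> x _; rewrite /f3 mulrDr lerD2r ler_peMl ?powR_ge0// lerDl.
apply: le_trans f3le.
rewrite -(leeD2rE _ _ f4fin) -SUM.
exact: leeD2l.
Qed.

End calibration.

Ltac isolate := clear -R m p r rho p1 r0 rrho z M M0 dz zM h Hm mh hH h_ray h_int p0 p10 rho0 Hm0 mD ray_young.

(** [e] is the allowed distance between the hole and the graph. It is kept independent of [t], up to
    [C * t^2 <= e], so that the undeformed ball, [t = 0], can be treated with the same [e]. *)
Theorem radial_lower_bound : exists C t0 e0, [/\ 0 < C, 0 < t0 & 0 < e0] /\
  forall t e (A : set rV), 0 <= t <= t0 -> 0 < e <= e0 -> C * t ^+ 2 <= e ->
  (forall x, x != 0 -> enorm x < r + t * h x - e -> A x) ->
  0 <= flux p z rho * (1 - C * (t ^+ 2 + e)) /\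
  forall u : rV -> R, smooth u -> (forall x, A x -> u x = 0) ->
    ((flux p z rho * (1 - C * (t ^+ 2 + e)))%:E * \int[surf]_(x in bd) (`|u x| `^ p)%:E <= en (u, grad u))%E.
Proof.
have [mm [k0 [C1 [Mm [phi [cmm [k00 k02 C10 Mm0 phi0] mmM Hprof]]]]]] :=
  lower_profile p1 r0 rrho M0 dz zM.
pose Mg := Hm * Mm; have Mg0 : 0 <= Mg by rewrite mulr_ge0.
(* With this [K] a radial field of size [P >= 2^(-p) phi] satisfies [P^2 + eps^2 <= (P q)^2] for
   [q = 1 + K eps^2]: the tangential component is paid for by a factor that differs from 1 by
   [O(t^2)]. *)
pose K := (2 * (2 `^ (- p) * phi) ^+ 2)^-1.
have K0 : 0 < K by rewrite invr_gt0 mulr_gt0// exprn_gt0// mulr_gt0// powR_gt0.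
have [Cq Cq0 HCq] := powR_quadratic (- p).
pose e1 := Mg * (4 * 2 ^+ N * N%:R) * rho / r.
have e10 : 0 <= e1 by rewrite /e1; nonneg.
(* In order: what [tre] demands of [e], the expansion of [q^(-p)], the two parts of [E3], and 1 for
   positivity. *)
pose C := 32 * Hm ^+ 2 / r + (p + Cq) * K * e1 ^+ 2 + 2 * Mm / r + C1 * (2 * Hm ^+ 2 + 8) / r ^+ 2 + 1.
have c_a : 0 <= 32 * Hm ^+ 2 / r by nonneg.
have c_b : 0 <= (p + Cq) * K * e1 ^+ 2 by nonneg.
have c_c : 0 <= 2 * Mm / r by nonneg.
have c_d : 0 <= C1 * (2 * Hm ^+ 2 + 8) / r ^+ 2 by nonneg.
have C0 : 0 < C by rewrite /C ltr_wpDl// !addr_ge0.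
have key (a b : R) : 0 <= a -> 0 < b -> exists2 s : R, 0 < s & forall t, 0 <= t <= s -> t * a <= b.
  move=> a0 b0; exists (b / (a + 1)); first by rewrite divr_gt0// ltr_wpDl.
  move=> t /andP[t0 ts]; apply: le_trans (_ : t * (a + 1) <= _); first by rewrite ler_wpM2l// lerDl.
  by rewrite -ler_pdivlMr// ltr_wpDl.
have half0 : 0 < (2^-1 : R) by rewrite invr_gt0.
have [s1 s10 S1] : exists2 s : R, 0 < s & forall t, 0 <= t <= s -> t * Hm <= r * k0 / 2.
  by apply: key => //; rewrite divr_gt0// mulr_gt0.
have [s2 s20 S2] : exists2 s : R, 0 < s & forall t, 0 <= t <= s -> t * Hm <= rho - r.
  by apply: key => //; rewrite subr_gt0.
have [s3 s30 S3] : exists2 s : R, 0 < s & forall t, 0 <= t <= s -> t * (e1 * (1 + p)) <= 2^-1.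
  by apply: key => //; nonneg.
have [s4 s40 S4] : exists2 s : R, 0 < s & forall t, 0 <= t <= s -> t * (Mg / r) <= 2^-1.
  by apply: key => //; nonneg.
have [s5 s50 S5] : exists2 s : R, 0 < s & forall t, 0 <= t <= s -> t * (K * e1 ^+ 2) <= 2^-1.
  by apply: key => //; nonneg.
have [s6 s60 S6] : exists2 s : R, 0 < s & forall t, 0 <= t <= s -> t * C <= 2^-1.
  by apply: key => //; exact: ltW.
pose t0 := Num.min (Num.min (Num.min s1 s2) (Num.min s3 s4)) (Num.min (Num.min s5 s6) 1).
pose e0 := Num.min (Num.min 1 (r * k0 / 4)) (Num.min (r / 32) ((2 * C)^-1)).
exists C, t0, e0; split.
  split => //; first by rewrite !lt_min s10 s20 s30 s40 s50 s60 ltr01.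
  by rewrite !lt_min ltr01 !divr_gt0 ?mulr_gt0//= invr_gt0 mulr_gt0.
move=> t e A /andP[tp tt0] /andP[ep ee0] te HA.
move: tt0; rewrite !le_min -!andbA => /and5P[l1 l2 l3 l4 /and3P[l5 l6 l7]].
move: ee0; rewrite !le_min -!andbA => /and4P[L1 L2 L3 L4].
have T1 : t * Hm <= r * k0 / 2 by apply: S1; rewrite tp.
have T2 : t * Hm <= rho - r by apply: S2; rewrite tp.
have T3 : t * (e1 * (1 + p)) <= 2^-1 by apply: S3; rewrite tp.
have T4 : t * (Mg / r) <= 2^-1 by apply: S4; rewrite tp.
have T5 : t * (K * e1 ^+ 2) <= 2^-1 by apply: S5; rewrite tp.
have T6 : t * C <= 2^-1 by apply: S6; rewrite tp.
have tt : t ^+ 2 <= t by rewrite expr2 ler_piMl.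
have t20 : 0 <= t ^+ 2 by exact: sqr_ge0.
have Ct2 : C * t ^+ 2 <= 2^-1.
  by apply: le_trans T6; rewrite mulrC ler_wpM2r// ltW.
have Ce : C * e <= 2^-1.
  move: L4; rewrite -[leRHS]mul1r ler_pdivlMr ?mulr_gt0//.
  by isolate; lra.
have fl0 : 0 < flux p z rho by rewrite /flux powR_gt0//; have /andP[] := zM rrho.
have C12 : 0 <= 1 - C * (t ^+ 2 + e) by rewrite mulrDr; move: Ct2 Ce; isolate; lra.
split; first by rewrite mulr_ge0// ltW.
move=> u su uA.
pose eps := t / r * Mg * (4 * 2 ^+ N * N%:R) * rho.
have epsE : eps = t * e1 by rewrite /eps /e1; ring.
pose q := 1 + K * eps ^+ 2.
pose E3 := 2 * e * Mm / r + C1 * ((t * Hm + 2 * e) / r) ^+ 2.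
have Keps : K * eps ^+ 2 = K * e1 ^+ 2 * t ^+ 2 by rewrite epsE; ring.
have Keps2 : K * eps ^+ 2 <= 2^-1.
  rewrite Keps; apply: le_trans T5; rewrite mulrC ler_wpM2r//; nonneg.
have Keps0 : 0 <= K * eps ^+ 2 by nonneg.
have q2 : q <= 2 by rewrite /q; move: Keps2; isolate; lra.
have ee : e ^+ 2 <= e * (r / 32) by rewrite expr2 ler_wpM2l// ltW.
have e1' : e ^+ 2 <= e by rewrite expr2 ler_piMl// ltW.
have e20 : 0 <= e ^+ 2 by exact: sqr_ge0.
have sq2 : (t * Hm + 2 * e) ^+ 2 <= 2 * (Hm ^+ 2 * t ^+ 2) + 8 * e ^+ 2.
  have : 0 <= (t * Hm - 2 * e) ^+ 2 by exact: sqr_ge0.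
  by rewrite -subr_ge0; congr (0 <= _); ring.
have B := calibrated_lower_bound cmm k02 C10 phi0 mmM Hprof tp ep _ _ _ _ (erefl eps) _ (erefl K) (erefl q) q2 (erefl E3) HA su uA.
have {}B : ((q `^ (- p) * flux p z rho)%:E * \int[surf]_(x in bd) (`|u x| `^ p)%:E <= (1 + E3)%:E * en (u, grad u))%E.
  apply: B.
  - by rewrite ler_pdivrMr//; move: T1 L2; isolate; lra.
  - by lra.
  - apply: (le_lt_trans sq2).
    have h1 : 32 * (Hm ^+ 2 * t ^+ 2) <= r * e.
      have : 32 * Hm ^+ 2 / r * t ^+ 2 <= e.
        apply: le_trans te; rewrite ler_wpM2r// /C -!addrA lerDl; nonneg.
      by rewrite mulrAC ler_pdivrMr// (mulrC r) mulrA.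
    have re : 0 < r * e by exact: mulr_gt0.
    have : e * (r / 32) = r * e / 32 by field.
    by move=> h2; rewrite h2 in ee; move: h1 re ee; isolate; lra.
  - by rewrite mulrAC -mulrA.
  - by rewrite epsE -mulrA.
have E30 : 0 <= E3 by rewrite /E3; nonneg.
have E31 : 0 < 1 + E3 by rewrite ltr_wpDr.
have q1 : 1 <= q by rewrite lerDl.
have qp : 1 - (p + Cq) * K * e1 ^+ 2 * t ^+ 2 <= q `^ (- p).
  have := HCq (K * eps ^+ 2); rewrite (ger0_norm Keps0) => /(_ Keps2).
  rewrite -/q ler_norml => /andP[h1 _].
  have h2 : (K * eps ^+ 2) ^+ 2 <= K * eps ^+ 2 by rewrite expr2 ler_piMl//; move: Keps2; isolate; lra.
  have := ler_wpM2l Cq0 h2.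
  have -> : (p + Cq) * K * e1 ^+ 2 * t ^+ 2 = p * (K * eps ^+ 2) + Cq * (K * eps ^+ 2) by rewrite Keps; ring.
  by rewrite mulNr in h1; move: h1; isolate; lra.
have E3le : E3 <= (2 * Mm / r) * e + C1 * (2 * Hm ^+ 2 + 8) / r ^+ 2 * (t ^+ 2 + e).
  rewrite /E3; apply: lerD; first by rewrite le_eqVlt; apply/orP; left; apply/eqP; ring.
  rewrite expr_div_n.
  have -> : C1 * (2 * Hm ^+ 2 + 8) / r ^+ 2 * (t ^+ 2 + e) = C1 * ((2 * Hm ^+ 2 + 8) * (t ^+ 2 + e) / r ^+ 2) by ring.
  rewrite ler_wpM2l// ler_wpM2r ?invr_ge0 ?sqr_ge0//; apply: (le_trans sq2).
  have : 0 <= Hm ^+ 2 * e by nonneg.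
  have -> : (2 * Hm ^+ 2 + 8) * (t ^+ 2 + e) = 2 * (Hm ^+ 2 * t ^+ 2) + 8 * e + 2 * (Hm ^+ 2 * e) + 8 * t ^+ 2 by ring.
  by move: e1' t20; isolate; lra.
have LL : (1 - C * (t ^+ 2 + e)) * (1 + E3) <= q `^ (- p).
  apply: le_trans qp.
  have h1 : C * (t ^+ 2 + e) >= E3 + (p + Cq) * K * e1 ^+ 2 * t ^+ 2.
    have te0 : 0 <= t ^+ 2 + e by rewrite addr_ge0// ltW.
    have h2 : (2 * Mm / r) * e <= (2 * Mm / r) * (t ^+ 2 + e) by rewrite ler_wpM2l// lerDr.
    have h3 : (p + Cq) * K * e1 ^+ 2 * t ^+ 2 <= (p + Cq) * K * e1 ^+ 2 * (t ^+ 2 + e).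
      by rewrite ler_wpM2l// lerDl ltW.
    have h4 : 0 <= 32 * Hm ^+ 2 / r * (t ^+ 2 + e) by exact: mulr_ge0.
    by rewrite /C !mulrDl; move: E3le h2 h3 h4 te0; isolate; lra.
  have h2 : 0 <= C * (t ^+ 2 + e) * E3 by rewrite mulr_ge0// mulr_ge0 ?(ltW C0)// addr_ge0// ltW.
  by rewrite mulrBl mul1r mulrDr mulr1; move: h1 h2; isolate; lra.
have I0 : (0 <= \int[surf]_(x in bd) (`|u x| `^ p)%:E)%E.
  apply: surf_integral_ge0 => //; apply: measurable_funTS.
  exact: measurable_powR_smooth.
rewrite -(@lee_pmul2l _ (1 + E3)%:E)// ?lte_fin//; apply: le_trans B.
rewrite muleA -EFinM; apply: lee_wpmul2r => //; rewrite lee_fin.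
by rewrite mulrCA mulrC ler_wpM2r ?(ltW fl0)// mulrC.
Qed.

End lower_bound.

(** * The radial extremal *)

Lemma is_derive_exprn (R : realType) (n : nat) (x : R) : x != 0 ->
  is_derive x 1 (fun x : R => x ^+ n) (n%:R * x ^+ n / x).
Proof.
move=> x0; apply: DeriveDef; first exact: exprn_derivable.
rewrite exp_derive; case: n => [|n]; first by rewrite /GRing.scale/= !mul0r.
by rewrite /= exprSr mulrA mulfK// /GRing.scale/= mulr1.
Qed.

Lemma Ck_on_exprn (R : realType) k n (D : set R) : open D -> Ck_on k D (fun x : R => x ^+ n).
Proof.
move=> oD; elim: n => [|n IH]; first exact: Ck_on_cst.
apply: (Ck_on_eq oD _ (Ck_on_mul oD (Ck_on_id k oD) IH)) => x _.
by rewrite exprS.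
Qed.

Section cutoff.
Context (R : realType) (d : R) (d0 : 0 < d).

(** A primitive of a smooth step. Composed with the extremal it removes small values without
    increasing the slope, and it loses at most [2 * d]. *)
Lemma smooth_cutoff : exists Psi dPsi : R -> R,
  [/\ forall k, Ck_on k [set s : R | -1 < s] Psi,
      forall s : R, -1 < s -> is_derive s 1 Psi (dPsi s) /\ 0 <= dPsi s <= 1,
      forall s : R, 0 <= s <= d -> Psi s = 0 &
      forall s : R, 0 <= s -> s - 2 * d <= Psi s <= s /\ 0 <= Psi s].
Proof.
pose f s := @smooth_step R ((s - d) / d).
have oD : open [set s : R | -1 < s] by exact: open_gt.
have fC k : Ck_on k setT f.
  apply: (@Ck_on_comp R _ k setT setT (fun s => (s - d) / d) (@smooth_step R)) => //; try exact: openT.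
    exact: Ck_on_smooth_step.
  apply: Ck_on_mul; [exact: openT| |exact/Ck_on_cst/openT].
  by apply: Ck_on_sub_fun; [exact: openT|exact/Ck_on_id/openT|exact/Ck_on_cst/openT].
have cf : continuous f by move=> x; exact: (fC 0%N).
have [S dS] := exists_primitive (-1) cf.
have dPsi (s : R) : -1 < s -> is_derive s 1 (fun s => S s - S 0) (f s).
  by move=> /dS h; rewrite -[f s]subr0; apply: is_deriveB.
have flat0 (s : R) : s <= d -> f s = 0.
  by move=> sd; apply: smooth_step0; rewrite pmulr_lle0 ?invr_gt0// subr_le0.
have one (s : R) : 2 * d <= s -> f s = 1.
  by move=> sd; apply: smooth_step1; rewrite ler_pdivlMr//; lra.
have z0 (s : R) : 0 <= s <= d -> S s - S 0 = 0.
  move=> /andP[s0 sd]; apply/eqP; rewrite eq_le; apply/andP; split.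
    rewrite -[leRHS](subrr (S 0)); apply: (MVT_leT s0 (f := S) (g := cst (S 0)) (df := f) (dg := fun=> 0)) => x /andP[x0 xs].
    - by apply: dS; lra.
    - by rewrite flat0//; lra.
  rewrite -[leLHS](subrr (S 0)); apply: (MVT_leT s0 (g := S) (f := cst (S 0)) (dg := f) (df := fun=> 0)) => x /andP[x0 xs].
  - by apply: dS; lra.
  - by rewrite flat0//; lra.
have ge0 (s : R) : 0 <= s -> 0 <= S s - S 0.
  move=> s0; rewrite -[leLHS](subrr (S 0)); apply: (MVT_leT s0 (g := S) (f := cst (S 0)) (dg := f) (df := fun=> 0)) => x /andP[x0 xs].
  - by apply: dS; lra.
  - by have /andP[] := smooth_step_itv ((x - d) / d).
exists (fun s => S s - S 0), f; split => //.
- case=> [|k]; last by apply: (Ck_on_derive oD dPsi); apply: Ck_on_sub (fC k).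
  by move=> s /dPsi; exact: is_derive_continuous.
- by move=> s /dPsi; split => //; exact: smooth_step_itv.
- move=> s s0; split; last exact: ge0.
  apply/andP; split.
    have [sd|sd] := leP s (2 * d); first by apply: le_trans (ge0 _ s0); lra.
    have h := ltW sd; have d20 : 0 <= 2 * d by rewrite mulr_ge0// ltW.
    have : s - 2 * d <= S s - S (2 * d).
      apply: (MVT_leT h (g := S) (f := id) (dg := f) (df := fun=> 1)) => x /andP[x0 xs].
      - by apply: dS; lra.
      - by rewrite one.
    by have := ge0 _ d20; lra.
  rewrite -[leRHS]subr0.
  apply: (MVT_leT s0 (f := S) (g := id) (df := f) (dg := fun=> 1)) => x /andP[x0 xs].
  - by apply: dS; lra.
  - by have /andP[] := smooth_step_itv ((x - d) / d).
Qed.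

End cutoff.

Section extremal.
Context (R : realType) (p r rho : R) (n : nat).
Hypotheses (p1 : 1 < p) (r0 : 0 < r) (rrho : r < rho).
Variables (z : R -> R) (M : R).
Hypothesis dz : forall x, r < x -> is_derive x 1 z (1 + n%:R / (p - 1) * z x / x - z x `^ p / (p - 1)).
Hypothesis zM : forall x, r < x -> 0 < z x <= M.
Hypotheses (cz : continuous z) (zr : z r = 0).
Local Notation beyond := (beyond r).
Local Notation leb := (@lebesgue_measure R).

Let p10 : 0 < p - 1. Proof. by rewrite subr_gt0. Qed.
Let p0 : 0 < p. Proof. exact: lt_trans p1. Qed.
Let z0 x : r < x -> 0 < z x. Proof. by move=> /zM/andP[]. Qed.
Let ob := @open_beyond R r.
Let ozC k := Ck_on_riccati r0 dz zM k.
Let open_pos : open [set x : R | 0 < x]. Proof. exact: open_gt. Qed.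
Let x0 x : r < x -> 0 < x. Proof. exact: lt_trans. Qed.

(** The logarithmic derivative of [v']: from [((v')^(p-1) x^n)' = v^(p-1) x^n] one gets
    [(p - 1) v'' / v' + n / x = z^(p-1)]. The absolute value and the maximum with [r] only make it
    continuous on the whole line. *)
Let pot x := `|z x| `^ (p - 1) / (p - 1) - n%:R / (p - 1) / Num.max x r.

Let cmax : continuous (fun x : R => Num.max x r).
Proof. by move=> x; apply: continuous_max; [exact: cvg_id|exact: cvg_cst]. Qed.

Let max0 x : 0 < Num.max x r. Proof. by rewrite lt_max r0 orbT. Qed.

Let cinvmax : continuous (fun x : R => (Num.max x r)^-1).
Proof. by move=> x; apply: cvgV; [rewrite gt_eqF|exact: cmax]. Qed.

Let cpot : continuous pot.
Proof.
move=> x; rewrite /pot; apply: cvgB; last by apply: cvgMr; exact: cinvmax.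
apply: cvgM; last exact: cvg_cst.
by apply: (@continuous_comp _ _ _ z (fun y => `|y| `^ (p - 1))); [exact: cz|exact: continuous_norm_powR].
Qed.

Section potential.
Variable I : R -> R.
Hypothesis dI : forall x, r / 2 < x -> is_derive x 1 I (pot x).

(** [y] plays the part of [v'], so that [v = z * y]; [F] is the energy density [v'^p + v^p], with
    [y] frozen to the left of [r]. *)
Let y x := expR (I x).
Let v x := z x * y x.
Let F x := y (Num.max x r) `^ p + `|z x * y (Num.max x r)| `^ p.

Let y0 x : 0 < y x. Proof. exact: expR_gt0. Qed.
Let r2 x : r <= x -> r / 2 < x.
Proof. by have := r0; move=> h1 h2; lra. Qed.

Let dI' x : r < x -> is_derive x 1 I (z x `^ (p - 1) / (p - 1) - n%:R / (p - 1) / x).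
Proof.
move=> rx; have := dI (r2 (ltW rx)).
by rewrite /pot (gtr0_norm (z0 rx)) max_l// ltW.
Qed.

Let cI x : r <= x -> {for x, continuous I}.
Proof. by move=> rx; exact: is_derive_continuous (dI (r2 rx)). Qed.

Let cy x : r <= x -> {for x, continuous y}.
Proof. by move=> rx; apply: continuous_comp; [exact: cI|exact: continuous_expR]. Qed.

Let dy x : r < x -> is_derive x 1 y (y x * (z x `^ (p - 1) / (p - 1) - n%:R / (p - 1) / x)).
Proof. by move=> rx; exact: (is_derive1_comp (is_derive_expR (I x)) (dI' rx)). Qed.

Let zzp x : r < x -> z x * z x `^ (p - 1) = z x `^ p.
Proof. by move=> rx; rewrite powR_mulD ?z0// addrC subrK. Qed.

Let dv x : r < x -> is_derive x 1 v (y x).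
Proof.
move=> rx; have := is_deriveM (dz rx) (dy rx) => /is_derive_eq; apply.
rewrite /GRing.scale/= -(zzp rx).
by field; rewrite !gt_eqF// x0.
Qed.

Let Ck_I k : Ck_on k beyond I.
Proof.
case: k => [|k]; first by move=> x rx; apply: cI; exact: ltW.
apply: (Ck_on_derive ob dI').
have cV : Ck_on k beyond (fun x => x `^ (-1)).
  by apply: Ck_on_powR => // x /= rx; exact: x0.
have cp : Ck_on k beyond (fun x => z x `^ (p - 1)).
  by apply: (@Ck_on_comp R _ k beyond [set x | 0 < x] z (fun x => x `^ (p - 1))) => //; exact: Ck_on_powR.
have c1 := Ck_on_mul ob cp (Ck_on_cst k (p - 1)^-1 ob).
have c2 := Ck_on_mul ob (Ck_on_cst k (n%:R / (p - 1)) ob) cV.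
apply: (Ck_on_eq ob _ (Ck_on_sub_fun ob c1 c2)) => x /= rx.
by rewrite powR_inv1// ltW// x0.
Qed.

Let Ck_y k : Ck_on k beyond y.
Proof.
apply: (@Ck_on_comp R _ k beyond setT I expR) => //; first exact: openT.
exact/Ck_on_expR/openT.
Qed.

Let Ck_v k : Ck_on k beyond v.
Proof. by apply: Ck_on_mul. Qed.

Let Ck_yp k : Ck_on k beyond (fun x => y x `^ p).
Proof.
apply: (@Ck_on_comp R _ k beyond [set x | 0 < x] y (fun x => x `^ p)) => // [x _|]; first exact: y0.
exact: Ck_on_powR.
Qed.

(** The boundary term [x^n v (v')^(p-1)] of the integration by parts, without quotients. Its
    derivative is the energy density times [x^n], and its value at [rho] is the flux times
    [v^p rho^n]. *)
Let T x := x ^+ n * (z x * y x `^ p).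

Let Ck_T k : Ck_on k beyond T.
Proof. exact: (Ck_on_mul ob (Ck_on_exprn k n ob) (Ck_on_mul ob (ozC k) (Ck_yp k))). Qed.

Let FE x : r < x -> F x = y x `^ p + v x `^ p.
Proof.
by move=> rx; rewrite /F max_l ?(ltW rx)// -/(v x) ger0_norm// mulr_ge0// ltW// z0.
Qed.

Let dT x : r < x -> is_derive x 1 T (F x * x ^+ n).
Proof.
move=> rx; have h := is_derive1_comp (is_derive1_powR p (y0 x)) (dy rx).
have := is_deriveM (is_derive_exprn n (lt0r_neq0 (x0 rx))) (is_deriveM (dz rx) h) => /is_derive_eq; apply.
rewrite /GRing.scale/= -[(z * _) x]/(z x * y x `^ p) (FE rx) powRM ?ltW ?z0//.
have E : y x * y x `^ (p - 1) = y x `^ p by rewrite powR_mulD ?y0// addrC subrK.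
rewrite -E -(zzp rx).
field; rewrite !gt_eqF//= ?x0//.
Qed.

Let cymax : continuous (fun x => y (Num.max x r)).
Proof.
move=> x; apply: (@continuous_comp _ _ _ (fun x => Num.max x r) y); first exact: cmax.
by apply: cy; rewrite le_max lexx orbT.
Qed.

Lemma extremal_continuous : continuous F.
Proof.
move=> x; rewrite /F; apply: cvgD.
  suff : continuous (fun x => y (Num.max x r) `^ p) by exact.
  have -> : (fun x => y (Num.max x r) `^ p) = (fun x => `|y (Num.max x r)| `^ p).
    by apply/funext => u; rewrite ger0_norm// ltW.
  move=> {}x.
  by apply: (@continuous_comp _ _ _ (fun x => y (Num.max x r)) (fun y => `|y| `^ p)); [exact: cymax|exact: continuous_norm_powR].
apply: (@continuous_comp _ _ _ (fun x => z x * y (Num.max x r)) (fun y => `|y| `^ p)); last exact: continuous_norm_powR.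
by apply: cvgM; [exact: cz|exact: cymax].
Qed.

Let F0 x : 0 <= F x. Proof. by rewrite addr_ge0 ?powR_ge0. Qed.

Let cT x : r <= x -> {for x, continuous T}.
Proof.
move=> rx; apply: cvgM; first exact: exprn_continuous.
apply: cvgM; first exact: cz.
apply: (@continuous_comp _ _ _ y (fun y => y `^ p)); first exact: cy.
exact: is_derive_continuous (is_derive1_powR p (y0 x)).
Qed.

(** The profile is shifted by [k] while the volume factor remains [s^n]. Expanding that factor about
    [s - k] gives the part [Q rho - Q r] of [E1], the loss of an interval of length [k] at the outer
    end gives [- F rho * rho^n]. *)
Lemma extremal_energy : exists E1 C : R, 0 <= C /\ forall k : R,
  `|k| <= Num.min 1 (Num.min (r / 2) ((rho - r) / 2)) ->
  (\int[leb]_(s in `[(r + k)%R, rho]) (F (s - k) * s ^+ n)%:E <=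
   (flux p z rho * v rho `^ p * rho ^+ n + k * E1 + C * k ^+ 2)%:E)%E.
Proof.
have cX : continuous (fun x => F x * x ^+ n).
  by move=> x; apply: cvgM; [exact: extremal_continuous|exact: exprn_continuous].
have cQ : continuous (fun x => F x * (n%:R * x ^+ n * (Num.max x r)^-1)).
  move=> x; apply: cvgM; first exact: extremal_continuous.
  apply: cvgM; last exact: cinvmax.
  by apply: cvgM; [exact: cvg_cst|exact: exprn_continuous].
have [T0 dT0] := exists_primitive (r / 2) cX.
have [Q dQ] := exists_primitive (r / 2) cQ.
have [X dX] := exists_primitive (r / 2) extremal_continuous.
have abD x : (r + rho) / 2 <= x <= rho + 1 -> beyond x.
  by move: rrho => h /andP[hx _]; rewrite /beyond/=; lra.
(* [T] vanishes at [r] because [z] does, and has the derivative of [T0] beyond [r]; only [T0] is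
   known to be differentiable at [r] itself. *)
have T0E x : r <= x -> T0 x - T0 r = T x.
  move=> rx; have Tr : T r = 0 by rewrite /T zr mul0r mulr0.
  have ct : {within `[r, x], continuous T}.
    by apply: continuous_in_subspaceT => u; rewrite inE/= in_itv/= => /andP[ru _]; exact: cT.
  have ct0 : {within `[r, x], continuous T0}.
    apply: continuous_in_subspaceT => u; rewrite inE/= in_itv/= => /andP[ru _].
    exact: is_derive_continuous (dT0 _ (r2 ru)).
  have h1 u : r < u < x -> is_derive u 1 T (F u * u ^+ n) by move=> /andP[ru _]; exact: dT.
  have h2 u : r < u < x -> is_derive u 1 T0 (F u * u ^+ n) by move=> /andP[ru _]; exact: dT0 (r2 (ltW ru)).
  rewrite -[RHS]subr0 -Tr; apply/eqP; rewrite eq_le; apply/andP; split.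
    exact: (MVT_le rx h2 h1).
  exact: (MVT_le rx h1 h2).
have [CT CT0 HT] := Ck_on_taylor2 ob (Ck_T 2) abD.
have dTrho : 'D_1 T rho = F rho * rho ^+ n by apply: derive_val; exact: dT.
have CkQ : Ck_on 1 beyond Q.
  apply: (Ck_on_derive ob (fun x rx => dQ x (r2 (ltW rx)))) => x _; exact: cQ.
have [CQ CQ0 HQ] := Ck_on_lipschitz ob CkQ abD.
have CkX : Ck_on 1 beyond X.
  apply: (Ck_on_derive ob (fun x rx => dX x (r2 (ltW rx)))) => x _; exact: extremal_continuous.
have [B B0 HB] := Ck_on_bounded ob CkX abD.
have [Cn Cn0 Hn] := @Ck_on_taylor2 R (fun x => x ^+ n) setT (r / 2) (rho + 1) openT (Ck_on_exprn 2 n openT) (fun x _ => Logic.I).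
pose E1 := Q rho - Q r - F rho * rho ^+ n.
exists E1, (CT + CQ + Cn * (B + `|X r|)); split.
  by rewrite !addr_ge0// mulr_ge0// addr_ge0.
move=> k; rewrite !le_min => /and3P[k1 k2 k3].
have := k1; rewrite ler_norml => /andP[k1a k1b].
have := k2; rewrite ler_norml => /andP[k2a k2b].
have := k3; rewrite ler_norml => /andP[k3a k3b].
have rrho' := rrho; have r0' := r0.
have rk : r + k <= rho by lra.
pose K s := F (s - k) * (s - k) ^+ n + k * (F (s - k) * (n%:R * (s - k) ^+ n * (Num.max (s - k) r)^-1)) +
  Cn * k ^+ 2 * F (s - k).
have csub : continuous (fun s : R => s - k).
  by move=> s; apply: cvgB; [exact: cvg_id|exact: cvg_cst].
have comp (f : R -> R) : continuous f -> continuous (fun s => f (s - k)).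
  by move=> cf s; apply: (@continuous_comp _ _ _ (fun s : R => s - k) f); [exact: csub|exact: cf].
have cK : continuous K.
  move=> s; apply: cvgD; last by apply: cvgM; [exact: cvg_cst|exact: (comp _ extremal_continuous)].
  apply: cvgD; first exact: (comp _ cX).
  by apply: cvgM; [exact: cvg_cst|exact: (comp _ cQ)].
have dK s : r + k <= s <= rho -> is_derive s 1
    (fun s => T0 (s - k) + k * Q (s - k) + Cn * k ^+ 2 * X (s - k)) (K s).
  move=> /andP[s1 s2]; have sk : r / 2 < s - k by lra.
  have shift (f : R -> R) d : is_derive (s - k) 1 f d -> is_derive s 1 (fun s => f (s - k)) d.
    move=> fd; have hs : is_derive s 1 (fun s : R => s - k) 1.
      by rewrite -[X in is_derive _ _ _ X](subr0 1); exact: is_deriveB.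
    by have := @is_derive1_comp R f (fun s : R => s - k) s _ _ fd hs; rewrite mulr1.
  apply: is_deriveD; last exact: (is_derive1_comp (is_derive_mull _ _) (shift _ _ (dX _ sk))).
  apply: is_deriveD; first exact: shift (dT0 _ sk).
  exact: (is_derive1_comp (is_derive_mull _ _) (shift _ _ (dQ _ sk))).
apply: (@le_trans _ _ (\int[leb]_(s in `[(r + k)%R, rho]) (K s)%:E)%E).
  apply: ge0_le_integral => //.
  - by move=> s; rewrite /= in_itv/= => /andP[s1 _]; rewrite lee_fin mulr_ge0// exprn_ge0//; lra.
  - apply/measurable_EFinP; apply: measurable_funTS; apply: continuous_measurable_fun => s.
    by apply: cvgM; [exact: (comp _ extremal_continuous)|exact: exprn_continuous].
  - by apply/measurable_EFinP; apply: measurable_funTS; exact: continuous_measurable_fun.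
  move=> s; rewrite /= in_itv/= => /andP[s1 s2]; rewrite lee_fin.
  have := Hn (s - k) s; have -> : r / 2 <= s - k <= rho + 1 by lra.
  have -> : r / 2 <= s <= rho + 1 by lra.
  move=> /(_ isT isT); have sk0 : 0 < s - k by lra.
  have dn : 'D_1 (fun x : R => x ^+ n) (s - k) = n%:R * (s - k) ^+ n / (s - k).
    by apply: derive_val; apply: is_derive_exprn; rewrite gt_eqF.
  rewrite dn opprB addrCA subrr addr0 ler_norml => /andP[_ hn].
  rewrite /K max_l; last by lra.
  have : s ^+ n <= (s - k) ^+ n + k * (n%:R * (s - k) ^+ n / (s - k)) + Cn * k ^+ 2 by lra.
  move=> /(ler_wpM2l (F0 (s - k))); congr (_ <= _); ring.
rewrite (integral_FTC rk cK dK) lee_fin addrK.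
have A1 : (r + rho) / 2 <= rho <= rho + 1 by lra.
have A2 : (r + rho) / 2 <= rho - k <= rho + 1 by lra.
have hT := HT _ _ A1 A2; move: hT; rewrite dTrho (_ : rho - k - rho = - k); last by ring.
rewrite sqrrN mulrN opprK ler_norml => /andP[_ hT].
have TE : T rho = flux p z rho * v rho `^ p * rho ^+ n.
  rewrite /T /flux powRM ?ltW ?z0// -(powR_mulD)//; last exact: z0.
  have zz : z rho `^ (- p) * z rho `^ p = 1 by rewrite powRN mulVf// gt_eqF//; apply: powR_gt0; exact: z0.
  transitivity (z rho * (z rho `^ (- p) * z rho `^ p) * y rho `^ p * rho ^+ n); last by ring.
  by rewrite zz; ring.
have T0k : T0 (rho - k) - T0 r = T (rho - k) by apply: T0E; rewrite lerBrDr.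
have hQ : k * (Q (rho - k) - Q rho) <= CQ * k ^+ 2.
  apply: le_trans (ler_norm _) _; rewrite normrM -[k ^+ 2]real_normK ?num_real// expr2 mulrA [leRHS]mulrC.
  apply: ler_wpM2l => //; have := HQ _ _ A2 A1.
  by rewrite (_ : rho - k - rho = - k) ?normrN//; ring.
have hX : Cn * k ^+ 2 * (X (rho - k) - X r) <= Cn * k ^+ 2 * (B + `|X r|).
  apply: ler_wpM2l; first by rewrite mulr_ge0// sqr_ge0.
  by apply: lerD; [apply: le_trans (ler_norm _) (HB _ A2)|rewrite -normrN; exact: ler_norm].
have -> : T0 (rho - k) + k * Q (rho - k) + Cn * k ^+ 2 * X (rho - k) - (T0 r + k * Q r + Cn * k ^+ 2 * X r) =
    (T (rho - k) + k * (Q (rho - k) - Q rho) + Cn * k ^+ 2 * (X (rho - k) - X r)) + k * (Q rho - Q r).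
  by rewrite -T0k; ring.
have -> : flux p z rho * v rho `^ p * rho ^+ n + k * E1 + (CT + CQ + Cn * (B + `|X r|)) * k ^+ 2 =
    (T rho - F rho * rho ^+ n * k + CT * k ^+ 2 + CQ * k ^+ 2 + Cn * k ^+ 2 * (B + `|X r|)) + k * (Q rho - Q r).
  by rewrite -TE /E1; ring.
rewrite lerD2r; apply: lerD hX; apply: lerD hQ.
have -> : T rho - F rho * rho ^+ n * k + CT * k ^+ 2 = CT * k ^+ 2 - F rho * rho ^+ n * k + T rho by ring.
by rewrite -lerBlDr lerBrDr.
Qed.

Lemma extremal_boundary : exists2 C : R, 0 <= C & forall k : R,
  `|k| <= (rho - r) / 2 -> `|k| <= 1 -> v rho - y rho * k - C * k ^+ 2 <= v (rho - k).
Proof.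
have abD x : (r + rho) / 2 <= x <= rho + 1 -> beyond x.
  by move: rrho => h /andP[hx _]; rewrite /beyond/=; lra.
have [C C0 H] := Ck_on_taylor2 ob (Ck_v 2) abD.
exists C => // k; rewrite !ler_norml => /andP[k1 k2] /andP[k3 k4].
have rrho' := rrho.
have A1 : (r + rho) / 2 <= rho <= rho + 1 by lra.
have A2 : (r + rho) / 2 <= rho - k <= rho + 1 by lra.
have := H _ _ A1 A2; rewrite (_ : 'D_1 v rho = y rho); last by apply: derive_val; exact: dv.
rewrite (_ : rho - k - rho = - k); last by ring.
by rewrite sqrrN mulrN opprK ler_norml => /andP[h _]; lra.
Qed.

(** Continued by 0, [v] has a corner at [r]. Cutting it off at height [d] gives a function that
    vanishes up to [r + eta], is smooth on the whole line and has no larger energy density. *)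
Lemma extremal_truncation (d : R) : 0 < d -> exists (P dP : R -> R) (eta : R),
  [/\ 0 < eta, forall k, Ck_on k setT P, forall s : R, is_derive s 1 P (dP s),
      forall s : R, s <= r + eta -> P s = 0 &
      forall s : R, r < s -> `|dP s| `^ p + `|P s| `^ p <= F s /\ v s - 2 * d <= P s].
Proof.
move=> d0; have [Psi [dPsi [PsiC Psid Psi0 PsiE]]] := smooth_cutoff d0.
have v0 s : r < s -> 0 < v s by move=> rs; rewrite mulr_gt0// z0.
have [eta eta0 veta] : exists2 eta, 0 < eta & forall s, r < s -> s < r + 2 * eta -> v s <= d.
  have cv : {for r, continuous v} by apply: cvgM; [exact: cz|exact: cy].
  have vr : v r = 0 by rewrite /v zr mul0r.
  have /cvgrPdist_lt/(_ _ d0) := cv.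
  rewrite near_simpl -nbhs_nearE => /nbhs_ballP[e /= e0 He].
  exists (e / 2); first by rewrite divr_gt0.
  move=> s rs se; have /He : ball r e s.
    by rewrite /ball/= ltr0_norm ?subr_lt0// opprB; lra.
  by rewrite /= vr sub0r normrN => h; apply: le_trans (ler_norm _) (ltW h).
pose P s := if s <= r then 0 else Psi (v s).
pose dP s := if s <= r then 0 else dPsi (v s) * y s.
have Pflat s : s < r + 2 * eta -> P s = 0.
  move=> sr; rewrite /P; case: leP => // rs; apply: Psi0.
  by rewrite ltW ?v0//=; exact: veta.
pose D1 : set R := [set s | s < r + 2 * eta].
have oD1 : open D1 by exact: open_lt.
have DT : setT = beyond `|` D1.
  apply/seteqP; split=> // s _ /=; rewrite /beyond /D1/=.
  by have [rs|rs] := ltP r s; [left|right; lra].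
have CP k : Ck_on k setT P.
  rewrite DT; apply: Ck_on_setU; last by apply: (Ck_on_eq oD1 _ (Ck_on_cst k 0 oD1)) => s /Pflat ->.
  have c : Ck_on k beyond (Psi \o v).
    have oE : open [set s : R | -1 < s] by exact: open_gt.
    apply: (@Ck_on_comp R _ k beyond [set s : R | -1 < s] v Psi) => //.
    by move=> s /= rs; have := v0 _ rs; lra.
  by apply: (Ck_on_eq ob _ c) => s /= rs; rewrite /P leNgt rs.
have dPE (s : R) : is_derive s 1 P (dP s).
  have [rs|sr] := ltP r s.
    have vs : -1 < v s by have := v0 _ rs; lra.
    have h := is_derive1_comp (Psid _ vs).1 (dv rs).
    rewrite /dP leNgt rs/=; apply: near_eq_is_derive h.
    near=> u; rewrite /P leNgt (_ : r < u)//; near: u; exact: lt_nbhsr.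
  rewrite /dP sr; apply: (@near_eq_is_derive _ R^o R^o (cst 0)).
    near=> u; rewrite Pflat//; near: u; apply: lt_nbhsl.
    by move: sr eta0 => h1 h2; lra.
exists P, dP, eta; split => //.
  by move=> s sr; apply: Pflat; move: sr eta0 => h1 h2; lra.
move=> s rs; have sF : (s <= r) = false by apply/negbTE; rewrite -ltNge.
rewrite /dP /P sF; have [/andP[h1 h2] h3] := PsiE _ (ltW (v0 _ rs)).
split => //; rewrite (FE rs); apply: lerD; last first.
  by apply: powR_ge_le => //; [exact: ltW|rewrite ger0_norm].
have vs : -1 < v s by have := v0 _ rs; lra.
have [_ /andP[g1 g2]] := Psid _ vs.
apply: powR_ge_le => //; first exact: ltW.
by rewrite normrM (gtr0_norm (y0 s)) (ger0_norm g1) ger_pMl.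
Unshelve. all: by end_near. Qed.

End potential.

(** [a] and [b] are the value and the slope of the extremal at the outer sphere. The truncation
    height [d] is quantified after all constants, because it will be tied to [e]. *)
Theorem upper_profile : exists (F : R -> R) (a b E1 C k0 : R),
  [/\ continuous F, forall s : R, 0 <= F s, 0 < a /\ 0 <= C & 0 < k0 <= 1 /\ k0 <= r / 2 /\ k0 <= (rho - r) / 2] /\
  (forall k : R, `|k| <= k0 ->
    (\int[leb]_(s in `[(r + k)%R, rho]) (F (s - k) * s ^+ n)%:E <=
      (flux p z rho * a `^ p * rho ^+ n + k * E1 + C * k ^+ 2)%:E)%E) /\
  forall d : R, 0 < d -> exists (P dP : R -> R) (eta : R),
    [/\ 0 < eta, forall k, Ck_on k setT P, forall s : R, is_derive s 1 P (dP s),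
        forall s : R, s <= r + eta -> P s = 0 &
        (forall s : R, r < s -> `|dP s| `^ p + `|P s| `^ p <= F s) /\
        (forall k : R, `|k| <= k0 -> a - b * k - C * k ^+ 2 - 2 * d <= P (rho - k))].
Proof.
have [I dI] := exists_primitive (r / 2) cpot.
have [E1 [C1 [C10 H1]]] := extremal_energy dI.
have [C2 C20 H2] := extremal_boundary dI.
pose k0 := Num.min 1 (Num.min (r / 2) ((rho - r) / 2)).
have rr : 0 < rho - r by rewrite subr_gt0.
pose y x := expR (I x).
pose F x := y (Num.max x r) `^ p + `|z x * y (Num.max x r)| `^ p.
exists F, (z rho * y rho), (y rho), E1, (C1 + C2), k0; split.
  split.
  - exact: (extremal_continuous dI).
  - by move=> s; rewrite addr_ge0 ?powR_ge0.
  - by rewrite addr_ge0// mulr_gt0 ?expR_gt0 ?z0.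
  - rewrite /k0; split; last by rewrite !ge_min !lexx !orbT.
    by rewrite ge_min lexx !lt_min ltr01 !divr_gt0.
split.
  move=> k kk; apply: (le_trans (H1 k kk)); rewrite lee_fin lerD2l mulrDl lerDl.
  by rewrite mulr_ge0// sqr_ge0.
move=> d d0; have [P [dP [eta [eta0 PC PD P0 PF]]]] := extremal_truncation dI d0.
exists P, dP, eta; split => //; split; first by move=> s /PF[].
move=> k; rewrite !le_min => /and3P[k1 k2 k3].
have rk : r < rho - k.
  by have := rr; move: k3; rewrite ler_norml => /andP[_ k3] r3; lra.
have [_] := PF _ rk; apply: le_trans; have h := H2 _ k3 k1.
rewrite lerD2r; apply: le_trans h; rewrite lerD2l lerN2 ler_wpM2r ?sqr_ge0//.
by rewrite lerDr.
Qed.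

End extremal.

(** * The radial part of a vector field *)

Section vector_valued.
Context (R : realType) (n : nat) (U : normedModType R).
Implicit Types (F : U -> 'rV[R]_n) (x v : U) (D : set U).

Lemma continuous_rV F x : (forall i, {for x, continuous (fun x => F x ord0 i)}) ->
  {for x, continuous F}.
Proof.
move=> cF; apply/cvg_ballP => e e0.
have : \forall y \near x, forall i : 'I_n, ball (F x ord0 i) e (F y ord0 i).
  by apply: filter_forall => i; exact: (cvg_ball (cF i) e0).
by apply: filterS => y h; split=> // i j; rewrite (ord1 i); exact: h.
Qed.

Lemma differentiable_rV F x : (forall i, differentiable (fun x => F x ord0 i) x) ->
  differentiable F x.
Proof.
move=> dF; rewrite (_ : F = \sum_(i < n) (fun x => F x ord0 i *: delta_mx ord0 i)).
  by apply: differentiable_sum => i; exact: differentiableZl.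
by apply/funext => y; rewrite fct_sumE -rV_sum_delta.
Qed.

Lemma derive_coord_rV F x v i : differentiable F x ->
  'D_v (fun x => F x ord0 i) x = ('D_v F x) ord0 i.
Proof.
move=> dF; rewrite [in RHS]derive_mx ?mxE//; exact: diff_derivable.
Qed.

Lemma derive_comp_rV F (g : 'rV[R]_n -> R) x v : differentiable F x ->
  differentiable g (F x) -> 'D_v (g \o F) x = dot (grad g (F x)) ('D_v F x).
Proof.
move=> dF dg; rewrite deriveE; last exact: differentiable_comp.
by rewrite diff_comp//= -!deriveE// deriveE_grad.
Qed.

Lemma Ck_on_comp_rV k D F (g : 'rV[R]_n -> R) : open D ->
  (forall i, Ck_on k D (fun x => F x ord0 i)) -> Ck_on k setT g -> Ck_on k D (g \o F).
Proof.
move=> oD; elim: k g => [|k IH] g cF cg.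
  move=> x Dx; apply: continuous_comp; last exact: cg.
  by apply: continuous_rV => i; exact: cF.
have dF x : D x -> differentiable F x.
  by move=> Dx; apply: differentiable_rV => i; have [/(_ _ Dx)] := cF i.
have dg y : differentiable g y by have [/(_ y I)] := cg.
split=> [x Dx|v]; first by apply: differentiable_comp => //; exact: dF.
have c : Ck_on k D (fun x => \sum_(i < n) ('D_(delta_mx ord0 i) g \o F) x * 'D_v (fun x => F x ord0 i) x).
  apply: Ck_on_sum => // i; apply: Ck_on_mul => //.
    by apply: IH => [j|]; [exact: Ck_onW (cF j)|have [_] := cg; apply].
  by have [_] := cF i; apply.
apply: (Ck_on_eq oD _ c) => x Dx.
rewrite derive_comp_rV//; last exact: dF.
by apply: eq_bigr => i _; rewrite derive_coord_rV ?mxE//; exact: dF.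
Qed.

End vector_valued.

Lemma differentiable_coordinate (R : realType) (n : nat) (x : 'rV[R]_n) i :
  differentiable (fun x : 'rV[R]_n => x ord0 i) x.
Proof. exact: differentiable_coord. Qed.

Lemma Ck_on_coord (R : realType) (n : nat) k (D : set 'rV[R]_n) i : open D ->
  Ck_on k D (fun x => x ord0 i).
Proof.
move=> oD; case: k => [|k]; first by move=> x _; exact: coord_continuous_rV.
split=> [x _|v]; first exact: differentiable_coordinate.
apply: (Ck_on_eq oD _ (Ck_on_cst k (v ord0 i) oD)) => x _.
by rewrite (@derive_coord_rV R n _ id) ?derive_id.
Qed.

Lemma smooth_coord (R : realType) (N n : nat) (V : 'rV[R]_N -> 'rV[R]_n) i :
  smooth V -> smooth (fun x => V x ord0 i).
Proof.
move=> sV k; have := sV k; elim: k V {sV} => [|k IH] V.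
  by move=> cV x; apply: (@continuous_comp _ _ _ V (fun y : 'rV[R]_n => y ord0 i)); [exact: cV|exact: coord_continuous_rV].
move=> [dV DV]; split=> [x|v].
  by apply: (@differentiable_comp _ _ _ _ V (fun y : 'rV[R]_n => y ord0 i)); [exact: dV|exact: differentiable_coordinate].
rewrite (_ : 'D_v _ = fun x => ('D_v V x) ord0 i); first exact: (IH _ (DV v)).
by apply/funext => x; rewrite derive_coord_rV.
Qed.

Section off_origin.
Context (R : realType) (N : nat).
Local Notation off0 := [set x : 'rV[R]_N | x != 0].

Lemma open_off0 : open off0.
Proof.
rewrite (_ : off0 = @enorm R N @^-1` [set s | 0 < s]); last first.
  by apply/seteqP; split=> x /=; rewrite enorm_gt0.
by apply: open_comp => [x _|]; [exact: continuous_enorm|exact: open_gt].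
Qed.

Lemma Ck_on_powR_enorm k a : Ck_on k off0 (fun x => enorm x `^ a).
Proof.
have o := open_off0.
have c : Ck_on k off0 (fun x => \sum_(i < N) x ord0 i * x ord0 i).
  by apply: Ck_on_sum => // i; apply: Ck_on_mul => //; exact: Ck_on_coord.
have pos x : off0 x -> 0 < \sum_(i < N) x ord0 i * x ord0 i.
  by move=> /= x0; rewrite -/(dot x x) -enorm2 exprn_gt0// enorm_gt0.
have op : open [set x : R | 0 < x] by exact: open_gt.
have := Ck_on_comp o op pos (Ck_on_powR k (a / 2) op (fun x h => h)) c.
apply: (Ck_on_eq o) => x /= x0.
rewrite -/(dot x x) -enorm2 -powR_mulrn ?enorm_ge0// -powRrM.
by congr (_ `^ _); field.
Qed.

Lemma Ck_on_enorm k : Ck_on k off0 (@enorm R N).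
Proof.
by apply: (Ck_on_eq open_off0 _ (Ck_on_powR_enorm k 1)) => x _; rewrite powRr1 ?enorm_ge0.
Qed.

Lemma Ck_on_dir k i : Ck_on k off0 (fun x => ((enorm x)^-1 *: x) ord0 i).
Proof.
have o := open_off0.
apply: (Ck_on_eq o _ (Ck_on_mul o (Ck_on_powR_enorm k (-1)) (Ck_on_coord k i o))) => x _.
by rewrite mxE powR_inv1// enorm_ge0.
Qed.

(* The normal component of [V] on the sphere of radius [r] only; elsewhere extended by homogeneity of degree 0. *)
Definition radial_part (V : 'rV[R]_N -> 'rV[R]_N) (r : R) (x : 'rV[R]_N) : R :=
  dot (V ((r / enorm x) *: x)) ((enorm x)^-1 *: x).

Lemma Ck_on_radial_part V r k : smooth V -> Ck_on k off0 (radial_part V r).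
Proof.
move=> sV; have o := open_off0.
apply: Ck_on_sum => // i; apply: Ck_on_mul => //; last exact: Ck_on_dir.
apply: (@Ck_on_comp_rV R N _ k off0 (fun x => (r / enorm x) *: x) (fun y => V y ord0 i)) => // [j|].
  apply: (Ck_on_eq o _ (Ck_on_mul o (Ck_on_cst k r o) (Ck_on_dir k j))) => x _.
  by rewrite !mxE mulrA.
by apply/is_CkP; exact: smooth_coord.
Qed.

Lemma radial_part_scale V r s x : x != 0 -> 0 < s -> radial_part V r (s *: x) = radial_part V r x.
Proof.
move=> x0 s0; have e0 : enorm x != 0 by rewrite enorm_eq0.
by rewrite /radial_part enormZ gtr0_norm// !scalerA; congr (dot (V (_ *: _)) (_ *: _)); field; rewrite e0 gt_eqF.
Qed.

Lemma radial_part_le V r M x : (forall y, enorm (V y) <= M) -> `|radial_part V r x| <= M.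
Proof.
move=> VM; have M0 : 0 <= M by exact: le_trans (enorm_ge0 _) (VM 0).
apply: (le_trans (normr_dot_le_enorm _ _)); have [->|x0] := eqVneq x 0.
  by rewrite !scaler0 enorm0 mulr0.
by rewrite enormZ normfV (ger0_norm (enorm_ge0 x)) mulVf ?mulr1// enorm_eq0.
Qed.

(** Euler's identity for degree 0. *)
Lemma homogeneous0_grad (h : 'rV[R]_N -> R) x : differentiable h x -> x != 0 ->
  (forall s : R, 0 < s -> h (s *: x) = h x) -> dot (grad h x) x = 0.
Proof.
move=> dh x0 hs.
have dc : is_derive (1 : R) 1 (fun s : R => s *: x) x.
  have := is_derive_scale (is_derive_cst x (1 : R) 1) (is_derive_id (1 : R) 1).
  by rewrite scaler0 addr0 scale1r.
have dh1 : differentiable h ((fun s : R => s *: x) 1) by rewrite scale1r.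
have := is_derive_curve dh1 dc; rewrite scale1r => h1.
have h2 : is_derive (1 : R) 1 (h \o (fun s : R => s *: x)) 0.
  apply: (@near_eq_is_derive _ R^o R^o (cst (h x))).
  near=> s; rewrite /= hs//; near: s; exact: lt_nbhsr.
by rewrite -(@derive_val _ _ _ _ _ _ _ h1) (@derive_val _ _ _ _ _ _ _ h2).
Unshelve. all: by end_near. Qed.

(** The gradient of [|x| - t h] is a radial unit vector minus [t] times a vector orthogonal to it.
    By Pythagoras the angular dependence costs only [t^2]. *)
Lemma enorm_grad_radial (P dP : R -> R) (h : 'rV[R]_N -> R) (t e : R) (x : 'rV[R]_N) : x != 0 ->
  (forall s : R, is_derive s 1 P (dP s)) -> differentiable h x ->
  (forall s : R, 0 < s -> h (s *: x) = h x) ->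
  enorm (grad (fun x => P (enorm x - (t * h x + e))) x) ^+ 2 =
  dP (enorm x - (t * h x + e)) ^+ 2 * (1 + t ^+ 2 * enorm (grad h x) ^+ 2).
Proof.
move=> x0 dPE dh hs; set y := enorm x - _.
have e1 : enorm ((enorm x)^-1 *: x) = 1.
  by rewrite enormZ normfV (ger0_norm (enorm_ge0 x)) mulVf// enorm_eq0.
pose g x := enorm x - (t * h x + e).
have dN : differentiable (@enorm R N) x by have [/(_ x x0)] := Ck_on_enorm 1.
have dg : differentiable g x.
  apply: differentiableB => //; apply: differentiableD => //.
  by apply: differentiableM => //; exact: differentiable_cst.
have dPg : differentiable P (g x) by apply/derivable1_diffP; have [] := dPE (g x).
have df : differentiable (fun x => P (enorm x - (t * h x + e))) x by exact: (differentiable_comp dg dPg).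
have G : grad (fun x => P (enorm x - (t * h x + e))) x = dP y *: ((enorm x)^-1 *: x - t *: grad h x).
  apply/rowP => i; pose c (s : R) := x + s *: (delta_mx ord0 i : 'rV[R]_N).
  have cx : c 0 = x by rewrite /c scale0r addr0.
  have dc : is_derive (0 : R) 1 c (delta_mx ord0 i : 'rV[R]_N).
    have := is_deriveD (is_derive_cst x (0 : R) 1) (is_derive_scale (is_derive_cst (delta_mx ord0 i : 'rV[R]_N) (0 : R) 1) (is_derive_id (0 : R) 1)).
    by rewrite scaler0 addr0 scale1r add0r.
  have cx0 : c 0 != 0 by rewrite cx.
  have dE := is_derive_enorm dc cx0.
  have dh1 : differentiable h (c 0) by rewrite cx.
  have dH := is_derive_curve dh1 dc.
  have df1 : differentiable (fun x => P (enorm x - (t * h x + e))) (c 0) by rewrite cx.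
  have dF := is_derive_curve df1 dc.
  have dI := is_deriveB dE (is_deriveD (is_derive1_comp (is_derive_mull t _) dH) (is_derive_cst e (0 : R) 1)).
  have h1 := @is_derive1_comp R P _ 0 _ _ (dPE _) dI.
  have := @derive_val _ _ _ _ _ _ _ dF; rewrite [LHS](@derive_val _ _ _ _ _ _ _ h1).
  rewrite -[X in dP X]/(enorm (c 0) - (t * h (c 0) + e)) cx -/y !dot_delta addr0 => <-.
  by rewrite !mxE; congr (_ * _); rewrite mulrC.
rewrite G enormZ exprMn real_normK ?num_real//; congr (_ * _).
have key (a b : 'rV[R]_N) : dot a b = 0 -> enorm a = 1 -> enorm (a - t *: b) ^+ 2 = 1 + t ^+ 2 * enorm b ^+ 2.
  move=> ab a1; rewrite [LHS]enorm2 -scaleNr dotDl !dotDr !dotZl !dotZr (dotC b) ab -(enorm2 a) -(enorm2 b) a1; ring.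
by apply: key => //; rewrite dotZl dotC homogeneous0_grad ?mulr0.
Qed.

End off_origin.

(** * Weak gradients *)

Lemma continuous_bounded_rV (R : realType) (N : nat) (K : set 'rV[R]_N) (f : 'rV[R]_N -> R) (b : R) :
  closed K -> (forall x, K x -> enorm x <= b) -> (forall x, K x -> {for x, continuous f}) ->
  exists2 M, 0 <= M & forall x, K x -> `|f x| <= M.
Proof.
move=> cK Kb cf.
have Kc : compact K.
  apply: bounded_closed_compact => //; exists b; split; first exact: num_real.
  move=> M bM x Kx; apply: le_trans (normr_le_enorm x) _.
  by apply: le_trans (Kb _ Kx) (ltW bM).
have cK' : compact (f @` K).
  by apply: continuous_compact => //; apply: continuous_in_subspaceT => x /set_mem; exact: cf.
have [M [Mr HM]] := compact_bounded cK'.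
exists (`|M| + 1); first by rewrite addr_ge0.
move=> x Kx; apply: HM; last by exists x.
by apply: le_lt_trans (ler_norm M) _; rewrite ltrDl.
Qed.

Lemma closed_enorm_le (R : realType) (N : nat) (b : R) : closed [set x : 'rV[R]_N | enorm x <= b].
Proof.
rewrite (_ : [set x | _] = @enorm R N @^-1` [set s | s <= b]) //.
by apply: closed_comp => [x _|]; [exact: continuous_enorm|exact: closed_le].
Qed.

Section weak_gradient.
Context (R : realType) (N : nat).
Local Notation rV := 'rV[R]_N.
Local Notation leb := (lebesgue_rV R N).

Lemma integral_translation (g : rV -> R) (b : rV) : measurable_fun setT g ->
  (\int[leb]_x (g (x + b))%:E = \int[leb]_x (g x)%:E)%E.
Proof.
move=> mg; have mE : measurable_fun setT (EFin \o g) by exact/measurable_EFinP.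
have tr (f : rV -> \bar R) : measurable_fun setT f -> (forall x, 0 <= f x)%E ->
    (\int[leb]_x f (x + b)%R = \int[leb]_x f x)%E.
  move=> mf f0; have := integral_affine_rV b ltr01 mf f0.
  by rewrite invr1 expr1n mul1e; under eq_integral do rewrite scale1r.
rewrite [LHS]integralE [RHS]integralE; congr (_ - _)%E.
  rewrite -[RHS]tr; last by move=> x; exact: funepos_ge0.
    by apply: eq_integral => x _; rewrite !funeposE.
  exact: measurable_funepos.
rewrite -[RHS]tr; last by move=> x; exact: funeneg_ge0.
  by apply: eq_integral => x _; rewrite !funenegE.
exact: measurable_funeneg.
Qed.

Lemma integral_eball_eq (g : rV -> R) (a b : R) : a <= b -> (forall x, a <= enorm x -> g x = 0) ->
  (\int[leb]_(x in eball N a) (g x)%:E = \int[leb]_(x in eball N b) (g x)%:E)%E.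
Proof.
move=> ab g0; rewrite [LHS]integral_mkcond [RHS]integral_mkcond.
apply: eq_integral => x _; rewrite /patch; case: ifPn => [/set_mem /= xa|/negP xa].
  by rewrite mem_set//; exact: lt_le_trans ab.
case: ifPn => // _; rewrite g0// leNgt; apply/negP => h; apply: xa; exact: mem_set.
Qed.

Lemma integral_eball_setT (g : rV -> R) (a : R) : (forall x, a <= enorm x -> g x = 0) ->
  (\int[leb]_(x in eball N a) (g x)%:E = \int[leb]_x (g x)%:E)%E.
Proof.
move=> g0; rewrite [LHS]integral_mkcond.
apply: eq_integral => x _; rewrite /patch; case: ifPn => // /negP xa.
by rewrite g0// leNgt; apply/negP => h; apply: xa; exact: mem_set.
Qed.

Lemma continuous_integrable_eball (g : rV -> R) (a : R) : continuous g ->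
  leb.-integrable (eball N a) (EFin \o g).
Proof.
move=> cg; have [M M0 HM] := continuous_bounded_rV (@closed_enorm_le R N a) (fun x h => h) (fun x _ => cg x).
apply: measurable_bounded_integrable.
- exact: measurable_eball.
- exact: lebesgue_eball_lty.
- by apply: measurable_funTS; exact: continuous_measurable_rV.
- exists M; split; first exact: num_real.
  by move=> M' MM' x xa; apply: le_trans (ltW MM'); apply: HM; exact: ltW.
Qed.

(** Translation invariance in place of Fubini: [w (x + t v) - w x] has integral 0 and equals [t]
    times the derivative up to [C t^2], so the integral [J] of the derivative satisfies
    [t |J| <= C L t^2] for [0 < t <= 1]. *)
Lemma integral_derive_eq0 (w : rV -> R) (v : rV) (rho : R) : smooth w -> enorm v = 1 -> 0 < rho ->
  (forall x, rho <= enorm x -> w x = 0) -> (forall x, rho <= enorm x -> 'D_v w x = 0) ->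
  (\int[leb]_(x in eball N rho) ('D_v w x)%:E = 0)%E.
Proof.
(* A margin of 1 keeps the translates by at most [v] inside the ball. *)
move=> sw v1 rho0 w0 dw0; pose rho1 := rho + 1.
have r1 : rho <= rho1 by rewrite lerDl.
rewrite (integral_eball_eq r1 dw0); set B := eball N rho1.
have sdw := smooth_derive v sw; have sddw := smooth_derive v sdw.
have csddw : continuous ('D_v ('D_v w)) by exact: smooth_continuous.
have [C C0 HC] := continuous_bounded_rV (@closed_enorm_le R N (rho1 + 1)) (fun x h => h)
  (fun x _ => csddw x).
have dline (f : rV -> R) x (s : R) : smooth f -> is_derive s 1 (fun s => f (x + s *: v)) ('D_v f (x + s *: v)).
  move=> sf; have df := smooth_differentiable sf (x + s *: v).
  have dc : is_derive s 1 (fun s : R => x + s *: v) v.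
    have := is_deriveD (is_derive_cst x s 1) (is_derive_scale (is_derive_cst v s 1) (is_derive_id s (1 : R))).
    by rewrite scaler0 addr0 scale1r add0r.
  by rewrite (deriveE_grad _ df); exact: is_derive_curve df dc.
have lip x (s : R) : B x -> 0 <= s <= 1 -> `|'D_v w (x + s *: v) - 'D_v w x| <= C * s.
  move=> Bx /andP[s0 s1].
  have bd u : 0 <= u <= s -> `|'D_v ('D_v w) (x + u *: v)| <= C.
    move=> /andP[u0 us]; apply: HC => /=; apply: le_trans (enormD _ _) _.
    by rewrite enormZ v1 mulr1 ger0_norm// lerD// ?(ltW Bx)// (le_trans us).
  have dC (c u : R) : is_derive u 1 ( *%R c) c by exact: is_derive_mull.
  have x0 : 'D_v w x = 'D_v w (x + 0 *: v) by rewrite scale0r addr0.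
  rewrite ler_norml; apply/andP; split.
    rewrite -mulNr -[leLHS]subr0 -(mulr0 (- C)) x0.
    apply: (MVT_leT s0 (f := *%R (- C)) (g := fun s => 'D_v w (x + s *: v)) (df := fun=> - C)
      (dg := fun s => 'D_v ('D_v w) (x + s *: v))) => u /bd.
    - by move=> _; exact: dline.
    - by rewrite ler_norml => /andP[].
  rewrite -[leRHS]subr0 -(mulr0 C) x0.
  apply: (MVT_leT s0 (g := *%R C) (f := fun s => 'D_v w (x + s *: v)) (dg := fun=> C)
    (df := fun s => 'D_v ('D_v w) (x + s *: v))) => u /bd.
  - by move=> _; exact: dline.
  - by rewrite ler_norml => /andP[].
have taylor x (t : R) : B x -> 0 <= t <= 1 -> `|w (x + t *: v) - w x - t * 'D_v w x| <= C * t ^+ 2.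
  move=> Bx /andP[t0 t1].
  have bd u : 0 <= u <= t -> `|'D_v w (x + u *: v) - 'D_v w x| <= C * t.
    move=> /andP[u0 ut]; apply: le_trans (lip _ _ Bx _) _; first by rewrite u0 (le_trans ut).
    by rewrite ler_wpM2l.
  have dC (c u : R) : is_derive u 1 ( *%R c) c by exact: is_derive_mull.
  have x0 : w x = w (x + 0 *: v) by rewrite scale0r addr0.
  rewrite ler_norml; apply/andP; split.
    rewrite lerBrDr -subr_ge0.
    have : ('D_v w x - C * t) * t - ('D_v w x - C * t) * 0 <= w (x + t *: v) - w (x + 0 *: v).
      apply: (MVT_leT t0 (f := *%R ('D_v w x - C * t)) (g := fun s => w (x + s *: v)) (df := fun=> 'D_v w x - C * t)
        (dg := fun s => 'D_v w (x + s *: v))) => u /bd.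
      - by move=> _; exact: dline.
      - by rewrite ler_norml => /andP[h _]; lra.
    by rewrite -x0 mulr0 subr0 -subr_ge0; congr (0 <= _); ring.
  rewrite lerBlDr -subr_ge0.
  have : w (x + t *: v) - w (x + 0 *: v) <= ('D_v w x + C * t) * t - ('D_v w x + C * t) * 0.
    apply: (MVT_leT t0 (g := *%R ('D_v w x + C * t)) (f := fun s => w (x + s *: v)) (dg := fun=> 'D_v w x + C * t)
      (df := fun s => 'D_v w (x + s *: v))) => u /bd.
    - by move=> _; exact: dline.
    - by rewrite ler_norml => /andP[_ h]; lra.
  by rewrite -x0 mulr0 subr0 -subr_ge0; congr (0 <= _); ring.
have mB : measurable B by exact: measurable_eball.
have cw := smooth_continuous sw; have cdw := smooth_continuous sdw.
have ctw (t : R) : continuous (fun x : rV => w (x + t *: v)).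
  have cs : continuous (fun x : rV => x + t *: v).
    move=> x; exact: (continuousD (@cvg_id _ (nbhs x)) (@cvg_cst _ (t *: v) _ (nbhs x) _)).
  by move=> x; apply: (@continuous_comp _ _ _ (fun x : rV => x + t *: v) w); [exact: cs|exact: cw].
have I1 := continuous_integrable_eball rho1 cdw.
have I0 := continuous_integrable_eball rho1 cw.
have It t := continuous_integrable_eball rho1 (ctw t).
have Bfin : leb B \is a fin_num by rewrite ge0_fin_numE ?measure_ge0//; exact: lebesgue_eball_lty.
have E (t : R) : 0 < t <= 1 -> (`|t%:E * \int[leb]_(x in B) ('D_v w x)%:E| <= (C * t ^+ 2)%:E * leb B)%E.
  move=> /andP[t0 t1].
  have e0 : (\int[leb]_(x in B) (w (x + t *: v))%:E - \int[leb]_(x in B) (w x)%:E = 0)%E.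
    rewrite (@integral_eball_setT (fun x => w (x + t *: v))) => [|x xr]; last first.
      apply: w0; have := enormB (x + t *: v) (t *: v).
      by rewrite addrK enormZ v1 mulr1 gtr0_norm// => h; rewrite /rho1 in xr; lra.
    rewrite (@integral_eball_setT w) => [|x xr]; last by apply: w0; exact: le_trans xr.
    rewrite integral_translation; last exact: continuous_measurable_rV.
    rewrite -(@integral_eball_setT w rho1) => [|x xr]; last by apply: w0; exact: le_trans xr.
    by rewrite subee// integrable_fin_num.
  have e1 : (t%:E * \int[leb]_(x in B) ('D_v w x)%:E = - \int[leb]_(x in B) (w (x + t *: v) - w x - t * 'D_v w x)%:E)%E.
    under [X in (- X)%E]eq_integral do rewrite EFinB.
    have It1 : leb.-integrable B (fun x => (t%:E * ('D_v w x)%:E)%E) by exact: integrableZl.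
    have Id : leb.-integrable B (EFin \o (fun x => w (x + t *: v) - w x)).
      by have := integrableB mB (It t) I0; apply: eq_integrable => // x _.
    rewrite (integralB mB Id); last by apply: eq_integrable It1.
    rewrite (_ : (\int[leb]_(x in B) (EFin \o _) x)%E = 0%E); last first.
      by rewrite -[RHS]e0 -(integralB mB (It t) I0); exact: eq_integral.
    rewrite sub0e oppeK.
    under [RHS]eq_integral do rewrite EFinM.
    by rewrite integralZl.
  rewrite e1 abseN; have m1 : measurable_fun B (fun x => w (x + t *: v) - w x - t * 'D_v w x).
    apply: measurable_funTS; apply: measurable_funB.
      by apply: measurable_funB; exact: continuous_measurable_rV.
    by apply: measurable_funM => //; exact: continuous_measurable_rV.
  apply: (le_trans (le_abse_integral _ mB _)); first exact/measurable_EFinP.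
  rewrite -integral_cst//; apply: ge0_le_integral => //.
  - apply: (measurableT_comp (@abse_measurable _ _)) => //; exact/measurable_EFinP.
  - by move=> x Bx; rewrite /= lee_fin; apply: taylor => //; rewrite t1 ltW.
have Ifin := integrable_fin_num mB I1.
rewrite -(fineK Ifin) -(fineK Bfin) in E *.
set J := fine _ in E *; set L := fine (leb B) in E.
have L0 : 0 <= L by exact: fine_ge0.
have E' (t : R) : 0 < t <= 1 -> `|J| <= C * L * t.
  move=> t01; have /andP[t0 t1] := t01; have := E t t01.
  rewrite -EFinM /abse lee_fin normrM gtr0_norm// -ler_pdivlMl//.
  by rewrite (_ : t^-1 * _ = C * L * t)//; field; rewrite gt_eqF.
congr EFin; apply/eqP; rewrite -normr_le0 leNgt; apply/negP => J0.
have K0 : 0 <= C * L by exact: mulr_ge0.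
pose t := Num.min 1 (`|J| / (2 * (C * L + 1))).
have t0 : 0 < t by rewrite lt_min ltr01/= divr_gt0// mulr_gt0// ltr_wpDl.
have t1 : t <= 1 by rewrite ge_min lexx.
have := E' t; rewrite t0 t1 => /(_ isT); apply/negP; rewrite -ltNge.
apply: (@le_lt_trans _ _ (C * L * (`|J| / (2 * (C * L + 1))))).
  by rewrite ler_wpM2l// ge_min lexx orbT.
rewrite mulrA ltr_pdivrMr; last by rewrite mulr_gt0// ltr_wpDl.
rewrite [ltLHS]mulrC ltr_pM2l//; lra.
Qed.

Lemma derive_outside_supp (phi : rV -> R) v x : ~ supp phi x -> 'D_v phi x = 0 /\ phi x = 0.
Proof.
move=> nx; have op : open (~` supp phi) by apply: closed_openC; exact: closed_closure.
have z : \forall y \near x, cst 0 y = phi y.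
  apply: filterS (open_nbhs_nbhs (conj op nx)) => y ny /=.
  by apply/esym/eqP/negPn/negP => h; apply: ny; exact: subset_closure.
split; last by rewrite -(nbhs_singleton z).
have d := near_eq_is_derive z (is_derive_cst 0 x v).
exact: (@derive_val _ _ _ _ _ _ _ d).
Qed.

Theorem weak_grad_smooth (u : rV -> R) (rho : R) : 0 < rho -> smooth u ->
  weak_grad (eball N rho) u (grad u).
Proof.
move=> rho0 su phi [sphi _ phis] i.
have out x : rho <= enorm x -> forall v, 'D_v phi x = 0 /\ phi x = 0.
  move=> xr v; apply: derive_outside_supp => /phis; rewrite /eball/= => h.
  by move: h; rewrite ltNge xr.
pose v : rV := delta_mx ord0 i.
have dM x : 'D_v (fun x => u x * phi x) x = u x * grad phi x ord0 i + grad u x ord0 i * phi x.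
  rewrite deriveM; try by apply: diff_derivable; exact: smooth_differentiable.
  by rewrite !mxE /GRing.scale/= (mulrC (phi x)).
have H := @integral_derive_eq0 (fun x => u x * phi x) v rho (smoothM su sphi) (enorm_delta _ i) rho0.
have : (\int[leb]_(x in eball N rho) (u x * grad phi x ord0 i + grad u x ord0 i * phi x)%:E = 0)%E.
  rewrite -[RHS]H => [|x /out h|x /out h]; last 2 first.
  - by have [_ ->] := h v; rewrite mulr0.
  - by rewrite dM grad_coord; have [-> ->] := h v; rewrite !mulr0 addr0.
  by apply: eq_integral => x _; rewrite dM.
have cu : continuous u by exact: smooth_continuous.
have cphi : continuous phi by exact: smooth_continuous.
have cgu : continuous (fun x => grad u x ord0 i) by exact: continuous_grad_coord.
have cgp : continuous (fun x => grad phi x ord0 i) by exact: continuous_grad_coord.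
have c1 : continuous (fun x => u x * grad phi x ord0 i).
  by move=> x; exact: (cvgM (cu x) (cgp x)).
have c2 : continuous (fun x => grad u x ord0 i * phi x).
  by move=> x; exact: (cvgM (cgu x) (cphi x)).
have mB := @measurable_eball R N rho.
have i1 := continuous_integrable_eball rho c1; have i2 := continuous_integrable_eball rho c2.
under eq_integral do rewrite EFinD.
have f1 := integrable_fin_num mB i1; have f2 := integrable_fin_num mB i2.
rewrite (integralD mB i1 i2) -[in X in X -> _](fineK f1) -[in X in X -> _](fineK f2) -EFinD => -[h].
by rewrite -(fineK f1) -(fineK f2) -EFinN; congr EFin; apply/eqP; rewrite -addr_eq0 h.
Qed.

End weak_gradient.

(** * Upper bounds for the Steklov quotient *)

Section steklov_upper.
Context (R : realType) (n : nat) (rho p : R) (rho0 : 0 < rho) (p1 : 1 < p).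
Local Notation N := n.+1.
Local Notation leb := (lebesgue_rV R N).
Local Notation ball := (eball N rho : set 'rV[R]_N).
Local Notation bd := (bdry (eball N rho) : set 'rV[R]_N).
Local Notation surf := (sphere_measure N rho : set 'rV[R]_N -> \bar R).
Local Notation en := (@energy R N p ball).
Local Notation area := (@sphere_area R n rho).

Let p0 : 0 < p. Proof. exact: lt_trans p1. Qed.

Lemma energy_smooth_fin (u : 'rV[R]_N -> R) : smooth u -> (en (u, grad u) < +oo)%E.
Proof.
move=> su; have := continuous_integrable_eball rho (continuous_energy_density p1 su).
move=> /(integrable_fin_num (@measurable_eball R N rho)).
rewrite ge0_fin_numE//; apply: integral_ge0 => x _; rewrite lee_fin.
by rewrite addr_ge0 ?powR_ge0.
Qed.

Lemma W1p_smooth (u : 'rV[R]_N -> R) : smooth u -> W1p p ball (u, grad u).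
Proof.
move=> su; split.
- exact: measurable_smooth.
- exact: measurable_funTS (measurable_grad su).
- exact: energy_smooth_fin.
- exact: weak_grad_smooth.
Qed.

Lemma W1p_cvg_cst (u : 'rV[R]_N -> R) : W1p_cvg p ball (fun=> u) (u, grad u).
Proof.
rewrite /W1p_cvg (_ : (fun _ => _) = cst 0%E); first exact: cvg_cst.
apply/funext => k; rewrite /energy/= -[RHS](integral0 leb ball).
apply: eq_integral => x _; rewrite !subrr enorm0 normr0 powR0 ?addr0//.
by rewrite gt_eqF.
Qed.

Lemma trace_finite (u : 'rV[R]_N -> R) : smooth u ->
  (\int[surf]_(x in bd) (`|u x| `^ p)%:E < +oo)%E.
Proof.
move=> su; have [C C0 HC] := @trace_inequality R n rho p rho0 p1.
apply: (le_lt_trans (HC u su)); apply: lte_mul_pinfty => //; exact: energy_smooth_fin.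
Qed.

(** The approximants vanish on the sphere, so the trace inequality makes the boundary integral of
    [u] arbitrarily small. Test functions with a positive boundary integral are therefore outside
    [W1p0]. *)
Lemma surf_W1p0_eq0 (u : 'rV[R]_N -> R) (L : R) : smooth u -> W1p0 p ball (u, grad u) ->
  (L%:E <= \int[surf]_(x in bd) (`|u x| `^ p)%:E)%E -> L <= 0.
Proof.
move=> su [_ [phi phiC phicvg]] HL; rewrite leNgt; apply/negP => L0.
have [C C0 HC] := @trace_inequality R n rho p rho0 p1.
have e0 : 0 < L / (2 * (C + 1)) by rewrite divr_gt0// mulr_gt0// ltr_wpDl.
have CL : C * (L / (2 * (C + 1))) < L.
  rewrite mulrA ltr_pdivrMr; last by rewrite mulr_gt0// ltr_wpDl.
  by rewrite [ltLHS]mulrC ltr_pM2l//; lra.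
have [k _ Hk] := ereal_cvg0_lt e0 phicvg.
have {}Hk := Hk k (leqnn k).
have [sphi _ phis] := phiC k.
have sB := smoothB sphi su.
have U x : bd x -> `|u x| = `|phi k x - u x|.
  rewrite bdry_eball// => xr.
  have [|_ ->] := @derive_outside_supp R N (phi k) 0 x; last by rewrite sub0r normrN.
  by move=> /phis; rewrite /eball/= xr ltxx.
have E : (\int[surf]_(x in bd) (`|u x| `^ p)%:E = \int[surf]_(x in bd) (`|phi k x - u x| `^ p)%:E)%E.
  have mv (v : 'rV[R]_N -> R) : smooth v -> measurable_fun bd (fun x => `|v x| `^ p).
    by move=> sv; apply: measurable_funTS; exact: measurable_powR_smooth.
  rewrite (integral_sphere rho0 (mv _ su) (fun x => powR_ge0 _ _)) (integral_sphere rho0 (mv _ sB) (fun x => powR_ge0 _ _)).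
  apply: (congr1 (fun t => _ * t)%E); apply: eq_integral => x /set_mem Dx.
  by rewrite U//; exact: bdry_ray.
have gB : grad (fun x => phi k x - u x) = (fun x => grad (phi k) x - grad u x).
  by apply/funext => x; exact: gradB (smooth_differentiable sphi x) (smooth_differentiable su x).
have GB : en (fun x => phi k x - u x, grad (fun x => phi k x - u x)) =
    en (fun x => phi k x - (u, grad u).1 x, fun x => grad (phi k) x - (u, grad u).2 x).
  by rewrite gB.
have := HC _ sB; rewrite -E GB => H.
have : (L%:E <= C%:E * (L / (2 * (C + 1)))%:E)%E.
  apply: (le_trans HL); apply: (le_trans H); apply: lee_wpmul2l; first by rewrite lee_fin.
  exact: ltW.
by rewrite -EFinM lee_fin leNgt CL.
Qed.

(** A smooth function is its own approximating sequence, both for the closure and for the trace. *)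
Theorem steklov_upper_bound (q : R) (A : set 'rV[R]_N) (u : 'rV[R]_N -> R) (E c : R) :
  0 < q -> q <= p -> smooth u -> (forall x, A x -> u x = 0) ->
  (en (u, grad u) <= E%:E)%E -> 0 < c ->
  (c%:E <= \int[surf]_(x in bd) (`|u x| `^ q)%:E)%E ->
  (steklov p ball q surf A <= (E / c `^ (p / q))%:E)%E.
Proof.
move=> q0 qp su uA uE c0 cu.
have mu : measurable_fun bd u by exact: measurable_smooth.
have [Q [Q0 /(_ (trace_finite su)) QE QT]] := surf_jensen rho0 q0 qp mu.
have cQ : c <= Q by rewrite -lee_fin -QE.
have Qp : 0 < Q by exact: lt_le_trans cQ.
have k0 : 0 < p / q by rewrite divr_gt0.
have Qk : 0 < Q `^ (p / q) by rewrite powR_gt0.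
apply: (@le_trans _ _ (en (u, grad u) / (\int[surf]_(x in bd) (`|u x| `^ q)%:E) `^ (p / q))%E).
  apply: ereal_inf_lbound; exists (u, grad u), u; split => //.
  - split; first exact: W1p_smooth.
    by exists (fun=> u) => //; exact: W1p_cvg_cst.
  - move=> /(surf_W1p0_eq0 su) => /(_ _ QT); apply/negP; rewrite -ltNge mulr_gt0//.
    by rewrite powR_gt0// sphere_area_gt0.
  - split => //; first exact: trace_finite.
    exists (fun=> u); split => //; first exact: W1p_cvg_cst.
    rewrite (_ : (fun _ => _) = cst 0%E); first exact: cvg_cst.
    apply/funext => k; rewrite (_ : (fun x => (`|u x - u x| `^ p)%:E) = fun=> 0%:E); last first.
      by apply/funext => x; rewrite subrr normr0 powR0// gt_eqF.
    by rewrite (integral_sphere_cst n rho0 (lexx 0)) mul0r.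
rewrite QE poweR_EFin inver gt_eqF//.
have E0 : 0 <= E by rewrite -lee_fin; apply: le_trans uE; exact: energy_ge0.
apply: (@le_trans _ _ (E%:E * ((Q `^ (p / q))^-1)%:E)%E).
  by apply: lee_wpmul2r => //; rewrite lee_fin invr_ge0 ltW.
rewrite -EFinM lee_fin ler_wpM2l// lef_pV2 ?posrE ?powR_gt0//.
by apply: powR_ge_le => //; exact: ltW.
Qed.

End steklov_upper.

(** * Test functions for perturbed holes *)

Lemma tangent_combine (R : realFieldType) (X Y A QA W B S Z : R) :
  Y <= X + (QA - A) -> QA - W - Z <= Y -> Z <= B -> A - B + S <= X + (S + W).
Proof. lra. Qed.

Section test_function.
Context (R : realType) (m : nat) (p r rho : R).
Hypotheses (p1 : 1 < p) (r0 : 0 < r) (rrho : r < rho).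
Local Notation N := m.+2.
Local Notation leb := (lebesgue_rV R N).
Local Notation rV := ('rV[R]_N).
Local Notation D := (@punctured_ball R m.+1 rho).
Local Notation ball := (eball N rho : set rV).
Local Notation bd := (bdry (eball N rho) : set rV).
Local Notation surf := (sphere_measure N rho : set rV -> \bar R).
Local Notation en := (@energy R N p ball).
Local Notation area := (@sphere_area R m.+1 rho).
Local Notation off0 := [set x : rV | x != 0].
Variables (h : rV -> R) (Hm : R).
Hypotheses (hC : forall k, Ck_on k off0 h) (mh : measurable_fun setT h).
Hypotheses (hH : forall x, `|h x| <= Hm).
Hypothesis h_hom : forall x (s : R), x != 0 -> 0 < s -> h (s *: x) = h x.
Hypothesis h_int : (\int[leb]_(x in D) (h x)%:E = 0)%E.
Variables (F P dP : R -> R) (E0 E1 C1 k0 eta t e c G : R).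
Hypotheses (cF : continuous F) (F0 : forall s : R, 0 <= F s) (C10 : 0 <= C1).
Hypotheses (k0r : k0 <= r / 2) (k0rho : k0 <= (rho - r) / 2).
Hypothesis HE : forall k : R, `|k| <= k0 ->
  (\int[@lebesgue_measure R]_(s in `[(r + k)%R, rho]) (F (s - k) * s ^+ m.+1)%:E <=
    (E0 + k * E1 + C1 * k ^+ 2)%:E)%E.
Hypotheses (eta0 : 0 < eta) (PC : forall k, Ck_on k setT P).
Hypothesis dPE : forall s : R, is_derive s 1 P (dP s).
Hypothesis P0 : forall s : R, s <= r + eta -> P s = 0.
Hypothesis PF : forall s : R, r < s -> `|dP s| `^ p + `|P s| `^ p <= F s.
Hypotheses (t0 : 0 <= t) (e0 : 0 < e) (tk : t * Hm + e <= k0).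
Hypothesis hG : forall x, r / 2 <= enorm x <= rho -> enorm (grad h x) <= G.
Hypotheses (c1 : 1 <= c) (Gc : (1 + t ^+ 2 * G ^+ 2) `^ (p / 2) <= c).

Let p0 : 0 < p. Proof. exact: lt_trans p1. Qed.
Let rho0 : 0 < rho. Proof. exact: lt_trans rrho. Qed.
Let Hm0 : 0 <= Hm. Proof. exact: le_trans (normr_ge0 (h 0)) (hH 0). Qed.
Let mD := @measurable_punctured_ball R m.+1 rho.

(** The profile [P] starts beyond [r]; shifting it by [kap] makes [U] vanish up to the outer graph
    [r + t h + e], hence on the hole. *)
Let kap (x : rV) := t * h x + e.
Let U (x : rV) := P (enorm x - kap x).

Let kap_le x : `|kap x| <= t * Hm + e.
Proof.
apply: (le_trans (ler_normD _ _)); rewrite normrM (ger0_norm t0) (gtr0_norm e0) lerD2r.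
exact: ler_wpM2l.
Qed.

Let kap_k0 x : `|kap x| <= k0. Proof. exact: le_trans (kap_le x) tk. Qed.

Let near0 x : enorm x < r / 2 -> enorm x - kap x < r.
Proof.
move=> xr; have := kap_k0 x; rewrite ler_norml => /andP[h1 _].
by have := k0r; move: xr h1; lra.
Qed.

Let U_zero x : enorm x - kap x < r + eta -> U x = 0.
Proof. by move=> xr; apply: P0; exact: ltW. Qed.

Let U_near0 x : enorm x < r / 2 -> U x = 0.
Proof. by move=> /near0 xr; apply: U_zero; apply: lt_trans xr _; rewrite ltrDl. Qed.

Let oC : open [set x : rV | enorm x < r / 2]. Proof. exact: open_eball. Qed.

(** The possible singularity of [h] at the origin is invisible, because [U] vanishes identically for
    [|x| < r / 2]; the two open regions are glued. *)
Lemma smooth_test_function : smooth U.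
Proof.
move=> k; apply/is_CkP; have o := @open_off0 R N.
have -> : setT = off0 `|` [set x : rV | enorm x < r / 2].
  apply/seteqP; split=> // x _ /=; have [->|x0] := eqVneq x 0; last by left.
  by right; rewrite enorm0 divr_gt0.
apply: Ck_on_setU; last by apply: (Ck_on_eq oC _ (Ck_on_cst k 0 oC)) => x /= /U_near0.
apply: (@Ck_on_comp R _ k off0 setT (fun x => enorm x - kap x) P) => //; first exact: openT.
apply: Ck_on_sub_fun => //; first exact: Ck_on_enorm.
apply: Ck_on_add => //; last exact: Ck_on_cst.
by apply: Ck_on_mul => //; exact: Ck_on_cst.
Qed.
Let sU := smooth_test_function.

Let grad_near0 x : enorm x < r / 2 -> grad U x = 0.
Proof.
move=> xr; have z : \forall y \near x, cst 0 y = U y.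
  by apply: filterS (open_nbhs_nbhs (conj oC xr)) => y /= /U_near0.
apply/rowP => i; rewrite grad_coord mxE.
have d := near_eq_is_derive z (is_derive_cst 0 x (delta_mx ord0 i)).
exact: (@derive_val _ _ _ _ _ _ _ d).
Qed.

Let dP0 s : s < r + eta -> dP s = 0.
Proof.
move=> sr; have d : is_derive s 1 P 0.
  apply: (@near_eq_is_derive _ R^o R^o (cst 0)).
  near=> u; rewrite P0//; apply: ltW; near: u; exact: lt_nbhsl.
by rewrite -(@derive_val _ _ _ _ _ _ _ (dPE s)) (@derive_val _ _ _ _ _ _ _ d).
Unshelve. all: by end_near. Qed.

Let g y := enorm (grad U y) `^ p + `|U y| `^ p.

Let h_ray x s : x != 0 -> 0 < s -> h (ray x s) = h x.
Proof. by move=> x0 s0; rewrite /ray h_hom// divr_gt0// enorm_gt0. Qed.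

Let powR0p : 0 `^ p = 0 :> R. Proof. by rewrite powR0// gt_eqF. Qed.

Let g_inner x s : x != 0 -> 0 <= s -> s < r + kap x -> g (ray x s) = 0.
Proof.
move=> x0 s0 sr; have ns := enorm_ray x0 s0.
have [sm|sM] := ltP s (r / 2); first by rewrite /g grad_near0 ?U_near0 ?ns// enorm0 normr0 powR0p addr0.
have sp : 0 < s by apply: lt_le_trans sM; rewrite divr_gt0.
have rx0 : ray x s != 0 by rewrite -enorm_gt0 ns.
have kE : enorm (ray x s) - kap (ray x s) < r + eta.
  by rewrite ns /kap h_ray// -/(kap x) ltrBlDr; apply: lt_trans sr _; rewrite -addrA ltrD2l ltrDr.
rewrite /g U_zero// normr0 powR0p addr0.
have dh : differentiable h (ray x s) by have [/(_ _ rx0)] := hC 1%N.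
have := enorm_grad_radial t e rx0 dPE dh (fun u u0 => h_hom rx0 u0).
rewrite dP0// expr0n/= mul0r => /eqP; rewrite sqrf_eq0 => /eqP.
by rewrite -/(U) => ->; rewrite powR0p.
Qed.

(** [c] absorbs the factor [(1 + t^2 |grad h|^2)^(p/2)] produced by the tilt of the level sets. *)
Let g_outer x s : x != 0 -> r + kap x <= s -> s <= rho -> g (ray x s) <= c * F (s - kap x).
Proof.
move=> x0 rs srho; have c0 : 0 <= c by exact: le_trans c1.
have sM : r / 2 <= s.
  have := kap_k0 x; rewrite ler_norml => /andP[h1 _].
  by have := k0r; move: rs h1; lra.
have sp : 0 < s by apply: lt_le_trans sM; rewrite divr_gt0.
have ns := enorm_ray x0 (ltW sp).
have rx0 : ray x s != 0 by rewrite -enorm_gt0 ns.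
have kE : enorm (ray x s) - kap (ray x s) = s - kap x by rewrite ns /kap h_ray.
have dh : differentiable h (ray x s) by have [/(_ _ rx0)] := hC 1%N.
have Gx : enorm (grad h (ray x s)) <= G by apply: hG; rewrite ns sM.
have E := enorm_grad_radial t e rx0 dPE dh (fun u u0 => h_hom rx0 u0).
rewrite -/(U) -/(kap _) kE in E.
have gE : enorm (grad U (ray x s)) `^ p <= c * `|dP (s - kap x)| `^ p.
  have T0 : 0 <= 1 + t ^+ 2 * enorm (grad h (ray x s)) ^+ 2 by rewrite addr_ge0// mulr_ge0// sqr_ge0.
  have -> : enorm (grad U (ray x s)) `^ p = (enorm (grad U (ray x s)) ^+ 2) `^ (p / 2).
    by rewrite -powR_mulrn ?enorm_ge0// -powRrM; congr (_ `^ _); field.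
  rewrite E powRM ?sqr_ge0// -real_normK ?num_real//.
  have -> : (`|dP (s - kap x)| ^+ 2) `^ (p / 2) = `|dP (s - kap x)| `^ p.
    by rewrite -powR_mulrn// -powRrM; congr (_ `^ _); field.
  rewrite mulrC ler_wpM2r ?powR_ge0//; apply: le_trans Gc.
  apply: powR_ge_le => //; first by rewrite divr_ge0// ltW.
  rewrite lerD2l ler_wpM2l ?sqr_ge0//; apply: lerXn2r; rewrite ?nnegrE ?enorm_ge0//.
  exact: le_trans (enorm_ge0 _) Gx.
have UE : U (ray x s) = P (s - kap x) by rewrite /U kE.
have gc : g (ray x s) <= c * (`|dP (s - kap x)| `^ p + `|P (s - kap x)| `^ p).
  rewrite /g UE mulrDr; apply: lerD => //.
  by rewrite ler_peMl// powR_ge0.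
apply: (le_trans gc); apply: ler_wpM2l => //.
have : r <= s - kap x by rewrite lerBrDr.
(* [PF] speaks only of radii beyond [r]; at [r] itself [P] and [dP] vanish. *)
rewrite le_eqVlt => /predU1P[<-|/PF//].
have re : r < r + eta by rewrite ltrDl.
have Pr : P r = 0 by apply: P0; exact: ltW.
by rewrite dP0// Pr normr0 powR0p addr0.
Qed.

Let g0 y : 0 <= g y. Proof. by rewrite addr_ge0 ?powR_ge0. Qed.
Let mg : measurable_fun setT g.
Proof. by apply: continuous_measurable_rV; exact: continuous_energy_density. Qed.

Let ray_energy x : x != 0 ->
  (\int[@lebesgue_measure R]_(s in `[0%R, rho]) (g (ray x s) * s ^+ m.+1)%:E <=
   (c * (E0 + kap x * E1 + C1 * kap x ^+ 2))%:E)%E.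
Proof.
move=> x0; have c0 : 0 <= c by exact: le_trans c1.
have kk := kap_k0 x; have := kk; rewrite ler_norml => /andP[k1 k2].
have r1 : 0 <= r + kap x by have := k0r; have := r0; move: k1; lra.
have r2 : r + kap x <= rho by have := k0rho; have := rrho; move: k2; lra.
pose B := [set` `[r + kap x, rho]].
have BI : `[0%R, rho] `&` B = B.
  apply/seteqP; split=> s /=; first by case.
  by rewrite /B/= !in_itv/= => /andP[h1 h2]; rewrite h1 h2 (le_trans r1).
pose f s : \bar R := (c * (F (s - kap x) * s ^+ m.+1))%:E.
have mf : measurable_fun setT (fun s : R => F (s - kap x) * s ^+ m.+1).
  apply: measurable_funM; last by apply: continuous_measurable_fun; exact: exprn_continuous.
  apply: continuous_measurable_fun => s.
  apply: (@continuous_comp _ _ _ (fun s : R => s - kap x) F); last exact: cF.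
  by apply: cvgB; [exact: cvg_id|exact: cvg_cst].
apply: (@le_trans _ _ (\int[@lebesgue_measure R]_(s in `[0%R, rho]) (f \_ B) s)%E).
  apply: ge0_le_integral => //.
  - by move=> s; rewrite /= in_itv/= => /andP[s0 _]; rewrite lee_fin mulr_ge0// exprn_ge0.
  - apply/measurable_EFinP; apply: measurable_funM.
      apply: measurable_funTS; apply: continuous_measurable_fun => s.
      apply: (@continuous_comp _ _ _ (ray x) g); first exact: continuous_ray.
      exact: continuous_energy_density.
    by apply: measurable_funTS; apply: continuous_measurable_fun; exact: exprn_continuous.
  - apply: measurable_funTS; apply/(measurable_restrictT _ (measurable_itv _)).
    apply: measurable_funTS; apply/measurable_EFinP; exact: measurable_funM.
  - move=> s; rewrite /= in_itv/= => /andP[s0 s1]; rewrite /patch.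
    case: ifPn => [/set_mem|/negP sB].
      rewrite /B/= in_itv/= => /andP[h1 h2]; rewrite /f lee_fin mulrA ler_wpM2r ?exprn_ge0//.
      exact: g_outer.
    rewrite g_inner ?mul0r// ltNge; apply/negP => h1; apply: sB; apply: mem_set.
    by rewrite /B/= in_itv/= h1.
rewrite -integral_mkcondr BI /f; under eq_integral do rewrite EFinM.
rewrite ge0_integralZl//.
- by rewrite EFinM; apply: lee_wpmul2l; [rewrite lee_fin|exact: HE].
- exact: measurable_itv.
- by apply/measurable_EFinP; exact: measurable_funTS.
- move=> s; rewrite /B/= in_itv/= => /andP[h1 _]; rewrite lee_fin mulr_ge0// exprn_ge0//.
  exact: le_trans h1.
Qed.

Let leb_D : leb D = (fine (leb D))%:E.
Proof. by rewrite fineK// ge0_fin_numE// lebesgue_punctured_ball_lty. Qed.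

(** Ray by ray the bound is affine in [h] up to the errors collected in [B], and the linear part
    integrates to 0. The second hypothesis keeps the affine bound nonnegative. *)
Lemma energy_test_function (B : R) : `|E1| * e + C1 * (t * Hm + e) ^+ 2 <= B ->
  `|t * E1| * Hm <= E0 + B ->
  (en (U, grad U) <= (area / rho ^+ m.+1 * (c * (E0 + B)))%:E)%E.
Proof.
move=> HB Ht; have c0 : 0 <= c by exact: le_trans c1.
have d0 : 0 <= N%:R / rho ^+ N by rewrite divr_ge0// exprn_ge0// ltW.
pose k x := (E0 + B) + t * E1 * h x.
have k_ge0 x : 0 <= k x.
  have : `|t * E1 * h x| <= E0 + B by rewrite normrM; apply: le_trans (ler_wpM2l _ (hH x)) Ht.
  by rewrite ler_norml => /andP[h1 _]; rewrite /k; move: h1; lra.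
have mk : measurable_fun setT k by apply: measurable_funD => //; exact: measurable_funM.
have -> : en (U, grad U) = (\int[leb]_(x in ball) (g x)%:E)%E by [].
rewrite (polar_eball rho0 mg g0).
apply: (@le_trans _ _ ((N%:R / rho ^+ N)%:E * \int[leb]_(x in D) (c * k x)%:E)%E).
  apply: lee_wpmul2l; first by rewrite lee_fin.
  apply: ge0_le_integral => //.
  - move=> x _; apply: integral_ge0 => s; rewrite /= in_itv/= => /andP[s0 _].
    by rewrite lee_fin mulr_ge0// exprn_ge0.
  - apply: measurable_funTS.
    refine (@measurable_integral_param _ _ _ _ R (@lebesgue_measure R)
      (fun p : rV * measurableTypeR R => (g (ray p.1 p.2) * p.2 ^+ m.+1)%:E) `[0%R, rho] _ _ _) => //.
      apply/measurable_EFinP; apply: measurable_funM; first exact: (measurableT_comp mg (@measurable_ray2 R m.+1)).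
      by apply: measurable_funX; exact: measurable_snd.
    by move=> q /=; rewrite in_itv/= => /andP[s0 _]; rewrite lee_fin mulr_ge0// exprn_ge0.
  - by apply: measurable_funTS; apply/measurable_EFinP; exact: measurable_funM.
  move=> x Dx; apply: (le_trans (ray_energy (punctured_ball_neq0 Dx))).
  rewrite lee_fin ler_wpM2l// /k -!addrA lerD2l.
  have h1 : C1 * kap x ^+ 2 <= C1 * (t * Hm + e) ^+ 2.
    rewrite ler_wpM2l// -[kap x ^+ 2]real_normK ?num_real//.
    by apply: lerXn2r; rewrite ?nnegrE ?kap_le// (le_trans _ (kap_le 0)).
  have h2 : e * E1 <= `|E1| * e by rewrite mulrC ler_wpM2r ?(ltW e0)// ler_norm.
  rewrite {1}/kap mulrDl (_ : t * h x * E1 = t * E1 * h x); last by ring.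
  by move: h1 h2 HB; lra.
rewrite ge0_integralZl_fin//; last exact: measurable_funTS.
rewrite (integral_affine_mean0 _ _ mh hH h_int) leb_D -!EFinM lee_fin.
rewrite le_eqVlt; apply/orP; left; apply/eqP.
by rewrite /sphere_area exprS; field; rewrite ?expf_neq0 gt_eqF.
Qed.

(** The tangent of [y^q] at [a] bounds the boundary values from below by an affine function of [h],
    whose linear part integrates to 0. Adding [S >= |w h|] on both sides keeps the integrands
    nonnegative. *)
Lemma boundary_test_function (q a b B : R) : 1 <= q -> 0 <= a ->
  (forall k : R, `|k| <= k0 -> a - b * k - C1 * k ^+ 2 - e <= P (rho - k)) ->
  q * a `^ (q - 1) * (`|b| * e + C1 * (t * Hm + e) ^+ 2 + e) <= B -> B <= a `^ q ->
  ((area * (a `^ q - B))%:E <= \int[surf]_(x in bd) (`|U x| `^ q)%:E)%E.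
Proof.
move=> q1 a0 HP HB Ba; pose be := q * a `^ (q - 1).
have be0 : 0 <= be by rewrite mulr_ge0 ?powR_ge0// (le_trans ler01).
pose w := be * t * b; pose S := `|w| * Hm.
have S0 : 0 <= S by rewrite mulr_ge0.
have mUq : measurable_fun setT (fun x => `|U x| `^ q).
  by apply: measurable_powR_normr; apply: continuous_measurable_rV; exact: smooth_continuous.
have pt x : D x -> a `^ q - B + S <= `|U (ray x rho)| `^ q + (S + w * h x).
  move=> Dx; have x0 := punctured_ball_neq0 Dx.
  have UE : U (ray x rho) = P (rho - kap x).
    by rewrite /U /kap enorm_ray ?(ltW rho0)// h_ray.
  have h1 := HP _ (kap_k0 x); rewrite -UE in h1.
  have h2 : C1 * kap x ^+ 2 <= C1 * (t * Hm + e) ^+ 2.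
    rewrite ler_wpM2l// -[kap x ^+ 2]real_normK ?num_real//.
    by apply: lerXn2r; rewrite ?nnegrE ?kap_le// (le_trans _ (kap_le 0)).
  have h3 : b * e <= `|b| * e by rewrite ler_wpM2r ?(ltW e0)// ler_norm.
  have h4 : a - b * t * h x - (`|b| * e + C1 * (t * Hm + e) ^+ 2 + e) <= `|U (ray x rho)|.
    apply: le_trans (ler_norm _); apply: le_trans h1.
    rewrite /kap mulrDr mulrA; move: h2 h3; rewrite /kap; lra.
  have h5 := powR_tangent q1 (normr_ge0 (U (ray x rho))) a0.
  have h6 := ler_wpM2l be0 h4.
  have ea : be * a = q * a `^ q.
    have [->|an] := eqVneq a 0; first by rewrite mulr0 powR0 ?mulr0// gt_eqF// (lt_le_trans ltr01).
    by rewrite /be -mulrA [_ * a]mulrC powR_mulD ?lt0r ?an// addrC subrK.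
  have h7 : q * (`|U (ray x rho)| * a `^ (q - 1)) = be * `|U (ray x rho)| by rewrite /be; ring.
  rewrite h7 in h5.
  have h8 : be * (a - b * t * h x - (`|b| * e + C1 * (t * Hm + e) ^+ 2 + e)) =
    q * a `^ q - w * h x - be * (`|b| * e + C1 * (t * Hm + e) ^+ 2 + e) by rewrite -ea /w; ring.
  rewrite h8 in h6; have h9 : be * (`|b| * e + C1 * (t * Hm + e) ^+ 2 + e) <= B by exact: HB.
  rewrite mulrBl mul1r in h5; exact: tangent_combine h5 h6 h9.
rewrite (integral_sphere rho0 (measurable_funTS mUq)); last by move=> x; exact: powR_ge0.
have mUr : measurable_fun D (fun x => `|U (ray x rho)| `^ q).
  by apply: measurable_funTS; exact: (measurableT_comp mUq (measurable_ray rho)).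
have I : (\int[leb]_(x in D) (a `^ q - B + S)%:E <=
    \int[leb]_(x in D) (`|U (ray x rho)| `^ q + (S + w * h x))%:E)%E.
  apply: ge0_le_integral => //.
  - by move=> x _; rewrite lee_fin addr_ge0// subr_ge0.
  - apply/measurable_EFinP; apply: measurable_funD => //; apply: measurable_funTS.
    by apply: measurable_funD => //; exact: measurable_funM.
have Sw x : 0 <= S + w * h x.
  have : `|w * h x| <= S by rewrite normrM ler_wpM2l.
  by rewrite ler_norml => /andP[h1 _]; rewrite addrC -lerBlDr sub0r.
have msw : measurable_fun D (fun x => S + w * h x).
  by apply: measurable_funTS; apply: measurable_funD => //; exact: measurable_funM.
have uq x : 0 <= `|U (ray x rho)| `^ q by exact: powR_ge0.
rewrite [X in (_ <= X)%E]ge0_integralD_fin// in I.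
rewrite (integral_affine_mean0 _ _ mh hH h_int) integral_cst// leb_D -!EFinM in I.
have J : (((a `^ q - B) * fine (leb D))%:E <= \int[leb]_(x in D) (`|U (ray x rho)| `^ q)%:E)%E.
  have Sf : (S * fine (leb D))%:E \is a fin_num by [].
  move: I; rewrite [X in (_ * X <= _)%E]leb_D.
  by rewrite -EFinM mulrDl EFinD leeD2rE.
apply: le_trans (lee_wpmul2l _ J); last by rewrite lee_fin divr_ge0// ltW.
by rewrite -EFinM lee_fin /sphere_area mulrAC mulrA.
Qed.

End test_function.

Lemma exists_small (R : realType) (a b : R) : 0 <= a -> 0 < b ->
  exists2 s : R, 0 < s & forall t, 0 <= t <= s -> t * a <= b.
Proof.
move=> a0 b0; exists (b / (a + 1)); first by rewrite divr_gt0// ltr_wpDl.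
move=> t /andP[t0 ts]; apply: le_trans (_ : t * (a + 1) <= _); first by rewrite ler_wpM2l// lerDl.
by rewrite -ler_pdivlMr// ltr_wpDl.
Qed.

Lemma mul3_affine_le (R : realFieldType) (a b c t : R) : 0 <= a -> 0 <= b -> 0 <= c -> 0 <= t <= 1 ->
  (1 + a * t) * (1 + b * t) * (1 + c * t) <= 1 + ((1 + a) * (1 + b) * (1 + c)) * t.
Proof.
move=> a0 b0 c0 /andP[t0 t1].
have step (x y : R) : 0 <= x -> 0 <= y -> (1 + x * t) * (1 + y * t) <= 1 + (x + y + x * y) * t.
  move=> x0 y0; have : x * y * t * t <= x * y * t.
    by rewrite ler_piMr// !mulr_ge0.
  have -> : (1 + x * t) * (1 + y * t) = 1 + x * t + y * t + x * y * t * t by ring.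
  by rewrite !mulrDl; lra.
have ab0 : 0 <= a + b + a * b by rewrite !addr_ge0// mulr_ge0.
apply: (@le_trans _ _ ((1 + (a + b + a * b) * t) * (1 + c * t))).
  by rewrite ler_wpM2r ?step// addr_ge0// mulr_ge0.
apply: (le_trans (step _ _ ab0 c0)); rewrite lerD2l ler_wpM2r//.
have -> : (1 + a) * (1 + b) * (1 + c) = 1 + (a + b + a * b + c + (a + b + a * b) * c) by ring.
by rewrite lerDr.
Qed.

Lemma powR_1D_le (R : realType) (s : R) : exists2 C, 0 <= C & forall x, `|x| <= 2^-1 ->
  (1 + x) `^ s <= 1 + C * `|x|.
Proof.
have [C C0 HC] := powR_quadratic s; exists (`|s| + C); first by rewrite addr_ge0.
move=> x x2; have := HC _ x2; rewrite ler_norml => /andP[_ h].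
have h1 : s * x <= `|s| * `|x| by rewrite -normrM ler_norm.
have h2 : C * x ^+ 2 <= C * `|x|.
  rewrite ler_wpM2l// -real_normK ?num_real// expr2 ler_piMl//.
  by apply: le_trans x2 _; rewrite invf_le1// ler1n.
by rewrite mulrDl; lra.
Qed.

Section upper_bound.
Context (R : realType) (m : nat) (p q r rho : R).
Hypotheses (p1 : 1 < p) (q1 : 1 < q) (qp : q <= p) (r0 : 0 < r) (rrho : r < rho).
Local Notation N := m.+2.
Local Notation leb := (lebesgue_rV R N).
Local Notation rV := ('rV[R]_N).
Local Notation D := (@punctured_ball R m.+1 rho).
Local Notation ball := (eball N rho : set rV).
Local Notation surf := (sphere_measure N rho : set rV -> \bar R).
Local Notation area := (@sphere_area R m.+1 rho).
Variables (z : R -> R) (M : R).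
Hypothesis dz : forall x, r < x -> is_derive x 1 z (1 + m.+1%:R / (p - 1) * z x / x - z x `^ p / (p - 1)).
Hypothesis zM : forall x, r < x -> 0 < z x <= M.
Hypotheses (cz : continuous z) (zr : z r = 0).
Variables (h : rV -> R) (Hm : R).
Hypotheses (hC : forall k, Ck_on k [set x : rV | x != 0] h) (mh : measurable_fun setT h).
Hypotheses (hH : forall x, `|h x| <= Hm).
Hypothesis h_hom : forall x (s : R), x != 0 -> 0 < s -> h (s *: x) = h x.
Hypothesis h_int : (\int[leb]_(x in D) (h x)%:E = 0)%E.

Let p0 : 0 < p. Proof. exact: lt_trans p1. Qed.
Let q0 : 0 < q. Proof. exact: lt_trans q1. Qed.
Let rho0 : 0 < rho. Proof. exact: lt_trans rrho. Qed.
Let Hm0 : 0 <= Hm. Proof. exact: le_trans (normr_ge0 (h 0)) (hH 0). Qed.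

Let grad_bound : exists2 G, 0 <= G & forall x, r / 2 <= enorm x <= rho -> enorm (grad h x) <= G.
Proof.
pose K : set rV := [set x | r / 2 <= enorm x] `&` [set x | enorm x <= rho].
have cK : closed K.
  apply: closedI; last exact: closed_enorm_le.
  rewrite (_ : [set x | _] = @enorm R N @^-1` [set s | r / 2 <= s]) //.
  by apply: closed_comp => [x _|]; [exact: continuous_enorm|exact: closed_ge].
have K0 x : K x -> x != 0.
  by move=> [h1 _]; rewrite -enorm_gt0; apply: lt_le_trans h1; rewrite divr_gt0.
have cf x : K x -> {for x, continuous (fun x => enorm (grad h x))}.
  move=> /K0 x0; apply: (@continuous_comp _ _ _ (grad h) (@enorm R N)); last exact: continuous_enorm.
  apply: continuous_rV => i; rewrite (_ : (fun x => _) = 'D_(delta_mx ord0 i) h).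
    by have [_ /(_ (delta_mx ord0 i))] := hC 1%N; apply.
  by apply/funext => y; rewrite grad_coord.
have [G G0 HG] := continuous_bounded_rV cK (fun x h => h.2) cf.
exists G => // x /andP[x1 x2]; apply: le_trans (HG x _) => //.
by rewrite ger0_norm ?enorm_ge0.
Qed.

(* [X] and [B] are the errors in the boundary and energy terms. *)
Let quotient_le (a fl S c E0 B X Y : R) : 0 < a -> 0 < fl -> 0 < S -> E0 = fl * a `^ p * rho ^+ m.+1 ->
  0 <= c -> 0 <= B -> 0 <= X <= 2^-1 -> (1 - X) `^ (- (p / q)) <= Y ->
  S / rho ^+ m.+1 * (c * (E0 + B)) / (S * (a `^ q - X * a `^ q)) `^ (p / q) <=
  fl * S `^ (1 - p / q) * (c * (1 + E0^-1 * B) * Y).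
Proof.
move=> a0 fl0 S0 E0E c0 B0 /andP[X0 X2] HY.
have ap : 0 < a `^ p by rewrite powR_gt0.
have rn : 0 < rho ^+ m.+1 by rewrite exprn_gt0.
have X1 : 0 < 1 - X by lra.
have E00 : 0 < E0 by rewrite E0E !mulr_gt0.
have -> : S * (a `^ q - X * a `^ q) = S * (a `^ q * (1 - X)) by ring.
rewrite powRM ?(ltW S0)//; last by rewrite mulr_ge0 ?powR_ge0// ltW.
rewrite (@powRM _ (a `^ q)) ?powR_ge0 ?(ltW X1)// -powRrM (_ : q * (p / q) = p); last by field; rewrite gt_eqF.
rewrite -powR_mulD// powRN.
rewrite powRN in HY.
have Sk : 0 < S `^ (p / q) by rewrite powR_gt0.
have Xk : 0 < (1 - X) `^ (p / q) by rewrite powR_gt0.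
have -> : S / rho ^+ m.+1 * (c * (E0 + B)) / (S `^ (p / q) * (a `^ p * (1 - X) `^ (p / q))) =
  fl * (S * (S `^ (p / q))^-1) * (c * (1 + E0^-1 * B) * ((1 - X) `^ (p / q))^-1).
  rewrite E0E; field; rewrite !gt_eqF//=.
apply: ler_wpM2l; first by rewrite mulr_ge0 ?(ltW fl0)// mulr_ge0 ?(ltW S0)// invr_ge0 ltW.
by apply: ler_wpM2l => //; rewrite mulr_ge0// addr_ge0// mulr_ge0// invr_ge0 ltW.
Qed.

Ltac isolate := clear -R m p q r rho p1 q1 qp r0 rrho z M dz zM cz zr h Hm hC mh hH h_hom h_int p0 q0 rho0 Hm0 grad_bound quotient_le.

Theorem radial_upper_bound : exists C t0 e0, [/\ 0 < C, 0 < t0 & 0 < e0] /\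
  forall t e (A : set rV), 0 <= t <= t0 -> 0 < e <= e0 ->
  (forall x, A x -> enorm x < r + t * h x + e) ->
  (steklov p ball q surf A <= (flux p z rho * area `^ (1 - p / q) * (1 + C * (t ^+ 2 + e)))%:E)%E.
Proof.
have [F [a [b [E1 [C1 [k0 [[cF F0 [a0 C10] [/andP[k00 k01] [k0r k0rho]]] [HE HP]]]]]]]] :=
  upper_profile p1 r0 rrho dz zM cz zr.
have [G G0 HG] := grad_bound.
have [Cp Cp0 HCp] := powR_1D_le (p / 2); have [Cq Cq0 HCq] := powR_1D_le (- (p / q)).
have fl0 : 0 < flux p z rho by rewrite /flux powR_gt0//; have /andP[] := zM rrho.
have S0 : 0 < area by exact: sphere_area_gt0.
pose E0 := flux p z rho * a `^ p * rho ^+ m.+1.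
have E00 : 0 < E0 by rewrite !mulr_gt0 ?exprn_gt0// powR_gt0.
pose B1 := `|E1| + C1 * (2 * Hm ^+ 2 + 2).
have H20 : 0 <= 2 * Hm ^+ 2 + 2 by nonneg.
have B10 : 0 <= B1 by rewrite addr_ge0// mulr_ge0.
pose be := q * a `^ (q - 1).
have be0 : 0 <= be by rewrite mulr_ge0 ?powR_ge0// ltW.
pose B2 := be * (`|b| + C1 * (2 * Hm ^+ 2 + 2) + 1).
have B20 : 0 <= B2 by rewrite mulr_ge0// !addr_ge0// mulr_ge0.
have aq : 0 < a `^ q by rewrite powR_gt0.
pose K1 := Cp * G ^+ 2; pose K2 := E0^-1 * B1; pose K3 := Cq * (B2 / a `^ q).
have K10 : 0 <= K1 by rewrite mulr_ge0// sqr_ge0.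
have K20 : 0 <= K2 by rewrite mulr_ge0// invr_ge0 ltW.
have K30 : 0 <= K3 by rewrite mulr_ge0// divr_ge0// ltW.
(* [K1], [K2], [K3] are the relative errors of gradient, energy and boundary term per unit of
   [t^2 + e]; the product form is what [mul3_affine_le] delivers. *)
pose C := (1 + K1) * (1 + K2) * (1 + K3).
have C0 : 0 < C by rewrite !mulr_gt0// ltr_pwDl.
have half0 : 0 < (2^-1 : R) by rewrite invr_gt0.
have [s1 s10 S1] := exists_small Hm0 (divr_gt0 k00 (ltr0Sn R 1)).
have [s2 s20 S2] := exists_small (sqr_ge0 G) half0.
have [s3 s30 S3] := exists_small (mulr_ge0 (normr_ge0 E1) Hm0) E00.
have [s4 s40 S4] := exists_small B20 (divr_gt0 aq (ltr0Sn R 3)).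
exists C, (Num.min (Num.min s1 s2) (Num.min (Num.min s3 s4) 2^-1)), (Num.min (k0 / 2) (Num.min s4 2^-1)); split.
  by split; rewrite // !lt_min ?s10 ?s20 ?s30 ?s40 ?half0 ?divr_gt0.
move=> t e A /andP[t0 tt] /andP[e0 ee] HA.
move: tt; rewrite !le_min -!andbA => /and5P[t1 t2 t3 t4 t5].
move: ee; rewrite !le_min => /and3P[e1 e2 e3].
have {}S1 : t * Hm <= k0 / 2 by apply: S1; rewrite t0.
have {}S2 : t * G ^+ 2 <= 2^-1 by apply: S2; rewrite t0.
have {}S3 : t * (`|E1| * Hm) <= E0 by apply: S3; rewrite t0.
have S4t : t * B2 <= a `^ q / 4 by apply: S4; rewrite t0.
have S4e : e * B2 <= a `^ q / 4 by apply: S4; rewrite e2 ltW.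
have ti : t <= 1 by apply: le_trans t5 _; rewrite invf_le1// ler1n.
have ei : e <= 1 by apply: le_trans e3 _; rewrite invf_le1// ler1n.
have tsq : t ^+ 2 <= t by rewrite expr2 ler_piMl.
have esq : e ^+ 2 <= e by rewrite expr2 ler_piMl// ltW.
have t20 : 0 <= t ^+ 2 by exact: sqr_ge0.
pose tau := t ^+ 2 + e.
have tau0 : 0 <= tau by rewrite addr_ge0// ltW.
have tau1 : tau <= 1 by rewrite /tau; move: tsq t5 e3; isolate; lra.
have ttau : t ^+ 2 <= tau by rewrite lerDl ltW.
have etau : e <= tau by rewrite lerDr.
have sq2 : (t * Hm + e) ^+ 2 <= (2 * Hm ^+ 2 + 2) * tau.
  have h1 : (t * Hm + e) ^+ 2 <= 2 * Hm ^+ 2 * t ^+ 2 + 2 * e ^+ 2.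
    by rewrite -subr_ge0 (_ : _ - _ = (t * Hm - e) ^+ 2) ?sqr_ge0//; ring.
  apply: (le_trans h1); have -> : (2 * Hm ^+ 2 + 2) * tau = 2 * Hm ^+ 2 * tau + 2 * tau by ring.
  apply: lerD; first by rewrite ler_wpM2l// mulr_ge0// sqr_ge0.
  by rewrite ler_wpM2l//; exact: le_trans esq etau.
pose c := 1 + K1 * tau.
have c1 : 1 <= c by rewrite lerDl mulr_ge0.
have Gc : (1 + t ^+ 2 * G ^+ 2) `^ (p / 2) <= c.
  have y0 : 0 <= t ^+ 2 * G ^+ 2 by rewrite mulr_ge0// sqr_ge0.
  have y2 : `|t ^+ 2 * G ^+ 2| <= 2^-1.
    by rewrite ger0_norm//; apply: le_trans S2; rewrite ler_wpM2r ?sqr_ge0.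
  apply: (le_trans (HCp _ y2)); rewrite ger0_norm// lerD2l /K1 -mulrA ler_wpM2l// mulrC.
  by rewrite ler_wpM2l// sqr_ge0.
have tk : t * Hm + e <= k0 by move: S1 e1; isolate; lra.
(* Truncation at height [e / 2], so that the loss [2 * d] at the outer sphere is [e]. *)
have [P [dP [eta [eta0 PC dPE Pz [PF Pb]]]]] := HP _ (divr_gt0 e0 (ltr0Sn R 1)).
have Pb' (k : R) : `|k| <= k0 -> a - b * k - C1 * k ^+ 2 - e <= P (rho - k).
  by move=> /Pb; rewrite (_ : 2 * (e / 2) = e)//; field.
pose B := B1 * tau.
have HB : `|E1| * e + C1 * (t * Hm + e) ^+ 2 <= B.
  by rewrite /B mulrDl lerD// ?ler_wpM2l// -mulrA ler_wpM2l.
have B0 : 0 <= B by exact: mulr_ge0.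
have HtE : `|t * E1| * Hm <= E0 + B.
  by apply: le_trans (_ : E0 <= _); [rewrite normrM (ger0_norm t0) -mulrA|rewrite lerDl].
pose X := B2 / a `^ q * tau.
have XE : X * a `^ q = B2 * tau by rewrite /X; field; rewrite gt_eqF.
have Xtau : B2 * tau <= a `^ q / 2.
  have : B2 * t ^+ 2 <= B2 * t by rewrite ler_wpM2l.
  by move: S4t S4e; rewrite /tau mulrDr !(mulrC _ B2); isolate; lra.
have X0 : 0 <= X by rewrite mulr_ge0// divr_ge0// ltW.
have X2 : X <= 2^-1 by rewrite -(ler_pM2r aq) XE; apply: (le_trans Xtau); rewrite mulrC.
have HB2 : q * a `^ (q - 1) * (`|b| * e + C1 * (t * Hm + e) ^+ 2 + e) <= B2 * tau.
  have -> : B2 * tau = be * (`|b| * tau + C1 * ((2 * Hm ^+ 2 + 2) * tau) + tau) by rewrite /B2; ring.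
  apply: ler_wpM2l => //; apply: (lerD _ etau); apply: lerD.
    by apply: ler_wpM2l; [exact: normr_ge0|exact: etau].
  by apply: ler_wpM2l; [exact: C10|exact: sq2].
have B2a : B2 * tau <= a `^ q by apply: (le_trans Xtau); move: aq; isolate; lra.
pose U x := P (enorm x - (t * h x + e)).
have sU : smooth U by exact: (smooth_test_function r0 hC hH k0r eta0 PC Pz t0 e0 tk).
have EU := energy_test_function p1 r0 rrho hC mh hH h_hom h_int cF F0 C10 k0r k0rho HE eta0 PC dPE Pz PF t0 e0 tk HG c1 Gc HB HtE.
have BU := boundary_test_function r0 rrho hC mh hH h_hom h_int C10 k0r eta0 PC Pz t0 e0 tk (ltW q1) (ltW a0) Pb' HB2 B2a.
have UA x : A x -> U x = 0.
  move=> /HA xA; apply: Pz; apply: ltW; apply: lt_trans (_ : r < _); last by rewrite ltrDl.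
  by rewrite ltrBlDr addrA.
have cb : 0 < area * (a `^ q - B2 * tau) by rewrite mulr_gt0// subr_gt0; apply: (le_lt_trans Xtau); move: aq; isolate; lra.
apply: (le_trans (steklov_upper_bound rho0 p1 q0 qp sU UA EU cb BU)).
rewrite lee_fin -XE.
have HY : (1 - X) `^ (- (p / q)) <= 1 + K3 * tau.
  have := HCq (- X); rewrite normrN (ger0_norm X0) => /(_ X2) hX.
  by apply: (le_trans hX); have -> : K3 * tau = Cq * X by rewrite /K3 /X; ring.
have X02 : 0 <= X <= 2^-1 by rewrite X0.
apply: (le_trans (quotient_le a0 fl0 S0 erefl (le_trans ler01 c1) B0 X02 HY)).
apply: ler_wpM2l; first by rewrite mulr_ge0 ?powR_ge0// ltW.
rewrite /B mulrA -/K2 /c; apply: mul3_affine_le => //.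
by rewrite tau0.
Qed.

End upper_bound.

(** * The flow *)

Lemma lipschitz_bound_continuous (R : realType) (U W : normedModType R) (f : U -> W) (k : R) :
  0 < k -> (forall x y, `|f x - f y| <= k * `|x - y|) -> continuous f.
Proof.
move=> k0 fk x; apply/cvgrPdist_lt => e e0.
have ek : 0 < e / k by rewrite divr_gt0.
near=> y; apply: le_lt_trans (fk _ _) _; rewrite -ltr_pdivlMl// mulrC.
suff : ball x (e / k) y by rewrite -ball_normE.
by near: y; exact: nbhsx_ballx.
Unshelve. all: by end_near. Qed.

Section curves.
Context (R : realType) (N : nat).
Implicit Types (x y e : 'rV[R]_N) (c : R -> 'rV[R]_N).

Lemma dotBl x y e : dot (x - y) e = dot x e - dot y e.
Proof. by rewrite dotDl -scaleN1r dotZl mulN1r. Qed.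

Lemma enorm_le_dot e (k : R) : 0 <= k -> dot e e <= k * enorm e -> enorm e <= k.
Proof.
move=> k0; rewrite -enorm2 expr2; have [->//|e0] := eqVneq e 0; first by rewrite enorm0.
by rewrite ler_pM2r// enorm_gt0.
Qed.

(** A mean value inequality for curves, paired with a fixed vector. With the increment itself as [e]
    and division by its length in [enorm_le_dot], it yields Euclidean estimates without
    differentiating the norm. *)
Lemma curve_dot_le c (c' : R -> 'rV[R]_N) e (k t : R) : 0 <= t ->
  {within `[0, t], continuous c} -> (forall s, 0 < s < t -> is_derive s 1 c (c' s)) ->
  (forall s, 0 < s < t -> dot (c' s) e <= k) -> dot (c t - c 0) e <= k * t.
Proof.
move=> t0 cc dc ck.
have cd : {within `[0, t], continuous (fun s => dot (c s) e)}.
  have ce : continuous (fun y : 'rV[R]_N => dot y e).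
    apply: (@continuous_dot R N _ (fun y : 'rV[R]_N => y) (fun=> e)); first by move=> y; exact: cvg_id.
    by move=> y; exact: cst_continuous.
  by move=> s; apply: (@continuous_comp _ _ _ (c : subspace _ -> _) (fun y => dot y e)); [exact: cc|exact: ce].
have ck' : {within `[0, t], continuous ( *%R k)}.
  by apply: continuous_subspaceT => s; exact: is_derive_continuous (is_derive_mull k s).
have d1 s : 0 < s < t -> is_derive s 1 (fun s => dot (c s) e) (dot (c' s) e).
  move=> /dc ds; have := is_derive_dot ds (is_derive_cst e s 1).
  have -> : dot (c s) (0 : 'rV[R]_N) = 0 by rewrite -(scale0r e) dotZr mul0r.
  by rewrite addr0.
have d2 s : 0 < s < t -> is_derive s 1 ( *%R k) k by move=> _; exact: is_derive_mull.
have := MVT_le t0 d1 d2 ck cd ck'; rewrite mulr0 subr0.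
by rewrite dotBl.
Qed.

End curves.

Section flow.
Context (R : realType) (N : nat) (V : 'rV[R]_N -> 'rV[R]_N) (psi : R -> 'rV[R]_N -> 'rV[R]_N).
Variables (K M : R).
Hypotheses (flowV : is_flow V psi) (K0 : 0 <= K) (M0 : 0 <= M).
Hypotheses (VK : forall x y, enorm (V x - V y) <= K * enorm (x - y)) (VM : forall x, enorm (V x) <= M).
Local Notation rV := 'rV[R]_N.

Let psi0 x : psi 0 x = x. Proof. by have [] := flowV x. Qed.
Let psi_c x t : {within `[0, t], continuous (psi ^~ x)}.
Proof.
have [_ c _] := flowV x; apply: continuous_subspaceW c.
by move=> s /=; rewrite !in_itv/= => /andP[->].
Qed.
Let psi_d x (s t : R) : 0 < s < t -> is_derive s 1 (psi ^~ x) (V (psi s x)).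
Proof. by move=> /andP[s0 _]; have [_ _] := flowV x; apply. Qed.

Lemma flow_near x t : 0 <= t -> enorm (psi t x - x) <= M * t.
Proof.
move=> t0; apply: enorm_le_dot; first exact: mulr_ge0.
set e := psi t x - x; have := @curve_dot_le R N (psi ^~ x) (fun s => V (psi s x)) e (M * enorm e) t t0.
rewrite psi0 -/e mulrAC; apply; [exact: psi_c|by move=> s; exact: psi_d|].
move=> s _; apply: le_trans (dot_le_enorm _ _) _.
by rewrite ler_wpM2r ?enorm_ge0.
Qed.

Lemma flow_linear x t : 0 <= t -> enorm (psi t x - x - t *: V x) <= K * M * t ^+ 2.
Proof.
move=> t0; apply: enorm_le_dot; first by rewrite !mulr_ge0// sqr_ge0.
set e := _ - _ - _.
have := @curve_dot_le R N (psi ^~ x) (fun s => V (psi s x)) e (dot (V x) e + K * M * t * enorm e) t t0.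
rewrite psi0 => H.
have {}H : dot (psi t x - x) e <= (dot (V x) e + K * M * t * enorm e) * t.
  apply: H; [exact: psi_c|by move=> s; exact: psi_d|].
  move=> s /andP[s0 st].
  have -> : dot (V (psi s x)) e = dot (V x) e + dot (V (psi s x) - V x) e.
    by rewrite -dotDl addrC subrK.
  rewrite lerD2l; apply: le_trans (dot_le_enorm _ _) _; rewrite ler_wpM2r ?enorm_ge0//.
  apply: le_trans (VK _ _) _; rewrite -mulrA ler_wpM2l//.
  by apply: le_trans (flow_near _ (ltW s0)) _; rewrite ler_wpM2l// ltW.
have -> : dot e e = dot (psi t x - x) e - t * dot (V x) e.
  by rewrite -dotZl -dotBl.
have -> : K * M * t ^+ 2 * enorm e = (dot (V x) e + K * M * t * enorm e) * t - t * dot (V x) e by ring.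
by rewrite lerD2r.
Qed.

(** In place of Gronwall's lemma: the maximum of [|d|] over [[0, t]] is at most [|x - y|] plus a
    quarter of itself, hence at most [2 |x - y|], and this bounds the drift. *)
Lemma flow_distortion x y t : 0 <= t -> K * t <= 4^-1 ->
  enorm (psi t x - psi t y - (x - y)) <= 2^-1 * enorm (x - y).
Proof.
move=> t0 Kt; pose d s := psi s x - psi s y.
have cd : {within `[0, t], continuous d}.
  by move=> s; apply: cvgB; [exact: psi_c|exact: psi_c].
have cn : {within `[0, t], continuous (fun s => enorm (d s))}.
  by move=> s; apply: (@continuous_comp _ _ _ (d : subspace _ -> _) (@enorm R N)); [exact: cd|exact: continuous_enorm].
have [c cI cmax] := EVT_max t0 cn.
move: cI; rewrite in_itv/= => /andP[c0 ct].
have d0 : d 0 = x - y by rewrite /d !psi0.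
have dk s : 0 <= s -> s <= t -> enorm (d s - (x - y)) <= K * enorm (d c) * s.
  move=> s0 st; apply: enorm_le_dot; first by rewrite !mulr_ge0// enorm_ge0.
  set e := d s - _; have := @curve_dot_le R N d (fun s => V (psi s x) - V (psi s y)) e (K * enorm (d c) * enorm e) s s0.
  rewrite d0 -/e [K * _ * _ * s]mulrAC; apply.
  - by apply: continuous_subspaceW cd => u /=; rewrite !in_itv/= => /andP[->]/= us; exact: le_trans st.
  - by move=> u us; apply: is_deriveB; exact: psi_d us.
  - move=> u /andP[u0 us]; apply: le_trans (dot_le_enorm _ _) _; rewrite ler_wpM2r ?enorm_ge0//.
    apply: le_trans (VK _ _) _; rewrite ler_wpM2l//; apply: cmax.
    by rewrite in_itv/= (ltW u0) (le_trans (ltW us)).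
have m2 : enorm (d c) <= 2 * enorm (x - y).
  have h1 : enorm (d c) <= enorm (x - y) + enorm (d c - (x - y)).
    by apply: le_trans (enormD _ _); rewrite addrC subrK.
  have h2 := dk _ c0 ct.
  have h3 : K * enorm (d c) * c <= 4^-1 * enorm (d c).
    rewrite mulrAC ler_wpM2r ?enorm_ge0//; apply: le_trans Kt; exact: ler_wpM2l.
  have := enorm_ge0 (d c); move: h1 h2 h3; lra.
apply: le_trans (dk t t0 (lexx t)) _; rewrite mulrAC.
apply: (@le_trans _ _ (4^-1 * (2 * enorm (x - y)))).
  by apply: ler_pM => //; rewrite ?mulr_ge0// enorm_ge0.
by have := enorm_ge0 (x - y); lra.
Qed.

Lemma flow_defect_continuous t y : 0 <= t -> K * t <= 4^-1 -> continuous (fun x => psi t x - y).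
Proof.
move=> t0 Kt; apply: (@lipschitz_bound_continuous R _ _ _ (2 * N%:R + 1)) => [|a b].
  by rewrite ltr_wpDl// mulr_ge0.
rewrite opprB addrA subrK; apply: (le_trans (normr_le_enorm _)).
have h1 := flow_distortion a b t0 Kt.
have h2 : enorm (psi t a - psi t b) <= enorm (a - b) + enorm (psi t a - psi t b - (a - b)).
  by apply: le_trans (enormD _ _); rewrite [a - b + _]addrC subrK.
have h3 := enorm_le_normr (a - b); have h4 := enorm_ge0 (a - b); have h5 := normr_ge0 (a - b).
by rewrite mulrDl mul1r -mulrA; move: h1 h2 h3 h4 h5; lra.
Qed.

(* A minimiser [x] of [|psi_t x - y|] near [y] is improved by moving it by the defect, unless the defect is 0. *)
Lemma flow_surjective t y : 0 <= t -> K * t <= 4^-1 -> exists x, psi t x = y.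
Proof.
move=> t0 Kt; pose b := 3 * (M * t) + enorm y.
have b0 : 0 <= b by rewrite addr_ge0 ?enorm_ge0// mulr_ge0// mulr_ge0.
have Mt0 : 0 <= M * t by exact: mulr_ge0.
pose C : set rV := [set x | enorm x <= b].
have cf : continuous (fun x => - enorm (psi t x - y)).
  have c1 := @flow_defect_continuous t y t0 Kt.
  have c2 : continuous (fun x => enorm (psi t x - y)).
    by move=> x; apply: (@continuous_comp _ _ _ (fun x => psi t x - y) (@enorm R N)); [exact: c1|exact: continuous_enorm].
  by move=> x; first [exact: (cvgN (c2 x)) | exact: (continuousN (c2 x))].
have Cc : compact C.
  apply: bounded_closed_compact; last exact: closed_enorm_le.
  exists b; split; first exact: num_real.
  move=> B bB x Cx; apply: le_trans (normr_le_enorm x) _.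
  by apply: le_trans Cx (ltW bB).
have C0 : C !=set0 by exists 0; rewrite /C/= enorm0.
have [x /set_mem Cx xmax] := compact_EVT_max C0 Cc (continuous_subspaceT cf).
exists x; apply/eqP; rewrite -subr_eq0 -enorm_eq0; set d := psi t x - y.
have Cy : C y by rewrite /C/= /b lerDr mulr_ge0.
have dM : enorm d <= M * t.
  have := xmax y (mem_set Cy); rewrite lerN2 => /le_trans; apply; exact: flow_near.
have Cxd : C (x - d).
  have h : enorm (x - d) <= enorm y + enorm (psi t x - x).
    by apply: le_trans (enormB _ _); rewrite (_ : x - d = y - (psi t x - x))// /d !opprB addrA addrAC addrC !addrA.
  apply: (le_trans h); rewrite /b addrC lerD2r; apply: le_trans (flow_near x t0) _.
  by move: Mt0; lra.
have := xmax _ (mem_set Cxd); rewrite lerN2 -/d => h1.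
have h2 := flow_distortion (x - d) x t0 Kt.
have E1 : x - d - x = - d by rewrite addrAC subrr add0r.
rewrite E1 opprK enormN in h2.
have E2 : psi t (x - d) - psi t x + d = psi t (x - d) - y.
  by rewrite /d addrA subrK.
rewrite E2 in h2; rewrite eq_le enorm_ge0 andbT.
by move: h1 h2; lra.
Qed.

(** Openness makes the deformed ball measurable. By [flow_distortion] the flow shrinks distances at
    most by half, so with surjectivity the points near an image have preimages near the given
    one. *)
Lemma open_flow_ball t r : 0 <= t -> K * t <= 4^-1 -> open (psi t @` eball N r).
Proof.
move=> t0 Kt; rewrite openE => _ [x xr <-]; apply/nbhs_ballP.
have d0 : 0 < (r - enorm x) / (2 * (N%:R + 1)).
  by rewrite divr_gt0 ?subr_gt0// mulr_gt0// ltr_wpDl.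
exists ((r - enorm x) / (2 * (N%:R + 1))) => //= y.
rewrite -ball_normE /= => yx.
have [x' E] := flow_surjective y t0 Kt; exists x' => //; rewrite -E in yx.
have h1 := flow_distortion x x' t0 Kt.
have h2 : enorm (x - x') <= enorm (psi t x - psi t x') + enorm (psi t x - psi t x' - (x - x')).
  by apply: le_trans (enormB _ _); rewrite subKr.
have h3 := enorm_le_normr (psi t x - psi t x').
have h4 : N%:R * `|psi t x - psi t x'| <= (r - enorm x) / 2 * (N%:R / (N%:R + 1)).
  have -> : (r - enorm x) / 2 * (N%:R / (N%:R + 1)) = N%:R * ((r - enorm x) / (2 * (N%:R + 1))).
    by field; rewrite gt_eqF// ltr_wpDl.
  by rewrite ler_wpM2l// ltW.
have h6 : N%:R / (N%:R + 1) < 1 :> R by rewrite ltr_pdivrMr ?ltr_wpDl// mul1r ltrDl.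
have h7 : (r - enorm x) / 2 * (N%:R / (N%:R + 1)) < (r - enorm x) / 2.
  by rewrite gtr_pMr// divr_gt0// subr_gt0.
have h8 : enorm x' <= enorm x + enorm (x - x').
  by apply: le_trans (enormB _ _); rewrite subKr.
rewrite /eball/=; move: h1 h2 h3 h4 h7 h8; lra.
Qed.

End flow.

Lemma radial_part0 (R : realType) (N : nat) (V : 'rV[R]_N -> 'rV[R]_N) (r : R) : radial_part V r 0 = 0.
Proof. by rewrite /radial_part /dot big1// => i _; rewrite !mxE !mulr0. Qed.

Section sandwich.
Context (R : realType) (N : nat) (V : 'rV[R]_N -> 'rV[R]_N) (psi : R -> 'rV[R]_N -> 'rV[R]_N).
Variables (K M r : R).
Hypotheses (flowV : is_flow V psi) (K0 : 0 <= K) (M0 : 0 <= M) (r0 : 0 < r).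
Hypotheses (VK : forall x y, enorm (V x - V y) <= K * enorm (x - y)) (VM : forall x, enorm (V x) <= M).
Local Notation h := (radial_part V r).
Variable t : R.
Hypotheses (t0 : 0 <= t) (Kt : K * t <= 4^-1).

Let polar_form (y : 'rV[R]_N) : y != 0 -> exists2 u : 'rV[R]_N, enorm u = 1 &
  [/\ y = enorm y *: u, dot y u = enorm y & h y = dot (V (r *: u)) u].
Proof.
move=> y0; have e0 : enorm y != 0 by rewrite enorm_eq0.
exists ((enorm y)^-1 *: y).
  by rewrite enormZ normfV (ger0_norm (enorm_ge0 y)) mulVf.
split; first by rewrite scalerA mulfV// scale1r.
- by rewrite dotZr -enorm2 expr2 mulKf.
- by rewrite /radial_part scalerA.
Qed.

Let radial_le (x u : 'rV[R]_N) : enorm u = 1 -> `|dot (V x - V (r *: u)) u| <= K * enorm (x - r *: u).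
Proof.
by move=> u1; apply: le_trans (normr_dot_le_enorm _ _) _; rewrite u1 mulr1.
Qed.

Let dist_le (x y u : 'rV[R]_N) (d : R) : enorm u = 1 -> y = enorm y *: u -> psi t x = y ->
  `|enorm x - r| <= d -> enorm (x - r *: u) <= 2 * (M * t) + d.
Proof.
move=> u1 yu E xr; have h1 := flow_near flowV M0 VM x t0; rewrite E in h1.
have h2 : enorm (x - r *: u) <= enorm (y - x) + enorm (y - r *: u).
  have -> : x - r *: u = (y - r *: u) - (y - x) by apply/rowP => i; rewrite !mxE; ring.
  by rewrite [leRHS]addrC; exact: enormB.
have h3 : enorm (y - r *: u) = `|enorm y - r|.
  by rewrite {1}yu -scalerBl enormZ u1 mulr1.
have h4 : `|enorm y - r| <= `|enorm x - r| + M * t.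
  have d1 := le_trans (enorm_distl y x) h1.
  have d2 : enorm x - enorm y <= M * t.
    by apply: le_trans (enorm_distl x y) _; rewrite -enormN opprB.
  rewrite ler_norml; have := ler_norm (enorm x - r); have := ler_norm (- (enorm x - r)).
  by rewrite normrN => h5 h6; apply/andP; split; move: h5 h6 d1 d2; lra.
by move: h1 h2 h3 h4 xr; lra.
Qed.

(** Write [y = |y| u] and pair [y = x + t V x + O(t^2)] with [u]. Then [V x . u] differs from [h y]
    by at most [K] times the distance from [x] to [r u]; the part [r - |x|] of that distance is
    absorbed because [K t <= 1/4]. *)
Lemma flow_ball_upper y : (psi t @` eball N r) y -> enorm y < r + t * h y + 3 * (K * M) * t ^+ 2.
Proof.
move=> [x xr E]; have xr' : enorm x < r by exact: xr.
have KM : 0 <= 3 * (K * M) * t ^+ 2 by rewrite !mulr_ge0// sqr_ge0.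
have [->|y0] := eqVneq y 0.
  by rewrite radial_part0 enorm0 mulr0 addr0 ltr_wpDr.
have [u u1 [yu yd hy]] := polar_form y0.
have d0 : `|enorm x - r| <= r - enorm x by rewrite ltr0_norm ?subr_lt0// opprB.
have h1 := dist_le u1 yu E d0.
have h2 := flow_linear flowV K0 M0 VK VM x t0; rewrite E in h2.
have h3 := radial_le x u1.
have h4 : K * enorm (x - r *: u) <= K * (2 * (M * t) + (r - enorm x)) by rewrite ler_wpM2l.
have E1 : enorm y = dot x u + t * dot (V x) u + dot (y - x - t *: V x) u.
  by rewrite -yd -dotZl -!dotDl; congr (dot _ u); apply/rowP => i; rewrite !mxE; ring.
have h5 : dot x u <= enorm x by apply: le_trans (dot_le_enorm _ _) _; rewrite u1 mulr1.
have h6 : dot (y - x - t *: V x) u <= K * M * t ^+ 2.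
  by apply: le_trans (dot_le_enorm _ _) _; rewrite u1 mulr1.
have h7 : dot (V x) u <= h y + K * (2 * (M * t) + (r - enorm x)).
  move: h3; rewrite dotBl -hy ler_norml => /andP[_ h3]; move: h3 h4; lra.
have h8 := ler_wpM2l t0 h7.
have h9 : K * t * (r - enorm x) <= 4^-1 * (r - enorm x) by rewrite ler_wpM2r// subr_ge0 ltW.
have E2 : t * (h y + K * (2 * (M * t) + (r - enorm x))) = t * h y + 2 * (K * M * t ^+ 2) + K * t * (r - enorm x) by ring.
have E3 : 3 * (K * M) * t ^+ 2 = 3 * (K * M * t ^+ 2) by ring.
by rewrite E1 E3; rewrite E2 in h8; move: h5 h6 h8 h9 xr'; lra.
Qed.

Hypothesis Mt : M * t <= r / 4.

(** [y] has a preimage [x]; if [|x| >= r], the same pairing forces [|y|] up to the graph. The extra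
    [M^2 / r] bounds the second-order gap between the length of [y - t V x] and its component along
    [u]. *)
Lemma flow_ball_lower y : enorm y < r + t * h y - (3 * (K * M) + M ^+ 2 / r) * t ^+ 2 ->
  (psi t @` eball N r) y.
Proof.
move=> yr; have [x E] := flow_surjective flowV K0 M0 VK VM y t0 Kt.
exists x => //; rewrite /eball/=.
have h1 := flow_near flowV M0 VM x t0; rewrite E in h1.
have Mt0 : 0 <= M * t by exact: mulr_ge0.
have r0' := r0; have Mt' := Mt.
have [y0|y0] := eqVneq y 0.
  by move: h1; rewrite y0 sub0r enormN; move: r0' Mt'; lra.
have [u u1 [yu yd hy]] := polar_form y0.
rewrite ltNge; apply/negP => rx; move: yr; apply/negP; rewrite -leNgt.
have d0 : `|enorm x - r| <= enorm x - r by rewrite ger0_norm// subr_ge0.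
have h2 := dist_le u1 yu E d0.
have h3 := flow_linear flowV K0 M0 VK VM x t0; rewrite E in h3.
have h4 := radial_le x u1.
have h5 : K * enorm (x - r *: u) <= K * (2 * (M * t) + (enorm x - r)) by rewrite ler_wpM2l.
have yx : enorm x - M * t <= enorm y.
  have := le_trans (enorm_distl x y) (_ : enorm (x - y) <= M * t).
  by rewrite -enormN opprB => /(_ h1); lra.
pose a := enorm y - t * dot (V x) u.
have Vu : `|dot (V x) u| <= M.
  by apply: le_trans (normr_dot_le_enorm _ _) _; rewrite u1 mulr1.
have tVu : t * dot (V x) u <= M * t.
  by rewrite mulrC; apply: ler_wpM2r => //; apply: le_trans (ler_norm _) Vu.
have ar : r <= 2 * a by rewrite /a; move: yx rx tVu Mt' r0'; lra.
have h6 : enorm (y - t *: V x) <= a + M ^+ 2 / r * t ^+ 2.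
  have q0 : 0 <= M ^+ 2 / r * t ^+ 2 by rewrite mulr_ge0 ?sqr_ge0// divr_ge0 ?sqr_ge0// ltW.
  have s0 : 0 <= a + M ^+ 2 / r * t ^+ 2 by move: ar r0' q0; lra.
  rewrite -(ler_pXn2r (ltn0Sn 1)) ?nnegrE ?enorm_ge0//.
  have -> : enorm (y - t *: V x) ^+ 2 = enorm y ^+ 2 - 2 * (enorm y * (t * dot (V x) u)) + t ^+ 2 * enorm (V x) ^+ 2.
    rewrite enorm2 dotBl (dotC y) (dotC (t *: V x)) !dotBl (dotC (t *: V x) y) !dotZl !dotZr -!enorm2.
    rewrite (_ : dot y (V x) = enorm y * dot (V x) u); first by ring.
    by rewrite {1}yu dotZl dotC.
  have v2 : enorm (V x) ^+ 2 <= M ^+ 2 by apply: lerXn2r; rewrite ?nnegrE ?enorm_ge0.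
  have g1 : t ^+ 2 * enorm (V x) ^+ 2 <= t ^+ 2 * M ^+ 2 by rewrite ler_wpM2l// sqr_ge0.
  have g2 : (t * dot (V x) u) ^+ 2 >= 0 by exact: sqr_ge0.
  have g3 : t ^+ 2 * M ^+ 2 <= 2 * a * (M ^+ 2 / r * t ^+ 2).
    have -> : t ^+ 2 * M ^+ 2 = r * (M ^+ 2 / r * t ^+ 2) by field; rewrite gt_eqF.
    by rewrite ler_wpM2r.
  have g4 : (M ^+ 2 / r * t ^+ 2) ^+ 2 >= 0 by exact: sqr_ge0.
  have -> : (a + M ^+ 2 / r * t ^+ 2) ^+ 2 = (enorm y ^+ 2 - 2 * (enorm y * (t * dot (V x) u))) +
     (t * dot (V x) u) ^+ 2 + 2 * a * (M ^+ 2 / r * t ^+ 2) + (M ^+ 2 / r * t ^+ 2) ^+ 2.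
    by rewrite /a; ring.
  by move: g1 g2 g3 g4; lra.
have h7 : enorm x <= enorm (y - t *: V x) + K * M * t ^+ 2.
  have xE : x = (y - t *: V x) - (y - x - t *: V x).
    by apply/rowP => i; rewrite !mxE; ring.
  by rewrite {1}xE; apply: le_trans (enormB _ _) _; rewrite lerD2l.
have h8 : h y - K * (2 * (M * t) + (enorm x - r)) <= dot (V x) u.
  move: h4; rewrite dotBl -hy ler_norml => /andP[h4 _]; move: h4 h5; lra.
have h9 := ler_wpM2l t0 h8.
have h10 : K * t * (enorm x - r) <= 4^-1 * (enorm x - r) by rewrite ler_wpM2r// subr_ge0.
have E2 : t * (h y - K * (2 * (M * t) + (enorm x - r))) = t * h y - 2 * (K * M * t ^+ 2) - K * t * (enorm x - r) by ring.
have E3 : (3 * (K * M) + M ^+ 2 / r) * t ^+ 2 = 3 * (K * M * t ^+ 2) + M ^+ 2 / r * t ^+ 2 by ring.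
rewrite E3; rewrite E2 in h9; rewrite /a in h6; move: h6 h7 h9 h10 rx; lra.
Qed.

End sandwich.

Section star_volume.
Context (R : realType) (m : nat) (rho : R) (rho0 : 0 < rho).
Local Notation N := m.+2.
Local Notation leb := (lebesgue_rV R N).
Local Notation D := (@punctured_ball R m.+1 rho).
Local Notation rV := ('rV[R]_N).

Lemma integral_below_pow (k : R) : 0 <= k <= rho ->
  (\int[@lebesgue_measure R]_(s in `[0%R, rho]) (\1_[set s | s < k] s * s ^+ m.+1)%:E = (k ^+ N / N%:R)%:E)%E.
Proof.
move=> /andP[k0 kr].
have N0 : N%:R != 0 :> R by rewrite pnatr_eq0.
have I : `[0%R, rho] `&` `[0%R, k[ = `[0%R, k[%classic :> set R.
  apply/seteqP; split=> s /=; first by case.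
  by rewrite !in_itv/= => /andP[h1 h2]; rewrite h1 h2 (le_trans (ltW h2)).
transitivity (\int[@lebesgue_measure R]_(s in `[0%R, rho]) ((fun s => (s ^+ m.+1)%:E) \_ `[0%R, k[) s)%E.
  apply: eq_integral => s; rewrite inE/= in_itv/= => /andP[s0 _].
  rewrite /patch indicE; case: (ltP s k) => sk.
    by rewrite !mem_set ?mul1r//= in_itv/= s0.
  by rewrite !memNset ?mul0r//= ?in_itv/= ?s0 ?ltNge sk//.
have mp : measurable_fun setT (fun s : R => (s ^+ m.+1)%:E).
  by apply/measurable_EFinP; apply: continuous_measurable_fun; exact: exprn_continuous.
rewrite -integral_mkcondr I integral_itv_bndo_bndc; last exact: measurable_funTS.
have dF x : 0 <= x <= k -> is_derive x 1 (fun x => N%:R^-1 * x ^+ N) (x ^+ m.+1).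
  move=> _; have h : is_derive x 1 (fun x : R => x ^+ N) (N%:R * x ^+ m.+1).
    by apply: DeriveDef; [exact: exprn_derivable|rewrite exp_derive /GRing.scale/= mulr1].
  have := @is_derive1_comp R ( *%R N%:R^-1) (fun x : R => x ^+ N) x _ _ (is_derive_mull _ _) h.
  by rewrite mulKf.
rewrite (integral_FTC k0 (@exprn_continuous _ m.+1) dF) expr0n mulr0 subr0 mulrC//.
Qed.

Lemma star_volume (k : rV -> R) : measurable_fun setT k -> (forall x, 0 <= k x < rho) ->
  (forall x s, x != 0 -> 0 < s -> k (ray x s) = k x) ->
  leb [set x | enorm x < k x] = ((rho ^- N)%:E * \int[leb]_(x in D) (k x ^+ N)%:E)%E.
Proof.
move=> mk k0 kray; pose G : set rV := [set x | enorm x < k x].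
have mG : measurable G.
  have := measurable_fun_ltr (@measurable_enorm R N) mk.
  by move=> /(_ measurableT [set true] I); rewrite setTI (_ : _ @^-1` _ = G)//.
have Gball : G `<=` eball N rho.
  by move=> x Gx; apply: lt_trans Gx _; have /andP[] := k0 x.
rewrite -/G -(setIidl Gball) -integral_indic//; last exact: measurable_eball.
rewrite (polar_eball rho0) => [||x]; [|exact: measurable_indic|by rewrite indicE].
have -> : (\int[leb]_(x in D) \int[@lebesgue_measure R]_(s in `[0%R, rho]) (\1_G (ray x s) * s ^+ m.+1)%:E =
   \int[leb]_(x in D) (N%:R^-1 * k x ^+ N)%:E)%E.
  apply: eq_integral => x /set_mem Dx; have x0 := punctured_ball_neq0 Dx.
  have /andP[kx0 kx1] := k0 x.
  rewrite mulrC -(@integral_below_pow (k x)); last by rewrite kx0 ltW.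
  apply: eq_integral => s; rewrite inE/= in_itv/= => /andP[s0 _].
  have [->|sn] := eqVneq s 0; first by rewrite expr0n !mulr0.
  have sp : 0 < s by rewrite lt0r sn.
  congr (_ * _)%:E; rewrite !indicE; congr (nat_of_bool _)%:R.
  by apply/idP/idP => /set_mem h; apply: mem_set; move: h; rewrite /G/= enorm_ray// kray.
have mkN : measurable_fun setT (fun x => k x ^+ N) by exact: measurable_funX.
rewrite ge0_integralZl_fin//; last 3 first.
- exact: measurable_punctured_ball.
- exact: measurable_funTS.
- by move=> x; rewrite exprn_ge0//; have /andP[] := k0 x.
rewrite muleA -EFinM; congr ((_)%:E * _)%E.
by field; rewrite expf_neq0 ?gt_eqF//= ?pnatr_eq0.
Qed.

End star_volume.

(** * Volume preservation and criticality *)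

Lemma le_small_eq0 (R : realType) (x k t1 : R) : 0 < t1 -> (forall t, 0 < t <= t1 -> `|x| <= k * t) -> x = 0.
Proof.
move=> t10 H; apply/eqP; rewrite -normr_le0 leNgt; apply/negP => x0.
pose t := Num.min t1 (`|x| / (2 * (`|k| + 1))).
have k0 : 0 < `|k| + 1 by rewrite ltr_wpDl.
have t0 : 0 < t by rewrite lt_min t10/= divr_gt0// mulr_gt0.
have tt : t <= t1 by rewrite ge_min lexx.
have := H t; rewrite t0 tt => /(_ isT); apply/negP; rewrite -ltNge.
apply: (@le_lt_trans _ _ ((`|k| + 1) * (`|x| / (2 * (`|k| + 1))))).
  apply: (@le_trans _ _ ((`|k| + 1) * t)).
    by rewrite ler_wpM2r ?(ltW t0)//; apply: le_trans (ler_norm k) _; rewrite lerDl.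
  by rewrite ler_wpM2l ?(ltW k0)// ge_min lexx orbT.
have -> : (`|k| + 1) * (`|x| / (2 * (`|k| + 1))) = `|x| / 2 by field; rewrite gt_eqF.
by rewrite ltr_pdivrMr// ltr_pMr// ltr1n.
Qed.

Lemma lee_pscale (R : realType) (c : R) (x y : \bar R) : 0 < c ->
  (c%:E * x <= c%:E * y)%E -> (x <= y)%E.
Proof. by move=> c0; rewrite lee_pmul2l// lte_fin. Qed.

Section flow_mean.
Context (R : realType) (m : nat) (V : 'rV[R]_m.+2 -> 'rV[R]_m.+2) (psi : R -> 'rV[R]_m.+2 -> 'rV[R]_m.+2).
Local Notation N := m.+2.
Variables (K M r rho : R).
Hypotheses (flowV : is_flow V psi) (K0 : 0 <= K) (M0 : 0 <= M) (r0 : 0 < r) (rrho : r < rho).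
Hypotheses (VK : forall x y, enorm (V x - V y) <= K * enorm (x - y)) (VM : forall x, enorm (V x) <= M).
Hypothesis hvol : preserves_volume psi (eball N r).
Local Notation h := (radial_part V r).
Hypothesis mh : measurable_fun setT h.
Local Notation leb := (lebesgue_rV R N).
Local Notation D := (@punctured_ball R m.+1 rho).

Let rho0 : 0 < rho. Proof. exact: lt_trans rrho. Qed.
Let mD := @measurable_punctured_ball R m.+1 rho.
Let hM x : `|h x| <= M. Proof. exact: radial_part_le. Qed.
Let h_ray x (s : R) : x != 0 -> 0 < s -> h (ray x s) = h x.
Proof. by move=> x0 s0; rewrite /ray radial_part_scale// divr_gt0// enorm_gt0. Qed.

Let ih : leb.-integrable D (EFin \o h).
Proof.
apply: measurable_bounded_integrable => //.
- exact: lebesgue_punctured_ball_lty.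
- exact: measurable_funTS.
- exists M; split; first exact: num_real.
  by move=> M' MM' x _; apply: le_trans (hM x) (ltW MM').
Qed.

Let J := fine (\int[leb]_(x in D) (h x)%:E)%E.
Let L := fine (leb D).
Let JE : (\int[leb]_(x in D) (h x)%:E = J%:E)%E.
Proof. by rewrite /J fineK//; exact: integrable_fin_num. Qed.
Let LE : leb D = L%:E.
Proof. by rewrite /L fineK// ge0_fin_numE// lebesgue_punctured_ball_lty. Qed.

Let gcst (b : R) : (\int[leb]_(x in D) b%:E = (b * L)%:E)%E.
Proof.
transitivity (b%:E * leb D)%E; last by rewrite LE.
exact: (integral_cst leb mD).
Qed.

Let gint (a b : R) : (\int[leb]_(x in D) (b + a * h x)%:E = (b * L + a * J)%:E)%E.
Proof.
have ic : leb.-integrable D (EFin \o cst b).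
  apply: measurable_bounded_integrable => //; first exact: lebesgue_punctured_ball_lty.
  exists `|b|; split; first exact: num_real.
  by move=> M' MM' x _; exact: ltW.
under eq_integral do rewrite EFinD EFinM.
have ia : leb.-integrable D (fun x => a%:E * (h x)%:E)%E by exact: integrableZl.
transitivity (\int[leb]_(x in D) (cst b x)%:E + \int[leb]_(x in D) (a%:E * (h x)%:E))%E.
  exact: (integralD mD ic ia).
have -> : (\int[leb]_(x in D) (a%:E * (h x)%:E) = (a * J)%:E)%E.
  transitivity (a%:E * \int[leb]_(x in D) (h x)%:E)%E; last by rewrite JE.
  exact: (integralZl mD ih).
by rewrite gcst -EFinD.
Qed.

Let star (k : 'rV[R]_N -> R) := [set x | enorm x < k x].

Ltac isolate := clear -R m V psi K M r rho flowV K0 M0 r0 rrho VK VM hvol mh rho0 mD hM h_ray ih J L JE LE gcst gint star.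

(** The deformed ball lies between two graphs at distance [C t^2] from [r + t h]. Comparing volumes
    and expanding [k^N] at [r] gives [c1 t |J| <= E t^2 L] for the integral [J] of [h], for all
    small [t > 0]; dividing by [t] leaves [J = 0]. *)
Theorem flow_mean0 : (\int[leb]_(x in D) (h x)%:E = 0)%E.
Proof.
have [C2 C20 HC2] := @Ck_on_taylor2 R (fun x => x ^+ N) setT (r / 2) (2 * r) openT (Ck_on_exprn 2 N openT) (fun x _ => Logic.I).
pose C := 3 * (K * M) + M ^+ 2 / r.
have C0 : 0 <= C by apply: addr_ge0; [apply: mulr_ge0 => //; exact: mulr_ge0|apply: divr_ge0; [exact: sqr_ge0|exact: ltW]].
pose c1 : R := N%:R * r ^+ m.+1.
have c10 : 0 < c1 by rewrite mulr_gt0// ?exprn_gt0// ltr0n.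
pose E := c1 * C + C2 * (M + C) ^+ 2.
have q0 : 0 < (4^-1 : R) by rewrite invr_gt0.
have [s1 s10 S1] := exists_small K0 q0.
have [s2 s20 S2] := exists_small M0 (divr_gt0 r0 (ltr0Sn R 3)).
have MC : 0 <= M + C by exact: addr_ge0.
have [s3 s30 S3] := exists_small MC (divr_gt0 r0 (ltr0Sn R 1)).
have rr : 0 < rho - r by rewrite subr_gt0.
have [s4 s40 S4] := exists_small MC (divr_gt0 rr (ltr0Sn R 1)).
pose t1 := Num.min (Num.min s1 s2) (Num.min (Num.min s3 s4) 1).
have t10 : 0 < t1 by rewrite !lt_min s10 s20 s30 s40 ltr01.
rewrite JE; congr EFin; apply: (@le_small_eq0 R J (E * L / c1) t1 t10) => t /andP[tp tt].
move: tt; rewrite !le_min -!andbA => /and5P[l1 l2 l3 l4 l5]; have t0 := ltW tp.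
have Kt : K * t <= 4^-1 by rewrite mulrC; apply: S1; rewrite t0.
have Mt : M * t <= r / 4 by rewrite mulrC; apply: S2; rewrite t0.
have {}S3 : t * (M + C) <= r / 2 by apply: S3; rewrite t0.
have {}S4 : t * (M + C) <= (rho - r) / 2 by apply: S4; rewrite t0.
have tsq : t ^+ 2 <= t by rewrite expr2 ler_piMl.
have Ct : C * t ^+ 2 <= C * t by rewrite ler_wpM2l.
have Ct0 : 0 <= C * t ^+ 2 by rewrite mulr_ge0// sqr_ge0.
(* [s = 1] gives the outer graph, [s = -1] the inner one. *)
pose u (s : R) x := t * h x + s * (C * t ^+ 2).
have ub s x : `|s| <= 1 -> `|u s x| <= t * (M + C).
  move=> s1'; apply: le_trans (ler_normD _ _) _; rewrite mulrDr; apply: lerD.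
    by rewrite normrM ger0_norm// ler_wpM2l.
  rewrite normrM (ger0_norm Ct0); apply: le_trans (_ : 1 * (C * t ^+ 2) <= _); first exact: ler_wpM2r.
  by rewrite mul1r (mulrC t).
pose k s x := r + u s x.
have kb s x : `|s| <= 1 -> r / 2 <= k s x <= 2 * r /\ 0 <= k s x < rho.
  move=> /(ub s x); rewrite ler_norml => /andP[h1 h2]; rewrite /k; have r0' := r0.
  by split; apply/andP; split; move: h1 h2 S3 S4 rr r0'; isolate; lra.
have mk s : measurable_fun setT (k s).
  apply: measurable_funD => //; apply: measurable_funD => //; exact: measurable_funM.
have kray s x a : x != 0 -> 0 < a -> k s (ray x a) = k s x by move=> x0 a0; rewrite /k /u h_ray.
have n1 : `|1 : R| <= 1 by rewrite normr1.
have nN1 : `|-1 : R| <= 1 by rewrite normrN normr1.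
have mA : measurable (psi t @` eball N r).
  by apply: measurable_open_rV; exact: (open_flow_ball flowV K0 M0 VK VM).
have lebA : leb (psi t @` eball N r) = ((rho ^- N)%:E * (r ^+ N * L)%:E)%E.
  rewrite (hvol t0) -[eball N r]/(star (fun=> r)) (star_volume rho0)//; last by move=> x; rewrite (ltW r0) rrho.
  by rewrite gcst.
have mstar s : measurable (star (k s)).
  have := measurable_fun_ltr (@measurable_enorm R N) (mk s).
  by move=> /(_ measurableT [set true] Logic.I); rewrite setTI (_ : _ @^-1` _ = star (k s)).
have vol s : `|s| <= 1 -> leb (star (k s)) = ((rho ^- N)%:E * \int[leb]_(x in D) (k s x ^+ N)%:E)%E.
  by move=> s1'; apply: star_volume => // [x|x a]; [have [] := kb s x s1'|exact: kray].
have rN : 0 < rho ^- N by rewrite invr_gt0 exprn_gt0.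
have up : ((r ^+ N * L)%:E <= \int[leb]_(x in D) (k 1%R x ^+ N)%:E)%E.
  apply: (lee_pscale rN).
  have H : (leb (psi t @` eball N r) <= leb (star (k 1%R)))%E.
    apply: le_measure; rewrite ?inE// => y /(flow_ball_upper flowV K0 M0 r0 VK VM t0 Kt) yk.
    have Cle : 3 * (K * M) * t ^+ 2 <= C * t ^+ 2.
      apply: ler_wpM2r; first exact: sqr_ge0.
      by rewrite /C lerDl; apply: divr_ge0; [exact: sqr_ge0|exact: ltW].
    by apply: lt_le_trans yk _; rewrite /k /u mul1r addrA lerD2l.
  by rewrite lebA (vol 1 n1) in H.
have lo : (\int[leb]_(x in D) (k (-1)%R x ^+ N)%:E <= (r ^+ N * L)%:E)%E.
  apply: (lee_pscale rN).
  have H : (leb (star (k (-1)%R)) <= leb (psi t @` eball N r))%E.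
    apply: le_measure; rewrite ?inE// => y yk.
    apply: (flow_ball_lower flowV K0 M0 r0 VK VM t0 Kt Mt).
    by apply: lt_le_trans yk _; rewrite /k /u mulN1r addrA.
  by rewrite lebA (vol (-1) nN1) in H.
have dN : 'D_1 (fun x : R => x ^+ N) r = c1 by rewrite exp_derive /GRing.scale/= mulr1.
have pt s x : `|s| <= 1 -> `|k s x ^+ N - r ^+ N - c1 * u s x| <= C2 * (M + C) ^+ 2 * t ^+ 2.
  move=> s1'; have [kk _] := kb s x s1'.
  have r2 : r / 2 <= r <= 2 * r by apply/andP; split; move: (r0); isolate; lra.
  have ku : k s x - r = u s x by rewrite /k addrC addKr.
  have := HC2 _ _ r2 kk; rewrite dN ku => /le_trans; apply.
  rewrite -mulrA ler_wpM2l// -exprMn -real_normK ?num_real//.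
  by apply: lerXn2r; rewrite ?nnegrE ?mulr_ge0// mulrC ub.
have mkN s : measurable_fun D (fun x => k s x ^+ N).
  by apply: measurable_funTS; exact: measurable_funX.
have kN0 s x : `|s| <= 1 -> 0 <= k s x ^+ N by move=> /(kb s x)[_ /andP[h1 _]]; rewrite exprn_ge0.
have Lp : 0 <= L by rewrite -lee_fin -LE.
have E0 : 0 <= E by apply: addr_ge0; [apply: mulr_ge0; [exact: ltW|exact: C0]|apply: mulr_ge0; [exact: C20|exact: sqr_ge0]].
have Et0 : 0 <= E * t ^+ 2 by apply: mulr_ge0; [exact: E0|exact: sqr_ge0].
have rNp : 0 <= r ^+ N by rewrite exprn_ge0// ltW.
have c1t : 0 <= c1 * t by rewrite mulr_ge0// ltW.
have c1h x : `|c1 * t * h x| <= c1 * t * M by rewrite normrM (ger0_norm c1t) ler_wpM2l.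
have c1tM : 0 <= c1 * t * M by exact: mulr_ge0.
have I1 : r ^+ N * L <= (r ^+ N + E * t ^+ 2) * L + c1 * t * J.
  rewrite -lee_fin -gint; apply: (le_trans up); apply: ge0_le_integral => //.
  - by move=> x _; rewrite lee_fin kN0.
  - by apply/measurable_EFinP.
  - apply/measurable_EFinP; apply: measurable_funTS; apply: measurable_funD => //; exact: measurable_funM.
  move=> x _; rewrite lee_fin; have := pt 1 x n1; rewrite ler_norml => /andP[_ h1].
  have -> : r ^+ N + E * t ^+ 2 + c1 * t * h x = r ^+ N + c1 * u 1 x + C2 * (M + C) ^+ 2 * t ^+ 2 by rewrite /E /u; ring.
  by rewrite -lerBlDl opprD addrA.
(* The constant [c1 * t * M] is added on both sides to keep the integrands nonnegative. *)
have I2 : (r ^+ N + c1 * t * M) * L + c1 * t * J <= r ^+ N * L + (E * t ^+ 2 + c1 * t * M) * L.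
  rewrite -lee_fin -gint EFinD.
  have -> : ((E * t ^+ 2 + c1 * t * M) * L)%:E = (\int[leb]_(x in D) (E * t ^+ 2 + c1 * t * M)%:E)%E.
    by rewrite gcst.
  apply: le_trans (leeD lo (lexx _)).
  rewrite -ge0_integralD_fin//; last 2 first.
  - by move=> x; rewrite kN0.
  - by move=> x; rewrite addr_ge0.
  apply: ge0_le_integral => //.
  - move=> x _; rewrite lee_fin; have := c1h x; rewrite ler_norml => /andP[h1 _].
    by move: h1 rNp; isolate; lra.
  - apply/measurable_EFinP; apply: measurable_funTS; apply: measurable_funD => //; exact: measurable_funM.
  - by apply/measurable_EFinP; apply: measurable_funD.
  move=> x _; rewrite lee_fin; have := pt (-1) x nN1; rewrite ler_norml => /andP[h1 _].
  have e1 : c1 * u (-1) x = c1 * t * h x - c1 * C * t ^+ 2 by rewrite /u; ring.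
  have e2 : E * t ^+ 2 = c1 * C * t ^+ 2 + C2 * (M + C) ^+ 2 * t ^+ 2 by rewrite /E; ring.
  by rewrite e2; rewrite e1 in h1; move: h1; isolate; lra.
have a1 : (r ^+ N + E * t ^+ 2) * L = r ^+ N * L + E * t ^+ 2 * L by exact: mulrDl.
have a2 : (r ^+ N + c1 * t * M) * L = r ^+ N * L + c1 * t * M * L by exact: mulrDl.
have a3 : (E * t ^+ 2 + c1 * t * M) * L = E * t ^+ 2 * L + c1 * t * M * L by exact: mulrDl.
rewrite a1 in I1; rewrite a2 a3 in I2.
have key : `|c1 * t * J| <= E * t ^+ 2 * L.
  rewrite ler_norml; apply/andP; split.
    by move: I1; rewrite -addrA lerDl -lerBlDl sub0r.
  by move: I2; rewrite -addrA lerD2l addrC lerD2r.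
have c1tp : 0 < c1 * t by exact: mulr_gt0.
rewrite -(ler_pM2l c1tp) -{1}(gtr0_norm c1tp) -normrM; apply: (le_trans key).
rewrite le_eqVlt; apply/orP; left; apply/eqP.
by field; rewrite gt_eqF.
Qed.

End flow_mean.

Lemma lipschitz_enorm (R : realType) (N : nat) (V : 'rV[R]_N -> 'rV[R]_N) :
  [lipschitz V x | x in setT] ->
  exists2 K, 0 <= K & forall x y, enorm (V x - V y) <= K * enorm (x - y).
Proof.
move=> [k [_ Hk]]; pose k1 := `|k| + 1.
have kk : k < k1 by apply: le_lt_trans (ler_norm k) _; rewrite ltrDl.
have k10 : 0 <= k1 by rewrite addr_ge0.
exists (N%:R * k1) => [|x y]; first exact: mulr_ge0.
have := Hk _ kk (x, y) (conj I I) => /= h.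
apply: le_trans (enorm_le_normr _) _; rewrite -mulrA ler_wpM2l//.
by apply: le_trans h _; rewrite ler_wpM2l// normr_le_enorm.
Qed.

Lemma vanishing_outside_supp (R : realType) (N : nat) (V : 'rV[R]_N -> 'rV[R]_N) (rho K : R) :
  0 <= K -> 0 <= rho -> (forall x y, enorm (V x - V y) <= K * enorm (x - y)) ->
  supp V `<=` eball N rho -> exists2 M, 0 <= M & forall x, enorm (V x) <= M.
Proof.
move=> K0 rho0 VK sV; exists (enorm (V 0) + K * rho) => [|x].
  by rewrite addr_ge0 ?enorm_ge0// mulr_ge0.
have [->|Vx] := eqVneq (V x) 0; first by rewrite enorm0 addr_ge0 ?enorm_ge0// mulr_ge0.
have xr : enorm x < rho by apply: sV; exact: subset_closure.
have h : enorm (V x) <= enorm (V 0) + enorm (V x - V 0).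
  by apply: le_trans (enormD _ _); rewrite addrC subrK.
apply: (le_trans h); rewrite lerD2l; apply: le_trans (VK _ _) _.
by rewrite subr0 ler_wpM2l// ltW.
Qed.

Lemma measurable_radial_part (R : realType) (m : nat) (V : 'rV[R]_m.+2 -> 'rV[R]_m.+2) (r : R) :
  smooth V -> measurable_fun setT (radial_part V r).
Proof.
move=> sV; apply: (@measurable_dot R m.+2 _ _ (fun x => V (ray x r)) (@dir R m)); last exact: measurable_dir.
apply: measurable_fun_rV_comp => i.
have sVi := smooth_continuous (smooth_coord i sV).
exact: (measurableT_comp (continuous_measurable_rV sVi) (@measurable_ray R m.+1 r)).
Qed.

(** [S t] and [S 0] are within [c * t^2] of the same [l], so the quotient is at most [2 * c * t] in
    absolute value; the bounds also make both values finite. *)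
Lemma difference_quotient_cvg0 (R : realType) (S : R -> \bar R) (l c t1 : R) : 0 < t1 ->
  (forall t, 0 < t <= t1 -> ((l - c * t ^+ 2)%:E <= S t)%E /\ (S t <= (l + c * t ^+ 2)%:E)%E /\
    ((l - c * t ^+ 2)%:E <= S 0%R)%E /\ (S 0%R <= (l + c * t ^+ 2)%:E)%E) ->
  ((S t - S 0%R) * (t^-1)%:E)%E @[t --> 0^'+] --> 0%E.
Proof.
move=> t10 H.
have cv (k : R) : (k * t)%:E @[t --> 0^'+] --> 0%E.
  apply: cvg_EFin; first by near=> t.
  apply: cvg_at_right_filter; rewrite -[X in _ --> X](mulr0 k).
  by apply: cvgMr; exact: cvg_id.
apply: (@squeeze_cvge _ _ _ _ (fun t => (- (2 * c) * t)%:E) _ (fun t => (2 * c * t)%:E) _ _ (cv _) (cv _)).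
near=> t.
have tp : 0 < t by near: t; exact: nbhs_right_gt.
have tt : t <= t1 by near: t; exact: nbhs_right_le.
have := H t; rewrite tp tt => /(_ isT) [h1 [h2 [h3 h4]]].
have f1 : S t \is a fin_num by rewrite fin_numE -ltey -ltNye (le_lt_trans h2 (ltry _)) (lt_le_trans (ltNyr _) h1).
have f0 : S 0 \is a fin_num by rewrite fin_numE -ltey -ltNye (le_lt_trans h4 (ltry _)) (lt_le_trans (ltNyr _) h3).
move: h1 h2 h3 h4; rewrite -(fineK f1) -(fineK f0) !lee_fin => h1 h2 h3 h4.
apply/andP; split.
  rewrite ler_pdivlMr//; have -> : - (2 * c) * t * t = - (2 * (c * t ^+ 2)) by ring.
  by move: h1 h4; lra.
rewrite ler_pdivrMr//; have -> : 2 * c * t * t = 2 * (c * t ^+ 2) by ring.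
by move: h2 h3; lra.
Unshelve. all: by end_near. Qed.

Lemma steklov_flow_cvg0 (R : realType) (m : nat) (p q r rho : R)
    (hp : 1 < p) (hr : 0 < r) (hrho : r < rho) (hq : 1 < q) (hqp : q <= p)
    (V : 'rV[R]_m.+2 -> 'rV[R]_m.+2) (psi : R -> 'rV[R]_m.+2 -> 'rV[R]_m.+2)
    (hVsmooth : smooth V) (hVlip : [lipschitz V x | x in setT])
    (hVsupp : supp V `<=` eball m.+2 rho)
    (hpsi : is_flow V psi) (hvol : preserves_volume psi (eball m.+2 r)) :
  let S (t : R) := steklov p (eball m.+2 rho) q (sphere_measure m.+2 rho) (psi t @` eball m.+2 r) in
  ((S t - S 0%R) * (t^-1)%:E)%E @[t --> 0^'+] --> 0%E.
Proof.
have hrho0 : 0 < rho by exact: lt_trans hrho.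
have q0 : 0 < q by exact: lt_trans hq.
have [K K0 VK] := lipschitz_enorm hVlip.
have [M M0 VM] := vanishing_outside_supp K0 (ltW hrho0) VK hVsupp.
pose h := radial_part V r.
have mh : measurable_fun setT h by exact: measurable_radial_part.
have hM x : `|h x| <= M by exact: radial_part_le.
have h_hom (x : 'rV[R]_m.+2) (s : R) : x != 0 -> 0 < s -> h (s *: x) = h x.
  by move=> x0 s0; exact: radial_part_scale.
have h_ray (x : 'rV[R]_m.+2) (s : R) : x != 0 -> 0 < s -> h (ray x s) = h x.
  by move=> x0 s0; rewrite /ray h_hom// divr_gt0// enorm_gt0.
have hC k := Ck_on_radial_part r k hVsmooth.
have h_int := flow_mean0 hpsi K0 M0 hr hrho VK VM hvol mh.
have c00 : 0 <= m.+1%:R / (p - 1) by rewrite divr_ge0// subr_ge0 ltW.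
have [z [Z [Kz [cz zr [Z0 _] dz zZ]]]] := exists_riccati hp hr c00.
have zM x : r < x -> 0 < z x <= Z by move=> /zZ[-> ->].
have [C1 [t1 [e1 [[C10 t10 e10] LB]]]] := radial_lower_bound hp hr hrho Z0 dz zM mh hM h_ray h_int.
have [C2 [t2 [e2 [[C20 t20 e20] UB]]]] := radial_upper_bound hp hq hqp hr hrho dz zM cz zr hC mh hM h_hom h_int.
pose lam := flux p z rho; pose w := @sphere_area R m.+1 rho `^ (1 - p / q).
have lam0 : 0 <= lam by exact: powR_ge0.
have w0 : 0 <= w by exact: powR_ge0.
(* [e = c * t^2] dominates both errors of the sandwich and satisfies the requirement [C1 * t^2 <= e]
   of the lower bound. *)
pose c := 3 * (K * M) + M ^+ 2 / r + C1 + 1.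
have cKM : 0 <= 3 * (K * M) by rewrite mulr_ge0// mulr_ge0.
have cM2 : 0 <= M ^+ 2 / r by rewrite divr_ge0 ?sqr_ge0// ltW.
have c0 : 0 < c by rewrite /c; move: cKM cM2 C10; lra.
have q4 : 0 < (4^-1 : R) by rewrite invr_gt0.
have [s1 s10 S1] := exists_small K0 q4.
have [s2 s20 S2] := exists_small M0 (divr_gt0 hr (ltr0Sn R 3)).
have [s3 s30 S3] := exists_small (ltW c0) e10.
have [s4 s40 S4] := exists_small (ltW c0) e20.
pose C := lam * w * ((C1 + C2) * (1 + c)).
pose t3 := Num.min (Num.min (Num.min s1 s2) (Num.min s3 s4)) (Num.min (Num.min t1 t2) 1).
have t30 : 0 < t3 by rewrite !lt_min s10 s20 s30 s40 t10 t20 ltr01.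
move=> S; apply: (@difference_quotient_cvg0 R S (lam * w) C t3 t30) => t /andP[tp].
rewrite !le_min -!andbA => /and5P[l1 l2 l3 l4 /and3P[l5 l6 l7]]; have tn := ltW tp.
pose e := c * t ^+ 2.
have Kt : K * t <= 4^-1 by rewrite mulrC; apply: S1; rewrite tn.
have Mt : M * t <= r / 4 by rewrite mulrC; apply: S2; rewrite tn.
have tsq : t ^+ 2 <= t by rewrite expr2 ler_piMl.
have t2p : 0 < t ^+ 2 by rewrite exprn_gt0.
have ep : 0 < e by exact: mulr_gt0.
have ec : e <= t * c by rewrite /e mulrC ler_wpM2r// ltW.
have ee1 : e <= e1 by apply: le_trans ec _; apply: S3; rewrite tn.
have ee2 : e <= e2 by apply: le_trans ec _; apply: S4; rewrite tn.
have C1e : C1 * t ^+ 2 <= e by rewrite ler_wpM2r ?(ltW t2p)// /c; move: cKM cM2; clear; lra.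
(* With [e] fixed by [t], the graph parameter [s] is free: [s = t] serves the deformed ball, [s = 0]
   the original one. *)
have inner_outer s A : 0 <= s <= t ->
  (forall x : 'rV[R]_m.+2, x != 0 -> enorm x < r + s * h x - e -> A x) ->
  (forall x, A x -> enorm x < r + s * h x + e) ->
  ((lam * w - C * t ^+ 2)%:E <= steklov p (eball m.+2 rho) q (sphere_measure m.+2 rho) A)%E /\
  (steklov p (eball m.+2 rho) q (sphere_measure m.+2 rho) A <= (lam * w + C * t ^+ 2)%:E)%E.
  move=> /andP[s0 st] HL HU.
  have s2t : s ^+ 2 <= t ^+ 2 by apply: lerXn2r; rewrite ?nnegrE.
  have tau : s ^+ 2 + e <= (1 + c) * t ^+ 2 by rewrite mulrDl mul1r lerD2r.
  have tau0 : 0 <= s ^+ 2 + e by rewrite addr_ge0 ?sqr_ge0// ltW.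
  have lw0 : 0 <= lam * w by exact: mulr_ge0.
  have Ck (k : R) : 0 <= k -> k <= C1 + C2 -> lam * w * (k * (s ^+ 2 + e)) <= C * t ^+ 2.
    move=> k0 k12; rewrite /C -[leRHS]mulrA ler_wpM2l//; apply: le_trans (ler_wpM2l k0 tau) _.
    by rewrite mulrA !ler_wpM2r ?(ltW t2p)// addr_ge0// ltW.
  split.
    have se1 : 0 < e <= e1 by rewrite ep.
    have st1 : 0 <= s <= t1 by rewrite s0 (le_trans st).
    have C1s : C1 * s ^+ 2 <= e by apply: le_trans C1e; rewrite ler_wpM2l// ltW.
    have [L0 Lu] := LB s e A st1 se1 C1s HL.
    apply: le_trans (steklov_lower_bound hrho0 hp q0 hqp L0 Lu); rewrite lee_fin.
    have -> : flux p z rho * (1 - C1 * (s ^+ 2 + e)) * sphere_area m.+1 rho `^ (1 - p / q) =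
      lam * w - lam * w * (C1 * (s ^+ 2 + e)) by rewrite /lam /w; ring.
    by rewrite lerD2l lerN2 Ck ?(ltW C10)// lerDl ltW.
  have se2 : 0 < e <= e2 by rewrite ep.
  have st2 : 0 <= s <= t2 by rewrite s0 (le_trans st).
  apply: le_trans (UB s e A st2 se2 HU) _; rewrite lee_fin.
  have -> : flux p z rho * sphere_area m.+1 rho `^ (1 - p / q) * (1 + C2 * (s ^+ 2 + e)) =
    lam * w + lam * w * (C2 * (s ^+ 2 + e)) by rewrite /lam /w; ring.
  by rewrite lerD2l Ck ?(ltW C20)// lerDr ltW.
have [|||A1 A2] := @inner_outer t (psi t @` eball m.+2 r).
- by rewrite tn lexx.
- move=> x _ xr; apply: (flow_ball_lower hpsi K0 M0 hr VK VM tn Kt Mt).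
  apply: lt_le_trans xr _; rewrite lerD2l lerN2 /e ler_wpM2r ?(ltW t2p)// /c.
  by move: C10; clear; lra.
- move=> x /(flow_ball_upper hpsi K0 M0 hr VK VM tn Kt) xr.
  apply: lt_le_trans xr _; rewrite lerD2l /e ler_wpM2r ?(ltW t2p)// /c.
  by move: C10 cM2; clear; lra.
have psi0 : psi 0 @` eball m.+2 r = eball m.+2 r.
  apply/seteqP; split=> [_ [x xr <-]|x xr]; first by have [-> _ _] := hpsi x.
  by exists x => //; have [] := hpsi x.
have [|||B1 B2] := @inner_outer 0 (psi 0 @` eball m.+2 r).
- by rewrite lexx tn.
- by move=> x _ xr; rewrite psi0 /eball/=; apply: lt_trans xr _; rewrite mul0r addr0 ltrBlDr ltrDl.
- by move=> x; rewrite psi0 /eball/= => xr; apply: lt_trans xr _; rewrite mul0r addr0 ltrDl.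
by split => //; split => //; split.
Qed.

Unset Implicit Arguments.

Theorem theorem1p3 (R : realType) (N : nat) (p q r rho : R)
    (hN : (2 <= N)%N) (hp : 1 < p) (hr : 0 < r) (hrho : r < rho)
    (hq : 1 < q) (hqp : q <= p)
    (V : 'rV[R]_N -> 'rV[R]_N) (psi : R -> 'rV[R]_N -> 'rV[R]_N)
    (hVsmooth : smooth V) (hVlip : [lipschitz V x | x in setT])
    (hVsupp : supp V `<=` eball N rho)
    (hpsi : is_flow V psi) (hvol : preserves_volume psi (eball N r)) :
  let S (t : R) := steklov p (eball N rho) q (sphere_measure N rho)
                     (psi t @` eball N r) in
  ((S t - S 0%R) * (t^-1)%:E)%E @[t --> 0^'+] --> 0%E.
Proof.
(* The form [m.+2] of the dimension is what makes lines null and [1 / |z|] integrable in the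
   Poincare inequality. *)
case: N hN V psi hVsmooth hVlip hVsupp hpsi hvol => [//|[//|m]] _ V psi sV lV suV fV vV.
exact: (steklov_flow_cvg0 hp hr hrho hq hqp sV lV suV fV vV).
Qed.
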